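(* Let $A$ be a simple unital $C^*$-algebra. If $A$ is tracially $\mathcal{Z}$-absorbing, then the Cuntz semigroup $W(A)$ is almost unperforated, and therefore $A$ has strict comparison.
   Context: Cuntz subequivalence: for positive elements $a,b$ of a $C^*$-algebra $B$, $a\precsim b$ means there is a sequence $(x_n)$ in $B$ with $\lim_n\|a-x_nbx_n^*\|=0$. A completely positive contractive (c.p.c.) map $\varphi:B\to C$ has order zero if $\varphi(a)\varphi(b)=0$ whenever $a,b\in B_+$ satisfy $ab=0$. A unital $C^*$-algebra $A$ is tracially $\mathcal{Z}$-absorbing if $A\not\cong\mathbb{C}$ and for every finite set $F\subset A$, every $\varepsilon>0$, every non-zero positive $a\in A$ and every positive integer $n$ there is a c.p.c. order zero map $\varphi:M_n\to A$ such that: (1) $1-\varphi(1)\precsim a$; (2) $\|[\varphi(x),y]\|<\varepsilon$ for every $x\in M_n$ with $\|x\|=1$ and every $y\in F$. $W(A)$ is the ordered abelian semigroup of classes $\langle a\rangle$ of positive elements $a\in M_\infty(A)=\bigcup_n M_n(A)$ under the equivalence relation ($a\precsim b$ and $b\precsim a$), with $\langle a\rangle+\langle b\rangle=\langle a\oplus b\rangle$ and $\langle a\rangle\le\langle b\rangle$ iff $a\precsim b$. $W(A)$ is almost unperforated if for all $x,y\in W(A)$, $(k+1)x\le ky$ for some positive integer $k$ implies $x\le y$. A simple unital $C^*$-algebra $A$ has strict comparison if, for all positive $a,b\in M_\infty(A)$ with $b\ne 0$, the condition $d_\tau(a)<d_\tau(b)$ for all normalized 2-quasitraces $\tau$ on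 $A$ (extended to matrices) implies $a\precsim b$, where $d_\tau(a)=\lim_{n\to\infty}\tau(a^{1/n})$. *)

(* Defs.v *)
From HB Require Import structures.
From mathcomp Require Import all_boot all_order all_algebra.
From mathcomp Require Import complex.
From mathcomp Require Import all_classical all_reals all_analysis.
Set Implicit Arguments.
Unset Strict Implicit.
Unset Printing Implicit Defensive.
Import Order.TTheory GRing.Theory Num.Theory.
Import numFieldNormedType.Exports ComplexField.Normc.
Local Open Scope classical_set_scope.
Local Open Scope ring_scope.
Local Open Scope complex_scope.

HB.mixin Record isStarRing B of GRing.PzRing B := {
  star : B -> B ;
  starK : involutive star ;
  starD : {morph star : x y / x + y} ;
  starM : forall x y, star (x * y) = star y * star x
}.

#[short(type="starRingType")]
HB.structure Definition StarRing := {B of GRing.PzRing B & isStarRing B}.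

(* Unital C*-algebras, nonzero because algebras are nontrivial rings.  The norm
   is a field of the structure: HB does not allow a join of rings and normed
   modules other than the numDomainType one, so CompleteNormedModule cannot be
   inherited here. *)
HB.mixin Record isCStarAlgebra (R : realType) A
    of StarRing A & GRing.Algebra R[i] A := {
  starZ : forall (c : R[i]) (x : A), star (c *: x) = conjc c *: star x ;
  cnorm : A -> R ;
  cnorm_eq0 : forall x, cnorm x = 0 -> x = 0 ;
  ler_cnormD : forall x y, cnorm (x + y) <= cnorm x + cnorm y ;
  cnormZ : forall (c : R[i]) (x : A), cnorm (c *: x) = normc c * cnorm x ;
  ler_cnormM : forall x y, cnorm (x * y) <= cnorm x * cnorm y ;
  cnorm_star : forall x, cnorm (star x * x) = cnorm x ^+ 2 ;
  cnorm_complete : forall u : nat -> A,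
    (forall e : R, 0 < e -> exists N, forall m n, (N <= m)%N -> (N <= n)%N ->
       cnorm (u m - u n) < e) ->
    exists l : A, (fun n => cnorm (u n - l)) @ \oo --> (0 : R)
}.

#[short(type="cstarAlgType")]
HB.structure Definition CStarAlgebra (R : realType) :=
  {A of StarRing A & GRing.Algebra R[i] A & isCStarAlgebra R A}.

Section ComplexCStar.
Variable R : realType.
Implicit Types x y c : R[i].

Let conjcMr x y : conjc (x * y) = conjc y * conjc x.
Proof. by rewrite rmorphM mulrC. Qed.

HB.instance Definition _ :=
  isStarRing.Build R[i] (@conjcK R) (raddfD (@conjc R)) conjcMr.

Let normcZ c x : normc (c *: x) = normc c * normc x.
Proof. exact: normcM. Qed.

Let normcM_le x y : normc (x * y) <= normc x * normc y.
Proof. by rewrite normcM. Qed.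

Let normc_star x : normc (conjc x * x) = normc x ^+ 2.
Proof.
by rewrite normcM expr2; congr (_ * _); case: x => a b; rewrite /= sqrrN.
Qed.

Let normc_complete (u : nat -> R[i]) :
  (forall e : R, 0 < e -> exists N, forall m n, (N <= m)%N -> (N <= n)%N ->
     normc (u m - u n) < e) ->
  exists l : R[i], (fun n => normc (u n - l)) @ \oo --> (0 : R).
Proof.
move=> uC.
have ReC x : `|complex.Re x| <= normc x.
  by case: x => a b; rewrite -sqrtr_sqr ler_sqrt ?lerDl ?addr_ge0 ?sqr_ge0.
have ImC x : `|complex.Im x| <= normc x.
  by case: x => a b; rewrite -sqrtr_sqr ler_sqrt ?lerDr ?addr_ge0 ?sqr_ge0.
have normc_le x : normc x <= `|complex.Re x| + `|complex.Im x|.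
  case: x => a b /=; rewrite -[leRHS]ger0_norm ?addr_ge0 // -sqrtr_sqr.
  rewrite ler_sqrt ?sqr_ge0 // sqrrD !real_normK ?num_real //.
  by rewrite lerD2r lerDl mulrn_wge0 // mulr_ge0.
have part (p : R[i] -> R) : (forall x y, p (x - y) = p x - p y) ->
    (forall x, `|p x| <= normc x) -> cvgn (p \o u).
  move=> pB pC; apply/cauchy_cvgP/cauchy_exP => e /uC[N uN].
  exists (p (u N)); exists N => // n /= Nn; rewrite -ball_normE /ball_ /=.
  by rewrite -pB (le_lt_trans (pC _)) // uN.
have /part/(_ ReC) :
    forall x y, complex.Re (x - y) = complex.Re x - complex.Re y.
  by move=> [a b] [c d].
have /part/(_ ImC) :
    forall x y, complex.Im (x - y) = complex.Im x - complex.Im y.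
  by move=> [a b] [c d].
move=> /cvg_ex[/= b bP] /cvg_ex[/= a aP]; exists (a +i* b)%C.
have lim0 (f : nat -> R) (l : R) : f @ \oo --> l ->
    (fun n => `|f n - l|) @ \oo --> (0 : R).
  move=> fl; rewrite -[0](normr0 R) -(subrr l).
  by apply: cvg_norm; apply: cvgB => //; exact: cvg_cst.
apply: (@squeeze_cvgr _ _ _ _ (fun=> 0)
  (fun n => `|complex.Re (u n) - a| + `|complex.Im (u n) - b|)).
- apply: nearW => n; case: (u n) => c d; rewrite sqrtr_ge0 /=.
  exact: (normc_le ((c +i* d) - (a +i* b))%C).
- exact: cvg_cst.
- by rewrite -[0](addr0 0); apply: cvgD; exact: lim0.
Qed.

HB.instance Definition _ := GRing.Algebra.copy R[i] R[i]^o.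
HB.instance Definition _ := isCStarAlgebra.Build R R[i]
  (fun c x => rmorphM (@conjc R) c x) (@eq0_normc R) (@le_normcD R) normcZ
  normcM_le normc_star normc_complete.
End ComplexCStar.

Definition adjmx (B : starRingType) m n (a : 'M[B]_(m, n)) : 'M[B]_(n, m) :=
  \matrix_(i, j) star (a j i).

Section MatrixStar.
Variables (B : starRingType) (n : nat).
Let star0 : star (0 : B) = 0.
Proof. by apply: (addrI (star 0)); rewrite -starD !addr0. Qed.
Let mx_starK : involutive (@adjmx B n n).
Proof. by move=> a; apply/matrixP => i j; rewrite !mxE starK. Qed.
Let mx_starD : {morph (@adjmx B n n) : x y / x + y}.
Proof. by move=> a b; apply/matrixP => i j; rewrite !mxE starD. Qed.
Let mx_starM (x y : 'M[B]_n) : adjmx (x * y) = adjmx y * adjmx x.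
Proof.
apply/matrixP => i j; rewrite !mxE (big_morph star (@starD B) star0).
by apply: eq_bigr => k _; rewrite !mxE starM.
Qed.
HB.instance Definition _ :=
  isStarRing.Build 'M[B]_n mx_starK mx_starD mx_starM.
End MatrixStar.

Definition positive (B : starRingType) (a : B) : Prop :=
  exists x : B, a = star x * x.

(* The C*-norm of M_(m,n)(B), i.e. the operator norm B^n -> B^m, where B^n is
   the Hilbert B-module of column vectors with <v, w> = v^* w and
   |v| = |<v, v>|^(1/2).  For B = R[i] this is the usual l^2 operator norm. *)
Definition vnorm (R : realType) (B : cstarAlgType R) n
    (v : 'cV[B]_n) : R :=
  Num.sqrt (cnorm ((adjmx v *m v) ord0 ord0)).

Definition opnorm (R : realType) (B : cstarAlgType R) m n
    (a : 'M[B]_(m, n)) : R :=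
  sup [set vnorm (a *m v) | v in [set v : 'cV[B]_n | vnorm v <= 1]].

(* On matrices over a complex algebra, *: denotes scaling by the entry ring;
   this is scaling by complex numbers. *)
Definition mx_cscale (R : realType) (A : cstarAlgType R) n
    (c : R[i]) (a : 'M[A]_n) : 'M[A]_n :=
  map_mx (fun x => c *: x) a.

Definition simple_cstar (R : realType) (A : cstarAlgType R) : Prop :=
  forall I : set A, I 0 ->
    (forall x y, I x -> I y -> I (x + y)) ->
    (forall (c : R[i]) x, I x -> I (c *: x)) ->
    (forall a x, I x -> I (a * x) /\ I (x * a)) ->
    (forall (u : nat -> A) l, (forall n, I (u n)) ->
       (fun n => cnorm (u n - l)) @ \oo --> (0 : R) -> I l) ->
    I = [set 0] \/ I = setT.

Definition isomorphic_to_C (R : realType) (A : cstarAlgType R) : Prop :=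
  exists f : {lrmorphism R[i] -> A},
    bijective f /\ forall z : R[i], f (star z) = star (f z).

Definition cuntz_sub (R : realType) (A : cstarAlgType R) (a b : A) : Prop :=
  exists x : nat -> A,
    (fun k => cnorm (a - x k * b * star (x k))) @ \oo --> (0 : R).

Section OrderZero.
Variables (R : realType) (A : cstarAlgType R) (n : nat).
Implicit Type phi : 'M[R[i]]_n -> A.

Definition completely_positive phi : Prop :=
  forall (k : nat) (a : 'M['M[R[i]]_n]_k),
    positive a -> positive (map_mx phi a).

Definition contractive phi : Prop := forall x, cnorm (phi x) <= opnorm x.

Definition order_zero phi : Prop :=
  forall a b, positive a -> positive b -> a * b = 0 -> phi a * phi b = 0.

Definition cpc_order_zero phi : Prop :=
  [/\ linear phi, completely_positive phi, contractive phi & order_zero phi].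
End OrderZero.

Definition tracially_Z_absorbing (R : realType) (A : cstarAlgType R) : Prop :=
  ~ isomorphic_to_C A /\
  forall (F : set A) (eps : R) (a : A) (n : nat),
    finite_set F -> 0 < eps -> positive a -> a != 0 -> (0 < n)%N ->
    exists phi : 'M[R[i]]_n -> A,
      [/\ cpc_order_zero phi,
          cuntz_sub (1 - phi 1) a
        & forall x y, opnorm x = 1 -> F y ->
            cnorm (phi x * y - y * phi x) < eps].

(* An element of M_oo(A), the union of the M_n(A) for n >= 1 under the
   embeddings a |-> diag(a, 0), presented by a representative in some M_n(A);
   [pad] is its image in a larger matrix algebra. *)
Record minf (R : realType) (A : cstarAlgType R) :=
  MInf { mdim : nat ; mval :> 'M[A]_mdim.+1 }.

Section CuntzSemigroup.
Variables (R : realType) (A : cstarAlgType R).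
Implicit Types (a b c : minf A) (X Y : set (minf A)).

Definition pad (N : nat) a : 'M[A]_N.+1 :=
  \matrix_(i, j)
    if (i <= mdim a)%N && (j <= mdim a)%N then a (inord i) (inord j) else 0.

Definition minf_cuntz_sub a b : Prop :=
  exists x : nat -> minf A,
    (fun k => let N := maxn (mdim (x k)) (maxn (mdim a) (mdim b)) in
       opnorm (pad N a - pad N (x k) * pad N b * star (pad N (x k)))) @ \oo
    --> (0 : R).

Definition minf_oplus a b : minf A :=
  MInf (block_mx a 0 0 b : 'M[A]_((mdim a + (mdim b).+1).+1)).

Definition W_class a : set (minf A) :=
  [set b | [/\ positive (mval b), minf_cuntz_sub a b & minf_cuntz_sub b a]].

Definition W : set (set (minf A)) :=
  [set W_class a | a in [set a | positive (mval a)]].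

(* Stated through arbitrary representatives, so that these make sense without
   first proving compatibility: <a> + <b> is the class of a (+) b, and
   <a> <= <b> iff a is Cuntz subequivalent to b. *)
Definition W_add X Y : set (minf A) :=
  [set c | exists a b, [/\ X a, Y b & W_class (minf_oplus a b) c]].

Definition W_le X Y : Prop :=
  exists a b, [/\ X a, Y b & minf_cuntz_sub a b].

Definition W_muln (k : nat) X : set (minf A) :=
  iterop k W_add X (W_class (@MInf R A 0 0)).

Definition W_almost_unperforated : Prop :=
  forall X Y, W X -> W Y ->
    (exists2 k : nat, (0 < k)%N & W_le (W_muln k.+1 X) (W_muln k Y)) ->
    W_le X Y.
End CuntzSemigroup.

Section Quasitrace.
Variables (R : realType) (B : starRingType) (scal : R[i] -> B -> B).

Definition commutative_star_subalgebra (S : set B) : Prop :=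
  [/\ S 0,
      forall x y, S x -> S y -> S (x + y) /\ S (x * y),
      forall (c : R[i]) x, S x -> S (scal c x),
      forall x, S x -> S (star x)
    & forall x y, S x -> S y -> x * y = y * x].

(* In the sense of Blackadar and Handelman. *)
Definition quasitrace (tau : B -> R[i]) : Prop :=
  [/\ forall x, 0 <= tau (star x * x) /\ tau (star x * x) = tau (x * star x),
      forall a b, star a = a -> star b = b ->
        tau (a + scal 'i%C b) = tau a + 'i%C * tau b
    & forall S, commutative_star_subalgebra S ->
        forall (c : R[i]) x y, S x -> S y ->
          tau (scal c x + y) = c * tau x + tau y].
End Quasitrace.

Section StrictComparison.
Variables (R : realType) (A : cstarAlgType R).

(* T is a quasitrace on M_(n+1)(A) with T (x (x) e_11) = tau x. *)
Definition quasitrace_ext (tau : A -> R[i]) n (T : 'M[A]_n.+1 -> R[i]) : Prop :=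
  quasitrace (@mx_cscale R A n.+1) T /\
  forall x : A, T (x *: delta_mx ord0 ord0) = tau x.

Definition two_quasitrace (tau : A -> R[i]) : Prop :=
  quasitrace (fun (c : R[i]) (x : A) => c *: x) tau /\
  exists T : 'M[A]_2 -> R[i], quasitrace_ext tau T.

(* a^(1/n): the unique positive n-th root of a positive a. *)
Definition nth_root m (n : nat) (a : 'M[A]_m.+1) : 'M[A]_m.+1 :=
  xget 0 [set r : 'M[A]_m.+1 | positive r /\ r ^+ n = a].

Definition dtau m (T : 'M[A]_m.+1 -> R[i]) (a : 'M[A]_m.+1) : R :=
  lim ((fun n : nat => complex.Re (T (nth_root n.+1 a))) @ \oo).

(* A 2-quasitrace extends to a quasitrace T n on each M_(n+1)(A), in a unique
   way; d_tau on M_(n+1)(A) is computed with this extension. *)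
Definition strict_comparison : Prop :=
  forall a b : minf A,
    positive (mval a) -> positive (mval b) -> mval b != 0 ->
    (forall (tau : A -> R[i]) (T : forall n, 'M[A]_n.+1 -> R[i]),
       two_quasitrace tau -> tau 1 = 1 ->
       (forall n, quasitrace_ext tau (T n)) ->
       dtau (T (mdim a)) a < dtau (T (mdim b)) b) ->
    minf_cuntz_sub a b.
End StrictComparison.

(* Main.v *)
(** Almost unperforation: if (k+1)<a> <= k<b> is witnessed by matrices c_il with
    sum_l c_il b c_jl^* close to delta_ij a, and phi : M_(k+1) -> A is an order zero
    map with entries E_ij = phi(e_ij) that almost commutes with all data, then
    y = sum c_il E_il satisfies y b y^* ~ a phi(1)^2, so that a is below b up to
    1 - phi(1)^2 <= 2(1 - phi(1)), which is Cuntz below any prescribed d <> 0.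
    To absorb d one needs room inside b: if b <> 0 had no two orthogonal nonzero
    elements in its corner, a suitable multiple of b would be a projection p with
    pBp = Cp, and an order zero map from M_2 would give A = C.  Hence <b> can be
    replaced by a class y' with 2k<b> <= (2k+1)y' and y' + <d> <= <b>.

    Strict comparison: if a is not below b, almost unperforation lets one extend the
    order of W(A) to a total one and obtain a state f on W(A) with
    f<b> <= f<(a - e)_+> for some e > 0.  Integrating, tau(x) = int f<(x - s)_+> ds
    is a 2-quasitrace; it is additive on commuting elements because
    <u> + <v> = <u + v> + <uv> for commuting positive u and v.  Since
    d_tau(x) = sup_e f<(x - e)_+>, this gives d_tau(b) <= d_tau(a). *)
Require Import Defs.
From HB Require Import structures.
From mathcomp Require Import all_boot all_order all_algebra.
From mathcomp Require Import complex.
From mathcomp Require Import all_classical all_reals all_analysis.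
From mathcomp Require Import ring lra zify.
From Stdlib Require Ncring Ncring_tac.
Set Implicit Arguments.
Unset Strict Implicit.
Unset Printing Implicit Defensive.
Import Order.TTheory GRing.Theory Num.Theory.
Import numFieldNormedType.Exports ComplexField.Normc.
Local Open Scope classical_set_scope.
Local Open Scope ring_scope.
Local Open Scope complex_scope.

(** * Star rings and C*-algebras *)

(** Positivity is encoded by the norm condition [|t - a| <= t], and functional calculus is a limit
    of Bernstein polynomials: their weights at a self-adjoint element are positive and sum to 1, so
    a scalar inequality between coefficients becomes a norm inequality. The sum [y b star y]
    collapses because of the rules [E_ij E_jl = E_ii E_il] and [E_ij E_kl = 0] for [j <> k]. They
    are extracted from a Gram factorisation of the [E_ij], given by complete positivity, and from
    the orthogonality of images of orthogonal rank one projections. The k + 1 rows i and the k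
    columns l both fit among the indices of M_(k+1), and the surviving coefficients [E_ii E_ij] sum
    on the diagonal to [phi(1)^2]. Doubling the hypothesis leaves a gap of two copies,
    [(2k+2) a <= 2k b]; one copy pays for the room in which d is placed, and the other is the gap to
    which the order zero argument applies. A state on W(A) need not be lower semicontinuous, and
    d_tau of the integrated quasitrace is only its regularisation. This is why the state has to
    separate b from a cut of a, and not merely from a. *)

#[export] Instance pzring_ncops (B : pzRingType) :
  Ncring.Ring_ops (T := B) (ring0 := 0) (ring1 := 1) (add := +%R) (mul := *%R)
    (sub := fun x y => x - y) (opp := -%R) (ring_eq := @eq B).
Defined.

#[export] Instance pzring_ncring (B : pzRingType) :
  Ncring.Ring (Ro := pzring_ncops B).
Proof.
split; try exact _.
- exact: add0r.
- exact: addrC.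
- exact: addrA.
- exact: mul1r.
- exact: mulr1.
- exact: mulrA.
- exact: mulrDl.
- by move=> x y z; exact: mulrDr.
- by [].
- exact: subrr.
Qed.

Ltac ncring := Ncring_tac.non_commutative_ring.

Notation "r *` x" := ((r)%:C *: x) (at level 40, left associativity) : ring_scope.

Definition sa (B : starRingType) (a : B) := star a = a.

Section StarRingTheory.
Variable B : starRingType.
Implicit Types x y : B.

Lemma star0 : star (0 : B) = 0.
Proof. by apply: (addrI (star 0)); rewrite -starD !addr0. Qed.

Lemma starN x : star (- x) = - star x.
Proof. by apply: (addrI (star x)); rewrite -starD !subrr star0. Qed.

Lemma starB x y : star (x - y) = star x - star y.
Proof. by rewrite starD starN. Qed.

Lemma star1 : star (1 : B) = 1.
Proof. by rewrite -[LHS]mulr1 -{2}(starK (1 : B)) -starM mulr1 starK. Qed.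

Lemma star_sum I (r : seq I) (P : pred I) (F : I -> B) :
  star (\sum_(i <- r | P i) F i) = \sum_(i <- r | P i) star (F i).
Proof. exact: (big_morph _ (@starD B) star0). Qed.

Lemma sa0 : sa (0 : B). Proof. exact: star0. Qed.
Lemma sa1 : sa (1 : B). Proof. exact: star1. Qed.
Lemma saD x y : sa x -> sa y -> sa (x + y).
Proof. by rewrite /sa starD => -> ->. Qed.
Lemma saN x : sa x -> sa (- x).
Proof. by rewrite /sa starN => ->. Qed.
Lemma saB x y : sa x -> sa y -> sa (x - y).
Proof. by rewrite /sa starB => -> ->. Qed.
Lemma saM x y : sa x -> sa y -> x * y = y * x -> sa (x * y).
Proof. by rewrite /sa starM => -> -> ->. Qed.
Lemma sa_sum I (r : seq I) (P : pred I) (F : I -> B) :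
  (forall i, P i -> sa (F i)) -> sa (\sum_(i <- r | P i) F i).
Proof. by move=> FP; rewrite /sa star_sum; apply: eq_bigr => i /FP. Qed.
Lemma sa_starl x : sa (star x * x).
Proof. by rewrite /sa starM starK. Qed.
Lemma sa_starr x : sa (x * star x).
Proof. by rewrite /sa starM starK. Qed.
End StarRingTheory.

Section CStarBasics.
Variables (R : realType) (A : cstarAlgType R).
Implicit Types (x y a b c : A) (r s t e : R).

Lemma normcR r : normc (r%:C : R[i]) = `|r|.
Proof. by rewrite /= expr0n addr0 sqrtr_sqr. Qed.

Lemma cnormR r x : cnorm (r *` x) = `|r| * cnorm x.
Proof. by rewrite cnormZ normcR. Qed.

Lemma cnorm0 : cnorm (0 : A) = 0.
Proof. by rewrite -(scale0r (0 : A)) -[0 : R[i]]/((0 : R)%:C) cnormR normr0 mul0r. Qed.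

Lemma cnormN x : cnorm (- x) = cnorm x.
Proof.
have -> : - x = (-1 : R) *` x by rewrite rmorphN scaleN1r.
by rewrite cnormR normrN1 mul1r.
Qed.

Lemma cnormB x y : cnorm (x - y) <= cnorm x + cnorm y.
Proof. by rewrite (le_trans (ler_cnormD _ _)) ?cnormN. Qed.

Lemma cnorm_distC x y : cnorm (x - y) = cnorm (y - x).
Proof. by rewrite -cnormN opprB. Qed.

Lemma cnorm_ge0 x : 0 <= cnorm x.
Proof.
have := cnormB x x; rewrite subrr cnorm0 -mulr2n.
by rewrite pmulrn_lge0.
Qed.

Lemma ler_cnorm_dist y x z : cnorm (x - z) <= cnorm (x - y) + cnorm (y - z).
Proof. by rewrite (le_trans _ (ler_cnormD _ _))// addrA subrK. Qed.

Lemma cnorm_sum I (s : seq I) (P : pred I) (F : I -> A) :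
  cnorm (\sum_(i <- s | P i) F i) <= \sum_(i <- s | P i) cnorm (F i).
Proof.
elim/big_rec2: _ => [|i u v _ le_vu]; first by rewrite cnorm0.
by rewrite (le_trans (ler_cnormD _ _))// lerD2l.
Qed.

Lemma cnorm_starE x : cnorm (star x) = cnorm x.
Proof.
have le x' : cnorm x' <= cnorm (star x').
  have [/cnorm_eq0 ->|nz] := eqVneq (cnorm x') 0; first by rewrite star0.
  have x_gt0 : 0 < cnorm x' by rewrite lt_def nz cnorm_ge0.
  by rewrite -(ler_pM2r x_gt0) -expr2 -cnorm_star ler_cnormM.
by apply/le_anti; rewrite le {1}(le_trans (le _)) ?starK.
Qed.

Lemma cnorm_starr x : cnorm (x * star x) = cnorm x ^+ 2.
Proof. by rewrite -{1}(starK x) cnorm_star cnorm_starE. Qed.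

Lemma cnorm1 : cnorm (1 : A) = 1.
Proof.
have := @cnorm_star R A 1; rewrite star1 mulr1 => /esym/eqP.
rewrite expr2 -subr_eq0 -{3}[cnorm 1]mulr1 -mulrBr mulf_eq0 => /orP[/eqP/cnorm_eq0/eqP|].
  by rewrite oner_eq0.
by rewrite subr_eq0 => /eqP.
Qed.

Lemma cnormC r : cnorm ((r%:C)%:A : A) = `|r|.
Proof. by rewrite cnormR cnorm1 mulr1. Qed.

Lemma cnorm_sa_sqr x : sa x -> cnorm (x * x) = cnorm x ^+ 2.
Proof. by move=> {1}<-; rewrite cnorm_star. Qed.

Lemma starR r x : star (r *` x) = r *` star x.
Proof. by rewrite starZ conjc_real. Qed.

Lemma saR r x : sa x -> sa (r *` x).
Proof. by rewrite /sa starR => ->. Qed.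

Lemma saC r : sa ((r%:C)%:A : A).
Proof. exact/saR/sa1. Qed.

Definition clim (u : nat -> A) (l : A) :=
  (fun n => cnorm (u n - l)) @ \oo --> (0 : R).

Lemma clim_squeeze (u : nat -> A) l (v : nat -> R) :
  (forall n, cnorm (u n - l) <= v n) -> v @ \oo --> (0 : R) -> clim u l.
Proof.
move=> uv v0; apply: (@squeeze_cvgr _ _ _ _ (fun=> 0) v) => //.
  by apply: nearW => n; rewrite cnorm_ge0 uv.
exact: cvg_cst.
Qed.

Lemma climP u l : clim u l <->
  forall e, 0 < e -> exists N, forall n, (N <= n)%N -> cnorm (u n - l) < e.
Proof.
split=> [/cvgrPdist_lt ul e e0|ul].
  have [N _ NP] := ul e e0; exists N => n /NP /=.
  by rewrite sub0r normrN ger0_norm ?cnorm_ge0.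
apply/cvgrPdist_lt => e /ul[N NP]; exists N => // n /NP /=.
by rewrite sub0r normrN ger0_norm ?cnorm_ge0.
Qed.

Lemma clim_cst a : clim (fun=> a) a.
Proof. by rewrite /clim subrr cnorm0; exact: cvg_cst. Qed.

Lemma climD u v a b : clim u a -> clim v b -> clim (fun n => u n + v n) (a + b).
Proof.
move=> ua vb.
apply: (@clim_squeeze _ _ (fun n => cnorm (u n - a) + cnorm (v n - b))).
  by move=> n; rewrite opprD addrACA ler_cnormD.
by rewrite -[0](addr0 0); exact: cvgD.
Qed.

Lemma climN u a : clim u a -> clim (fun n => - u n) (- a).
Proof.
move=> ua; apply: (@clim_squeeze _ _ (fun n => cnorm (u n - a))) => // n.
by rewrite -opprD cnormN.
Qed.

Lemma climB u v a b : clim u a -> clim v b -> clim (fun n => u n - v n) (a - b).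
Proof. by move=> ua /climN vb; exact: climD. Qed.

Lemma climZ (c : R[i]) u a : clim u a -> clim (fun n => c *: u n) (c *: a).
Proof.
move=> ua; apply: (@clim_squeeze _ _ (fun n => normc c * cnorm (u n - a))).
  by move=> n; rewrite -scalerBr cnormZ.
by rewrite -[0](mulr0 (normc c)); apply: cvgM => //; exact: cvg_cst.
Qed.

Lemma climM u v a b : clim u a -> clim v b -> clim (fun n => u n * v n) (a * b).
Proof.
move=> ua vb.
apply: (@clim_squeeze _ _ (fun n => cnorm (u n - a) * cnorm (v n - b) +
  cnorm (u n - a) * cnorm b + cnorm a * cnorm (v n - b))).
  move=> n; have -> : u n * v n - a * b =
    (u n - a) * (v n - b) + (u n - a) * b + a * (v n - b) by ncring.
  do 2 (rewrite (le_trans (ler_cnormD _ _))// lerD ?ler_cnormM//).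
have -> : (0 : R) = 0 * 0 + 0 * cnorm b + cnorm a * 0 by rewrite !mul0r mulr0 !addr0.
by apply: cvgD; [apply: cvgD|]; apply: cvgM => //; exact: cvg_cst.
Qed.

Lemma clim_star u a : clim u a -> clim (fun n => star (u n)) (star a).
Proof.
move=> ua; apply: (@clim_squeeze _ _ (fun n => cnorm (u n - a))) => // n.
by rewrite -starB cnorm_starE.
Qed.

Lemma clim_norm u a : clim u a -> (fun n => cnorm (u n)) @ \oo --> cnorm a.
Proof.
move=> ua; apply/cvgrPdist_lt => e e0.
have [N NP] := (climP u a).1 ua e e0; exists N => // n /= /NP.
apply: le_lt_trans; rewrite ler_norml.
have h1 := ler_cnormD (a - u n) (u n); have h2 := ler_cnormD (u n - a) a.
rewrite !subrK in h1 h2; rewrite (cnorm_distC a) in h1.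
by apply/andP; split; lra.
Qed.

Lemma clim_unique u a b : clim u a -> clim u b -> a = b.
Proof.
move=> ua ub; apply/eqP; rewrite -subr_eq0; apply/eqP/cnorm_eq0/le_anti.
rewrite cnorm_ge0 andbT; apply/ler_addgt0Pr => e e0; rewrite add0r.
have e2 : 0 < e / 2 by rewrite divr_gt0.
have [N1 N1P] := (climP _ _).1 ua _ e2; have [N2 N2P] := (climP _ _).1 ub _ e2.
have h1 := N1P _ (leq_maxl N1 N2); have h2 := N2P _ (leq_maxr N1 N2).
rewrite cnorm_distC in h1.
by apply: le_trans (ler_cnorm_dist (u (maxn N1 N2)) _ _) _; lra.
Qed.

Lemma clim_ext u v a : clim u a -> (forall n, u n = v n) -> clim v a.
Proof. by move=> + uv; have -> : u = v by apply/funext. Qed.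

Lemma clim_sa u a : clim u a -> (forall n, sa (u n)) -> sa a.
Proof.
by move=> ua su; apply: (clim_unique (clim_star ua)); apply: clim_ext ua _ => n; rewrite su.
Qed.

Lemma clim_comm u a x y : clim u a -> (forall n, x * u n = u n * y) -> x * a = a * y.
Proof.
move=> ua xu; apply: (@clim_unique (fun n => x * u n)).
  exact: climM (clim_cst x) ua.
by apply: (@clim_ext (fun n => u n * y)) => [|n]//; exact: climM ua (clim_cst y).
Qed.

Lemma clim_cauchy (u : nat -> A) :
  (forall e : R, 0 < e -> exists N, forall m n, (N <= m)%N -> (N <= n)%N ->
     cnorm (u m - u n) < e) -> exists l, clim u l.
Proof. exact: cnorm_complete. Qed.

Lemma clim_geometric (u : nat -> A) (K q : R) : 0 <= K -> 0 <= q < 1 ->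
  (forall n, cnorm (u n.+1 - u n) <= K * q ^+ n) -> exists l, clim u l.
Proof.
move=> K0 /andP[q0 q1] uK; apply: clim_cauchy => e e0.
have q1' : 0 < 1 - q by rewrite subr_gt0.
have tail n k : cnorm (u (n + k)%N - u n) <= K * q ^+ n * (1 - q)^-1.
  have : cnorm (u (n + k)%N - u n) <= K * q ^+ n * ((1 - q ^+ k) / (1 - q)).
    elim: k => [|k IHk]; first by rewrite addn0 subrr cnorm0 expr0 subrr !mul0r mulr0.
    apply: le_trans (ler_cnorm_dist (u (n + k)%N) _ _) _.
    rewrite addnS (le_trans (lerD (uK _) IHk))// exprD exprS.
    rewrite le_eqVlt; apply/orP; left; apply/eqP; field; lra.
  move/le_trans; apply; rewrite ler_wpM2l ?mulr_ge0 ?exprn_ge0//.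
  by rewrite ler_pdivrMr// mulVf ?gt_eqF// gerBl exprn_ge0.
have : (fun n => K * q ^+ n * (1 - q)^-1) @ \oo --> (0 : R).
  rewrite -[X in _ --> X](mul0r ((1 - q)^-1)); apply: cvgM; last exact: cvg_cst.
  rewrite -[X in _ --> X](mulr0 K); apply: cvgM; first exact: cvg_cst.
  by apply: cvg_expr; rewrite ger0_norm.
move=> /cvgrPdist_lt/(_ (e / 2))[]; first by rewrite divr_gt0.
move=> N _ NP; exists N => m n /NP + /NP.
wlog le_mn : m n / (m <= n)%N.
  move=> H; have [/H|/ltnW/H H1 h1 h2] := leqP m n; first exact.
  by rewrite cnorm_distC H1.
rewrite /= !sub0r !normrN => h1 _; have := tail m (n - m)%N.
rewrite subnKC// cnorm_distC => h; apply: le_lt_trans h _.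
by apply: le_lt_trans (ler_norm _) _; lra.
Qed.
End CStarBasics.

(** * Positive elements *)

Section Psd.
Variables (R : realType) (A : cstarAlgType R).
Implicit Types (x y a b c d : A) (r s t e : R).

Lemma rsD r s x : (r + s) *` x = r *` x + s *` x.
Proof. by rewrite rmorphD scalerDl. Qed.
Lemma rsN r x : (- r) *` x = - (r *` x).
Proof. by rewrite rmorphN scaleNr. Qed.
Lemma rsB r s x : (r - s) *` x = r *` x - s *` x.
Proof. by rewrite rsD rsN. Qed.
Lemma rsM r s x : (r * s) *` x = r *` (s *` x).
Proof. by rewrite rmorphM scalerA. Qed.
Lemma rs0 x : 0 *` x = 0. Proof. exact: scale0r. Qed.
Lemma rs1 x : 1 *` x = x. Proof. exact: scale1r. Qed.
Lemma rsMl r x y : r *` x * y = r *` (x * y).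
Proof. by rewrite scalerAl. Qed.
Lemma rsMr r x y : x * (r *` y) = r *` (x * y).
Proof. by rewrite scalerAr. Qed.
Lemma rs_half x : (2^-1 : R) *` (x + x) = x.
Proof.
by rewrite scalerDr -rsD (_ : 2^-1 + 2^-1 = 1 :> R) ?rs1//; lra.
Qed.
Lemma rs2 x : (2 : R) *` x = x + x.
Proof. by rewrite (_ : 2 = 1 + 1 :> R)// rsD rs1. Qed.

Let iu : R[i] := (0 +i* 1)%C.
Let conjiu : conjc iu = - iu. Proof. by rewrite /iu; simpc. Qed.
Let II : iu * iu = -1. Proof. by apply/eqP; rewrite eq_complex /=; apply/andP; split; apply/eqP; ring. Qed.

(* (c + ib)/t is unitary. *)
Lemma sqr_sum_norm c b t : sa c -> sa b -> c * b = b * c -> 0 <= t ->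
  c * c + b * b = (t ^+ 2) *` 1 -> cnorm c <= t /\ cnorm b <= t.
Proof.
move=> sc sb cb t0 cbt; pose u := c + iu *: b.
have su : star u = c - iu *: b by rewrite /u starD starZ conjiu sc sb scaleNr.
have uu : star u * u = (t ^+ 2) *` 1.
  rewrite su /u mulrDr !mulrBl -!scalerAl -!scalerAr scalerA II cb -cbt.
  by rewrite scaleN1r opprK addrA subrK.
have nu : cnorm u = t.
  apply/eqP; rewrite -(eqrXn2 (n:=2)) ?cnorm_ge0 -?cnorm_star ?uu//.
  by rewrite cnormC ger0_norm ?sqr_ge0.
have nsu : cnorm (star u) = t by rewrite cnorm_starE.
have dblc : c + c = u + star u by rewrite su /u addrACA subrr addr0.
have dblb : iu *: (b + b) = u - star u.
  by rewrite su /u scalerDr; ncring.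
split.
  rewrite -(rs_half c) cnormR dblc ger0_norm ?invr_ge0// ler_pdivrMl//.
  by rewrite (le_trans (ler_cnormD _ _))// nu nsu; lra.
have ni : normc iu = 1 by rewrite /iu /= expr0n add0r expr1n sqrtr1.
rewrite -(rs_half b) cnormR ger0_norm ?invr_ge0// ler_pdivrMl//.
have -> : cnorm (b + b) = cnorm (iu *: (b + b)) by rewrite cnormZ ni mul1r.
by rewrite dblb (le_trans (cnormB _ _))// nu nsu; lra.
Qed.

(** The fixed point of [z = (y + z ^ 2) / 2] satisfies [(1 - z) ^ 2 = 1 - y]. On the ball of radius
    q the iteration is a contraction of ratio q, and every iterate is a real polynomial in y, hence
    self-adjoint and commuting with whatever commutes with y. *)
Lemma sqrt_near1 (y : A) (q : R) : sa y -> cnorm y <= q -> q < 1 ->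
  exists z : A, [/\ sa z, (1 - z) * (1 - z) = 1 - y
    & forall c, c * y = y * c -> c * z = z * c].
Proof.
move=> sy yq q1; have q0 : 0 <= q := le_trans (cnorm_ge0 _) yq.
pose zk := fix zk n := if n is k.+1 then (2^-1 : R) *` (y + zk k * zk k) else 0.
have zS k : zk k.+1 = (2^-1 : R) *` (y + zk k * zk k) by [].
have half : `|2^-1 : R| = 2^-1 by rewrite ger0_norm ?invr_ge0.
have zq k : cnorm (zk k) <= q.
  elim: k => [|k IHk]; first by rewrite cnorm0.
  rewrite zS cnormR half ler_pdivrMl// (le_trans (ler_cnormD _ _))//.
  rewrite (le_trans (lerD yq (ler_cnormM _ _)))//.
  have : cnorm (zk k) * cnorm (zk k) <= q * 1.
    by rewrite ler_pM ?cnorm_ge0// (le_trans IHk)// ltW.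
  lra.
have geo n : cnorm (zk n.+1 - zk n) <= 1 * q ^+ n.
  elim: n => [|n IHn].
    by rewrite subr0 (le_trans (zq _))// expr0 mulr1 ltW.
  rewrite [zk n.+2]zS [X in _ - X]zS -scalerBr opprD addrACA subrr add0r.
  have -> : zk n.+1 * zk n.+1 - zk n * zk n =
    zk n.+1 * (zk n.+1 - zk n) + (zk n.+1 - zk n) * zk n by ncring.
  rewrite cnormR half ler_pdivrMl// (le_trans (ler_cnormD _ _))//.
  have h1 := ler_cnormM (zk n.+1) (zk n.+1 - zk n).
  have h2 := ler_cnormM (zk n.+1 - zk n) (zk n).
  have h3 : cnorm (zk n.+1) * cnorm (zk n.+1 - zk n) <= q * (1 * q ^+ n).
    by rewrite ler_pM ?cnorm_ge0.
  have h4 : cnorm (zk n.+1 - zk n) * cnorm (zk n) <= (1 * q ^+ n) * q.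
    by rewrite ler_pM ?cnorm_ge0.
  by rewrite exprS; lra.
have [|z zl] := clim_geometric ler01 _ geo; first by rewrite q0.
have zl1 : clim (fun n => zk n.+1) z by apply: (cvg_comp (addn 1) _ _ zl); exact: cvg_addnl.
have zE : z = (2^-1 : R) *` (y + z * z).
  apply: (clim_unique zl1); apply: climZ; apply: climD; first exact: clim_cst.
  exact: climM.
exists z; split.
- apply: (clim_sa zl); elim=> [|k IHk]; first exact: sa0.
  by rewrite zS; apply/saR/saD => //; apply: saM.
- have -> : (1 - z) * (1 - z) = 1 - (z + z) + z * z by ncring.
  rewrite {1 2}zE -scalerDr rs_half; ncring.
- move=> c cy; apply: (clim_comm zl); elim=> [|k IHk].
    by rewrite mulr0 mul0r.
  by rewrite zS -scalerAr -scalerAl mulrDr mulrDl cy mulrA IHk -!mulrA IHk.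
Qed.

(* Positivity without spectra (Kelley and Vaught); sums and limits of such elements are
   visibly of this form.  See [positiveP] for the equivalence with [positive]. *)
Definition psd a := sa a /\ exists t, cnorm (t *` 1 - a) <= t.

(** Dividing [t - a] by [t + e] instead of t makes its norm less than 1, the range of [sqrt_near1];
    this is the reason for the shift by e. *)
Lemma psd_sqrt_eps a e : psd a -> 0 < e ->
  exists s : A, [/\ sa s, s * s = a + e *` 1
    & forall c, c * a = a * c -> c * s = s * c].
Proof.
move=> [sea [t tP]] e0; have t0 : 0 <= t := le_trans (cnorm_ge0 _) tP.
have te : 0 < t + e by lra.
pose y := (t + e)^-1 *` (t *` 1 - a).
have yq : cnorm y <= t / (t + e).
  rewrite /y cnormR ger0_norm ?invr_ge0 ?(ltW te)// mulrC.
  by rewrite ler_pM2r ?invr_gt0.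
have [||z [sz zz zc]] := sqrt_near1 _ yq.
- by apply/saR/saB => //; exact: saC.
- by rewrite ltr_pdivrMr// mul1r; lra.
exists (Num.sqrt (t + e) *` (1 - z)); split.
- by apply/saR/saB => //; exact: sa1.
- rewrite rsMl rsMr -rsM -expr2 sqr_sqrtr ?(ltW te)// zz /y scalerBr -rsM.
  by rewrite divff ?gt_eqF// rs1 rsD; ncring.
- move=> c ca; rewrite -scalerAr -scalerAl mulrBr mulrBl mulr1 mul1r zc//.
  by rewrite /y -scalerAr -scalerAl mulrBr mulrBl -scalerAl -scalerAr mulr1 mul1r ca.
Qed.

(** If c has norm less than 1 then [1 - c ^ 2] is a square [(1 - z) ^ 2], and [c + i (1 - z)] is
    unitary, so [1 - z] has norm at most 1. Norm 1 is reached by shrinking c slightly. *)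
Lemma sqr_bound c : sa c -> cnorm c <= 1 -> cnorm (1 - c * c) <= 1.
Proof.
move=> sc c1.
have lt1 (d : A) : sa d -> cnorm d < 1 -> cnorm (1 - d * d) <= 1.
  move=> sd d1.
  have [||z [sz zz zc]] := @sqrt_near1 (d * d) (cnorm (d * d)) _ (lexx _).
  - exact: saM.
  - by rewrite cnorm_sa_sqr// expr_lt1 ?cnorm_ge0.
  have sb : sa (1 - z) by apply: saB => //; exact: sa1.
  have dz : d * (1 - z) = (1 - z) * d by rewrite mulrBr mulrBl mulr1 mul1r zc// mulrA.
  have [] := @sqr_sum_norm d (1 - z) 1 sd sb dz ler01.
    by rewrite zz expr1n rs1 addrC subrK.
  by rewrite -zz cnorm_sa_sqr// => _; exact: exprn_ile1 (cnorm_ge0 _).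
apply/ler_addgt0Pr => e e0.
pose r := Num.max 0 (1 - e / 2).
have [r0 r1 re] : [/\ 0 <= r, r < 1 & 1 - r <= e / 2].
  by rewrite /r; case: (leP 0 (1 - e/2)) => h; split; lra.
have := lt1 (r *` c) (saR _ sc).
rewrite cnormR ger0_norm// rsMl rsMr -rsM => /(_ _)/wrap[].
  by rewrite (le_lt_trans _ r1)// ler_piMr.
have -> : 1 - c * c = (1 - (r * r) *` (c * c)) + (r * r - 1) *` (c * c).
  by rewrite rsB rs1; ncring.
move=> h; rewrite (le_trans (ler_cnormD _ _))// lerD//.
rewrite cnormR; have cc : cnorm (c * c) <= 1.
  by rewrite cnorm_sa_sqr// exprn_ile1 ?cnorm_ge0.
have h1 : `|r * r - 1| <= e by rewrite ler_norml; apply/andP; split; nra.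
by rewrite -[leRHS]mulr1 ler_pM// ?cnorm_ge0.
Qed.

Lemma psd_sqr_le c t : sa c -> cnorm (c * c) <= t -> cnorm (t *` 1 - c * c) <= t.
Proof.
move=> sc ct; have t0 : 0 <= t := le_trans (cnorm_ge0 _) ct.
have [te0|tn0] := eqVneq t 0; first rewrite te0 in ct *.
  suff -> : c * c = 0 by rewrite rs0 subr0 cnorm0.
  by apply/cnorm_eq0/le_anti; rewrite cnorm_ge0 andbT.
have tgt0 : 0 < t by rewrite lt_def tn0.
have st0 : 0 < Num.sqrt t by rewrite sqrtr_gt0.
have := @sqr_bound ((Num.sqrt t)^-1 *` c) (saR _ sc).
rewrite cnormR ger0_norm ?invr_ge0 ?(ltW st0)// => /(_ _)/wrap[].
  rewrite ler_pdivrMl// mulr1 -(ler_pXn2r (n:=2)) ?nnegrE ?cnorm_ge0 ?(ltW st0)//.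
  by rewrite -cnorm_sa_sqr// sqr_sqrtr.
rewrite rsMl rsMr -rsM -invfM -expr2 sqr_sqrtr// => h.
have -> : t *` 1 - c * c = t *` (1 - t^-1 *` (c * c)).
  by rewrite scalerBr -rsM divff// rs1.
by rewrite cnormR ger0_norm// ler_piMr.
Qed.

Lemma psd_sqr c : sa c -> psd (c * c).
Proof.
move=> sc; split; first exact: saM.
by exists (cnorm (c * c)); apply: psd_sqr_le.
Qed.

Lemma psd_sa a : psd a -> sa a. Proof. by case. Qed.

(** The definition of [psd] grants a single t; here t becomes any bound of the norm of a, which is
    what sums and limits require. *)
Lemma psd_le a t : psd a -> cnorm a <= t -> cnorm (t *` 1 - a) <= t.
Proof.
move=> pa at_; apply/ler_addgt0Pr => e e0.
have [s [ss sE _]] := psd_sqrt_eps pa e0.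
have := @psd_sqr_le s (t + e) ss; rewrite sE => /(_ _)/wrap[].
  by rewrite (le_trans (ler_cnormD _ _))// lerD// cnormC ger0_norm ?(ltW e0).
by rewrite rsD opprD addrACA subrr addr0.
Qed.

Lemma psdC t : 0 <= t -> psd (t *` 1).
Proof. by move=> t0; split; [exact: saC|exists t; rewrite subrr cnorm0]. Qed.

Lemma psd0 : psd 0. Proof. by rewrite -(rs0 1); exact: psdC. Qed.
Lemma psd1 : psd 1. Proof. by rewrite -(rs1 1); exact: psdC. Qed.

Lemma psdD a b : psd a -> psd b -> psd (a + b).
Proof.
move=> pa pb; split; first exact/saD/psd_sa/pb/psd_sa.
exists (cnorm a + cnorm b); rewrite rsD opprD addrACA.
by rewrite (le_trans (ler_cnormD _ _))// lerD// psd_le.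
Qed.

Lemma psdZ t a : 0 <= t -> psd a -> psd (t *` a).
Proof.
move=> t0 pa; split; first exact/saR/psd_sa.
exists (t * cnorm a); rewrite rsM -scalerBr cnormR ger0_norm// ler_wpM2l//.
exact: psd_le.
Qed.

Lemma psd_sum I (s : seq I) (P : pred I) (F : I -> A) :
  (forall i, P i -> psd (F i)) -> psd (\sum_(i <- s | P i) F i).
Proof. by move=> h; apply: big_ind => //; [exact: psd0|exact: psdD]. Qed.

Lemma psd_lim u a : clim u a -> (forall n, psd (u n)) -> psd a.
Proof.
move=> ua pu; split; first by apply: (clim_sa ua) => n; exact: psd_sa.
exists (cnorm a); apply/ler_addgt0Pr => e e0.
have [|N NP] := (climP u a).1 ua (e / 3); first by rewrite divr_gt0.
have h := NP _ (leqnn N).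
have h1 : cnorm (u N) <= cnorm a + e / 3.
  have := ler_cnormD (u N - a) a; rewrite subrK; lra.
have h2 := psd_le (pu N) h1.
have -> : cnorm a *` 1 - a = ((cnorm a + e / 3) *` 1 - u N) + (u N - a) - (e / 3) *` 1.
  rewrite rsD; ncring.
rewrite (le_trans (cnormB _ _))// cnormC ger0_norm ?divr_ge0 ?(ltW e0)//.
have := ler_cnormD ((cnorm a + e / 3) *` 1 - u N) (u N - a); lra.
Qed.

(** After a shift by [1 / (n + 1)] both factors have self-adjoint roots s and r that commute, and
    [s ^ 2 r ^ 2 = (s r) ^ 2]. *)
Lemma psdM a b : psd a -> psd b -> a * b = b * a -> psd (a * b).
Proof.
move=> pa pb ab; apply: (@psd_lim (fun n => (a + n.+1%:R^-1 *` 1) * (b + n.+1%:R^-1 *` 1))).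
  have e0 : clim (fun n => n.+1%:R^-1 *` 1) (0 : A).
    apply: (@clim_squeeze _ _ _ _ (fun n => n.+1%:R^-1)) => [n|].
      by rewrite subr0 cnormC ger0_norm ?invr_ge0.
    exact: cvg_harmonic.
  by rewrite -[X in X * _]addr0 -[X in _ * X]addr0; apply: climM; apply: climD => //; exact: clim_cst.
move=> n; have e0 : 0 < n.+1%:R^-1 :> R by rewrite invr_gt0.
have [s [ss sE sc]] := psd_sqrt_eps pa e0.
have [r [sr rE rc]] := psd_sqrt_eps pb e0.
have sr' : s * r = r * s.
  by apply: rc; symmetry; apply: sc.
rewrite -sE -rE; have -> : s * s * (r * r) = (s * r) * (s * r).
  by rewrite -!mulrA (mulrA r s) -sr' !mulrA.
by apply: psd_sqr; exact: saM.
Qed.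

(** If s and r are roots of [t - a + e] and [t + a + e], then [a ^ 2 + (s r) ^ 2 = (t + e) ^ 2], and
    [sqr_sum_norm] bounds a. *)
Lemma psd_norm_le a t : psd (t *` 1 - a) -> psd (t *` 1 + a) -> sa a -> cnorm a <= t.
Proof.
move=> p1 p2 sea; apply/ler_addgt0Pr => e e0.
have [s [ss sE sc]] := psd_sqrt_eps p1 e0.
have [r [sr rE rc]] := psd_sqrt_eps p2 e0.
have cst x (k : R) : x * (k *` 1) = (k *` 1) * x by rewrite rsMr rsMl mulr1 mul1r.
have as_ : a * s = s * a by apply: sc; rewrite mulrBr mulrBl cst.
have sr' : s * r = r * s by apply: rc; rewrite mulrDr mulrDl cst as_.
have ar : a * r = r * a by apply: rc; rewrite mulrDr mulrDl cst.
(* A negative t would make the negative scalar [2 t] positive. *)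
have te0 : 0 <= t + e.
  have : 0 <= t + t.
    case: (leP 0 (t + t)) => // tneg.
    have : psd ((t + t) *` 1).
      have -> : (t + t) *` 1 = (t *` 1 - a) + (t *` 1 + a) :> A by rewrite rsD; ncring.
      exact: psdD.
    move=> /(@psd_le _ (cnorm ((t + t) *` 1)))/(_ (lexx _)).
    by rewrite !cnormC -rsB cnormC (ltr0_norm tneg) ger0_norm; lra.
  lra.
have [] := @sqr_sum_norm a (s * r) (t + e) sea (saM ss sr sr') _ te0 => //.
  by rewrite !mulrA as_ -!mulrA ar.
have -> : s * r * (s * r) = (s * s) * (r * r) by rewrite -!mulrA (mulrA r s) -sr' !mulrA.
rewrite sE rE.
have -> : (t *` 1 - a + e *` 1) * (t *` 1 + a + e *` 1) = (t *` 1 + e *` 1) * (t *` 1 + e *` 1) - a * a + ((t *` 1 + e *` 1) * a - a * (t *` 1 + e *` 1)) by ncring.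
rewrite -rsD (cst a) subrr addr0 addrC subrK rsMl rsMr mulr1 -rsM//.
Qed.

Lemma psd_antisym a : psd a -> psd (- a) -> a = 0.
Proof.
move=> pa pna; apply/cnorm_eq0/le_anti; rewrite cnorm_ge0 andbT.
by apply: psd_norm_le (psd_sa pa); rewrite rs0 ?sub0r ?add0r.
Qed.

Lemma psd_of_norm a t : sa a -> cnorm a <= t -> psd (t *` 1 - a).
Proof.
move=> sea at_; split; first by apply: saB => //; exact: saC.
by exists t; rewrite opprB addrCA subrr addr0.
Qed.

Lemma psd_of_normN a t : sa a -> cnorm a <= t -> psd (t *` 1 + a).
Proof.
by move=> sea at_; rewrite -(opprK a); apply: psd_of_norm; rewrite ?cnormN//; exact: saN.
Qed.

Lemma psd_norm_mono a b : psd a -> psd (b - a) -> cnorm a <= cnorm b.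
Proof.
move=> pa pba; have sa_ := psd_sa pa.
have sb : sa b by rewrite -(subrK a b); exact/saD/sa_/psd_sa.
apply: psd_norm_le => //; last by apply: psdD => //; exact/psdC/cnorm_ge0.
have -> : cnorm b *` 1 - a = (cnorm b *` 1 - b) + (b - a) by ncring.
by apply: psdD => //; exact: psd_of_norm.
Qed.
End Psd.

(** * Continuous functional calculus *)

(* A form of uniform continuity on bounded sets that passes to operators, the square being
   controlled by the second moments of Bernstein weights. *)
Definition lucont (R : realType) (f : R -> R) := forall M e, 0 < e ->
  exists2 C : R, 0 <= C & forall s t, `|s| <= M -> `|t| <= M ->
    `|f s - f t| <= e + C * (s - t) ^+ 2.

Section Modulus.
Variable R : realType.
Implicit Types (f g : R -> R) (M e : R).

(** Compactness gives a radius [d / 2] within which f varies by less than e. Farther apart the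
    difference is at most twice a bound B of f, while [(s - t) ^ 2] is at least [(d / 2) ^ 2]; this
    fixes C. *)
Lemma continuous_lucont f : continuous f -> lucont f.
Proof.
move=> cf M e e0.
have [M0|M0] := ltP M 0.
  by exists 0 => // s t /(le_trans (normr_ge0 _)); rewrite leNgt M0.
have cK := @segment_compact R (- M) M.
pose P (d t : R) := forall s, `|s - t| < d -> `|f s - f t| < e.
have : \forall d \near (0 : R)^'+, `[(- M), M] `<=` P d.
  move/compact_near_coveringP : cK; apply => t0 _.
  have /cvgrPdist_lt/(_ (e / 2))[] := cf t0; first by rewrite divr_gt0.
  move=> d /= d0 dP.
  exists (ball t0 (d / 2), [set x | 0 < x < d / 2]) => /=.
    split; first by apply: nbhsx_ballx; rewrite divr_gt0.
    exists (d / 2) => /=; first by rewrite divr_gt0.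
    by move=> x /=; rewrite sub0r normrN => + x0; rewrite gtr0_norm// x0.
  move=> [t x] /= [t0t /andP[x0 xd]] s st.
  have t1 : `|f t0 - f t| < e / 2.
    by apply: dP; move: t0t; rewrite /ball /= => t0t; lra.
  have t2 : `|f t0 - f s| < e / 2.
    apply: dP; move: t0t; rewrite /ball /= => t0t.
    by have := ler_distD t t0 s; rewrite (distrC t s); lra.
  by have := ler_distD (f t0) (f s) (f t); rewrite (distrC (f s) (f t0)); lra.
case=> d /= d0 dP.
have d20 : 0 < d / 2 by rewrite divr_gt0.
have KP : `[(- M), M] `<=` P (d / 2).
  by apply: dP => //=; rewrite sub0r normrN gtr0_norm//; lra.
have [B B0 fB] : exists2 B, 0 <= B & forall s, `|s| <= M -> `|f s| <= B.
  have cfK : {within `[(- M), M], continuous f} by exact: continuous_subspaceT.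
  have MM : - M <= M by lra.
  have [c1 _ h1] := EVT_max MM cfK; have [c2 _ h2] := EVT_min MM cfK.
  exists (`|f c1| + `|f c2|) => [|s]; first by rewrite addr_ge0.
  rewrite ler_norml => sM; have sI : s \in `[(- M), M] by rewrite in_itv.
  have := h1 _ sI; have := h2 _ sI => g1 g2; rewrite ler_norml.
  move: (ler_norm (f c1)) (ler_norm (- f c2)) (normr_ge0 (f c1)) (normr_ge0 (f c2)).
  by clear -g1 g2; rewrite normrN => *; apply/andP; split; lra.
have d2 : 0 < (d / 2) ^+ 2 by rewrite exprn_gt0// divr_gt0.
exists ((B + B) / (d / 2) ^+ 2); first by rewrite divr_ge0 ?(ltW d2)// addr_ge0.
move=> s t sM tM; have [st|st] := ltP `|s - t| (d / 2).
  have tI : `[(- M), M]%classic t by rewrite /= in_itv/= -ler_norml.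
  have := KP t tI s st => /ltW/le_trans; apply; rewrite lerDl.
  by rewrite mulr_ge0 ?sqr_ge0// divr_ge0 ?(ltW d2)// addr_ge0.
have h : (d / 2) ^+ 2 <= (s - t) ^+ 2.
  by rewrite -[leRHS]real_normK ?num_real// ler_pXn2r ?nnegrE ?divr_ge0 ?(ltW d0).
apply: (@le_trans _ _ (B + B)).
  by rewrite (le_trans (ler_normB _ _))// lerD ?fB.
rewrite -mulrA mulrC; have : 1 <= (d / 2) ^- 2 * (s - t) ^+ 2.
  by rewrite mulrC ler_pdivlMr// mul1r.
set q := _ * _ => q1; have : 1 * (B + B) <= q * (B + B) by rewrite ler_wpM2r ?addr_ge0.
lra.
Qed.

Lemma lucont_bound f M : lucont f -> exists2 B, 0 < B & forall s, `|s| <= M -> `|f s| <= B.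
Proof.
move=> /(_ `|M| 1 ltr01)[C C0 fC].
exists (`|f 0| + 1 + C * M ^+ 2).
  by have := normr_ge0 (f 0); have := mulr_ge0 C0 (sqr_ge0 M); lra.
move=> s sM; have := fC s 0 (le_trans sM (ler_norm M)).
rewrite normr0 => /(_ (normr_ge0 _)); rewrite subr0.
have : s ^+ 2 <= M ^+ 2.
  rewrite -[leLHS]real_normK ?num_real// -[leRHS]real_normK ?num_real//.
  by rewrite ler_pXn2r ?nnegrE// (le_trans sM)// ler_norm.
move=> h h1; have h2 : C * s ^+ 2 <= C * M ^+ 2 by rewrite ler_wpM2l.
have := ler_normD (f s - f 0) (f 0); rewrite subrK; lra.
Qed.
End Modulus.

(** * Bernstein polynomials and their moments *)

Section Bernstein.
Variable S : comNzRingType.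
Implicit Types (X : S) (n : nat).
Definition bern n (i : nat) : {poly S} := ((1 - 'X) ^+ (n - i) * 'X ^+ i) *+ 'C(n, i).

Lemma bern_sum n : \sum_(i < n.+1) bern n i = 1.
Proof. by rewrite -exprDn subrK expr1n. Qed.

Lemma bern_shift n i : bern n.+1 i.+1 *+ i.+1 = 'X *+ n.+1 * bern n i.
Proof.
rewrite /bern subSS -mulrnA mulnC -mul_bin_diag mulrnAl mulrnAr -mulrnA mulnC.
by rewrite mulrCA -exprS.
Qed.

Lemma bern_sum1 n : \sum_(i < n.+1) bern n i *+ i = 'X *+ n.
Proof.
case: n => [|n]; first by rewrite big_ord1.
rewrite big_ord_recl mulr0n add0r -[RHS]mulr1 -(bern_sum n) mulr_sumr.
by apply: eq_bigr => i _; rewrite bern_shift.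
Qed.

Lemma bern_sum2 n : \sum_(i < n.+1) bern n i *+ (i * i.-1) = 'X ^+ 2 *+ (n * n.-1).
Proof.
case: n => [|n]; first by rewrite big_ord1.
rewrite big_ord_recl mulr0n add0r expr2 mulrnA -mulrnAl -mulrnAr.
rewrite -(bern_sum1 n) mulr_sumr.
apply: eq_bigr => i _; rewrite /= /bump add1n /= mulrnA bern_shift.
by rewrite add0n [RHS]mulrnAr.
Qed.
End Bernstein.

Section ResolutionBound.
Variables (R : realType) (A : cstarAlgType R).
Variables (I J : finType) (w : I -> A) (v : J -> A).
Hypotheses (w_psd : forall i, psd (w i)) (v_psd : forall j, psd (v j)).
Hypothesis wv : forall i j, w i * v j = v j * w i.
Hypotheses (w1 : \sum_i w i = 1) (v1 : \sum_j v j = 1).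

Lemma wv_psd i j : psd (w i * v j).
Proof. exact: psdM. Qed.

Lemma wv_sum_cst (e : R) : \sum_i \sum_j e *` (w i * v j) = e *` 1.
Proof.
under eq_bigr do rewrite -scaler_sumr -mulr_sumr v1 mulr1.
by rewrite -scaler_sumr w1.
Qed.

(** The products [w i * v j] are positive and sum to 1, so [(e + C s) 1] plus or minus the K-sum is
    C times the positive element [s 1] minus the D-sum, plus a combination with nonnegative
    coefficients. *)
Lemma resolution_bound (K D : I -> J -> R) (e C s : R) : 0 <= C ->
  (forall i j, `|K i j| <= e + C * D i j) ->
  cnorm (\sum_i \sum_j D i j *` (w i * v j)) <= s ->
  cnorm (\sum_i \sum_j K i j *` (w i * v j)) <= e + C * s.
Proof.
move=> C0 KD Ds.
set KK := \sum_i _; set DD := \sum_i _ in Ds.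
have sDD : sa DD by apply/sa_sum => i _; apply/sa_sum => j _; exact/saR/psd_sa/wv_psd.
have sKK : sa KK by apply/sa_sum => i _; apply/sa_sum => j _; exact/saR/psd_sa/wv_psd.
have h (q : R) : `|q| = 1 -> psd ((e + C * s) *` 1 + q *` KK).
  move=> q1.
  have -> : (e + C * s) *` 1 + q *` KK = C *` (s *` 1 - DD) +
     (\sum_i \sum_j (e + C * D i j + q * K i j) *` (w i * v j)).
    have -> : \sum_i \sum_j (e + C * D i j + q * K i j) *` (w i * v j) =
        e *` 1 + C *` DD + q *` KK.
      rewrite -wv_sum_cst /DD /KK !scaler_sumr -!big_split; apply: eq_bigr => i _.
      rewrite !scaler_sumr -!big_split; apply: eq_bigr => j _ /=.
      by rewrite !rsD !rsM.
    by rewrite rsD rsM scalerBr; ncring.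
  apply: psdD; first by apply: psdZ => //; exact: psd_of_norm.
  apply: psd_sum => i _; apply: psd_sum => j _; apply: psdZ (wv_psd i j).
  have : `|q * K i j| <= e + C * D i j by rewrite normrM q1 mul1r.
  by rewrite ler_norml => /andP[+ _]; rewrite -subr_ge0 opprK addrC.
apply: psd_norm_le => //.
  by have := h (-1); rewrite normrN1 rsN rs1; apply.
by have := h 1; rewrite normr1 rs1; apply.
Qed.

(** As for the mean square distance of two independent random variables, with w and v in the role of
    their distributions. *)
Lemma resolution_spread (x : I -> R) (y : J -> R) :
  \sum_i \sum_j (x i - y j) ^+ 2 *` (w i * v j) =
  \sum_i (x i ^+ 2) *` w i - (2 : R) *` ((\sum_i x i *` w i) * (\sum_j y j *` v j))
   + \sum_j (y j ^+ 2) *` v j.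
Proof.
rewrite mulr_suml scaler_sumr.
have -> : \sum_j (y j ^+ 2) *` v j = \sum_i \sum_j (y j ^+ 2) *` (w i * v j).
  rewrite exchange_big /=; apply: eq_bigr => j _.
  by rewrite -scaler_sumr -mulr_suml w1 mul1r.
rewrite -sumrB -big_split; apply: eq_bigr => i _ /=.
have -> : (x i ^+ 2) *` w i = \sum_j (x i ^+ 2) *` (w i * v j).
  by rewrite -scaler_sumr -mulr_sumr v1 mulr1.
rewrite mulr_sumr scaler_sumr -sumrB -big_split; apply: eq_bigr => j _ /=.
rewrite rsMl rsMr -!rsM -rsB -rsD; congr (_ *` _); ring.
Qed.
End ResolutionBound.

Section WeightedSums.
Variables (R : realType) (A : cstarAlgType R).
Implicit Types (x y a b c d : A) (r s t e M : R) (f g h : R -> R) (n m : nat).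

Definition frame M a : A := (2 * M)^-1 *` (a + M *` 1 : A).
Definition bw M a n (i : nat) : A := horner_alg (frame M a) (bern R[i] n.+1 i).
Definition pt M n (i : nat) : R := M * (2 * i%:R / n.+1%:R - 1).
(** The Bernstein polynomial of f on [[-M, M]], taken at a; [frame] carries this interval to
    [[0, 1]]. The degree is n + 1, so that the denominator in [pt] never vanishes. *)
Definition wsum f M a n : A := \sum_(i < n.+2) f (pt M n i) *` bw M a n i.

Lemma rs_nat k x : (k%:R : R) *` x = x *+ k.
Proof. by rewrite rmorph_nat scaler_nat. Qed.

Lemma horner_alg_intertwine x a b (p : {poly R[i]}) :
  x * a = b * x -> x * horner_alg a p = horner_alg b p * x.
Proof.
move=> xab; elim/poly_ind: p => [|p c IHp]; first by rewrite !rmorph0 mulr0 mul0r.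
rewrite !rmorphD !rmorphM /= !horner_algX !horner_algC mulrDr mulrDl.
by rewrite mulrA IHp -!mulrA xab -scalerAr -scalerAl mulr1 mul1r.
Qed.

Lemma frame_intertwine M x a b : x * a = b * x -> x * frame M a = frame M b * x.
Proof.
by move=> xab; rewrite /frame rsMl rsMr (mulrDr x) (mulrDl b) xab rsMl rsMr mulr1 mul1r.
Qed.

Lemma bw_intertwine M x a b n i : x * a = b * x -> x * bw M a n i = bw M b n i * x.
Proof. by move=> xab; apply/horner_alg_intertwine/frame_intertwine. Qed.

Lemma wsum_intertwine f M x a b n : x * a = b * x -> x * wsum f M a n = wsum f M b n * x.
Proof.
move=> xab; rewrite /wsum mulr_sumr mulr_suml; apply: eq_bigr => i _.
by rewrite rsMl rsMr (bw_intertwine _ _ _ xab).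
Qed.

Lemma bw_comm M M' a b n m i j : a * b = b * a -> bw M a n i * bw M' b m j = bw M' b m j * bw M a n i.
Proof. by move=> ab; apply: bw_intertwine; symmetry; apply: bw_intertwine. Qed.

Lemma bw_sum1 M a n : \sum_(i < n.+2) bw M a n i = 1.
Proof. by rewrite -rmorph_sum bern_sum rmorph1. Qed.

Lemma pt_le M n (i : 'I_n.+2) : 0 < M -> `|pt M n i| <= M.
Proof.
move=> M0; rewrite normrM gtr0_norm// ler_piMr ?(ltW M0)// ler_norml.
have : (i%:R : R) <= n.+1%:R by rewrite ler_nat -ltnS.
have i0 : 0 <= (i%:R : R) by [].
have n0 : 0 < (n.+1%:R : R) by [].
move=> h; have h1 : i%:R / n.+1%:R <= 1 :> R by rewrite ler_pdivrMr// mul1r.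
have h2 : 0 <= i%:R / n.+1%:R :> R by rewrite divr_ge0.
by rewrite -mulrA; move: h1 h2; set q : R := _ / _ => h1 h2; apply/andP; split; lra.
Qed.

Lemma wsumD f g M a n : wsum (f \+ g) M a n = wsum f M a n + wsum g M a n.
Proof. by rewrite /wsum -big_split; apply: eq_bigr => i _ /=; rewrite rsD. Qed.

Lemma wsumZ r f M a n : wsum (fun s => r * f s) M a n = r *` wsum f M a n.
Proof. by rewrite /wsum scaler_sumr; apply: eq_bigr => i _ /=; rewrite rsM. Qed.

Lemma wsum_cst r M a n : wsum (fun=> r) M a n = r *` 1.
Proof. by rewrite /wsum -scaler_sumr bw_sum1. Qed.

Lemma horner_frame_sum1 M a n :
  \sum_(i < n.+2) (i%:R : R) *` bw M a n i = n.+1%:R *` frame M a.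
Proof.
under eq_bigr do rewrite rs_nat -rmorphMn.
by rewrite -rmorph_sum bern_sum1 rmorphMn /= horner_algX rs_nat.
Qed.

Lemma horner_frame_sum2 M a n :
  \sum_(i < n.+2) (i%:R * i%:R : R) *` bw M a n i =
  (n.+1%:R * n%:R) *` (frame M a * frame M a) + n.+1%:R *` frame M a.
Proof.
rewrite -horner_frame_sum1.
have -> : (n.+1%:R * n%:R) *` (frame M a * frame M a) =
    \sum_(i < n.+2) ((i * i.-1)%:R : R) *` bw M a n i.
  under eq_bigr do rewrite rs_nat -rmorphMn.
  rewrite -rmorph_sum bern_sum2 rmorphMn rmorphXn /= horner_algX -natrM rs_nat.
  by rewrite expr2.
rewrite -big_split; apply: eq_bigr => -[[|i] ?] _ /=; first by rewrite mul0n mul0r !rs0 addr0.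
by rewrite -rsD -natrM -natrD -mulnSr.
Qed.

Lemma wsum_id M a n : M != 0 -> wsum id M a n = a.
Proof.
move=> M0; rewrite /wsum.
have -> : \sum_(i < n.+2) pt M n i *` bw M a n i =
   (2 * M / n.+1%:R) *` (\sum_(i < n.+2) i%:R *` bw M a n i) - M *` \sum_(i < n.+2) bw M a n i.
  rewrite !scaler_sumr -sumrB; apply: eq_bigr => i _.
  by rewrite -rsM -rsB /pt; congr (_ *` _); ring.
rewrite horner_frame_sum1 bw_sum1 -rsM /frame -rsM.
rewrite (_ : _ * (2 * M)^-1 = 1) ?rs1 ?addrK//.
by rewrite divfK ?pnatr_eq0// divff// mulf_neq0 ?pnatr_eq0.
Qed.

(** The error term is the variance of a binomial distribution; its factor [1 / (n + 1)] drives the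
    convergence of [wsum]. *)
Lemma wsum_sqr M a n : M != 0 ->
  wsum (fun s => s ^+ 2) M a n = a * a + n.+1%:R^-1 *` ((M ^+ 2) *` 1 - a * a).
Proof.
move=> M0; rewrite /wsum; set N : R := n.+1%:R.
have N0 : N != 0 by rewrite pnatr_eq0.
have -> : \sum_(i < n.+2) (pt M n i ^+ 2) *` bw M a n i =
   (4 * M ^+ 2 / N ^+ 2) *` (\sum_(i < n.+2) (i%:R * i%:R) *` bw M a n i)
   - (4 * M ^+ 2 / N) *` (\sum_(i < n.+2) i%:R *` bw M a n i)
   + (M ^+ 2) *` \sum_(i < n.+2) bw M a n i.
  rewrite !scaler_sumr -sumrB -big_split; apply: eq_bigr => i _ /=.
  by rewrite -!rsM -rsB -rsD /pt -/N; congr (_ *` _); field.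
rewrite horner_frame_sum1 bw_sum1 horner_frame_sum2 -/N.
have -> : n%:R = N - 1 by rewrite /N -(natr1 n) addrK.
have aE : a = (2 * M) *` frame M a - M *` 1.
  by rewrite -rsM divff ?mulf_neq0 ?pnatr_eq0// rs1 addrK.
move: (frame M a) aE => X aE.
have aa : a * a = (4 * M ^+ 2) *` (X * X) - (4 * M ^+ 2) *` X + (M ^+ 2) *` 1.
  rewrite aE mulrBl !mulrBr !(rsMl, rsMr) mulr1 mul1r -!rsM.
  have -> : 2 * M * (2 * M) = 4 * M ^+ 2 by ring.
  have -> : 4 * M ^+ 2 = 2 * M * M + M * (2 * M) by ring.
  by rewrite (rsD _ _ X) expr2 mulr1; ncring.
rewrite aa scalerBr [N^-1 *` (_ + _)]scalerDr [N^-1 *` (_ - _)]scalerBr scalerDr -!rsM.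
have -> : 4 * M ^+ 2 / N * N = 4 * M ^+ 2 by field.
have -> : 4 * M ^+ 2 / N ^+ 2 * (N * (N - 1)) = 4 * M ^+ 2 - N^-1 * (4 * M ^+ 2) by field.
have -> : 4 * M ^+ 2 / N ^+ 2 * N = N^-1 * (4 * M ^+ 2) by field.
rewrite [(_ - N^-1 * _) *` _]rsB; ncring.
Qed.

Section Converge.
Variables (a : A) (M : R).
Hypotheses (sa_a : sa a) (M_gt0 : 0 < M) (aM : cnorm a <= M).

Lemma frame_psd : psd (frame M a).
Proof.
by apply: psdZ; [rewrite invr_ge0 mulr_ge0 ?ltW|rewrite addrC; exact: psd_of_normN].
Qed.

Lemma frame_psd1 : psd (1 - frame M a).
Proof.
have -> : 1 - frame M a = (2 * M)^-1 *` (M *` 1 - a).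
  have one : 1 = (2 * M)^-1 *` (M *` 1 + M *` 1) :> A.
    rewrite -rsD -rsM (_ : M + M = 2 * M) ?mulVf ?rs1//; last ring.
    by rewrite mulf_neq0 ?pnatr_eq0 ?gt_eqF.
  by rewrite {1}one /frame -scalerBr; congr (_ *: _); ncring.
by apply: psdZ; [rewrite invr_ge0 mulr_ge0 ?ltW|exact: psd_of_norm].
Qed.

Lemma psdX x k : psd x -> psd (x ^+ k).
Proof.
move=> px; elim: k => [|k IHk]; first exact: psd1.
by rewrite exprS; apply: psdM => //; rewrite -exprSr -exprS.
Qed.

Lemma bw_psd n i : psd (bw M a n i).
Proof.
rewrite /bw /bern rmorphMn rmorphM !rmorphXn rmorphB rmorph1 /= horner_algX.
rewrite -rs_nat; apply: psdZ => //; apply: psdM.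
- exact/psdX/frame_psd1.
- exact/psdX/frame_psd.
- by apply: commrX; apply/commr_sym/commrX/commrB; [exact: commr1|].
Qed.

Lemma wsum_sa f n : sa (wsum f M a n).
Proof. by apply: sa_sum => i _; exact/saR/psd_sa/bw_psd. Qed.

Lemma wsum_psd f n : (forall s, `|s| <= M -> 0 <= f s) -> psd (wsum f M a n).
Proof.
move=> f0; apply: psd_sum => i _; apply: psdZ (bw_psd _ _); apply: f0.
exact: pt_le.
Qed.

Lemma wsum_sqr_le n :
  cnorm (wsum (fun s => s ^+ 2) M a n - a * a) <= M ^+ 2 * n.+1%:R^-1.
Proof.
rewrite wsum_sqr ?gt_eqF// addrC addKr cnormR ger0_norm ?invr_ge0// mulrC.
rewrite ler_wpM2r ?invr_ge0// psd_sqr_le// cnorm_sa_sqr//.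
by rewrite ler_pXn2r ?nnegrE ?cnorm_ge0 ?(ltW M_gt0).
Qed.
End Converge.

(** The function g serves two uses: [g = id] compares two approximations at one element, and b equal
    to [g(a)] gives the composition rule. In both cases the mean square spread on the right tends to
    0. *)
Lemma wsum_dist a b M M' n m f g h e C :
  sa a -> 0 < M -> cnorm a <= M -> sa b -> 0 < M' -> cnorm b <= M' ->
  a * b = b * a -> 0 <= C ->
  (forall s t, `|s| <= M -> `|t| <= M' -> `|f s - h t| <= e + C * (g s - t) ^+ 2) ->
  cnorm (wsum f M a n - wsum h M' b m) <= e + C *
    cnorm (wsum (fun s => g s ^+ 2) M a n - (2 : R) *` (wsum g M a n * b)
           + wsum (fun s => s ^+ 2) M' b m).
Proof.
move=> sea M0 aM seb M'0 bM' ab C0 fh.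
have pa i := bw_psd sea M0 aM n i; have pb i := bw_psd seb M'0 bM' m i.
have ca (i : 'I_n.+2) (j : 'I_m.+2) := bw_comm M M' n m i j ab.
have := @resolution_bound R A _ _ (fun i : 'I_n.+2 => bw M a n i)
  (fun j : 'I_m.+2 => bw M' b m j) _ _ ca (bw_sum1 M a n) (bw_sum1 M' b m)
  (fun i j => f (pt M n i) - h (pt M' m j)) (fun i j => (g (pt M n i) - pt M' m j) ^+ 2)
  e C _ C0 _ (lexx _).
have -> : \sum_(i < n.+2) \sum_(j < m.+2) (f (pt M n i) - h (pt M' m j)) *` (bw M a n i * bw M' b m j) =
    wsum f M a n - wsum h M' b m.
  under eq_bigr => i _ do under eq_bigr => j _ do rewrite rsB.
  under eq_bigr => i _ do rewrite sumrB -scaler_sumr -mulr_sumr bw_sum1 mulr1.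
  rewrite sumrB exchange_big /=; congr (_ - _).
  by apply: eq_bigr => j _; rewrite -scaler_sumr -mulr_suml bw_sum1 mul1r.
rewrite resolution_spread ?bw_sum1//.
rewrite -[\sum_(j < m.+2) pt M' m j *` _]/(wsum id M' b m) wsum_id ?gt_eqF//.
by apply=> // i j; apply: fh; exact: pt_le.
Qed.

(** Two bounds M and M' are allowed, so that the limit is seen not to depend on the interval. *)
Lemma wsum_cauchy a M M' f e : sa a -> lucont f -> 0 < M -> cnorm a <= M ->
  0 < M' -> cnorm a <= M' -> 0 < e ->
  exists N, forall n m, (N <= n)%N -> (N <= m)%N ->
    cnorm (wsum f M a n - wsum f M' a m) < e.
Proof.
move=> sea cf M0 aM M'0 aM' e0.
have [|C C0 fC] := cf (Num.max M M') (e / 2); first by rewrite divr_gt0.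
have : (fun n : nat => C * (M ^+ 2 + M' ^+ 2) * n.+1%:R^-1) @ \oo --> (0 : R).
  rewrite -[X in _ --> X](mulr0 (C * (M ^+ 2 + M' ^+ 2))).
  by apply: cvgM; [exact: cvg_cst|exact: cvg_harmonic].
move=> /cvgrPdist_lt/(_ (e / 2))[]; first by rewrite divr_gt0.
move=> N _ NP; exists N => n m Nn Nm.
have := NP N (leqnn N); rewrite /= sub0r normrN ger0_norm; last first.
  by rewrite !mulr_ge0 ?addr_ge0 ?sqr_ge0 ?invr_ge0.
move=> hN; have mono k : (N <= k)%N -> k.+1%:R^-1 <= N.+1%:R^-1 :> R.
  by move=> Nk; rewrite lef_pV2 ?posrE// ler_nat.
apply: le_lt_trans (@wsum_dist a a M M' n m f id f (e / 2) C _ _ _ _ _ _ _ _ _) _ => //.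
  by move=> s t sM tM; apply: fC; rewrite le_max ?sM ?tM ?orbT.
rewrite wsum_id ?gt_eqF// rs2.
have -> : wsum (fun s => id s ^+ 2) M a n - (a * a + a * a) + wsum (fun s => s ^+ 2) M' a m =
  (wsum (fun s => s ^+ 2) M a n - a * a) + (wsum (fun s => s ^+ 2) M' a m - a * a) by ncring.
have h1 := wsum_sqr_le sea M0 aM n; have h2 := wsum_sqr_le sea M'0 aM' m.
have h3 := ler_cnormD (wsum (fun s => s ^+ 2) M a n - a * a) (wsum (fun s => s ^+ 2) M' a m - a * a).
have h4 : M ^+ 2 * n.+1%:R^-1 <= M ^+ 2 * N.+1%:R^-1 by rewrite ler_wpM2l ?sqr_ge0 ?mono.
have h5 : M' ^+ 2 * m.+1%:R^-1 <= M' ^+ 2 * N.+1%:R^-1 by rewrite ler_wpM2l ?sqr_ge0 ?mono.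
have h6 := le_trans h3 (lerD (le_trans h1 h4) (le_trans h2 h5)).
rewrite -mulrDl in h6.
apply: le_lt_trans (lerD (lexx (e / 2)) (ler_wpM2l C0 h6)) _.
by rewrite mulrA [ltRHS](splitr e) ltrD2l.
Qed.

(** Adding 1 keeps the radius positive when a = 0. For self-adjoint a and [lucont] f the limit
    exists, so the default 0 is then not met. *)
Definition fc f a : A := xget 0 [set l | clim (wsum f (cnorm a + 1) a) l].

Lemma fc_lim f a M : sa a -> lucont f -> 0 < M -> cnorm a <= M ->
  clim (wsum f M a) (fc f a).
Proof.
move=> sea cf M0 aM.
have M1 : 0 < cnorm a + 1 by rewrite ltr_wpDl ?cnorm_ge0.
have aM1 : cnorm a <= cnorm a + 1 by rewrite lerDl.
have [|l hl] := @clim_cauchy _ _ (wsum f (cnorm a + 1) a).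
  by move=> e e0; have [N NP] := wsum_cauchy sea cf M1 aM1 M1 aM1 e0; exists N.
have hf : clim (wsum f (cnorm a + 1) a) (fc f a).
  exact: (@xgetPex _ 0 [set l | clim (wsum f (cnorm a + 1) a) l] (ex_intro _ l hl)).
have -> : wsum f M a = fun n => (wsum f M a n - wsum f (cnorm a + 1) a n) + wsum f (cnorm a + 1) a n.
  by apply/funext => n; rewrite subrK.
rewrite -[X in clim _ X]add0r; apply: climD => //; apply/climP => e e0.
have [N NP] := wsum_cauchy sea cf M0 aM M1 aM1 e0; exists N => n Nn.
by rewrite subr0; exact: NP.
Qed.
End WeightedSums.

Section LucontClosure.
Variable R : realType.
Implicit Types (f g : R -> R) (M e : R).

Lemma lipschitz_lucont f (L : R) : (forall s t, `|f s - f t| <= L * `|s - t|) -> lucont f.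
Proof.
move=> fL M e e0; exists (L ^+ 2 / (4 * e)).
  by rewrite divr_ge0 ?sqr_ge0// mulr_ge0// ltW.
move=> s t _ _; apply: le_trans (fL s t) _; set x := `|s - t|.
have -> : (s - t) ^+ 2 = x ^+ 2 by rewrite real_normK ?num_real.
have h : 0 <= (L * x - 2 * e) ^+ 2 / (4 * e) by rewrite divr_ge0 ?sqr_ge0// mulr_ge0// ltW.
rewrite -subr_ge0 (le_trans h)// le_eqVlt; apply/orP; left; apply/eqP.
by field; rewrite gt_eqF.
Qed.

Lemma lucont_cst (c : R) : lucont (fun=> c).
Proof. by apply: (@lipschitz_lucont _ 0) => s t; rewrite subrr normr0 mul0r. Qed.

Lemma lucont_id : lucont (id : R -> R).
Proof. by apply: (@lipschitz_lucont _ 1) => s t; rewrite mul1r. Qed.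

Lemma lucontD f g : lucont f -> lucont g -> lucont (fun s => f s + g s).
Proof.
move=> cf cg M e e0; have e2 : 0 < e / 2 by rewrite divr_gt0.
have [C C0 fC] := cf M _ e2; have [D D0 gD] := cg M _ e2.
exists (C + D) => [|s t sM tM]; first exact: addr_ge0.
have := fC _ _ sM tM; have := gD _ _ sM tM.
have -> : f s + g s - (f t + g t) = (f s - f t) + (g s - g t) by ring.
by have := ler_normD (f s - f t) (g s - g t); rewrite mulrDl; lra.
Qed.

Lemma lucontM f g : lucont f -> lucont g -> lucont (fun s => f s * g s).
Proof.
move=> cf cg M e e0.
have [Bf Bf0 fB] := lucont_bound M cf; have [Bg Bg0 gB] := lucont_bound M cg.
have e1 : 0 < e / (2 * Bg) by rewrite divr_gt0// mulr_gt0.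
have e2 : 0 < e / (2 * Bf) by rewrite divr_gt0// mulr_gt0.
have [C C0 fC] := cf M _ e1; have [D D0 gD] := cg M _ e2.
exists (C * Bg + Bf * D) => [|s t sM tM].
  by rewrite addr_ge0// mulr_ge0// ltW.
have -> : f s * g s - f t * g t = (f s - f t) * g s + f t * (g s - g t) by ring.
have h1 := fC _ _ sM tM; have h2 := gD _ _ sM tM.
apply: le_trans (ler_normD _ _) _; rewrite !normrM.
have k1 : `|f s - f t| * `|g s| <= (e / (2 * Bg) + C * (s - t) ^+ 2) * Bg by rewrite ler_pM// gB.
have k2 : `|f t| * `|g s - g t| <= Bf * (e / (2 * Bf) + D * (s - t) ^+ 2) by rewrite ler_pM// fB.
apply: le_trans (lerD k1 k2) _.
rewrite le_eqVlt; apply/orP; left; apply/eqP; field.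
by rewrite !gt_eqF.
Qed.

Lemma lucontZ (r : R) f : lucont f -> lucont (fun s => r * f s).
Proof. by apply: lucontM; exact: lucont_cst. Qed.

Lemma lucontB f g : lucont f -> lucont g -> lucont (fun s => f s - g s).
Proof.
move=> cf cg.
have -> : (fun s => f s - g s) = (fun s => f s + (-1) * g s) by apply/funext => s; ring.
by apply: lucontD => //; exact: lucontZ.
Qed.

Lemma lucont_comp f g : lucont f -> lucont g -> lucont (f \o g).
Proof.
move=> cf cg M e e0; have e2 : 0 < e / 2 by rewrite divr_gt0.
have [B B0 gB] := lucont_bound M cg.
have [C C0 fC] := cf B _ e2.
(* The modulus of g controls the first power of its difference, so one factor of the square is
   replaced by the bound [2 B]; C + 1 keeps the divisor positive. *)
have k0 : 0 < 2 * B * (C + 1) by rewrite !mulr_gt0// ltr_wpDl.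
have e3 : 0 < e / 2 / (2 * B * (C + 1)) by rewrite divr_gt0.
have [D D0 gD] := cg M _ e3.
exists (2 * B * (C + 1) * D) => [|s t sM tM]; first by rewrite mulr_ge0// ltW.
apply: le_trans (fC _ _ (gB _ sM) (gB _ tM)) _.
have h := gD _ _ sM tM.
have h1 : (g s - g t) ^+ 2 <= 2 * B * `|g s - g t|.
  rewrite -real_normK ?num_real// expr2 ler_wpM2r//.
  by rewrite (le_trans (ler_normB _ _))// mulr2n mulrDl mul1r lerD ?gB.
have h2 : C * (g s - g t) ^+ 2 <= 2 * B * (C + 1) * `|g s - g t|.
  apply: (@le_trans _ _ ((C + 1) * (g s - g t) ^+ 2)).
    by rewrite ler_wpM2r ?sqr_ge0// lerDl.
  by rewrite (mulrC (2 * B)) -mulrA ler_wpM2l// addr_ge0.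
have h3 := ler_wpM2l (ltW k0) h.
apply: le_trans (lerD (lexx _) (le_trans h2 h3)) _.
rewrite le_eqVlt; apply/orP; left; apply/eqP; field.
by apply/andP; split; rewrite gt_eqF// ltr_wpDl.
Qed.

Lemma lucont_max (c : R) : lucont (fun s => Num.max s c).
Proof.
apply: (@lipschitz_lucont _ 1) => s t; rewrite mul1r.
by case: (leP s c); case: (leP t c) => h1 h2; rewrite ler_norml; case: (ger0P (s - t)) => h3; apply/andP; split; lra.
Qed.

Lemma lucont_min (c : R) : lucont (fun s => Num.min s c).
Proof.
apply: (@lipschitz_lucont _ 1) => s t; rewrite mul1r.
by case: (leP s c); case: (leP t c) => h1 h2; rewrite ler_norml; case: (ger0P (s - t)) => h3; apply/andP; split; lra.
Qed.

Lemma lucont_abs : lucont (fun s : R => `|s|).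
Proof.
apply: (@lipschitz_lucont _ 1) => s t; rewrite mul1r.
exact: ler_dist_dist.
Qed.

Lemma lucont_sqrt : lucont (@Num.sqrt R).
Proof. by apply: continuous_lucont => s; exact: sqrt_continuous. Qed.

Lemma lucont_inv_max (c : R) : 0 < c -> lucont (fun s => (Num.max s c)^-1).
Proof.
move=> c0; apply: (@lipschitz_lucont _ (c ^- 2)) => s t.
set u := Num.max s c; set v := Num.max t c.
have uc : c <= u by rewrite le_max lexx orbT.
have vc : c <= v by rewrite le_max lexx orbT.
have u0 := lt_le_trans c0 uc; have v0 := lt_le_trans c0 vc.
have -> : u^-1 - v^-1 = (v - u) / (u * v) by field; rewrite !gt_eqF.
have uv : `|v - u| <= `|s - t|.
  rewrite /u /v.
  by case: (leP s c); case: (leP t c) => h1 h2; rewrite ler_norml; case: (ger0P (s - t)) => h3; apply/andP; split; lra.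
rewrite normrM mulrC (gtr0_norm (x := (u * v)^-1)) ?invr_gt0 ?mulr_gt0//.
rewrite ler_pM// ?invr_ge0 ?mulr_ge0 ?(ltW u0) ?(ltW v0)//.
by rewrite lef_pV2 ?posrE ?mulr_gt0// expr2 ler_pM// ltW.
Qed.
End LucontClosure.

Section FunctionalCalculus.
Variables (R : realType) (A : cstarAlgType R).
Implicit Types (x y a b c d : A) (r s t e M : R) (f g h : R -> R) (n m : nat).

Let bd a : 0 < cnorm a + 1 /\ cnorm a <= cnorm a + 1.
Proof. by rewrite ltr_wpDl ?cnorm_ge0// lerDl. Qed.

(** The relation holds for polynomials and passes to the limit, on an interval that serves both a
    and b. With [a = star x * x] and [b = x * star x] it moves functions across x. *)
Lemma fc_intertwine f x a b : sa a -> sa b -> lucont f -> x * a = b * x ->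
  x * fc f a = fc f b * x.
Proof.
move=> sea seb cf xab; pose M := Num.max (cnorm a) (cnorm b) + 1.
have M0 : 0 < M by rewrite ltr_wpDl// le_max cnorm_ge0.
have aM : cnorm a <= M by rewrite (le_trans (y := Num.max (cnorm a) (cnorm b))) ?lerDl// le_max lexx.
have bM : cnorm b <= M by rewrite (le_trans (y := Num.max (cnorm a) (cnorm b))) ?lerDl// le_max lexx orbT.
apply: (@clim_unique _ _ (fun n => x * wsum f M a n)).
  by apply: climM; [exact: clim_cst|exact: fc_lim].
apply: (@clim_ext _ _ (fun n => wsum f M b n * x)).
  by apply: climM; [exact: fc_lim|exact: clim_cst].
by move=> n; rewrite (wsum_intertwine _ _ _ xab).
Qed.

Lemma fc_comm f a x : sa a -> lucont f -> x * a = a * x -> x * fc f a = fc f a * x.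
Proof. by move=> sea; exact: fc_intertwine. Qed.

Lemma fcD f g a : sa a -> lucont f -> lucont g -> fc (fun s => f s + g s) a = fc f a + fc g a.
Proof.
move=> sea cf cg; have [M0 aM] := bd a.
apply: clim_unique (fc_lim sea (lucontD cf cg) M0 aM) _.
apply: (clim_ext (climD (fc_lim sea cf M0 aM) (fc_lim sea cg M0 aM))) => n.
by rewrite -wsumD.
Qed.

Lemma fcZ r f a : sa a -> lucont f -> fc (fun s => r * f s) a = r *` fc f a.
Proof.
move=> sea cf; have [M0 aM] := bd a.
apply: clim_unique (fc_lim sea (lucontZ r cf) M0 aM) _.
by apply: (clim_ext (climZ r%:C (fc_lim sea cf M0 aM))) => n; rewrite -wsumZ.
Qed.

Lemma fc_cst r a : sa a -> fc (fun=> r) a = r *` 1.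
Proof.
move=> sea; have [M0 aM] := bd a.
apply: clim_unique (fc_lim sea (lucont_cst r) M0 aM) _.
by apply: (clim_ext (clim_cst (r *` 1))) => n; rewrite wsum_cst.
Qed.

Lemma fc_id a : sa a -> fc id a = a.
Proof.
move=> sea; have [M0 aM] := bd a.
apply: clim_unique (fc_lim sea (@lucont_id R) M0 aM) _.
by apply: (clim_ext (clim_cst a)) => n; rewrite wsum_id// gt_eqF.
Qed.

Lemma fcB f g a : sa a -> lucont f -> lucont g -> fc (fun s => f s - g s) a = fc f a - fc g a.
Proof.
move=> sea cf cg.
have -> : (fun s => f s - g s) = (fun s => f s + (-1) * g s) by apply/funext => s; ring.
by rewrite fcD ?fcZ// ?rsN ?rs1//; exact: lucontZ.
Qed.

Lemma fc_sa f a : sa a -> lucont f -> sa (fc f a).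
Proof.
move=> sea cf; have [M0 aM] := bd a.
by apply: (clim_sa (fc_lim sea cf M0 aM)) => n; exact: wsum_sa.
Qed.

Lemma fc_psdM f a M : sa a -> lucont f -> 0 < M -> cnorm a <= M ->
  (forall s, `|s| <= M -> 0 <= f s) -> psd (fc f a).
Proof.
by move=> sea cf M0 aM f0; apply: (psd_lim (fc_lim sea cf M0 aM)) => n; exact: wsum_psd.
Qed.

Lemma fc_psd f a : sa a -> lucont f -> (forall s, 0 <= f s) -> psd (fc f a).
Proof. by move=> sea cf f0; have [M0 aM] := bd a; exact: fc_psdM M0 aM _. Qed.

Lemma fc_normM f a M r : sa a -> lucont f -> 0 < M -> cnorm a <= M ->
  (forall s, `|s| <= M -> `|f s| <= r) -> cnorm (fc f a) <= r.
Proof.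
move=> sea cf M0 aM fr; apply: psd_norm_le; last exact: fc_sa.
  rewrite -(fc_cst r sea) -fcB//; last exact: lucont_cst.
  apply: (fc_psdM (M := M)) => //; first by apply: lucontB => //; exact: lucont_cst.
  by move=> s /fr; rewrite subr_ge0; apply: le_trans; exact: ler_norm.
rewrite -(fc_cst r sea) -fcD//; last exact: lucont_cst.
apply: (fc_psdM (M := M)) => //; first by apply: lucontD => //; exact: lucont_cst.
by move=> s /fr; rewrite ler_norml => /andP[+ _]; lra.
Qed.

Lemma fc_norm f a r : sa a -> lucont f -> (forall s, `|f s| <= r) -> cnorm (fc f a) <= r.
Proof. by move=> sea cf fr; have [M0 aM] := bd a; exact: fc_normM M0 aM _. Qed.

(** With the same weights used twice, the defect of multiplicativity is the double sum of
    [f s_i (g s_i - g s_j) w_i w_j]; the bound of f and the vanishing spread of the weights control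
    it. *)
Lemma fcM f g a : sa a -> lucont f -> lucont g -> fc (fun s => f s * g s) a = fc f a * fc g a.
Proof.
move=> sea cf cg; have [M0 aM] := bd a; set M := _ + 1 in M0 aM.
have h1 := fc_lim sea (lucontM cf cg) M0 aM.
have h2 := climM (fc_lim sea cf M0 aM) (fc_lim sea cg M0 aM).
apply/eqP; rewrite -subr_eq0; apply/eqP.
apply: clim_unique (climB h1 h2) _ => {h1 h2}.
have [B B0 fB] := lucont_bound M cf.
apply/climP => e e0.
have e1 : 0 < e / (2 * B) by rewrite divr_gt0// mulr_gt0.
have [C C0 gC] := cg M _ e1.
have : (fun n : nat => B * C * (2 * M ^+ 2) * n.+1%:R^-1) @ \oo --> (0 : R).
  rewrite -[X in _ --> X](mulr0 (B * C * (2 * M ^+ 2))).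
  by apply: cvgM; [exact: cvg_cst|exact: cvg_harmonic].
move=> /cvgrPdist_lt/(_ (e / 2))[]; first by rewrite divr_gt0.
move=> N _ NP; exists N => n /NP /=; rewrite sub0r normrN => hn; rewrite subr0.
have pa i := bw_psd sea M0 aM n i.
have ca (i j : 'I_n.+2) := bw_comm M M n n i j (erefl (a * a)).
have := @resolution_bound R A _ _ (fun i : 'I_n.+2 => bw M a n i)
  (fun j : 'I_n.+2 => bw M a n j) _ _ ca (bw_sum1 M a n) (bw_sum1 M a n)
  (fun i j => f (pt M n i) * (g (pt M n i) - g (pt M n j)))
  (fun i j => (pt M n i - pt M n j) ^+ 2)
  (e / 2) (B * C) _ (mulr_ge0 (ltW B0) C0) _ (lexx _).
have -> : \sum_(i < n.+2) \sum_(j < n.+2) (f (pt M n i) * (g (pt M n i) - g (pt M n j))) *`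
      (bw M a n i * bw M a n j) =
    wsum (fun s => f s * g s) M a n - wsum f M a n * wsum g M a n.
  rewrite {2}/wsum mulr_suml -sumrB; apply: eq_bigr => i _.
  rewrite mulr_sumr.
  under eq_bigr => j _ do rewrite mulrBr rsB.
  rewrite sumrB; congr (_ - _).
    by rewrite -scaler_sumr -mulr_sumr bw_sum1 mulr1.
  by apply: eq_bigr => j _; rewrite rsMl rsMr -!rsM.
rewrite resolution_spread ?bw_sum1//.
rewrite -[\sum_(j < n.+2) pt M n j *` _]/(wsum id M a n) wsum_id ?gt_eqF//.
rewrite -[\sum_(j < n.+2) (pt M n j ^+ 2) *` _]/(wsum (fun s => s ^+ 2) M a n) rs2.
move=> /(_ pa pa) h; apply: le_lt_trans (h _) _ => [i j|].
  rewrite normrM; have pi := pt_le i M0; have pj := pt_le j M0.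
  apply: le_trans (ler_pM _ _ (fB _ pi) (gC _ _ pi pj)) _ => //.
  rewrite le_eqVlt; apply/orP; left; apply/eqP.
  by field; rewrite ?gt_eqF.
have -> : wsum (fun s => s ^+ 2) M a n - (a * a + a * a) + wsum (fun s => s ^+ 2) M a n =
  (wsum (fun s => s ^+ 2) M a n - a * a) + (wsum (fun s => s ^+ 2) M a n - a * a) by ncring.
rewrite [ltRHS](splitr e) ltrD2l; apply: le_lt_trans (le_lt_trans (ler_norm _) hn).
rewrite -mulrA; apply: ler_wpM2l; first by rewrite mulr_ge0// ltW.
rewrite (le_trans (ler_cnormD _ _))// -mulrA mulr2n mulrDl mul1r lerD//; exact: wsum_sqr_le.
Qed.

(** The nodes of a, moved by g, are compared with the nodes of [b = g(a)]; their mean square spread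
    tends to [g(a) ^ 2 - 2 g(a) b + b ^ 2 = 0]. *)
Lemma fc_comp f g a : sa a -> lucont f -> lucont g -> fc f (fc g a) = fc (f \o g) a.
Proof.
move=> sea cf cg; have [M0 aM] := bd a; set M := _ + 1 in M0 aM.
set b := fc g a; have seb : sa b by exact: fc_sa.
have [B B0 gB] := lucont_bound M cg.
pose M' := B + cnorm b; have M'0 : 0 < M' by rewrite ltr_wpDr ?cnorm_ge0.
have bM' : cnorm b <= M' by rewrite lerDr ltW.
have ab : a * b = b * a by apply: fc_comm.
have h1 := fc_lim sea (lucont_comp cf cg) M0 aM; have h2 := fc_lim seb cf M'0 bM'.
apply/esym/eqP; rewrite -subr_eq0; apply/eqP/cnorm_eq0/le_anti.
rewrite cnorm_ge0 andbT; apply/ler_addgt0Pr => e e0; rewrite add0r.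
have [C C0 fC] := cf M' e e0.
have h3 : clim (fun n => wsum (fun s => g s ^+ 2) M a n - (2 : R) *` (wsum g M a n * b)
           + wsum (fun s => s ^+ 2) M' b n) 0.
  have -> : (0 : A) = fc (fun s => g s ^+ 2) a - (2 : R) *` (b * b) + fc (fun s => s ^+ 2) b.
    rewrite [fc _ a](_ : _ = b * b); last exact: fcM.
    rewrite [fc _ b](_ : _ = b * b); last first.
      by rewrite -{2 3}(fc_id seb) -fcM//; exact: lucont_id.
    by rewrite rs2; ncring.
  apply: climD; first apply: climB.
  - by apply: fc_lim => //; exact: lucontM.
  - by apply: climZ; apply: climM; [exact: fc_lim|exact: clim_cst].
  - by apply: fc_lim => //; apply: lucontM; exact: lucont_id.
have h4 := clim_norm (climB h1 h2); have h5 := clim_norm h3.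
rewrite cnorm0 in h5.
have h6 : (fun n => e + C * cnorm (wsum (fun s => g s ^+ 2) M a n
   - (2 : R) *` (wsum g M a n * b) + wsum (fun s => s ^+ 2) M' b n)) @ \oo --> (e : R).
  rewrite -[X in _ --> X]addr0 -[X in _ --> _ + X](mulr0 C).
  by apply: cvgD; [exact: cvg_cst|apply: cvgM => //; exact: cvg_cst].
apply: (ler_cvg_to h4 h6); apply: nearW => n; apply: wsum_dist => // s t sM tM.
by apply: fC => //; rewrite (le_trans (gB _ sM))// lerDl cnorm_ge0.
Qed.
End FunctionalCalculus.

(** * Positive and negative parts *)

Section PositiveElements.
Variables (R : realType) (A : cstarAlgType R).
Implicit Types (x y a b c d : A) (r s t e M : R) (f g h : R -> R) (n m : nat).

Definition negp s : R := Num.max (- s) 0.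
Definition cut t s : R := Num.max (s - t) 0.
(** The element usually written [(a - t)_+]. *)
Definition pcut t a : A := fc (cut t) a.
Definition psqrt a : A := fc (@Num.sqrt R) a.

Lemma fc_eq f g a : f =1 g -> fc f a = fc g a.
Proof. by move/funext ->. Qed.

Lemma lucont_negp : lucont negp.
Proof.
apply: (@lucont_comp _ (fun s => Num.max s 0) (fun s => - s)); first exact: lucont_max.
have -> : (fun s : R => - s) = (fun s => (-1) * s) by apply/funext => s; rewrite mulN1r.
exact/lucontZ/lucont_id.
Qed.

Lemma lucont_cut t : lucont (cut t).
Proof.
apply: (@lucont_comp _ (fun s => Num.max s 0) (fun s => s - t)); first exact: lucont_max.
by apply: lucontB; [exact: lucont_id|exact: lucont_cst].
Qed.

Lemma negp_ge0 s : 0 <= negp s. Proof. by rewrite le_max lexx orbT. Qed.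
Lemma cut_ge0 t s : 0 <= cut t s. Proof. by rewrite le_max lexx orbT. Qed.

Lemma negpE s : s * negp s = - (negp s * negp s).
Proof. by rewrite /negp; case: leP => _; ring. Qed.

Lemma abs_negp s : `|s| = s + 2 * negp s.
Proof. by rewrite /negp; case: (leP (- s) 0) => h; [rewrite ger0_norm|rewrite ltr0_norm]; lra. Qed.

Lemma sa_sqr_eq0 a : sa a -> a * a = 0 -> a = 0.
Proof.
move=> sea aa; apply/cnorm_eq0/eqP; rewrite -sqrf_eq0 -cnorm_sa_sqr// aa.
by rewrite cnorm0.
Qed.

Lemma starl_eq0 x : star x * x = 0 -> x = 0.
Proof.
move=> xx; apply/cnorm_eq0/eqP; rewrite -sqrf_eq0 -cnorm_star xx.
by rewrite cnorm0.
Qed.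

(** The product of a and its negative part is positive, being a product of commuting positive
    elements, and it is also minus a square. *)
Lemma psd_negp0 a : psd a -> fc negp a = 0.
Proof.
move=> pa; have sea := psd_sa pa; have cn := lucont_negp.
have pn : psd (fc negp a) := fc_psd sea cn negp_ge0.
apply: sa_sqr_eq0; first exact: psd_sa.
apply: psd_antisym; first exact: psd_sqr (psd_sa pn).
rewrite -fcM//.
have -> : - fc (fun s => negp s * negp s) a = a * fc negp a.
  rewrite -{2}(fc_id sea) -fcM//; last exact: lucont_id.
  have -> : (fun s => id s * negp s) = (fun s => (-1) * (negp s * negp s)).
    by apply/funext => s /=; rewrite negpE mulN1r.
  by rewrite fcZ ?rsN ?rs1//; exact: lucontM.
by apply: psdM => //; exact: fc_comm.
Qed.

Lemma fc_absE a : sa a -> fc (fun s => `|s|) a = a + (2 : R) *` fc negp a.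
Proof.
move=> sea; have cn := lucont_negp.
have -> : (fun s : R => `|s|) = (fun s => id s + 2 * negp s).
  by apply/funext => s; exact: abs_negp.
by rewrite fcD ?fcZ ?fc_id//; [exact: lucont_id|exact: lucontZ].
Qed.

Lemma psd_abs a : psd a -> fc (fun s => `|s|) a = a.
Proof.
by move=> pa; rewrite fc_absE ?psd_negp0 ?scaler0 ?addr0//; exact: psd_sa.
Qed.

(** As a is its own absolute value, both functions may be composed with [|s|], after which they
    agree everywhere. *)
Lemma fc_psd_ext f g a : psd a -> lucont f -> lucont g ->
  (forall s, 0 <= s -> f s = g s) -> fc f a = fc g a.
Proof.
move=> pa cf cg fg; have sea := psd_sa pa; have ca := @lucont_abs R.
rewrite -(psd_abs pa) !fc_comp//; apply: fc_eq => s /=.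
exact: fg.
Qed.

Lemma fc_psd_ge0 f a : psd a -> lucont f -> (forall s, 0 <= s -> 0 <= f s) -> psd (fc f a).
Proof.
move=> pa cf f0; have sea := psd_sa pa; have ca := @lucont_abs R.
rewrite -(psd_abs pa) fc_comp//; apply: fc_psd => //; first exact: lucont_comp.
by move=> s; exact: f0.
Qed.

Lemma fc_psd_le f g a : psd a -> lucont f -> lucont g ->
  (forall s, 0 <= s -> f s <= g s) -> psd (fc g a - fc f a).
Proof.
move=> pa cf cg fg; rewrite -fcB//; last exact: psd_sa.
apply: fc_psd_ge0 => //; first exact: lucontB.
by move=> s s0; rewrite subr_ge0 fg.
Qed.

Lemma fc_psd_norm f a r : psd a -> lucont f ->
  (forall s, 0 <= s -> `|f s| <= r) -> cnorm (fc f a) <= r.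
Proof.
move=> pa cf fr; have sea := psd_sa pa; have ca := @lucont_abs R.
rewrite -(psd_abs pa) fc_comp//; apply: fc_norm => //; first exact: lucont_comp.
by move=> s; exact: fr.
Qed.

Lemma fc_psd_norm_le f a r : psd a -> lucont f ->
  (forall s, 0 <= s -> s <= cnorm a -> `|f s| <= r) -> cnorm (fc f a) <= r.
Proof.
move=> pa cf fr; have sea := psd_sa pa.
have cm := lucont_min (cnorm a); have ca := @lucont_abs R.
have [a0|a0] := eqVneq (cnorm a) 0.
  have -> : a = 0 by exact: cnorm_eq0.
  have h : fc f 0 = f 0 *` 1 :> A.
    have -> : (0 : A) = fc (fun=> 0 : R) 0 by rewrite fc_cst ?rs0//; exact: sa0.
    rewrite (fc_comp (sa0 A) cf (lucont_cst 0)).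
    exact: (fc_cst (f 0) (sa0 A)).
  by rewrite h cnormC fr// a0.
have agt0 : 0 < cnorm a by rewrite lt_def a0 cnorm_ge0.
rewrite -(psd_abs pa) fc_comp//.
apply: (fc_normM (M := cnorm a)) => //; first exact: lucont_comp.
by move=> s sa_ /=; rewrite fr.
Qed.

(* Kaplansky: with a = x^* x and y = x a_-^(1/2), y^* y = - a_-^2 is negative while
   y^* y + y y^* is a sum of two squares. *)
Lemma psd_starl x : psd (star x * x).
Proof.
set a := star x * x; have sea : sa a by exact: sa_starl.
have cn := lucont_negp; set am := fc negp a.
have pam : psd am := fc_psd sea cn negp_ge0.
suff am0 : am = 0.
  have -> : a = fc (fun s => `|s|) a by rewrite fc_absE// -/am am0 scaler0 addr0.
  by apply: fc_psd => //; exact: lucont_abs.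
have csn : lucont (fun s => Num.sqrt (negp s)).
  by apply: (lucont_comp _ cn); exact: lucont_sqrt.
set r := fc (fun s => Num.sqrt (negp s)) a.
have sr : sa r by exact: fc_sa.
pose y := x * r.
have yyE : star y * y = - (am * am).
  rewrite /y starM sr -mulrA (mulrA _ x) -/a.
  have ar : a * r = r * a by apply: fc_comm.
  rewrite ar mulrA -[am * am]fcM// -[r * r]fcM//.
  rewrite -{2}(fc_id sea) -fcM//; [|exact: lucontM|exact: lucont_id].
  have -> : (fun s => Num.sqrt (negp s) * Num.sqrt (negp s) * id s) =
      (fun s => (-1) * (negp s * negp s)).
    by apply/funext => s; rewrite -expr2 sqr_sqrtr ?negp_ge0// mulrC negpE mulN1r.
  by rewrite fcZ ?rsN ?rs1//; exact: lucontM.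
set c := star y * y in yyE; pose d := y * star y.
have pnc : psd (- c) by rewrite yyE opprK; exact: psd_sqr (psd_sa pam).
pose iu : R[i] := (0 +i* 1)%C.
have ciu : conjc iu = - iu by rewrite /iu; simpc.
have iiu : iu * iu = -1.
  by apply/eqP; rewrite eq_complex /=; apply/andP; split; apply/eqP; ring.
have pd : psd d.
  have s1 : sa (y + star y) by rewrite /sa starD starK addrC.
  have s2 : sa (iu *: (y - star y)).
    by rewrite /sa starZ ciu starB starK scaleNr -scalerN opprB.
  have -> : d = - c + (2^-1 : R) *` ((y + star y) * (y + star y) +
      (iu *: (y - star y)) * (iu *: (y - star y))).
    rewrite -scalerAl -scalerAr scalerA iiu scaleN1r.
    have -> : (y + star y) * (y + star y) - (y - star y) * (y - star y) = (c + d) + (c + d).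
      by rewrite /c /d; ncring.
    by rewrite rs_half addKr.
  by apply: psdD => //; apply: psdZ; rewrite ?invr_ge0//; apply: psdD; exact: psd_sqr.
have sc : sa c by exact: sa_starl.
have sd := psd_sa pd.
have cm := lucont_max (0 : R).
have c0 : fc (fun s => Num.max s 0) c = 0.
  have cN : lucont (fun s : R => - s).
    have -> : (fun s : R => - s) = (fun s => (-1) * s) by apply/funext => s; rewrite mulN1r.
    exact/lucontZ/lucont_id.
  have -> : c = fc (fun s => - s) (- c).
    have -> : (fun s : R => - s) = (fun s => (-1) * id s) by apply/funext => s; rewrite mulN1r.
    by rewrite fcZ ?rsN ?rs1 ?fc_id ?opprK//; [exact: psd_sa|exact: psd_sa|exact: lucont_id].
  by rewrite fc_comp//; [exact: psd_negp0|exact: psd_sa].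
have d0 : fc (fun s => Num.max s 0) d = d.
  rewrite -[RHS](fc_id sd); apply: fc_psd_ext => //; first exact: lucont_id.
  by move=> s s0; apply/max_idPl.
(* From [d y = y c] follows [d_+ y = y c_+] for the positive parts; here [d_+ = d] and [c_+ = 0]. *)
have dy : d * y = 0.
  rewrite -d0 -(@fc_intertwine _ _ _ y c d) ?c0 ?mulr0//.
  by rewrite /c /d mulrA.
have {}d0' : d = 0 by apply: sa_sqr_eq0; rewrite // {2}/d mulrA dy mul0r.
have y0 : star y = 0 by apply: starl_eq0; rewrite starK.
apply: sa_sqr_eq0; first exact: psd_sa.
by apply/oppr_inj; rewrite -yyE /c y0 mul0r oppr0.
Qed.

Lemma psd_starr x : psd (x * star x).
Proof. by rewrite -{1}(starK x); exact: psd_starl. Qed.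

Lemma lucont_sqr_sqrt : lucont (fun s : R => Num.sqrt s * Num.sqrt s).
Proof. by apply: lucontM; exact: lucont_sqrt. Qed.

Lemma psqrtK a : psd a -> psqrt a * psqrt a = a.
Proof.
move=> pa; have sea := psd_sa pa; have cs := @lucont_sqrt R.
rewrite -fcM// -[RHS](fc_id sea); apply: fc_psd_ext => //.
- exact: lucont_sqr_sqrt.
- exact: lucont_id.
- by move=> s s0; rewrite -expr2 sqr_sqrtr.
Qed.

Lemma psqrt_psd a : psd a -> psd (psqrt a).
Proof.
by move=> pa; apply: fc_psd => [||s]; [exact: psd_sa|exact: lucont_sqrt|exact: sqrtr_ge0].
Qed.

Lemma psqrt_sa a : psd a -> star (psqrt a) = psqrt a.
Proof. by move=> /psqrt_psd/psd_sa. Qed.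

Lemma positiveP a : positive a <-> psd a.
Proof.
split=> [[x ->]|pa]; first exact: psd_starl.
by exists (psqrt a); rewrite psqrt_sa// psqrtK.
Qed.

Lemma psd_conj x b : psd b -> psd (star x * b * x).
Proof.
move=> pb; rewrite -(psqrtK pb).
have -> : star x * (psqrt b * psqrt b) * x = star (psqrt b * x) * (psqrt b * x).
  by rewrite starM psqrt_sa// !mulrA.
exact: psd_starl.
Qed.

Lemma psd_conjr x b : psd b -> psd (x * b * star x).
Proof. by move=> pb; rewrite -{1}(starK x); exact: psd_conj. Qed.

Lemma psd_conjB x a b : psd (b - a) -> psd (star x * b * x - star x * a * x).
Proof. by move=> /(psd_conj x); rewrite mulrBr mulrBl. Qed.

Lemma psd_le_norm a : psd a -> psd (cnorm a *` 1 - a).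
Proof. by move=> /psd_sa sea; exact: psd_of_norm. Qed.

Lemma psd_trans a b c : psd (b - a) -> psd (c - b) -> psd (c - a).
Proof. by move=> p q; have -> : c - a = (b - a) + (c - b); [ncring|exact: psdD]. Qed.

Lemma psd_conj_le x b : psd b -> psd (cnorm b *` (star x * x) - star x * b * x).
Proof.
move=> pb; have := psd_conjB x (psd_le_norm pb).
by rewrite rsMr mulr1 rsMl.
Qed.

Lemma cut0 a : psd a -> pcut 0 a = a.
Proof.
move=> pa; rewrite -[RHS](fc_id (psd_sa pa)); apply: fc_psd_ext => //.
- exact: lucont_cut.
- exact: lucont_id.
- by move=> s s0; rewrite /cut subr0; apply/max_idPl.
Qed.

Lemma pcut_psd t a : sa a -> psd (pcut t a).
Proof. by move=> sea; apply: fc_psd => //; [exact: lucont_cut|exact: cut_ge0]. Qed.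

Lemma pcut_dist t a : psd a -> 0 <= t -> cnorm (a - pcut t a) <= t.
Proof.
move=> pa t0; have ct := lucont_cut t; have ci := @lucont_id R; have sea := psd_sa pa.
rewrite -{1}(fc_id sea) -fcB//; apply: fc_psd_norm => //; first exact: lucontB.
by move=> s s0; rewrite /cut; case: (leP (s - t) 0) => h; rewrite ger0_norm /=; lra.
Qed.

Lemma pcut_eq0 t a : psd a -> cnorm a <= t -> pcut t a = 0.
Proof.
move=> pa at_; apply/cnorm_eq0/le_anti; rewrite cnorm_ge0 andbT.
apply: fc_psd_norm_le => //; first exact: lucont_cut.
move=> s s0 sa_; have -> : cut t s = 0 by apply/max_idPr; lra.
by rewrite normr0.
Qed.

Lemma pcut_neq0 t a : psd a -> 0 <= t -> t < cnorm a -> pcut t a != 0.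
Proof.
move=> pa t0 ta; apply/eqP => p0; have := pcut_dist pa t0.
by rewrite p0 subr0 leNgt ta.
Qed.

Lemma sa_cut_decomp t a : sa a ->
  exists am, [/\ psd am, a - t *` 1 = pcut t a - am, pcut t a * am = 0
    & forall x, x * a = a * x -> x * am = am * x].
Proof.
move=> sea; have ct := lucont_cut t.
have cn : lucont (fun s => negp (s - t)).
  apply: (lucont_comp lucont_negp); apply: lucontB; [exact: lucont_id|exact: lucont_cst].
exists (fc (fun s => negp (s - t)) a); split.
- by apply: fc_psd => // s; exact: negp_ge0.
- rewrite -fcB// -{1}(fc_id sea) -(fc_cst t sea) -fcB//; [|exact: lucont_id|exact: lucont_cst].
  apply: fc_eq => s; rewrite /cut /negp /=.
  by case: (leP (s - t) 0); case: (leP (- (s - t)) 0); lra.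
- rewrite -fcM// (_ : (fun s => _) = (fun=> 0)) ?fc_cst ?rs0//.
  apply/funext => s; rewrite /cut /negp.
  by case: (leP (s - t) 0) => h1; rewrite ?mul0r//; case: (leP (- (s - t)) 0) => h2; rewrite ?mulr0//; lra.
- by move=> x xa; apply: fc_comm.
Qed.

(** Pointwise, one of x and y vanishes and the matching inequality gives c. In the algebra, with
    [m = c_-], the cube [m ^ 3] lies below both [m ^ 2 x] and [m ^ 2 y], whose product is zero;
    hence [(m ^ 3) ^ 2 <= 0] and m vanishes. *)
Lemma comm_lub x y c : psd x -> psd y -> x * y = 0 -> sa c -> x * c = c * x -> y * c = c * y ->
  psd (c + x) -> psd (c + y) -> psd c.
Proof.
move=> px py xy sc xc yc cx cy; have sx := psd_sa px; have sy := psd_sa py.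
have cn := lucont_negp; set cm := fc negp c.
have pcm : psd cm := fc_psd sc cn negp_ge0.
suff cm0 : cm = 0.
  have -> : c = fc (fun s => `|s|) c by rewrite fc_absE// -/cm cm0 scaler0 addr0.
  by apply: fc_psd => //; exact: lucont_abs.
have xm : x * cm = cm * x by apply: fc_comm.
have ym : y * cm = cm * y by apply: fc_comm.
have cmc : c * cm = cm * c by apply: fc_comm.
have ccm : cm * c = - (cm * cm).
  rewrite -cmc -{1}(fc_id sc) -[fc id c * cm]fcM//; last exact: lucont_id.
  have -> : (fun s => id s * negp s) = (fun s => (-1) * (negp s * negp s)).
    by apply/funext => s /=; rewrite negpE mulN1r.
  by rewrite fcZ ?rsN ?rs1 ?fcM//; exact: lucontM.
have pc2 : psd (cm * cm) by exact/psd_sqr/psd_sa.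
pose p := cm * cm * cm.
have pp : psd p by apply: psdM => //; rewrite !mulrA.
have key z : z * cm = cm * z -> psd z -> psd (c + z) -> psd (cm * cm * z - p).
  move=> zm pz cz; have -> : cm * cm * z - p = cm * cm * (c + z).
    rewrite mulrDr -(mulrA cm cm c) ccm /p; ncring.
  apply: psdM => //; rewrite mulrDr mulrDl.
  have -> : z * (cm * cm) = cm * cm * z by rewrite mulrA zm -mulrA zm mulrA.
  by have -> : c * (cm * cm) = cm * cm * c by rewrite mulrA cmc -mulrA cmc mulrA.
have q1 := key x xm px cx; have q2 := key y ym py cy.
set q := cm * cm * x in q1; set q' := cm * cm * y in q2.
have xc2 : x * (cm * cm) = cm * cm * x by rewrite mulrA xm -mulrA xm mulrA.
have yc2 : y * (cm * cm) = cm * cm * y by rewrite mulrA ym -mulrA ym mulrA.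
have qq : q * q' = 0 by rewrite /q /q' -(mulrA _ x) (mulrA x) xc2 -!mulrA xy !mulr0.
have xp : x * p = p * x by rewrite /p mulrA xc2 -!mulrA xm.
have yp : y * p = p * y by rewrite /p mulrA yc2 -!mulrA ym.
have c2p : cm * cm * p = p * (cm * cm) by rewrite /p !mulrA.
have qp : q * p = p * q by rewrite /q -mulrA xp mulrA c2p -mulrA.
have q'p : q' * p = p * q' by rewrite /q' -mulrA yp mulrA c2p -mulrA.
have qq' : q * q' = q' * q.
  have yx : y * x = 0 by rewrite -sx -sy -starM xy star0.
  by rewrite qq /q /q' -(mulrA _ y) (mulrA y) yc2 -!mulrA yx !mulr0.
have pq : psd q.
  by apply: psdM.
have pp0 : p * p = 0.
  apply: psd_antisym; first exact/psd_sqr/psd_sa.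
  have -> : - (p * p) = q * (q' - p) + (q - p) * p.
    have -> : q * (q' - p) + (q - p) * p = q * q' - p * p by ncring.
    by rewrite qq sub0r.
  apply: psdD; apply: psdM => //.
  - by rewrite mulrBr mulrBl qp qq'.
  - by rewrite mulrBl mulrBr qp.
have p0 : p = 0 by apply: sa_sqr_eq0 => //; exact: psd_sa.
have c20 : cm * cm = 0.
  apply: sa_sqr_eq0; first exact: psd_sa.
  by rewrite mulrA -/p p0 mul0r.
by apply: sa_sqr_eq0 => //; exact: psd_sa.
Qed.

(** Among positive elements commuting with a, [(a - t)_+] is the least one above [a - t]: apply
    [comm_lub] to [b - (a - t)_+] with the positive and the negative part of [a - t], which are
    orthogonal. *)
Lemma pcut_le_comm t a b : sa a -> psd b -> a * b = b * a -> psd (b - (a - t *` 1)) ->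
  psd (b - pcut t a).
Proof.
move=> sea pb ab h; have [am [pam aE aam amc]] := sa_cut_decomp t sea.
have ct := lucont_cut t; have pca := pcut_psd t sea.
have bca : b * pcut t a = pcut t a * b by apply: fc_comm.
have bam : b * am = am * b by apply: amc.
have sb := psd_sa pb.
have ama : am * pcut t a = 0 by rewrite -(psd_sa pam) -(psd_sa pca) -starM aam star0.
apply: (comm_lub pca pam aam).
- exact/saB/psd_sa.
- by rewrite mulrBr mulrBl bca.
- by rewrite mulrBr mulrBl bam aam ama.
- by rewrite subrK.
- by have -> : b - pcut t a + am = b - (a - t *` 1) by rewrite aE; ncring.
Qed.
End PositiveElements.

(** * Matrix algebras *)

Lemma cvg_sum0 (R : realType) (I : finType) (F : I -> nat -> R) :
  (forall i, F i @ \oo --> (0 : R)) -> (fun k => \sum_i F i k) @ \oo --> (0 : R).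
Proof.
move=> F0; elim: (index_enum I) => [|i s IHs].
  have -> : (fun k => \sum_(i <- [::]) F i k) = fun=> 0 :> R.
    by apply/funext => k; rewrite big_nil.
  exact: cvg_cst.
have -> : (fun k => \sum_(j <- i :: s) F j k) = fun k => F i k + \sum_(j <- s) F j k.
  by apply/funext => k; rewrite big_cons.
by rewrite -[X in _ --> X](addr0 (0 : R)); exact: cvgD.
Qed.

Section AdjointMatrix.
Variable B : starRingType.
Implicit Types (m n p : nat).

Lemma adjmxE m n (a : 'M[B]_(m, n)) i j : adjmx a i j = star (a j i).
Proof. by rewrite mxE. Qed.
Lemma adjmxK m n (a : 'M[B]_(m, n)) : adjmx (adjmx a) = a.
Proof. by apply/matrixP => i j; rewrite !mxE starK. Qed.
Lemma adjmxD m n (a b : 'M[B]_(m, n)) : adjmx (a + b) = adjmx a + adjmx b.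
Proof. by apply/matrixP => i j; rewrite !mxE starD. Qed.
Lemma adjmx0 m n : adjmx (0 : 'M[B]_(m, n)) = 0.
Proof. by apply/matrixP => i j; rewrite !mxE star0. Qed.
Lemma adjmxN m n (a : 'M[B]_(m, n)) : adjmx (- a) = - adjmx a.
Proof. by apply/matrixP => i j; rewrite !mxE starN. Qed.
Lemma adjmxB m n (a b : 'M[B]_(m, n)) : adjmx (a - b) = adjmx a - adjmx b.
Proof. by rewrite adjmxD adjmxN. Qed.
Lemma adjmxM m n p (a : 'M[B]_(m, n)) (b : 'M[B]_(n, p)) :
  adjmx (a *m b) = adjmx b *m adjmx a.
Proof.
apply/matrixP => i j; rewrite !mxE star_sum.
by apply: eq_bigr => k _; rewrite !mxE starM.
Qed.
Lemma adjmx_scalar n (x : B) : adjmx (x%:M : 'M[B]_n) = (star x)%:M.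
Proof.
apply/matrixP => i j; rewrite !mxE eq_sym.
by case: eqP => _; rewrite ?mulr1n// mulr0n star0.
Qed.
Lemma adjmx_star n (a : 'M[B]_n) : adjmx a = star a. Proof. by []. Qed.
Lemma adjmx_sum m n I (r : seq I) (P : pred I) (F : I -> 'M[B]_(m, n)) :
  adjmx (\sum_(i <- r | P i) F i) = \sum_(i <- r | P i) adjmx (F i).
Proof. exact: (big_morph _ (@adjmxD m n) (@adjmx0 m n)). Qed.
End AdjointMatrix.

(** * Column vectors as a Hilbert module, and the operator norm *)

Section HilbertModule.
Variables (R : realType) (A : cstarAlgType R).
Implicit Types (m n p : nat).

Definition ip n (v w : 'cV[A]_n) : A := \sum_i star (v i ord0) * w i ord0.

Lemma ipE n (v w : 'cV[A]_n) : (adjmx v *m w) ord0 ord0 = ip v w.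
Proof. by rewrite mxE; apply: eq_bigr => i _; rewrite mxE. Qed.

Lemma ip_psd n (v : 'cV[A]_n) : psd (ip v v).
Proof. by apply: psd_sum => i _; exact: psd_starl. Qed.

Lemma ip_star n (v w : 'cV[A]_n) : star (ip v w) = ip w v.
Proof. by rewrite star_sum; apply: eq_bigr => i _; rewrite starM starK. Qed.

Lemma ipDl n (u v w : 'cV[A]_n) : ip (u + v) w = ip u w + ip v w.
Proof. by rewrite -big_split; apply: eq_bigr => i _; rewrite mxE starD mulrDl. Qed.

Lemma ipDr n (u v w : 'cV[A]_n) : ip w (u + v) = ip w u + ip w v.
Proof. by rewrite -big_split; apply: eq_bigr => i _; rewrite mxE mulrDr. Qed.

Lemma ip_adj m n (a : 'M[A]_(m, n)) v w : ip (a *m v) w = ip v (adjmx a *m w).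
Proof. by rewrite -!ipE adjmxM mulmxA. Qed.

Lemma vnorm_ge0 n (v : 'cV[A]_n) : 0 <= vnorm v. Proof. exact: sqrtr_ge0. Qed.

Lemma vnorm_sqr n (v : 'cV[A]_n) : vnorm v ^+ 2 = cnorm (ip v v).
Proof. by rewrite sqr_sqrtr ?cnorm_ge0// ipE. Qed.

Lemma coord_psd n (v : 'cV[A]_n) i : psd (ip v v - star (v i ord0) * v i ord0).
Proof.
rewrite /ip (bigD1 i)//= addrAC subrr add0r; apply: psd_sum => k _; exact: psd_starl.
Qed.

Lemma coord_le n (v : 'cV[A]_n) i : cnorm (v i ord0) <= vnorm v.
Proof.
rewrite -(ler_pXn2r (n := 2)) ?nnegrE ?cnorm_ge0 ?vnorm_ge0//.
rewrite vnorm_sqr -cnorm_star; apply: psd_norm_mono; first exact: psd_starl.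
exact: coord_psd.
Qed.

Lemma vnorm_le_sum n (v : 'cV[A]_n) : vnorm v <= \sum_i cnorm (v i ord0).
Proof.
have s0 : 0 <= \sum_i cnorm (v i ord0) by apply: sumr_ge0 => i _; exact: cnorm_ge0.
rewrite -(ler_pXn2r (n := 2)) ?nnegrE ?vnorm_ge0// vnorm_sqr.
rewrite (le_trans (cnorm_sum _ _ _))// expr2 mulr_suml; apply: ler_sum => i _.
rewrite cnorm_star expr2 ler_wpM2l ?cnorm_ge0// (bigD1 i)//= lerDl.
by apply: sumr_ge0 => j _; exact: cnorm_ge0.
Qed.

Lemma vnorm_eq0 n (v : 'cV[A]_n) : vnorm v = 0 -> v = 0.
Proof.
move=> v0; apply/matrixP => i j; rewrite ord1 mxE; apply/cnorm_eq0/le_anti.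
by rewrite cnorm_ge0 andbT -v0 coord_le.
Qed.

Lemma vnorm0 n : vnorm (0 : 'cV[A]_n) = 0.
Proof.
by apply/le_anti; rewrite vnorm_ge0 andbT (le_trans (vnorm_le_sum _))// big1// => i _; rewrite mxE cnorm0.
Qed.

Definition vscale n (c : R[i]) (v : 'cV[A]_n) : 'cV[A]_n := map_mx (fun x => c *: x) v.

Lemma vnormZ n c (v : 'cV[A]_n) : vnorm (vscale c v) = normc c * vnorm v.
Proof.
have nc : 0 <= normc c by case: c => a b; exact: sqrtr_ge0.
apply/eqP; rewrite -(eqrXn2 (n := 2)) ?mulr_ge0 ?vnorm_ge0// exprMn !vnorm_sqr.
have -> : ip (vscale c v) (vscale c v) = (conjc c * c) *: ip v v.
  rewrite scaler_sumr; apply: eq_bigr => i _; rewrite !mxE starZ.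
  by rewrite -scalerAl -scalerAr scalerA.
rewrite cnormZ; apply/eqP; congr (_ * _); case: c {nc} => a b /=.
rewrite sqr_sqrtr ?addr_ge0 ?sqr_ge0//.
rewrite (_ : a * a - - b * b = a ^+ 2 + b ^+ 2); last by ring.
rewrite (_ : a * b + - b * a = 0); last by ring.
by rewrite expr0n addr0 sqrtr_sqr ger0_norm// addr_ge0 ?sqr_ge0.
Qed.

Lemma mulmx_vscale m n c (a : 'M[A]_(m, n)) v : a *m vscale c v = vscale c (a *m v).
Proof.
apply/matrixP => i j; rewrite !mxE scaler_sumr; apply: eq_bigr => k _.
by rewrite !mxE -scalerAr.
Qed.

Lemma vnormalize n (v : 'cV[A]_n) : vnorm v != 0 ->
  vnorm (vscale (vnorm v)^-1%:C v) = 1.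
Proof.
move=> v0; rewrite vnormZ normcR ger0_norm ?invr_ge0 ?vnorm_ge0//.
by rewrite mulVf.
Qed.

(** For w of norm at most 1 put [a = <w, v>] and [u = v - w a]; then [<v, v> - star a a = <u, u> +
    star a (1 - <w, w>) a] is positive. *)
Lemma cauchy_schwarz n (v w : 'cV[A]_n) : cnorm (ip w v) <= vnorm w * vnorm v.
Proof.
have cs1 (w' : 'cV[A]_n) : vnorm w' <= 1 -> cnorm (ip w' v) <= vnorm v.
  move=> w1; set a := ip w' v.
  rewrite -(ler_pXn2r (n := 2)) ?nnegrE ?cnorm_ge0 ?vnorm_ge0//.
  rewrite vnorm_sqr -cnorm_star; apply: psd_norm_mono; first exact: psd_starl.
  have W1 : psd (1 - ip w' w').
    rewrite -(rs1 1); apply: psd_of_norm; first exact/psd_sa/ip_psd.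
    by rewrite -vnorm_sqr exprn_ile1 ?vnorm_ge0.
  pose u := v - \col_i (w' i ord0 * a).
  have -> : ip v v - star a * a = ip u u + star a * (1 - ip w' w') * a.
    have -> : ip u u = ip v v - ip v w' * a - star a * ip w' v + star a * ip w' w' * a.
      rewrite {W1}/u; move: a => b; rewrite /ip !mulr_sumr !mulr_suml -!sumrB -big_split /=; apply: eq_bigr => i _.
      rewrite !mxE starB starM; ncring.
    rewrite -(ip_star w' v) -/a; ncring.
  by apply: psdD; [exact: ip_psd|exact: psd_conj].
have [w0|w0] := eqVneq (vnorm w) 0.
  rewrite w0 mul0r (vnorm_eq0 w0) /ip big1 ?cnorm0// => i _.
  by rewrite mxE star0 mul0r.
have wgt0 : 0 < vnorm w by rewrite lt_def w0 vnorm_ge0.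
have := cs1 (vscale (vnorm w)^-1%:C w); rewrite vnormalize// => /(_ (lexx _)).
have -> : ip (vscale (vnorm w)^-1%:C w) v = (vnorm w)^-1 *` ip w v.
  rewrite scaler_sumr; apply: eq_bigr => i _.
  by rewrite mxE starR -scalerAl.
by rewrite cnormR ger0_norm ?invr_ge0 ?vnorm_ge0// ler_pdivrMl.
Qed.

Lemma vnormD n (v w : 'cV[A]_n) : vnorm (v + w) <= vnorm v + vnorm w.
Proof.
rewrite -(ler_pXn2r (n := 2)) ?nnegrE ?addr_ge0 ?vnorm_ge0// vnorm_sqr.
rewrite ipDl !ipDr.
have h1 := cauchy_schwarz v w; have h2 := cauchy_schwarz w v.
have h3 := vnorm_sqr v; have h4 := vnorm_sqr w.
have h5 := ler_cnormD (ip v v) (ip v w); have h6 := ler_cnormD (ip w v) (ip w w).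
have h7 := ler_cnormD (ip v v + ip v w) (ip w v + ip w w).
apply: le_trans h7 _; rewrite sqrrD h3 h4.
by rewrite (mulrC (vnorm v)) in h2; rewrite mulr2n; nra.
Qed.

Definition nrm1 m n (a : 'M[A]_(m, n)) : R := \sum_i \sum_j cnorm (a i j).

Lemma nrm1_ge0 m n (a : 'M[A]_(m, n)) : 0 <= nrm1 a.
Proof. by apply: sumr_ge0 => i _; apply: sumr_ge0 => j _; exact: cnorm_ge0. Qed.

Lemma vnorm_mulmx_nrm1 m n (a : 'M[A]_(m, n)) v : vnorm (a *m v) <= nrm1 a * vnorm v.
Proof.
apply: le_trans (vnorm_le_sum _) _; rewrite mulr_suml; apply: ler_sum => i _.
rewrite mxE (le_trans (cnorm_sum _ _ _))// mulr_suml; apply: ler_sum => j _.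
by rewrite (le_trans (ler_cnormM _ _))// ler_wpM2l ?cnorm_ge0// coord_le.
Qed.

Lemma opnorm_has_sup m n (a : 'M[A]_(m, n)) :
  has_sup [set vnorm (a *m v) | v in [set v : 'cV[A]_n | vnorm v <= 1]].
Proof.
split; first by exists (vnorm (a *m 0)), 0 => //=; rewrite vnorm0.
exists (nrm1 a) => _ [v /= v1 <-]; rewrite (le_trans (vnorm_mulmx_nrm1 _ _))//.
by rewrite ler_piMr ?nrm1_ge0.
Qed.

Lemma opnorm_ub1 m n (a : 'M[A]_(m, n)) v : vnorm v <= 1 -> vnorm (a *m v) <= opnorm a.
Proof. by move=> v1; apply: ub_le_sup; [case: (opnorm_has_sup a)|exists v]. Qed.

Lemma opnorm_ge0 m n (a : 'M[A]_(m, n)) : 0 <= opnorm a.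
Proof. by rewrite (le_trans (vnorm_ge0 (a *m 0)))// opnorm_ub1// vnorm0. Qed.

Lemma opnorm_ub m n (a : 'M[A]_(m, n)) v : vnorm (a *m v) <= opnorm a * vnorm v.
Proof.
have [v0|v0] := eqVneq (vnorm v) 0.
  by rewrite v0 mulr0 (vnorm_eq0 v0) mulmx0 vnorm0.
have vgt0 : 0 < vnorm v by rewrite lt_def v0 vnorm_ge0.
have := opnorm_ub1 a (v := vscale (vnorm v)^-1%:C v).
rewrite vnormalize// => /(_ (lexx _)); rewrite mulmx_vscale vnormZ normcR.
by rewrite ger0_norm ?invr_ge0 ?vnorm_ge0// ler_pdivrMl// mulrC.
Qed.

Lemma opnorm_le m n (a : 'M[A]_(m, n)) (c : R) :
  (forall v, vnorm v <= 1 -> vnorm (a *m v) <= c) -> opnorm a <= c.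
Proof.
move=> ac; apply: ge_sup; first by case: (opnorm_has_sup a).
by move=> _ [v v1 <-]; exact: ac.
Qed.

Lemma opnorm_le_nrm1 m n (a : 'M[A]_(m, n)) : opnorm a <= nrm1 a.
Proof.
apply: opnorm_le => v v1; rewrite (le_trans (vnorm_mulmx_nrm1 _ _))//.
by rewrite ler_piMr ?nrm1_ge0.
Qed.

Lemma vnorm_delta n (j : 'I_n) : vnorm (delta_mx j ord0 : 'cV[A]_n) = 1.
Proof.
apply/eqP; rewrite -(eqrXn2 (n := 2)) ?vnorm_ge0// vnorm_sqr expr1n.
rewrite /ip (bigD1 j)//= big1 => [|k kj]; rewrite !mxE ?(negPf kj) ?mulr0//.
by rewrite !eqxx star1 mulr1 addr0 cnorm1.
Qed.

Lemma entry_le_opnorm m n (a : 'M[A]_(m, n)) i j : cnorm (a i j) <= opnorm a.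
Proof.
have := opnorm_ub1 a (v := delta_mx j ord0); rewrite vnorm_delta => /(_ (lexx _)).
apply: le_trans; apply: le_trans (coord_le _ i).
rewrite mxE (bigD1 j)//= big1 => [|k kj]; rewrite !mxE ?(negPf kj) ?mulr0//.
by rewrite !eqxx mulr1 addr0.
Qed.

Lemma opnorm_eq0 m n (a : 'M[A]_(m, n)) : opnorm a = 0 -> a = 0.
Proof.
move=> a0; apply/matrixP => i j; rewrite mxE; apply/cnorm_eq0/le_anti.
by rewrite cnorm_ge0 andbT -a0 entry_le_opnorm.
Qed.

Lemma opnormD m n (a b : 'M[A]_(m, n)) : opnorm (a + b) <= opnorm a + opnorm b.
Proof.
apply: opnorm_le => v v1; rewrite mulmxDl (le_trans (vnormD _ _))//.
by rewrite lerD ?opnorm_ub1.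
Qed.

Lemma opnormM m n p (a : 'M[A]_(m, n)) (b : 'M[A]_(n, p)) : opnorm (a *m b) <= opnorm a * opnorm b.
Proof.
apply: opnorm_le => v v1; rewrite -mulmxA (le_trans (opnorm_ub _ _))//.
by rewrite ler_wpM2l ?opnorm_ge0// opnorm_ub1.
Qed.

Lemma opnorm_adj_sqr m n (a : 'M[A]_(m, n)) : opnorm a ^+ 2 <= opnorm (adjmx a *m a).
Proof.
set q := opnorm (adjmx a *m a); have q0 : 0 <= q := opnorm_ge0 _.
suff : opnorm a <= Num.sqrt q.
  move=> h; rewrite -(sqr_sqrtr q0) ler_pXn2r ?nnegrE ?opnorm_ge0 ?sqrtr_ge0//.
apply: opnorm_le => v v1.
rewrite -(ler_pXn2r (n := 2)) ?nnegrE ?vnorm_ge0 ?sqrtr_ge0// vnorm_sqr sqr_sqrtr//.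
rewrite ip_adj mulmxA (le_trans (cauchy_schwarz _ _))//.
by rewrite -[leRHS]mul1r ler_pM ?vnorm_ge0// opnorm_ub1.
Qed.

Lemma opnorm_adj m n (a : 'M[A]_(m, n)) : opnorm (adjmx a) = opnorm a.
Proof.
have le p q (b : 'M[A]_(p, q)) : opnorm b <= opnorm (adjmx b).
  have [->|nz] := eqVneq (opnorm b) 0; first exact: opnorm_ge0.
  have b_gt0 : 0 < opnorm b by rewrite lt_def nz opnorm_ge0.
  by rewrite -(ler_pM2r b_gt0) -expr2 (le_trans (opnorm_adj_sqr b))// opnormM.
by apply/le_anti; rewrite le andbT (le_trans (le _ _ _))// adjmxK.
Qed.

Lemma opnorm_adjM m n (a : 'M[A]_(m, n)) : opnorm (adjmx a *m a) = opnorm a ^+ 2.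
Proof.
apply/le_anti; rewrite opnorm_adj_sqr andbT (le_trans (opnormM _ _))//.
by rewrite opnorm_adj expr2.
Qed.
End HilbertModule.

(* The same carrier as ['M[A]_n.+1], where [*:] means scaling by the ring A; on [mxalg A n] it
   means scaling by complex numbers, which gives a C*-algebra. *)
Definition mxalg (R : realType) (A : cstarAlgType R) (n : nat) : Type := 'M[A]_n.+1.

Section MatrixCStar.
Variables (R : realType) (A : cstarAlgType R) (n : nat).
Local Notation M := (mxalg A n).

HB.instance Definition _ := GRing.NzRing.copy M 'M[A]_n.+1.
HB.instance Definition _ := isStarRing.Build M (@starK 'M[A]_n.+1) (@starD 'M[A]_n.+1)
  (@starM 'M[A]_n.+1).

Definition mxscale (c : R[i]) (a : M) : M := mx_cscale c a.

Let mxscaleA c d (a : M) : mxscale c (mxscale d a) = mxscale (c * d) a.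
Proof. by apply/matrixP => i j; rewrite !mxE scalerA. Qed.
Let mxscale1 : left_id 1 mxscale.
Proof. by move=> a; apply/matrixP => i j; rewrite !mxE scale1r. Qed.
Let mxscaleDr : right_distributive mxscale +%R.
Proof. by move=> c a b; apply/matrixP => i j; rewrite !mxE scalerDr. Qed.
Let mxscaleDl (a : M) : {morph mxscale^~ a : c d / c + d}.
Proof. by move=> c d; apply/matrixP => i j; rewrite !mxE scalerDl. Qed.
HB.instance Definition _ := GRing.Zmodule_isLmodule.Build R[i] M
  mxscaleA mxscale1 mxscaleDr mxscaleDl.

Let mxscaleAl (c : R[i]) (a b : M) : c *: (a * b) = (c *: a) * b.
Proof.
apply/matrixP => i j; rewrite !mxE scaler_sumr; apply: eq_bigr => k _.
by rewrite mxE scalerAl.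
Qed.
HB.instance Definition _ := GRing.Lmodule_isLalgebra.Build R[i] M mxscaleAl.
Let mxscaleAr (c : R[i]) (a b : M) : c *: (a * b) = a * (c *: b).
Proof.
apply/matrixP => i j; rewrite !mxE scaler_sumr; apply: eq_bigr => k _.
by rewrite mxE scalerAr.
Qed.
HB.instance Definition _ := GRing.Lalgebra_isAlgebra.Build R[i] M mxscaleAr.

Let mx_starZ (c : R[i]) (x : M) : star (c *: x) = conjc c *: star x.
Proof. by apply/matrixP => i j; rewrite !mxE starZ. Qed.

Let mx_normZ (c : R[i]) (x : M) : opnorm (c *: x : 'M[A]_n.+1) = normc c * opnorm (x : 'M[A]_n.+1).
Proof.
have scE (y : M) (d : R[i]) v : (d *: y : 'M[A]_n.+1) *m v = vscale d ((y : 'M[A]_n.+1) *m v).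
  apply/matrixP => i j; rewrite !mxE scaler_sumr; apply: eq_bigr => k _.
  by rewrite mxE scalerAl.
have nc (d : R[i]) : 0 <= normc d by case: d => a b; exact: sqrtr_ge0.
have le (d : R[i]) (y : M) : opnorm (d *: y : 'M[A]_n.+1) <= normc d * opnorm (y : 'M[A]_n.+1).
  apply: opnorm_le => v v1; rewrite scE vnormZ ler_wpM2l ?nc//.
  exact: opnorm_ub1.
apply/le_anti; rewrite le /=.
have [->|c0] := eqVneq c 0; first by rewrite normc0 mul0r opnorm_ge0.
have c_gt0 : 0 < normc c.
  by rewrite lt_def nc andbT; apply: contraNneq c0 => /eq0_normc ->.
have := le c^-1 (c *: x); rewrite scalerA mulVf// scale1r.
have -> : normc c^-1 = (normc c)^-1.
  apply: (mulfI (lt0r_neq0 c_gt0)); rewrite -normcM (divff c0) (divff (lt0r_neq0 c_gt0)).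
  by rewrite -[1]/((1 : R)%:C) normcR normr1.
by rewrite ler_pdivlMl.
Qed.

Let mx_complete (u : nat -> M) :
  (forall e : R, 0 < e -> exists N, forall p q, (N <= p)%N -> (N <= q)%N ->
     opnorm (u p - u q : 'M[A]_n.+1) < e) ->
  exists l : M, (fun k => opnorm (u k - l : 'M[A]_n.+1)) @ \oo --> (0 : R).
Proof.
move=> uC.
have ex i j : exists l, clim (fun k => (u k : 'M[A]_n.+1) i j) l.
  apply: clim_cauchy => e /uC[N NP]; exists N => p q Np Nq.
  apply: le_lt_trans (NP p q Np Nq).
  by have := entry_le_opnorm (u p - u q : 'M[A]_n.+1) i j; rewrite !mxE.
have /choice[L LP] : forall ij : 'I_n.+1 * 'I_n.+1,
    exists l, clim (fun k => (u k : 'M[A]_n.+1) ij.1 ij.2) l.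
  by move=> [i j]; exact: ex.
exists (\matrix_(i, j) L (i, j)).
apply: (@squeeze_cvgr _ _ _ _ (fun=> 0)
   (fun k => \sum_i \sum_j cnorm ((u k : 'M[A]_n.+1) i j - L (i, j)))).
- apply: nearW => k; rewrite opnorm_ge0 (le_trans (opnorm_le_nrm1 _))//.
  by apply: ler_sum => i _; apply: ler_sum => j _; rewrite !mxE.
- exact: cvg_cst.
- by apply: cvg_sum0 => i; apply: cvg_sum0 => j; exact: (LP (i, j)).
Qed.

HB.instance Definition _ := isCStarAlgebra.Build R M mx_starZ
  (@opnorm_eq0 R A n.+1 n.+1) (@opnormD R A n.+1 n.+1) mx_normZ
  (@opnormM R A n.+1 n.+1 n.+1) (@opnorm_adjM R A n.+1 n.+1) mx_complete.
End MatrixCStar.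

(** * Cuntz comparison *)

Ltac luc := repeat first [assumption | exact: lucont_id | exact: lucont_cst
  | exact: lucont_sqrt | exact: lucont_cut | apply: lucontM | apply: lucontB
  | apply: lucontD].

Section CuntzOneAlgebra.
Variables (R : realType) (A : cstarAlgType R).
Implicit Types (x y a b c d : A) (r s t e M : R) (f g h : R -> R).

Definition cle a b := forall e, 0 < e -> exists x, cnorm (a - x * b * star x) < e.

Lemma fc0 f : lucont f -> fc f (0 : A) = f 0 *` 1.
Proof.
move=> cf; rewrite -[in LHS](rs0 1) -(fc_cst 0 (sa0 A)).
by rewrite (fc_comp (sa0 A) cf (lucont_cst 0)); exact: (fc_cst (f 0) (sa0 A)).
Qed.

(** [x a = 0] says that x intertwines a with 0, and [f(0) = 0]. *)
Lemma fc_ann f x a : sa a -> lucont f -> f 0 = 0 -> x * a = 0 -> x * fc f a = 0.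
Proof.
move=> sea cf f0 xa.
rewrite (@fc_intertwine _ _ f x a 0 sea (sa0 A) cf) ?mul0r// fc0// f0 rs0 mul0r//.
Qed.

Lemma fc_annl f x a : sa a -> lucont f -> f 0 = 0 -> a * x = 0 -> fc f a * x = 0.
Proof.
move=> sea cf f0 ax; rewrite -[LHS]starK starM (fc_sa sea cf).
by rewrite fc_ann ?star0// -sea -starM ax star0.
Qed.

Lemma fc_sandwich f a : sa a -> lucont f ->
  fc f a * a * fc f a = fc (fun s => f s * s * f s) a.
Proof.
move=> sea cf; have ci := @lucont_id R.
rewrite (@fcM _ _ (fun s => f s * s) f)//; last exact: (lucontM cf ci).
by rewrite (@fcM _ _ f id)// fc_id.
Qed.

Lemma cle_conj x b : cle (x * b * star x) b.
Proof. by move=> e e0; exists x; rewrite subrr cnorm0. Qed.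

(** [psi s = s / max s n] is an approximate unit of b, and [th ^ 2 = 1 - psi]. The witness
    [a^(1/2) k(b)] leaves the error [star z z] with [z = th(b) a^(1/2)], which has the norm of
    [th(b) a th(b) <= th(b) b th(b) <= n]. *)
Lemma cle_of_le a b : psd a -> psd (b - a) -> cle a b.
Proof.
move=> pa pba e e0; pose n := e / 2; have n0 : 0 < n by rewrite divr_gt0.
have pb : psd b by rewrite -(subrK a b); exact: psdD.
have sb := psd_sa pb.
pose k s : R := (Num.max (Num.sqrt s) (Num.sqrt n))^-1.
have sn0 : 0 < Num.sqrt n by rewrite sqrtr_gt0.
have ck : lucont k.
  by apply: (lucont_comp (lucont_inv_max sn0)); exact: lucont_sqrt.
pose psi s : R := k s * s * k s.
have cpsi : lucont psi by do 2?[apply: lucontM => //]; exact: lucont_id.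
have kE s : 0 <= s -> psi s = s / Num.max s n.
  move=> s0; rewrite /psi /k mulrAC mulrC -invfM -expr2; congr (_ / _).
  have [sn|sn] := leP s n.
    rewrite (max_idPr _) ?ler_wsqrtr// sqr_sqrtr ?(ltW n0)//.
  by rewrite (max_idPl _) ?ler_wsqrtr ?(ltW sn)// sqr_sqrtr.
have psi1 s : 0 <= s -> psi s <= 1.
  move=> s0; rewrite kE// ler_pdivrMr ?mul1r ?le_max ?lexx//.
  by rewrite lt_max n0 orbT.
pose th s := Num.sqrt (1 - psi s).
have cth : lucont th.
  apply: (lucont_comp (@lucont_sqrt R)); apply: lucontB => //; exact: lucont_cst.
have sth := fc_sa sb cth; have sk := fc_sa sb ck.
have thth : fc th b * fc th b = 1 - fc psi b.
  have one : 1 = fc (fun=> 1) b by rewrite fc_cst// rs1.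
  rewrite -fcM// one -fcB//; last exact: lucont_cst.
  apply: fc_psd_ext => //; [exact: lucontM|by apply: lucontB => //; exact: lucont_cst|].
  by move=> s s0; rewrite -expr2 sqr_sqrtr// subr_ge0 psi1.
exists (psqrt a * fc k b); rewrite starM sk (psqrt_sa pa).
have -> : psqrt a * fc k b * b * (fc k b * psqrt a) = psqrt a * fc psi b * psqrt a.
  rewrite /psi !fcM//; [|exact: lucont_id|apply: lucontM => //; exact: lucont_id].
  by rewrite fc_id// !mulrA.
have -> : a - psqrt a * fc psi b * psqrt a = star (fc th b * psqrt a) * (fc th b * psqrt a).
  rewrite starM sth psqrt_sa// mulrA -(mulrA _ (fc th b) (fc th b)) thth mulrBr mulr1 mulrBl.
  by rewrite psqrtK.
rewrite cnorm_star -cnorm_starr starM sth psqrt_sa// mulrA -(mulrA (fc th b)) psqrtK//.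
apply: (@le_lt_trans _ _ n); last by rewrite /n; lra.
apply: (@le_trans _ _ (cnorm (fc th b * b * fc th b))).
  apply: psd_norm_mono; first by have := psd_conj (fc th b) pa; rewrite sth.
  by have := psd_conjB (fc th b) pba; rewrite sth.
have -> : fc th b * b * fc th b = fc (fun s => th s * id s * th s) b.
  by rewrite !fcM ?fc_id//; luc.
apply: fc_psd_norm => //; first by luc.
move=> s s0; have -> : th s * id s * th s = (1 - psi s) * s.
  by rewrite mulrAC -expr2 sqr_sqrtr// subr_ge0 psi1.
rewrite kE// ger0_norm; last by rewrite mulr_ge0// -kE// subr_ge0 psi1.
have [sn|sn] := leP s n; last first.
  by rewrite divff ?gt_eqF ?(lt_trans n0 sn)// subrr mul0r ltW.
rewrite (le_trans _ sn)// ler_piMl// gerBl divr_ge0// ltW//.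
Qed.

(** With d the distance of a and b, [a - d <= b]. As [e > d], a continuous phi with
    [phi(a) (a - d) phi(a) = (a - e)_+] exists, so [(a - e)_+] lies below a conjugate of b. *)
Lemma cle_pcut a b e : psd a -> psd b -> cnorm (a - b) < e -> cle (pcut e a) b.
Proof.
move=> pa pb abe; set d := cnorm (a - b) in abe.
have d0 : 0 <= d := cnorm_ge0 _; have e0 := le_lt_trans d0 abe.
have sea := psd_sa pa; have seb := psd_sa pb.
have ed : 0 < Num.sqrt (e - d) by rewrite sqrtr_gt0 subr_gt0.
pose phi s : R := Num.sqrt (cut e s) * (Num.max (Num.sqrt (s - d)) (Num.sqrt (e - d)))^-1.
have cphi : lucont phi.
  apply: lucontM; first by apply: (lucont_comp (@lucont_sqrt R)); exact: lucont_cut.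
  apply: (lucont_comp (lucont_inv_max ed)); apply: (lucont_comp (@lucont_sqrt R)).
  by apply: lucontB; [exact: lucont_id|exact: lucont_cst].
have clin : lucont (fun s : R => s - d) by apply: lucontB; [exact: lucont_id|exact: lucont_cst].
have phiE : fc phi a * (a - d *` 1) * fc phi a = pcut e a.
  have -> : a - d *` 1 = fc (fun s => s - d) a.
    rewrite fcB ?fc_cst ?(fc_id sea)//; [exact: lucont_id|exact: lucont_cst].
  rewrite -!fcM//; last exact: lucontM.
  apply: fc_eq => s; rewrite /phi mulrAC.
  have [se|se] := leP s e.
    have -> : cut e s = 0 by apply/max_idPr; lra.
    by rewrite sqrtr0 !mul0r.
  have -> : cut e s = s - e by apply/max_idPl; lra.
  rewrite (max_idPl _); last by rewrite ler_wsqrtr//; lra.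
  by rewrite -expr2 exprMn exprVn !sqr_sqrtr ?divfK//; lra.
have sphi := fc_sa sea cphi.
move=> r r0.
have [] := @cle_of_le (pcut e a) (fc phi a * b * fc phi a) _ _ r r0.
- exact: pcut_psd.
- rewrite -phiE -mulrBl -mulrBr.
  rewrite -{1}sphi; apply: psd_conj.
  have -> : b - (a - d *` 1) = d *` 1 - (a - b) by ncring.
  by apply: psd_of_norm => //; exact: saB.
- by move=> x hx; exists (x * fc phi a); rewrite starM sphi !mulrA in hx *.
Qed.

Definition clip n s : R := n^-1 * Num.min s n.

Lemma lucont_clip n : lucont (clip n).
Proof. by apply: lucontZ; exact: lucont_min. Qed.

Lemma clip0 n : 0 < n -> clip n 0 = 0.
Proof. by move=> n0; rewrite /clip (min_idPl _) ?mulr0// ltW. Qed.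

Lemma clip_dist a n : psd a -> 0 < n ->
  cnorm (a - fc (clip n) a * a * fc (clip n) a) <= n.
Proof.
move=> pa n0; have sea := psd_sa pa; have cc := lucont_clip n; have ci := @lucont_id R.
rewrite -{1 3}(fc_id sea) -!fcM//; last exact: lucontM.
rewrite -fcB//; last by apply: lucontM => //; exact: lucontM.
apply: fc_psd_norm => // [|s s0].
  by apply: lucontB => //; apply: lucontM => //; exact: lucontM.
rewrite /clip /=; have [sn|sn] := leP s n; last first.
  by rewrite mulVf ?gt_eqF// mul1r mulr1 subrr normr0 ltW.
have k1 : n^-1 * s <= 1 by rewrite ler_pdivrMl// mulr1.
have k0 : 0 <= n^-1 * s by rewrite mulr_ge0// invr_ge0 ltW.
move: k0 k1; set q := n^-1 * s => k0 k1.
have q2 : q * q <= 1 by rewrite -[leRHS](mulr1 1) ler_pM.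
have q3 : 0 <= q * q by rewrite mulr_ge0.
have -> : s - q * s * q = (1 - q * q) * s by ring.
rewrite ger0_norm ?mulr_ge0 ?subr_ge0//.
by rewrite (le_trans _ sn)// ler_piMl// gerBl.
Qed.

Lemma pcut_le a e : psd a -> 0 <= e -> psd (a - pcut e a).
Proof.
move=> pa e0; rewrite -{1}(fc_id (psd_sa pa)); apply: fc_psd_le => //; [exact: lucont_cut|exact: lucont_id|].
by move=> s s0; rewrite /cut ge_max s0 andbT /=; lra.
Qed.

(** Conjugation by k(a), with [k s = sqrt s / max s n], turns [a ^ 2] back into a up to an error
    n. *)
Lemma cle_sqr a : psd a -> cle a (a * a).
Proof.
move=> pa e e0; have sea := psd_sa pa; pose n := e / 2; have n0 : 0 < n by rewrite divr_gt0.
pose k s : R := Num.sqrt s * (Num.max s n)^-1.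
have ck : lucont k by apply: lucontM; [exact: lucont_sqrt|exact: lucont_inv_max].
have ci := @lucont_id R; have c1 : lucont (fun s : R => id s * id s) by exact: lucontM.
have c2 : lucont (fun s => k s * (id s * id s)) by exact: lucontM.
have c3 : lucont (fun s => k s * (id s * id s) * k s) by exact: lucontM.
exists (fc k a); rewrite (fc_sa sea ck).
have -> : a - fc k a * (a * a) * fc k a = fc (fun s => id s - k s * (id s * id s) * k s) a.
  by rewrite (fcB sea ci c3) (fcM sea c2 ck) (fcM sea ck c1) (fcM sea ci ci) fc_id.
apply: (@le_lt_trans _ _ n); last by rewrite /n; lra.
apply: fc_psd_norm => // [|s s0]; first exact: lucontB.
rewrite /k /= mulrAC; set m := Num.max s n.
have m0 : 0 < m by rewrite lt_max n0 orbT.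
have -> : Num.sqrt s / m * (Num.sqrt s / m) * (s * s) = s * (s / m) ^+ 2.
  have := sqr_sqrtr s0; set q := Num.sqrt s => qE; rewrite -qE; field.
  by rewrite gt_eqF.
have q1 : s / m <= 1 by rewrite ler_pdivrMr// mul1r le_max lexx.
have q0 : 0 <= s / m by rewrite divr_ge0// ltW.
rewrite -{1}(mulr1 s) -mulrBr ger0_norm; last first.
  by rewrite mulr_ge0// subr_ge0 exprn_ile1.
have [sn|sn] := leP s n.
  by rewrite (le_trans _ sn)// ler_piMr// gerBl exprn_ge0.
by rewrite /m (max_idPl _) ?divff ?gt_eqF ?(lt_trans n0 sn) ?expr1n ?subrr ?mulr0 ?ltW.
Qed.
(** Approximate units of a and of b annihilate the other summand, so they cut each summand out of
    [a + b] without cross terms. *)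
Lemma orth_clip a b r : psd a -> psd b -> a * b = 0 -> 0 < r ->
  exists x y, [/\ cnorm (a - x * (a + b) * star x) <= r,
    cnorm (b - y * (a + b) * star y) <= r, x * (a + b) * star y = 0
    & y * (a + b) * star x = 0].
Proof.
move=> pa pb ab r0; have sea := psd_sa pa; have seb := psd_sa pb.
have ba : b * a = 0 by rewrite -sea -seb -starM ab star0.
have cc := @lucont_clip r; have c0 := clip0 r0.
pose fa := fc (clip r) a; pose fb := fc (clip r) b.
have fab : fa * b = 0 by exact: fc_annl.
have bfa : b * fa = 0 by exact: fc_ann.
have fba : fb * a = 0 by exact: fc_annl.
have afb : a * fb = 0 by exact: fc_ann.
have sfa : star fa = fa by exact: fc_sa.
have sfb : star fb = fb by exact: fc_sa.
exists fa, fb; rewrite sfa sfb !mulrDr fab fba addr0 add0r; split.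
- exact: clip_dist.
- exact: clip_dist.
- by rewrite -mulrA afb mulr0.
- by rewrite -mulrA bfa mulr0.
Qed.

(** In a polar decomposition [x = v |x|] the factor v may lie outside the algebra, but
    [v (|x| ^ 2 - t)_+ ^ (1/2)] lies inside: it is [x k(|x| ^ 2)] with k continuous and zero below
    t. The second identity comes from moving k across x. *)
Lemma pcut_polar x t : 0 < t -> exists y,
  star y * y = pcut t (star x * x) /\ y * star y = pcut t (x * star x).
Proof.
move=> t0.
pose k s : R := Num.sqrt (cut t s) * (Num.max (Num.sqrt s) (Num.sqrt t))^-1.
have st : 0 < Num.sqrt t by rewrite sqrtr_gt0.
have ck : lucont k.
  apply: lucontM; first by apply: (lucont_comp (@lucont_sqrt R)); exact: lucont_cut.
  by apply: (lucont_comp (lucont_inv_max st)); exact: lucont_sqrt.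
have key (z : A) : sa z -> fc k z * z * fc k z = pcut t z.
  move=> sz; rewrite fc_sandwich//.
  apply: fc_eq => s; rewrite /k mulrAC.
  have [s_le|s_gt] := leP s t.
    have -> : cut t s = 0 by apply/max_idPr; lra.
    by rewrite sqrtr0 !mul0r.
  have -> : cut t s = s - t by apply/max_idPl; lra.
  rewrite (max_idPl _) /=; last by rewrite ler_wsqrtr// ltW.
  by rewrite -expr2 exprMn exprVn !sqr_sqrtr ?divfK ?gt_eqF//; lra.
have sl : sa (star x * x) by exact: sa_starl.
have sr : sa (x * star x) by exact: sa_starr.
have int : x * fc k (star x * x) = fc k (x * star x) * x.
  by apply: fc_intertwine => //; rewrite mulrA.
have k1 := fc_sa sl ck; have k2 := fc_sa sr ck.
exists (x * fc k (star x * x)); split.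
  by rewrite starM k1 -mulrA (mulrA (star x)) mulrA key.
by rewrite int starM k2 mulrA -(mulrA _ x) key.
Qed.
End CuntzOneAlgebra.

Section Cuntz.
Variables (R : realType) (A : cstarAlgType R).
Implicit Types (m n p q : nat) (r s t e : R).

(* Cuntz comparison of matrices of different sizes through rectangular matrices, which makes
   the padding of [minf_cuntz_sub] unnecessary. *)
Definition csub m n (a : 'M[A]_m) (b : 'M[A]_n) := forall e, 0 < e ->
  exists x : 'M[A]_(m, n), opnorm (a - x *m b *m adjmx x) < e.

Lemma opnorm0 m n : opnorm (0 : 'M[A]_(m, n)) = 0.
Proof.
apply/le_anti; rewrite opnorm_ge0 andbT; apply: opnorm_le => v _.
by rewrite mul0mx vnorm0.
Qed.

Lemma csub_refl n (a : 'M[A]_n) : csub a a.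
Proof.
move=> e e0; exists 1%:M.
by rewrite mul1mx adjmx_scalar star1 mulmx1 subrr opnorm0.
Qed.

Lemma csub_conj m n (x : 'M[A]_(m, n)) b : csub (x *m b *m adjmx x) b.
Proof. by move=> e e0; exists x; rewrite subrr opnorm0. Qed.

Lemma opnormN m n (a : 'M[A]_(m, n)) : opnorm (- a) = opnorm a.
Proof.
have le (b : 'M[A]_(m, n)) : opnorm (- b) <= opnorm b.
  apply: opnorm_le => v v1; rewrite mulNmx -mulmxN; apply: opnorm_ub1.
  suff -> : vnorm (- v) = vnorm v by [].
  by rewrite /vnorm !ipE; congr (Num.sqrt (cnorm _)); apply: eq_bigr => i _; rewrite !mxE starN mulrNN.
by apply/le_anti; rewrite le -{1}(opprK a) le.
Qed.

Lemma opnorm_conj m n (x : 'M[A]_(m, n)) (b : 'M[A]_n) :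
  opnorm (x *m b *m adjmx x) <= opnorm x ^+ 2 * opnorm b.
Proof.
rewrite (le_trans (opnormM _ _))// opnorm_adj.
rewrite (le_trans (ler_wpM2r (opnorm_ge0 _) (opnormM _ _)))//.
by rewrite mulrAC expr2.
Qed.

Lemma csub_trans m n p (a : 'M[A]_m) (b : 'M[A]_n) (c : 'M[A]_p) :
  csub a b -> csub b c -> csub a c.
Proof.
move=> ab bc e e0; have e2 : 0 < e / 2 by rewrite divr_gt0.
have [x hx] := ab _ e2.
have k0 : 0 < opnorm x ^+ 2 + 1 by rewrite ltr_wpDl ?sqr_ge0.
have [y hy] := bc (e / 2 / (opnorm x ^+ 2 + 1)) (divr_gt0 e2 k0).
exists (x *m y); rewrite adjmxM.
have -> : a - x *m y *m c *m (adjmx y *m adjmx x) =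
  (a - x *m b *m adjmx x) + x *m (b - y *m c *m adjmx y) *m adjmx x.
  by rewrite mulmxBr mulmxBl !mulmxA addrA subrK.
apply: le_lt_trans (opnormD _ _) _; rewrite [ltRHS](splitr e) ltrD//.
apply: le_lt_trans (opnorm_conj _ _) _.
move: hy; rewrite ltr_pdivlMr// => /le_lt_trans; apply.
by rewrite mulrC ler_wpM2l ?opnorm_ge0// lerDl.
Qed.

Lemma csub_lim m n (a : 'M[A]_m) (b : 'M[A]_n) :
  (forall e, 0 < e -> exists2 a', csub a' b & opnorm (a - a') < e) -> csub a b.
Proof.
move=> h e e0; have e2 : 0 < e / 2 by rewrite divr_gt0.
have [a' ab aa] := h _ e2; have [x hx] := ab _ e2; exists x.
rewrite -[a](subrK a') -addrA; apply: le_lt_trans (opnormD _ _) _.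
by rewrite [ltRHS](splitr e) ltrD.
Qed.

Definition mpsd n (a : 'M[A]_n.+1) := psd (a : mxalg A n).
Definition mcut n t (a : 'M[A]_n.+1) : 'M[A]_n.+1 := pcut t (a : mxalg A n).
Definition msqrt n (a : 'M[A]_n.+1) : 'M[A]_n.+1 := psqrt (a : mxalg A n).

Lemma mpsdP n (a : 'M[A]_n.+1) : positive a <-> mpsd a.
Proof. exact: (@positiveP R (mxalg A n)). Qed.

Lemma mpsd_adj n (a : 'M[A]_n.+1) : mpsd a -> adjmx a = a.
Proof. exact: (@psd_sa R (mxalg A n)). Qed.

Lemma mpsdD n (a b : 'M[A]_n.+1) : mpsd a -> mpsd b -> mpsd (a + b).
Proof. exact: (@psdD R (mxalg A n)). Qed.

Lemma mpsd0 n : mpsd (0 : 'M[A]_n.+1).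
Proof. exact: (@psd0 R (mxalg A n)). Qed.

Lemma mcut_psd n t (a : 'M[A]_n.+1) : mpsd a -> mpsd (mcut t a).
Proof. by move=> pa; apply: (@pcut_psd R (mxalg A n)); exact: (@psd_sa R (mxalg A n)). Qed.

Lemma mcut_dist n t (a : 'M[A]_n.+1) : mpsd a -> 0 <= t -> opnorm (a - mcut t a) <= t.
Proof. exact: (@pcut_dist R (mxalg A n)). Qed.

Lemma msqrt_adj n (b : 'M[A]_n.+1) : mpsd b -> adjmx (msqrt b) = msqrt b.
Proof. exact: (@psqrt_sa R (mxalg A n)). Qed.

Lemma msqrtK n (b : 'M[A]_n.+1) : mpsd b -> msqrt b *m msqrt b = b.
Proof. exact: (@psqrtK R (mxalg A n)). Qed.

Lemma csub_pcut_near n (a b : 'M[A]_n.+1) e : mpsd a -> mpsd b -> opnorm (a - b) < e ->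
  csub (mcut e a) b.
Proof. exact: (@cle_pcut R (mxalg A n)). Qed.

Lemma csub_of_pcut n p (a : 'M[A]_n.+1) (b : 'M[A]_p) : mpsd a ->
  (forall e, 0 < e -> csub (mcut e a) b) -> csub a b.
Proof.
move=> pa h; apply: csub_lim => e e0; exists (mcut (e / 2) a); first by apply: h; rewrite divr_gt0.
apply: le_lt_trans (mcut_dist pa _) _; first by rewrite divr_ge0 ?ltW.
by lra.
Qed.

(** Positivity in [mxalg] concerns square matrices, so z is split into its columns, each completed
    by zeros to a square matrix [C j]. *)
Lemma mpsd_mulmx_adj m n (z : 'M[A]_(m.+1, n)) : mpsd (z *m adjmx z).
Proof.
pose C j : 'M[A]_m.+1 := \matrix_(i, k) if k == ord0 then z i j else 0.
have -> : z *m adjmx z = \sum_j (C j *m adjmx (C j)).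
  apply/matrixP => i l; rewrite !mxE summxE; apply: eq_bigr => j _.
  rewrite !mxE big_ord_recl !mxE eqxx big1 ?addr0// => k _.
  by rewrite !mxE mul0r.
by apply: (@psd_sum R (mxalg A m)) => j _; exact: (@psd_starr R (mxalg A m)).
Qed.

Lemma mpsd_conj m n (x : 'M[A]_(m.+1, n.+1)) (b : 'M[A]_n.+1) : mpsd b ->
  mpsd (x *m b *m adjmx x).
Proof.
move=> pb; have -> : x *m b *m adjmx x = (x *m msqrt b) *m adjmx (x *m msqrt b).
  by rewrite adjmxM msqrt_adj// -!mulmxA (mulmxA (msqrt b) (msqrt b)) msqrtK.
exact: mpsd_mulmx_adj.
Qed.

Lemma csub0 m n (b : 'M[A]_n) : csub (0 : 'M[A]_m) b.
Proof. by move=> e e0; exists 0; rewrite !mul0mx subr0 opnorm0. Qed.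

Lemma csub_exact m n (x : 'M[A]_(m, n)) a b : x *m b *m adjmx x = a -> csub a b.
Proof. by move=> <-; exact: csub_conj. Qed.

Definition dsum m n (a : 'M[A]_m) (b : 'M[A]_n) : 'M[A]_(m + n) := block_mx a 0 0 b.

Lemma adjmx_row_mx m n p (a : 'M[A]_(m, n)) (b : 'M[A]_(m, p)) :
  adjmx (row_mx a b) = col_mx (adjmx a) (adjmx b).
Proof. by apply/matrixP => i j; rewrite !mxE; case: splitP => k _; rewrite !mxE. Qed.

Lemma adjmx_col_mx m n p (a : 'M[A]_(m, n)) (b : 'M[A]_(p, n)) :
  adjmx (col_mx a b) = row_mx (adjmx a) (adjmx b).
Proof. by apply/matrixP => i j; rewrite !mxE; case: splitP => k _; rewrite !mxE. Qed.

Lemma row_dsum m n p q (x : 'M[A]_(p, m)) (y : 'M[A]_(p, n)) x' y' a b :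
  row_mx x y *m dsum a b *m adjmx (row_mx x' y' : 'M[A]_(q, _)) =
  x *m a *m adjmx x' + y *m b *m adjmx y'.
Proof. by rewrite mul_row_block !mulmx0 addr0 add0r adjmx_row_mx mul_row_col. Qed.

Lemma conj_row_dsum m n p (x : 'M[A]_(p, m)) (y : 'M[A]_(p, n)) a b :
  row_mx x y *m dsum a b *m adjmx (row_mx x y) = x *m a *m adjmx x + y *m b *m adjmx y.
Proof. exact: row_dsum. Qed.

Lemma col_conj m n p m' n' (x : 'M[A]_(m, p)) (y : 'M[A]_(n, p))
    (x' : 'M[A]_(m', p)) (y' : 'M[A]_(n', p)) c :
  col_mx x y *m c *m adjmx (col_mx x' y') =
  block_mx (x *m c *m adjmx x') (x *m c *m adjmx y') (y *m c *m adjmx x') (y *m c *m adjmx y').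
Proof. by rewrite mul_col_mx adjmx_col_mx mul_col_row. Qed.

Lemma conj_col m n p (x : 'M[A]_(m, p)) (y : 'M[A]_(n, p)) c :
  col_mx x y *m c *m adjmx (col_mx x y) =
  block_mx (x *m c *m adjmx x) (x *m c *m adjmx y) (y *m c *m adjmx x) (y *m c *m adjmx y).
Proof. exact: col_conj. Qed.

Lemma opnorm_block m n p q (a : 'M[A]_(m, p)) (b : 'M[A]_(m, q)) (c : 'M[A]_(n, p)) (d : 'M[A]_(n, q)) :
  opnorm (block_mx a b c d) <= nrm1 a + nrm1 b + nrm1 c + nrm1 d.
Proof.
apply: le_trans (opnorm_le_nrm1 _) _; rewrite le_eqVlt; apply/orP; left; apply/eqP.
rewrite /nrm1 big_split_ord /=.
under eq_bigr => i _ do rewrite big_split_ord /=.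
rewrite big_split /= -!addrA; congr (_ + _).
  by apply: eq_bigr => i _; apply: eq_bigr => j _; rewrite block_mxEul.
congr (_ + _).
  by apply: eq_bigr => i _; apply: eq_bigr => j _; rewrite block_mxEur.
under eq_bigr => i _ do rewrite big_split_ord /=.
rewrite big_split /=; congr (_ + _).
  by apply: eq_bigr => i _; apply: eq_bigr => j _; rewrite block_mxEdl.
by apply: eq_bigr => i _; apply: eq_bigr => j _; rewrite block_mxEdr.
Qed.

Lemma nrm1_le_opnorm m n (a : 'M[A]_(m, n)) : nrm1 a <= (m * n)%:R * opnorm a.
Proof.
apply: (@le_trans _ _ (\sum_(i < m) \sum_(j < n) opnorm a)).
  by apply: ler_sum => i _; apply: ler_sum => j _; exact: entry_le_opnorm.
by rewrite !sumr_const !card_ord -mulrnA mulr_natl mulnC.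
Qed.

Lemma opnorm_nrm1_small m n (e : R) : 0 < e -> exists2 d : R, 0 < d &
  forall a : 'M[A]_(m, n), opnorm a < d -> nrm1 a < e.
Proof.
move=> e0; exists (e / (m * n).+1%:R); first by rewrite divr_gt0.
move=> a; rewrite ltr_pdivlMr// => ad; apply: le_lt_trans (nrm1_le_opnorm a) _.
apply: le_lt_trans ad; rewrite mulrC ler_wpM2l ?opnorm_ge0//.
by rewrite ler_nat.
Qed.

Lemma csub_dsum_of m n p (a : 'M[A]_m) (b : 'M[A]_n) (c : 'M[A]_p) :
  (forall e, 0 < e -> exists x y, [/\ opnorm (a - x *m c *m adjmx x) < e,
     opnorm (b - y *m c *m adjmx y) < e, opnorm (x *m c *m adjmx y) < e
     & opnorm (y *m c *m adjmx x) < e]) -> csub (dsum a b) c.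
Proof.
move=> h e e0; have e4 : 0 < e / 4 by rewrite divr_gt0.
have [d1 d1_gt0 h1] := @opnorm_nrm1_small m m _ e4.
have [d2 d2_gt0 h2] := @opnorm_nrm1_small n n _ e4.
have [d3 d3_gt0 h3] := @opnorm_nrm1_small m n _ e4.
have [d4 d4_gt0 h4] := @opnorm_nrm1_small n m _ e4.
pose d := Num.min (Num.min d1 d2) (Num.min d3 d4).
have [] := h d; first by rewrite !lt_min d1_gt0 d2_gt0 d3_gt0.
move=> x [y [k1 k2 k3 k4]]; exists (col_mx x y); rewrite conj_col /dsum.
move: k1 k2 k3 k4; rewrite !lt_min => /andP[/andP[k1 _] _] /andP[/andP[_ k2] _].
move=> /andP[_ /andP[k3 _]] /andP[_ /andP[_ k4]].
rewrite opp_block_mx add_block_mx !sub0r; apply: le_lt_trans (opnorm_block _ _ _ _) _.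
have nN p' q' (z : 'M[A]_(p', q')) : nrm1 (- z) = nrm1 z.
  by apply: eq_bigr => i _; apply: eq_bigr => j _; rewrite mxE cnormN.
by rewrite !nN; have := h1 _ k1; have := h2 _ k2; have := h3 _ k3; have := h4 _ k4; lra.
Qed.

Lemma csub_dsum m n p q (a : 'M[A]_m) (b : 'M[A]_n) (c : 'M[A]_p) (d : 'M[A]_q) :
  csub a c -> csub b d -> csub (dsum a b) (dsum c d).
Proof.
move=> ac bd; apply: csub_dsum_of => e e0.
have [x hx] := ac _ e0; have [y hy] := bd _ e0.
exists (row_mx x 0), (row_mx 0 y); rewrite !conj_row_dsum !mul0mx addr0 add0r; split => //.
  by rewrite mul_row_block !mulmx0 !mul0mx !addr0 adjmx_row_mx mul_row_col adjmx0 mulmx0 mul0mx addr0 opnorm0.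
by rewrite mul_row_block !mulmx0 !mul0mx !add0r adjmx_row_mx mul_row_col adjmx0 mulmx0 mul0mx addr0 opnorm0.
Qed.

Lemma csub_addr m n (a : 'M[A]_m) (b : 'M[A]_n) : csub b (dsum a b).
Proof.
by apply: (@csub_exact _ _ (row_mx 0 1%:M)); rewrite conj_row_dsum !mul0mx add0r mul1mx adjmx_scalar star1 mulmx1.
Qed.

Lemma csub_sum n (a b : 'M[A]_n) : csub (a + b) (dsum a b).
Proof.
by apply: (@csub_exact _ _ (row_mx 1%:M 1%:M)); rewrite conj_row_dsum !mul1mx adjmx_scalar star1 !mulmx1.
Qed.

Lemma csub_dsumC m n (a : 'M[A]_m) (b : 'M[A]_n) : csub (dsum a b) (dsum b a).
Proof.
apply: (@csub_exact _ _ (block_mx 0 1%:M 1%:M 0)).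
rewrite /dsum mulmx_block !(mulmx0, mul0mx, mul1mx, addr0, add0r).
have -> : adjmx (block_mx 0 1%:M 1%:M 0) = block_mx 0 1%:M 1%:M 0 :> 'M[A]_(n + m, m + n).
  rewrite block_mxEv adjmx_col_mx !adjmx_row_mx !adjmx0 !adjmx_scalar !star1.
  by rewrite block_mxEh.
by rewrite mulmx_block !(mulmx0, mul0mx, mulmx1, addr0, add0r).
Qed.

Lemma csub_dsumA m n p (a : 'M[A]_m) (b : 'M[A]_n) (c : 'M[A]_p) :
  csub (dsum (dsum a b) c) (dsum a (dsum b c)) /\ csub (dsum a (dsum b c)) (dsum (dsum a b) c).
Proof.
split.
  apply: (@csub_exact _ _ (col_mx (col_mx (row_mx 1%:M 0) (row_mx 0 (row_mx 1%:M 0))) (row_mx 0 (row_mx 0 1%:M)))).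
  rewrite !(mul_col_mx, adjmx_col_mx, mul_mx_row).
  rewrite !(row_dsum, adjmx0, adjmx_scalar, star1, mulmx0, mul0mx, mul1mx, mulmx1, addr0, add0r).
  rewrite row_mx0 -[col_mx (row_mx (row_mx a 0) 0) _]block_mxEv block_mxEh col_mx0.
  by rewrite -block_mxEv -block_mxEv.
apply: (@csub_exact _ _ (col_mx (row_mx (row_mx 1%:M 0) 0) (col_mx (row_mx (row_mx 0 1%:M) 0) (row_mx 0 1%:M)))).
rewrite !(mul_col_mx, adjmx_col_mx, mul_mx_row).
rewrite !(row_dsum, adjmx0, adjmx_scalar, star1, mulmx0, mul0mx, mul1mx, mulmx1, addr0, add0r).
by rewrite row_mx0 col_mx0 -!block_mxEv.
Qed.

Section RectangularIntertwining.
Variables (m n : nat) (x : 'M[A]_(m.+1, n.+1)) (a : mxalg A n) (b : mxalg A m).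
Hypothesis xab : x *m (a : 'M[A]_n.+1) = (b : 'M[A]_m.+1) *m x.

Lemma mx_horner_intertwine (p : {poly R[i]}) :
  x *m (horner_alg a p : 'M[A]_n.+1) = (horner_alg b p : 'M[A]_m.+1) *m x.
Proof.
elim/poly_ind: p => [|p c IHp].
  by rewrite !rmorph0 (mulmx0 _ x) (mul0mx _ x).
rewrite !rmorphD !rmorphM /= !horner_algX !horner_algC.
rewrite (mulmxDr x) (mulmxDl _ _ x); congr (_ + _).
  by rewrite mulmxA IHp -mulmxA xab mulmxA.
apply/matrixP => i j; rewrite !mxE (bigD1 j)//= (bigD1 i)//=.
rewrite [\sum_(k < _ | k != j) _]big1 ?addr0; last first.
  by move=> k kj; rewrite !mxE (negPf kj) mulr0n scaler0 mulr0.
rewrite big1 ?addr0; last first.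
  by move=> k ki; rewrite !mxE eq_sym (negPf ki) mulr0n scaler0 mul0r.
by rewrite !mxE !eqxx -scalerAr -scalerAl mulr1 mul1r.
Qed.

End RectangularIntertwining.

Lemma mx_rs_mulr m n (x : 'M[A]_(m.+1, n.+1)) (r : R) (a : mxalg A n) :
  x *m (r *` a : 'M[A]_n.+1) = map_mx (fun y => r *` y) (x *m (a : 'M[A]_n.+1)).
Proof.
apply/matrixP => i j; rewrite !mxE scaler_sumr; apply: eq_bigr => k _.
by rewrite mxE -scalerAr.
Qed.

Lemma mx_rs_mull m n (x : 'M[A]_(m.+1, n.+1)) (r : R) (b : mxalg A m) :
  (r *` b : 'M[A]_m.+1) *m x = map_mx (fun y => r *` y) ((b : 'M[A]_m.+1) *m x).
Proof.
apply/matrixP => i j; rewrite !mxE scaler_sumr; apply: eq_bigr => k _.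
by rewrite mxE -scalerAl.
Qed.

Lemma mx_wsum_intertwine m n (x : 'M[A]_(m.+1, n.+1)) (a : mxalg A n) (b : mxalg A m) f M k :
  x *m (a : 'M[A]_n.+1) = (b : 'M[A]_m.+1) *m x ->
  x *m (wsum f M a k : 'M[A]_n.+1) = (wsum f M b k : 'M[A]_m.+1) *m x.
Proof.
move=> xab.
have frameE : x *m (frame M a : 'M[A]_n.+1) = (frame M b : 'M[A]_m.+1) *m x.
  rewrite mx_rs_mulr mx_rs_mull; congr map_mx.
  rewrite (mulmxDr x) (mulmxDl _ _ x) xab; congr (_ + _).
  by rewrite mx_rs_mulr mx_rs_mull mulmx1 mul1mx.
rewrite (mulmx_sumr x) mulmx_suml; apply: eq_bigr => i _.
by rewrite mx_rs_mulr mx_rs_mull (mx_horner_intertwine frameE).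
Qed.

(** The counterpart of [fc_intertwine] for an x that acts between matrix algebras of different sizes
    and lies in neither. *)
Lemma mx_fc_intertwine m n (x : 'M[A]_(m.+1, n.+1)) (a : mxalg A n) (b : mxalg A m) f :
  sa a -> sa b -> lucont f ->
  x *m (a : 'M[A]_n.+1) = (b : 'M[A]_m.+1) *m x ->
  x *m (fc f a : 'M[A]_n.+1) = (fc f b : 'M[A]_m.+1) *m x.
Proof.
move=> sea seb cf xab; pose M := cnorm a + cnorm b + 1.
have M0 : 0 < M by rewrite ltr_wpDl// addr_ge0 ?cnorm_ge0.
have aM : cnorm a <= M by rewrite /M -addrA lerDl addr_ge0 ?cnorm_ge0.
have bM : cnorm b <= M by rewrite /M (addrC (cnorm a)) -addrA lerDl addr_ge0 ?cnorm_ge0.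
apply/eqP; rewrite -subr_eq0; apply/eqP/opnorm_eq0/le_anti; rewrite opnorm_ge0 andbT.
apply/ler_addgt0Pr => e e0; rewrite add0r.
have k0 : 0 < 2 * (opnorm x + 1) by rewrite mulr_gt0// ltr_wpDl ?opnorm_ge0.
have d0 : 0 < e / (2 * (opnorm x + 1)) by rewrite divr_gt0.
have [N1 h1] := (climP _ _).1 (fc_lim sea cf M0 aM) _ d0.
have [N2 h2] := (climP _ _).1 (fc_lim seb cf M0 bM) _ d0.
pose N := maxn N1 N2; have {}h1 := h1 N (leq_maxl _ _); have {}h2 := h2 N (leq_maxr _ _).
have xw := mx_wsum_intertwine f M N xab.
set wa := wsum f M a N in h1 xw; set wb := wsum f M b N in h2 xw.
have -> : x *m (fc f a : 'M[A]_n.+1) - (fc f b : 'M[A]_m.+1) *m x =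
   ((wb - fc f b : mxalg A m) : 'M[A]_m.+1) *m x - x *m ((wa - fc f a : mxalg A n) : 'M[A]_n.+1).
  rewrite (mulmxBr x) (mulmxBl _ _ x) xw opprB addrA addrAC.
  by rewrite [RHS]addrC (addrAC _ (- _) (- _)) subrr add0r.
rewrite (le_trans (opnormD _ _))// opnormN.
have g1 : opnorm (x *m (wa - fc f a : 'M[A]_n.+1)) <= opnorm x * (e / (2 * (opnorm x + 1))).
  by rewrite (le_trans (opnormM _ _))// ler_wpM2l ?opnorm_ge0// ltW.
have g2 : opnorm ((wb - fc f b : 'M[A]_m.+1) *m x) <= (e / (2 * (opnorm x + 1))) * opnorm x.
  by rewrite (le_trans (opnormM _ _))// ler_wpM2r ?opnorm_ge0// ltW.
apply: le_trans (lerD g2 g1) _.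
have qE : e / (2 * (opnorm x + 1)) * (2 * (opnorm x + 1)) = e by rewrite divfK// gt_eqF.
move: d0 qE; set q := e / _; move: (opnorm x) => N0 q0 qE.
by rewrite -qE; lra.
Qed.

(** The isometry v intertwines a with its image c. On the complement of the range of v, c vanishes,
    hence so does its cut, t being nonnegative. *)
Lemma mcut_isometry m n t (v : 'M[A]_(m.+1, n.+1)) (a : 'M[A]_n.+1) :
  mpsd a -> 0 <= t -> adjmx v *m v = 1%:M ->
  mcut t (v *m a *m adjmx v) = v *m mcut t a *m adjmx v.
Proof.
move=> pa t0 vv; set c := v *m a *m adjmx v.
have pc : mpsd c by exact: mpsd_conj.
have sa_ : @sa (mxalg A n) a by exact: psd_sa.
have sc : @sa (mxalg A m) c by exact: psd_sa.
have i1 : v *m mcut t a = mcut t c *m v.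
  apply: mx_fc_intertwine => //; first exact: lucont_cut.
  by rewrite /c -!mulmxA vv mulmx1.
rewrite i1 -mulmxA; pose q : 'M[A]_m.+1 := 1%:M - v *m adjmx v.
have cq : c *m q = 0.
  by rewrite /q mulmxBr mulmx1 /c -!mulmxA (mulmxA (adjmx v) v) vv mul1mx subrr.
have : mcut t c *m q = 0.
  apply: (@fc_annl R (mxalg A m) (cut t) q c) => //; first exact: lucont_cut.
  by rewrite /cut sub0r; apply/max_idPr; rewrite oppr_le0.
by rewrite /q mulmxBr mulmx1 => /eqP; rewrite subr_eq0 => /eqP.
Qed.

Lemma mpsd_dsum m n (a : 'M[A]_m.+1) (b : 'M[A]_n.+1) : mpsd a -> mpsd b ->
  mpsd (dsum a b : 'M[A]_((m + n.+1).+1)).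
Proof.
move=> pa pb.
have -> : (dsum a b : 'M[A]_((m + n.+1).+1)) =
   (dsum (msqrt a) (msqrt b) : 'M[A]_(m.+1 + n.+1)) *m
   adjmx (dsum (msqrt a) (msqrt b) : 'M[A]_(m.+1 + n.+1)).
  have -> : adjmx (dsum (msqrt a) (msqrt b)) = dsum (msqrt a) (msqrt b).
    rewrite /dsum block_mxEv adjmx_col_mx !adjmx_row_mx !adjmx0.
    by rewrite !msqrt_adj// -block_mxEh.
  by rewrite /dsum mulmx_block !msqrtK// !(mulmx0, mul0mx, addr0, add0r).
exact: (@mpsd_mulmx_adj (m + n.+1) _).
Qed.

Lemma csub_orth n (a b : 'M[A]_n.+1) : mpsd a -> mpsd b -> a *m b = 0 ->
  csub (dsum a b) (a + b).
Proof.
move=> pa pb ab; apply: csub_dsum_of => e e0.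
have d0 : 0 < e / 2 by rewrite divr_gt0.
have ed : e / 2 < e by lra.
have [x [y [h1 h2 h3 h4]]] := @orth_clip R (mxalg A n) a b _ pa pb ab d0.
exists x, y; split; [exact: le_lt_trans h1 ed|exact: le_lt_trans h2 ed| |].
- by rewrite [X in opnorm X](_ : _ = 0); [rewrite opnorm0|exact: h3].
- by rewrite [X in opnorm X](_ : _ = 0); [rewrite opnorm0|exact: h4].
Qed.

End Cuntz.

(** * The Cuntz semigroup *)

Section Padding.
Variables (R : realType) (A : cstarAlgType R).
Implicit Types (a b c : minf A) (m n N K : nat).

Definition emb m N : 'M[A]_(m.+1, N.+1) := \matrix_(i, j) (i == j :> nat)%:R.

Lemma emb_adj m N : (m <= N)%N -> emb m N *m adjmx (emb m N) = 1%:M.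
Proof.
move=> mN; apply/matrixP => i j; rewrite !mxE.
rewrite (bigD1 (widen_ord (mN : m.+1 <= N.+1)%N i))//= big1 => [|k ki].
  rewrite !mxE /= eqxx mul1r addr0 eq_sym -(inj_eq val_inj) /=.
  by case: eqP => _; rewrite ?star1 ?star0.
rewrite !mxE (_ : (i == k :> nat) = false) ?mul0r//.
by apply/eqP => ik; move/eqP: ki; apply; apply: val_inj.
Qed.

Lemma opnorm1_le n : opnorm (1%:M : 'M[A]_n) <= 1.
Proof. by apply: opnorm_le => v v1; rewrite mul1mx. Qed.

Lemma opnorm_emb m N : (m <= N)%N -> opnorm (emb m N) <= 1.
Proof.
move=> mN; rewrite -(ler_pXn2r (n := 2)) ?nnegrE ?opnorm_ge0// expr1n.
by rewrite -opnorm_adj -opnorm_adjM adjmxK emb_adj// opnorm1_le.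
Qed.

Lemma emb_comp m N K : (m <= N)%N -> emb m N *m emb N K = emb m K.
Proof.
move=> mN; apply/matrixP => i j; rewrite !mxE.
rewrite (bigD1 (widen_ord (mN : m.+1 <= N.+1)%N i))//= big1 => [|k ki].
  by rewrite !mxE /= eqxx mul1r addr0.
rewrite !mxE (_ : (i == k :> nat) = false) ?mul0r//.
by apply/eqP => ik; move/eqP: ki; apply; apply: val_inj.
Qed.

Lemma padE N a : (mdim a <= N)%N -> pad N a = adjmx (emb (mdim a) N) *m a *m emb (mdim a) N.
Proof.
move=> aN; apply/matrixP => i j; rewrite [LHS]mxE [RHS]mxE.
have embk (k : 'I_(mdim a).+1) (l : 'I_N.+1) : (l <= mdim a)%N ->
    k != inord l -> emb (mdim a) N k l = 0.
  move=> la; rewrite !mxE => kl; rewrite (_ : (_ == _) = false)//.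
  by apply/eqP => E; move/eqP: kl; apply; apply: val_inj; rewrite /= inordK ?E.
have embk1 (l : 'I_N.+1) : (l <= mdim a)%N -> emb (mdim a) N (inord l) l = 1.
  by move=> la; rewrite !mxE inordK// eqxx.
have embk0 (k : 'I_(mdim a).+1) (l : 'I_N.+1) : ~~ (l <= mdim a)%N -> emb (mdim a) N k l = 0.
  rewrite -ltnNge !mxE => la; rewrite (_ : (_ == _) = false)//.
  by apply/eqP => E; move: (ltn_ord k); rewrite ltnS E leqNgt la.
have [ja|ja] := boolP (j <= mdim a)%N; last first.
  by rewrite andbF big1// => k _; rewrite embk0// mulr0.
rewrite (bigD1 (inord j))//= embk1// mulr1 [X in _ + X]big1 ?addr0; last first.
  by move=> k kj; rewrite embk// mulr0.
rewrite mxE andbT; have [ia|ia] := boolP (i <= mdim a)%N; last first.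
  by rewrite big1// => k _; rewrite adjmxE embk0// star0 mul0r.
rewrite (bigD1 (inord i))//= adjmxE embk1// star1 mul1r big1 ?addr0// => k ki.
by rewrite adjmxE embk// star0 mul0r.
Qed.

(** For [m <= N] the matrix [emb m N] is a coisometry, so padding and compression do not increase
    norms and turn the two kinds of witnesses into each other. *)
Lemma minf_cuntzP a b : minf_cuntz_sub a b <-> csub (mval a) (mval b).
Proof.
split=> [[x xP] e e0|ab].
  move/cvgrPdist_lt : xP => /(_ e e0)[k _ /(_ k (leqnn k))].
  rewrite /= sub0r normrN ger0_norm ?opnorm_ge0//.
  set N := maxn _ _.
  have xN : (mdim (x k) <= N)%N by rewrite leq_maxl.
  have aN : (mdim a <= N)%N by rewrite !leq_max leqnn orbT.
  have bN : (mdim b <= N)%N by rewrite !leq_max leqnn !orbT.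
  rewrite (padE aN) (padE bN) -adjmx_star; set X := pad N (x k).
  set P := emb (mdim a) N; set Q := emb (mdim b) N => h.
  exists (P *m X *m adjmx Q).
  have -> : mval a - P *m X *m adjmx Q *m mval b *m adjmx (P *m X *m adjmx Q) =
    P *m (adjmx P *m a *m P - X *m (adjmx Q *m b *m Q) *m adjmx X) *m adjmx P.
    rewrite mulmxBr mulmxBl !adjmxM adjmxK !mulmxA emb_adj// mul1mx.
    by rewrite -(mulmxA (mval a)) emb_adj// mulmx1.
  apply: le_lt_trans (opnorm_conj _ _) (le_lt_trans _ h).
  by rewrite ler_piMl ?opnorm_ge0// exprn_ile1 ?opnorm_ge0// opnorm_emb.
have /choice[x xP] : forall k : nat, exists x : 'M[A]_((mdim a).+1, (mdim b).+1),
    opnorm (mval a - x *m mval b *m adjmx x) < k.+1%:R^-1.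
  by move=> k; apply: ab; rewrite invr_gt0.
pose N := maxn (mdim a) (mdim b).
have aN : (mdim a <= N)%N by rewrite leq_maxl.
have bN : (mdim b <= N)%N by rewrite leq_maxr.
pose y k : minf A := MInf (adjmx (emb (mdim a) N) *m x k *m emb (mdim b) N).
exists y; apply: (@squeeze_cvgr _ _ _ _ (fun=> 0) (fun k => k.+1%:R^-1)).
- apply: nearW => k; rewrite opnorm_ge0 /=; set K := maxn _ _.
  have NK : (N <= K)%N by rewrite leq_maxl.
  have aK := leq_trans aN NK; have bK := leq_trans bN NK.
  rewrite (padE aK) (padE bK) (@padE K (y k))//= -adjmx_star.
  have -> : adjmx (emb N K) *m (adjmx (emb (mdim a) N) *m x k *m emb (mdim b) N) *m emb N K
     = adjmx (emb (mdim a) K) *m x k *m emb (mdim b) K.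
    by rewrite -(emb_comp K aN) -(emb_comp K bN) adjmxM !mulmxA.
  set P := emb (mdim a) K; set Q := emb (mdim b) K.
  have -> : adjmx P *m mval a *m P -
      adjmx P *m x k *m Q *m (adjmx Q *m mval b *m Q) *m adjmx (adjmx P *m x k *m Q) =
      adjmx P *m (mval a - x k *m mval b *m adjmx (x k)) *m adjmx (adjmx P).
    rewrite mulmxBr mulmxBl !adjmxM !adjmxK !mulmxA; congr (_ - _).
    rewrite -(mulmxA (adjmx P *m x k) Q) emb_adj// mulmx1.
    by rewrite -[_ *m Q *m adjmx Q]mulmxA emb_adj// mulmx1.
  apply: le_trans (opnorm_conj _ _) (le_trans _ (ltW (xP k))).
  by rewrite opnorm_adj ler_piMl ?opnorm_ge0// exprn_ile1 ?opnorm_ge0// opnorm_emb.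
- exact: cvg_cst.
- exact: cvg_harmonic.
Qed.
End Padding.

Section CuntzSemigroupType.
Variables (R : realType) (A : cstarAlgType R).
Implicit Types (a b c : minf A).

Definition mpos a := positive (mval a).
Definition msub a b := csub (mval a) (mval b).

Lemma msub_refl a : msub a a. Proof. exact: csub_refl. Qed.
Lemma msub_trans a b c : msub a b -> msub b c -> msub a c.
Proof. exact: csub_trans. Qed.

Lemma W_classP a b : W_class a b <-> [/\ mpos b, msub a b & msub b a].
Proof. by split=> -[pb /minf_cuntzP ab /minf_cuntzP ba]. Qed.

Lemma W_class_eq a b : msub a b -> msub b a -> W_class a = W_class b.
Proof.
move=> ab ba; apply/seteqP; split=> c /W_classP[pc h1 h2]; apply/W_classP; split => //.
- exact: msub_trans ba h1.
- exact: msub_trans h2 ab.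
- exact: msub_trans ab h1.
- exact: msub_trans h2 ba.
Qed.

Lemma W_class_self a : mpos a -> W_class a a.
Proof. by move=> pa; apply/W_classP; split=> //; exact: msub_refl. Qed.

Lemma mpos_oplus a b : mpos a -> mpos b -> mpos (minf_oplus a b).
Proof. by move=> /mpsdP pa /mpsdP pb; apply/mpsdP; exact: mpsd_dsum. Qed.

Lemma msub_oplus a b c d : msub a c -> msub b d -> msub (minf_oplus a b) (minf_oplus c d).
Proof. exact: csub_dsum. Qed.

Definition minf0 : minf A := @MInf R A 0 0.

Lemma mpos0 : mpos minf0. Proof. by apply/mpsdP; exact: mpsd0. Qed.

Lemma msub0 b : msub minf0 b. Proof. exact: csub0. Qed.

Lemma W_add_class a b : mpos a -> mpos b ->
  W_add (W_class a) (W_class b) = W_class (minf_oplus a b).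
Proof.
move=> pa pb; apply/seteqP; split=> [c [a' [b' [/W_classP[_ aa a'a] /W_classP[_ bb b'b]]]]|c h].
  rewrite (@W_class_eq _ (minf_oplus a b))//; exact: msub_oplus.
by exists a, b; split=> //; exact: W_class_self.
Qed.

Lemma W_le_class a b : mpos a -> mpos b -> W_le (W_class a) (W_class b) <-> msub a b.
Proof.
move=> pa pb; split=> [[a' [b' [/W_classP[_ aa a'a] /W_classP[_ bb b'b] /minf_cuntzP h]]]|h].
  exact: msub_trans aa (msub_trans h b'b).
by exists a, b; split; [exact: W_class_self|exact: W_class_self|exact/minf_cuntzP].
Qed.

Definition cuW : Type := {X : set (minf A) | W X}.

Lemma W_class_W a : mpos a -> W (W_class a). Proof. by move=> pa; exists a. Qed.

(** Total by convention: a non-positive element receives the class of 0. *)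
Definition cz a : cuW := match pselect (mpos a) with
  | left pa => exist _ (W_class a) (W_class_W pa)
  | right _ => exist _ (W_class minf0) (W_class_W mpos0)
  end.

Lemma czE a : mpos a -> sval (cz a) = W_class a.
Proof. by rewrite /cz; case: pselect. Qed.

Lemma cuW_inj (X Y : cuW) : sval X = sval Y -> X = Y.
Proof. by case: X Y => [X XP] [Y YP] /= E; subst Y; congr exist; exact: Prop_irrelevance. Qed.

Lemma cz_surj (X : cuW) : exists2 a, mpos a & X = cz a.
Proof. by case: X => X [a pa E]; exists a => //; apply: cuW_inj; rewrite czE. Qed.

Definition cule (X Y : cuW) := W_le (sval X) (sval Y).

Lemma cule_cz a b : mpos a -> mpos b -> cule (cz a) (cz b) <-> msub a b.
Proof. by move=> pa pb; rewrite /cule !czE//; exact: W_le_class. Qed.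

Lemma cz_eq a b : mpos a -> mpos b -> msub a b -> msub b a -> cz a = cz b.
Proof. by move=> pa pb ab ba; apply: cuW_inj; rewrite !czE//; exact: W_class_eq. Qed.

Definition curep (X : cuW) : minf A := sval (cid2 (cz_surj X)).
Lemma curep_pos X : mpos (curep X). Proof. by rewrite /curep; case: cid2. Qed.
Lemma curepK X : cz (curep X) = X. Proof. by rewrite /curep; case: cid2. Qed.

Definition cuadd (X Y : cuW) : cuW := cz (minf_oplus (curep X) (curep Y)).

Lemma cz_rep a : mpos a -> msub a (curep (cz a)) /\ msub (curep (cz a)) a.
Proof.
move=> pa; have pr := curep_pos (cz a).
by split; apply/cule_cz => //; rewrite curepK; apply/cule_cz => //; exact: msub_refl.
Qed.

Lemma cuaddE a b : mpos a -> mpos b -> cuadd (cz a) (cz b) = cz (minf_oplus a b).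
Proof.
move=> pa pb; have [h1 h2] := cz_rep pa; have [h3 h4] := cz_rep pb.
by apply: cz_eq; [exact/mpos_oplus/curep_pos/curep_pos|exact: mpos_oplus
  |exact: msub_oplus|exact: msub_oplus].
Qed.

Lemma cuaddA : associative cuadd.
Proof.
move=> X Y Z; have [a pa ->] := cz_surj X; have [b pb ->] := cz_surj Y.
have [c pc ->] := cz_surj Z; rewrite !cuaddE//; try exact: mpos_oplus.
have [h1 h2] := csub_dsumA (mval a) (mval b) (mval c).
by apply: cz_eq => //; [apply: mpos_oplus => //; exact: mpos_oplus
  |apply: mpos_oplus => //; exact: mpos_oplus].
Qed.

Lemma cuaddC : commutative cuadd.
Proof.
move=> X Y; have [a pa ->] := cz_surj X; have [b pb ->] := cz_surj Y.
rewrite !cuaddE//; apply: cz_eq; try exact: mpos_oplus.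
  exact: (csub_dsumC (mval a) (mval b)).
exact: (csub_dsumC (mval b) (mval a)).
Qed.

Lemma cuadd0 : left_id (cz minf0) cuadd.
Proof.
move=> X; have [a pa ->] := cz_surj X; rewrite cuaddE//; last exact: mpos0.
apply: cz_eq => //; first by apply: mpos_oplus => //; exact: mpos0.
  have : csub (dsum (0 : 'M[A]_1) (mval a)) (mval a); last by [].
  apply: (@csub_exact _ _ _ _ (col_mx 0 1%:M)).
  by rewrite conj_col !(adjmx0, mul0mx, mulmx0, mul1mx) adjmx_scalar star1 mulmx1.
exact: (csub_addr (0 : 'M[A]_1) (mval a)).
Qed.

HB.instance Definition _ := gen_eqMixin cuW.
HB.instance Definition _ := gen_choiceMixin cuW.
HB.instance Definition _ := GRing.isNmodule.Build cuW cuaddA cuaddC cuadd0.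

Lemma cz_oplus a b : mpos a -> mpos b -> cz (minf_oplus a b) = cz a + cz b.
Proof. by move=> pa pb; rewrite -cuaddE. Qed.

Lemma cule_refl X : cule X X.
Proof. by have [a pa ->] := cz_surj X; apply/cule_cz => //; exact: msub_refl. Qed.

Lemma cule_trans X Y Z : cule X Y -> cule Y Z -> cule X Z.
Proof.
have [a pa ->] := cz_surj X; have [b pb ->] := cz_surj Y; have [c pc ->] := cz_surj Z.
by move=> /cule_cz-/(_ pa pb) h1 /cule_cz-/(_ pb pc) h2; apply/cule_cz => //; exact: msub_trans h1 h2.
Qed.

Lemma culeD X Y Z T : cule X Y -> cule Z T -> cule (X + Z) (Y + T).
Proof.
have [a pa ->] := cz_surj X; have [b pb ->] := cz_surj Y; have [c pc ->] := cz_surj Z.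
have [d pd ->] := cz_surj T.
move=> /cule_cz-/(_ pa pb) h1 /cule_cz-/(_ pc pd) h2.
by rewrite -!cz_oplus//; apply/cule_cz; try exact: mpos_oplus; exact: msub_oplus.
Qed.

Lemma cule0 X : cule 0 X.
Proof. by have [a pa ->] := cz_surj X; apply/cule_cz => //; [exact: mpos0|exact: msub0]. Qed.

Lemma sval_cuadd (X Y : cuW) : sval (X + Y) = W_add (sval X) (sval Y).
Proof.
have [a pa ->] := cz_surj X; have [b pb ->] := cz_surj Y.
by rewrite -cz_oplus// !czE//; [rewrite W_add_class|exact: mpos_oplus].
Qed.

Lemma sval_cumuln (X : cuW) k : sval (X *+ k) = W_muln k (sval X).
Proof.
case: k => [|k]; first by rewrite mulr0n [LHS]czE//; exact: mpos0.
elim: k => [|k IHk]; first by [].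
by rewrite mulrS sval_cuadd IHk.
Qed.

Lemma W_almost_unperforatedP : W_almost_unperforated A <->
  forall (X Y : cuW) k, (0 < k)%N -> cule (X *+ k.+1) (Y *+ k) -> cule X Y.
Proof.
split=> [au X Y k k0 h|au X Y WX WY [k k0 h]].
  apply: (au _ _ (svalP X) (svalP Y)); exists k => //.
  by rewrite -!sval_cumuln.
apply: (au (exist _ X WX) (exist _ Y WY) k k0).
by rewrite /cule !sval_cumuln.
Qed.
End CuntzSemigroupType.

(** * States on ordered monoids *)

Section OrderedMonoidStates.
Variables (R : realType) (M : nmodType) (le : M -> M -> Prop) (u : M).
Implicit Types (r : M -> M -> Prop) (x y z a b s t q w : M) (m n k N : nat).

Definition compatible r := [/\ forall x, r x x, forall x y z, r x y -> r y z -> r x z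
  & forall x y z, r x y -> r (x + z) (y + z)].
(** For such a relation no monotone additive f can have [f u = 1]. *)
Definition degenerate r := exists n, r (u *+ n.+1) (u *+ n).

Hypotheses (le_comp : compatible le) (le0x : forall x, le 0 x).
Hypothesis le_unit : forall x, exists n, le x (u *+ n).

Lemma compatD r x y z w : compatible r -> r x y -> r z w -> r (x + z) (y + w).
Proof.
move=> [rr rt rD] xy zw; apply: rt (rD _ _ z xy) _.
by rewrite ![y + _]addrC; exact: rD.
Qed.

Lemma compatMn r x y k : compatible r -> r x y -> r (x *+ k) (y *+ k).
Proof.
move=> rc xy; elim: k => [|k IHk]; first by case: rc.
by rewrite !mulrS; exact: compatD.
Qed.

Definition extends r := forall x y, le x y -> r x y.

(** Iteration gives [(n + K) u + q <= n u + q] for every K. If q lies below [N u], then [K = N + 1]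
    already yields [(n + N + 1) u <= (n + N) u]. *)
Lemma degenerate_cancel r n q : compatible r -> extends r ->
  r (u *+ n.+1 + q) (u *+ n + q) -> degenerate r.
Proof.
move=> rc re h; have [rr rt rD] := rc.
have iter K : r (u *+ (n + K) + q) (u *+ n + q).
  elim: K => [|K IHK]; first by rewrite addn0.
  apply: rt IHK; have := rD _ _ (u *+ K) h.
  by rewrite addrAC -mulrnDr addSn -addnS [X in r _ X]addrAC -mulrnDr.
have [N qN] := le_unit q; exists (n + N)%N.
apply: rt (rt _ _ _ _ (iter N.+1)) _.
  by rewrite -addnS -[X in r X]addr0; apply: compatD => //; exact: re.
by rewrite mulrnDr; apply: compatD => //; exact: re.
Qed.

(* The smallest compatible cancellative enlargement of r in which a is below b. *)
Definition adjoin r a b s t := exists m q, r (s + b *+ m + q) (t + a *+ m + q).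

Lemma adjoin_compatible r a b : compatible r -> compatible (adjoin r a b).
Proof.
move=> rc; have [rr rt rD] := rc; split.
- by move=> x; exists 0%N, 0; rewrite !mulr0n; exact: rr.
- move=> x y z [m [q h]] [m' [q' h']]; exists (m + m')%N, (q + q').
  have h1 := rD _ _ (b *+ m' + q') h; have h2 := rD _ _ (a *+ m + q) h'.
  have -> : x + b *+ (m + m') + (q + q') = x + b *+ m + q + (b *+ m' + q').
    by rewrite mulrnDr [RHS]addrACA !addrA.
  have -> : z + a *+ (m + m') + (q + q') = z + a *+ m' + q' + (a *+ m + q).
    by rewrite (addnC m) (addrC q) mulrnDr [RHS]addrACA !addrA.
  apply: rt h1 _; have <- // : y + b *+ m' + q' + (a *+ m + q) = y + a *+ m + q + (b *+ m' + q').
  by rewrite -!addrA; congr (_ + _); rewrite !addrA [RHS](ACl (3*4*1*2)).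
- move=> x y z [m [q h]]; exists m, q.
  by rewrite (addrAC x z) (addrAC y z) (addrAC _ z) (addrAC (y + _) z); exact: rD.
Qed.

Lemma adjoin_sub r a b x y : compatible r -> r x y -> adjoin r a b x y.
Proof. by move=> [_ _ rD] xy; exists 0%N, 0; rewrite !mulr0n !addr0. Qed.

Lemma adjoin_le r a b : compatible r -> adjoin r a b a b.
Proof. by move=> [rr _ _]; exists 1%N, 0; rewrite !mulr1n !addr0 addrC. Qed.

Definition good r := [/\ compatible r, extends r & ~ degenerate r].

Lemma maximal_good r0 : good r0 -> exists r, [/\ good r,
  forall x y, r0 x y -> r x y & forall r', good r' -> (forall x y, r x y -> r' x y) ->
    forall x y, r' x y -> r x y].
Proof.
move=> g0; pose rel (S : set (M * M)) := fun x y => S (x, y).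
pose P (S : set (M * M)) := S = set0 \/ (good (rel S) /\ forall x y, r0 x y -> S (x, y)).
have [|S [PS Smax]] := @Zorn_bigcup (M * M) P.
  move=> F FP Ftot; have [->|/set0P[z [S0 FS0 S0z]]] := eqVneq (\bigcup_(X in F) X) set0.
    by left.
  right; have g S (z' : M * M) : F S -> S z' -> good (rel S) /\ forall x y, r0 x y -> S (x, y).
    by move=> /FP[->//|].
  have two (z1 z2 : M * M) : (\bigcup_(X in F) X) z1 -> (\bigcup_(X in F) X) z2 ->
      exists S, [/\ F S, S z1 & S z2].
    move=> [S1 F1 h1] [S2 F2 h2]; have [S12|S21] := Ftot _ _ F1 F2.
      by exists S2; split => //; exact: S12.
    by exists S1; split => //; exact: S21.
  have [[[rr0 _ _] re0 _] r0S] := g _ _ FS0 S0z.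
  split; last by move=> x y h; exists S0 => //; exact: r0S.
  split.
  - split.
    + by move=> x; exists S0 => //; exact: rr0.
    + move=> x y w h1 h2; have [S [FS k1 k2]] := two _ _ h1 h2.
      by have [[[_ rt _] _ _] _] := g _ _ FS k1; exists S => //; exact: rt k1 k2.
    + move=> x y w [S FS k]; have [[[_ _ rD] _ _] _] := g _ _ FS k.
      by exists S => //; exact: rD.
  - by move=> x y h; exists S0 => //; exact: re0.
  - move=> [n [S FS k]]; have [[_ _ nd] _] := g _ _ FS k.
    by apply: nd; exists n.
have Sne : S != set0.
  apply/eqP => S0; apply: (Smax [set z | r0 z.1 z.2]).
    rewrite S0; split; first exact: sub0set.
    by move=> /(_ (0, 0)); apply; have [[rr _ _] _ _] := g0; exact: rr.
  by right.
case: PS => [S0|[gS r0S]]; first by move/eqP: Sne.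
exists (rel S); split => // r' g' Sr' x y r'xy; apply: contrapT => nS.
apply: (Smax [set z | r' z.1 z.2]).
  by split; [move=> [a b] /Sr'|move=> /(_ (x, y) r'xy)].
by right; split => // a b /r0S /Sr'.
Qed.

(** If a and b were incomparable, adjoining either relation would be degenerate by maximality.
    Adding m' times the first degenerate inequality to m times the second puts the same multiples of
    a and b on both sides, and after cancellation r itself is degenerate. *)
Lemma maximal_total r : good r ->
  (forall r', good r' -> (forall x y, r x y -> r' x y) -> forall x y, r' x y -> r x y) ->
  forall a b, r a b \/ r b a.
Proof.
move=> [rc re nd] rmax a b; have [rr rt rD] := rc.
have main a' b' : ~ r a' b' -> exists n m q, (0 < m)%N /\
    r (u *+ n.+1 + b' *+ m + q) (u *+ n + a' *+ m + q).
  move=> nab; have : degenerate (adjoin r a' b').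
    apply: contrapT => nd'; apply: nab; apply: (rmax (adjoin r a' b')).
    - split => //; first exact: adjoin_compatible.
      by move=> x y /re; exact: adjoin_sub.
    - by move=> x y; exact: adjoin_sub.
    - exact: adjoin_le.
  move=> [n [m [q h]]]; exists n, m, q; split => //; rewrite lt0n; apply/eqP => m0.
  apply: nd; apply: (@degenerate_cancel _ n q) => //.
  by move: h; rewrite m0 !mulr0n !addr0.
apply: contrapT => /not_orP[/main[n [m [q [m0 h]]]] /main[n' [m' [q' [m'0 h']]]]].
apply: nd; pose K := (n * m' + n' * m)%N.
pose Q := b *+ (m * m') + a *+ (m * m') + (q *+ m' + q' *+ m).
apply: (@degenerate_cancel _ K Q) => //.
have H := compatD rc (compatMn m' rc h) (compatMn m rc h').
have E1 : (u *+ n.+1 + b *+ m + q) *+ m' + (u *+ n'.+1 + a *+ m' + q') *+ m =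
    u *+ (K + m' + m) + Q.
  rewrite !mulrnDl -!mulrnA !mulSn (addrACA (_ + _)) (addrACA (u *+ _)) -mulrnDr.
  by rewrite (mulnC m' m) /Q -!addrA; congr (u *+ _ + _); rewrite /K; lia.
have E2 : (u *+ n + a *+ m + q) *+ m' + (u *+ n' + b *+ m' + q') *+ m = u *+ K + Q.
  rewrite !mulrnDl -!mulrnA (addrACA (_ + _)) (addrACA (u *+ _)) -mulrnDr.
  by rewrite (mulnC m' m) (addrC (a *+ _)) /Q -!addrA.
rewrite E1 E2 in H; apply: rt _ H; rewrite -(subnKC (_ : (K.+1 <= K + m' + m)%N)); last first.
  by rewrite -addnA -addn1 leq_add2l addn_gt0 m0 orbT.
rewrite mulrnDr -addrA -[X in r (X + _)]addr0 -addrA; apply: compatD => //.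
by apply: compatD => //; exact/re/le0x.
Qed.

Section StateOfTotal.
Variable r : M -> M -> Prop.
Hypotheses (gr : good r) (tot : forall a b, r a b \/ r b a).
Let rc : compatible r. Proof. by case: gr. Qed.
Let re : extends r. Proof. by case: gr. Qed.
Let nd : ~ degenerate r. Proof. by case: gr. Qed.

Definition upper w : set R := [set c | exists n m, c = m%:R / n.+1%:R /\ r (w *+ n.+1) (u *+ m)].
Definition state w : R := inf (upper w).

Lemma unit_le n m : r (u *+ n) (u *+ m) -> (n <= m)%N.
Proof.
have [rr rt rD] := rc => h; rewrite leqNgt; apply/negP => mn; apply: nd; exists m.
apply: rt h; rewrite -(subnKC mn) mulrnDr -[X in r X]addr0.
by apply: compatD => //; exact/re/le0x.
Qed.

Lemma upper_lb w n m c : r (u *+ m) (w *+ n.+1) -> upper w c -> m%:R / n.+1%:R <= c.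
Proof.
have [rr rt rD] := rc.
move=> h [n' [m' [-> h']]]; rewrite ler_pdivrMr// mulrAC ler_pdivlMr//.
rewrite -!natrM ler_nat; apply: unit_le.
have := compatMn n'.+1 rc h; have := compatMn n.+1 rc h'; rewrite -!mulrnA => k1 k2.
by apply: rt k2 _; rewrite mulnC.
Qed.

(** Totality locates w between consecutive multiples of [u / (N + 1)]; additivity of the state
    follows with an error of order [1 / (N + 1)]. *)
Lemma bracket w N : exists p, r (u *+ p) (w *+ N.+1) /\ r (w *+ N.+1) (u *+ p.+1).
Proof.
have [rr rt rD] := rc.
have ex : exists p, `[< r (w *+ N.+1) (u *+ p) >].
  by have [n h] := le_unit (w *+ N.+1); exists n; apply/asboolP; exact: re.
case: (ex_minnP ex) => [[|p]] /asboolP h hmin.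
  exists 0%N; split; first by rewrite mulr0n; exact/re/le0x.
  by apply: rt h _; rewrite mulr0n; exact/re/le0x.
exists p; split => //; have [//|h'] := tot (u *+ p) (w *+ N.+1).
by have := hmin p (asboolT h'); rewrite ltnn.
Qed.

Lemma upper_has_inf w : has_inf (upper w).
Proof.
split; first by have [p [_ h]] := bracket w 0; exists (p.+1%:R / 1%:R), 0%N, p.+1.
by exists 0 => c [n [m [-> _]]]; rewrite divr_ge0.
Qed.

Lemma state_ge w n m : r (u *+ m) (w *+ n.+1) -> m%:R / n.+1%:R <= state w.
Proof.
move=> h; apply: lb_le_inf; first by case: (upper_has_inf w).
by move=> c; exact: upper_lb.
Qed.

Lemma state_le w n m : r (w *+ n.+1) (u *+ m) -> state w <= m%:R / n.+1%:R.
Proof.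
by move=> h; apply: ge_inf; [case: (upper_has_inf w)|exists n, m].
Qed.

Lemma state_mono x y : r x y -> state x <= state y.
Proof.
have [rr rt rD] := rc.
move=> xy; apply: lb_le_inf; first by case: (upper_has_inf y).
move=> c [n [m [-> h]]]; apply: state_le; apply: rt h; exact: compatMn.
Qed.

Lemma state_unit : state u = 1.
Proof.
have [rr rt rD] := rc.
have h := rr (u *+ 1).
apply/le_anti; have := @state_le u 0 1 h; have := @state_ge u 0 1 h.
by rewrite divr1 => -> ->.
Qed.

Lemma stateD x y : state (x + y) = state x + state y.
Proof.
have close N : `|state (x + y) - (state x + state y)| <= 2 * N.+1%:R^-1.
  have [p [p1 p2]] := bracket x N; have [q [q1 q2]] := bracket y N.
  have s1 := compatD rc p1 q1; have s2 := compatD rc p2 q2.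
  rewrite -!mulrnDl -!mulrnDr in s1 s2.
  have := state_ge p1; have := state_le p2; have := state_ge q1; have := state_le q2.
  have := state_ge s1; have := state_le s2.
  rewrite !natrD -(natr1 p) -(natr1 q).
  rewrite !mulrDl !mul1r.
  move: (state (x + y)) (state x) (state y) (N.+1%:R^-1) => a b c v.
  move: (p%:R * v) (q%:R * v) => p' q' *.
  by rewrite ler_norml; apply/andP; split; lra.
apply/eqP; rewrite -subr_eq0 -normr_eq0; apply/eqP/le_anti; rewrite normr_ge0 andbT.
have h : (fun N : nat => 2 * N.+1%:R^-1) @ \oo --> (0 : R).
  by rewrite -[X in _ --> X](mulr0 2); apply: cvgM; [exact: cvg_cst|exact: cvg_harmonic].
by apply: (ler_cvg_to (cvg_cst _) h); apply: nearW => N; exact: close.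
Qed.
End StateOfTotal.

(** The excluded relation is precisely the degeneracy of [adjoin le a b], from which the maximal
    extension starts. *)
Lemma exists_state (a b : M) :
  ~ (exists n m q, le (u *+ n.+1 + b *+ m + q) (u *+ n + a *+ m + q)) ->
  exists f : M -> R, [/\ forall x y, f (x + y) = f x + f y,
    forall x y, le x y -> f x <= f y, f u = 1 & f a <= f b].
Proof.
move=> nab; have g0 : good (adjoin le a b).
  split; first exact: adjoin_compatible.
    by move=> x y; exact: adjoin_sub.
  by move=> [n [m [q h]]]; apply: nab; exists n, m, q.
have [r [gr r0 rmax]] := maximal_good g0.
have tot := maximal_total gr rmax; have [_ re _] := gr.
exists (state r); split.
- exact: stateD.
- by move=> x y /re; exact: state_mono.
- exact: state_unit.
- by apply: state_mono => //; apply: r0; exact: adjoin_le.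
Qed.
End OrderedMonoidStates.

(** * Order zero maps *)

Lemma adjmx_delta (B : starRingType) m n i j :
  adjmx (delta_mx i j : 'M[B]_(m, n)) = delta_mx j i.
Proof.
apply/matrixP => k l; rewrite !mxE andbC.
by case: (_ && _); rewrite ?star1 ?star0.
Qed.

Lemma psd_sum_eq0 (R : realType) (A : cstarAlgType R) (I : finType) (F : I -> A) i :
  (forall i, psd (F i)) -> \sum_i F i = 0 -> F i = 0.
Proof.
move=> pF; rewrite (bigD1 i)//= => /eqP; rewrite addr_eq0 => /eqP FiE.
apply: psd_antisym => //; rewrite FiE opprK.
exact: psd_sum.
Qed.

Section OrderZero.
Variables (R : realType) (A : cstarAlgType R) (n : nat).
Local Notation C := R[i].
Variable phi : 'M[C]_n.+1 -> A.
Hypothesis oz : cpc_order_zero phi.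
Implicit Types (i j k l : 'I_n.+1).

Let phi_lin : linear phi. Proof. by case: oz. Qed.

Lemma oz0 : phi 0 = 0.
Proof.
by have := phi_lin (-1) 0 0; rewrite scaleN1r oppr0 addr0 scaleN1r addNr.
Qed.
Lemma ozD x y : phi (x + y) = phi x + phi y.
Proof. by have := phi_lin 1 x y; rewrite !scale1r. Qed.
Lemma ozN x : phi (- x) = - phi x.
Proof. by have := phi_lin (-1) x 0; rewrite !scaleN1r addr0 oz0 addr0. Qed.

Definition ozE i j : A := phi (delta_mx i j).

(** Complete positivity is applied to the matrix of all matrix units, which is [star z * z] for the
    z with first row [e_00, e_01, ...] and zeros elsewhere. The columns of x then behave as vectors
    whose inner products are the [E_ij]. *)
Lemma ozE_gram : exists x : 'M[A]_n.+1, forall i j,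
  ozE i j = \sum_k star (x k i) * x k j.
Proof.
pose a : 'M['M[C]_n.+1]_n.+1 := \matrix_(i, j) delta_mx i j.
have pa : positive a.
  exists (\matrix_(i, j) if i == ord0 then delta_mx ord0 j else 0).
  apply/matrixP => i j; rewrite !mxE (bigD1 ord0)//= big1 ?addr0 => [|k k0].
    rewrite !mxE eqxx -adjmx_star adjmx_delta.
    by rewrite -[RHS]/(delta_mx i ord0 *m delta_mx ord0 j) mul_delta_mx.
  by rewrite !mxE (negPf k0) mulr0.
have [_ cp _ _] := oz; have [x xE] := cp _ _ pa.
exists x => i j; move/matrixP: xE => /(_ i j); rewrite !mxE /ozE => ->.
by apply: eq_bigr => k _; rewrite !mxE.
Qed.

Lemma ozE_star i j : star (ozE i j) = ozE j i.
Proof.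
have [x xE] := ozE_gram; rewrite !xE star_sum; apply: eq_bigr => k _.
by rewrite starM starK.
Qed.

Lemma ozE_psd i : psd (ozE i i).
Proof. by have [x xE] := ozE_gram; rewrite xE; apply: psd_sum => k _; exact: psd_starl. Qed.

(** [star y E_ii y] is the sum of the [star (x_ki y) (x_ki y)], so every [x_ki y] vanishes, and y is
    built from the [star x_ki]. This cancels [E_ii] on the left although it need not be
    invertible. *)
Lemma ozE_cancel i y : (exists z : 'I_n.+1 -> A, exists2 x : 'M[A]_n.+1,
    (forall i j, ozE i j = \sum_k star (x k i) * x k j) &
    y = \sum_k star (x k i) * z k) -> ozE i i * y = 0 -> y = 0.
Proof.
move=> [z [x xE yE]] Ey; have xy k : x k i * y = 0.
  apply: starl_eq0.
  apply: (@psd_sum_eq0 _ _ _ (fun k => star (x k i * y) * (x k i * y)) k).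
    by move=> l; exact: psd_starl.
  transitivity (star y * (ozE i i * y)); last by rewrite Ey mulr0.
  rewrite xE mulr_suml mulr_sumr; apply: eq_bigr => l _.
  by rewrite starM !mulrA.
apply: starl_eq0; rewrite {1}yE star_sum mulr_suml big1// => k _.
by rewrite starM starK -mulrA xy mulr0.
Qed.

Lemma oz_rank1 (u w : 'cV[C]_n.+1) : adjmx u *m w = 0 ->
  phi (u *m adjmx u) * phi (w *m adjmx w) = 0.
Proof.
move=> uw; have pos (v : 'cV[C]_n.+1) : positive (v *m adjmx v : 'M[C]_n.+1).
  exists (delta_mx ord0 ord0 *m adjmx v); rewrite -adjmx_star adjmxM adjmxK adjmx_delta.
  rewrite -[RHS]/((v *m delta_mx ord0 ord0) *m (delta_mx ord0 ord0 *m adjmx v)).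
  by rewrite mulmxA -(mulmxA v) mul_delta_mx (_ : delta_mx ord0 ord0 = 1%:M) ?mulmx1//;
    apply/matrixP => i j; rewrite !ord1 !mxE.
have [_ _ _ ozp] := oz; apply: ozp => //.
rewrite -[LHS]/((u *m adjmx u) *m (w *m adjmx w)).
by rewrite mulmxA -(mulmxA u) uw mulmx0 mul0mx.
Qed.

Local Notation e i := (delta_mx i ord0 : 'cV[C]_n.+1).

Lemma oz_ii i j : i != j -> ozE i i * ozE j j = 0.
Proof.
move=> ij; have := @oz_rank1 (e i) (e j).
by rewrite !adjmx_delta !mul_delta_mx; apply; rewrite mul_delta_mx_0.
Qed.

(** Order zero gives the diagonal case [E_jj E_kk = 0]. The Gram vectors carry it over to the other
    entries: first [x_qk E_jj = 0], then [x_pj star x_qk = 0]. *)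
Lemma oz_ort i j k l : j != k -> ozE i j * ozE k l = 0.
Proof.
move=> jk; have [x xE] := ozE_gram.
have h q : x q k * ozE j j = 0.
  apply: starl_eq0; apply: (@psd_sum_eq0 _ _ _ (fun q => star (x q k * ozE j j) * (x q k * ozE j j)) q).
    by move=> p; exact: psd_starl.
  transitivity (ozE j j * ozE k k * ozE j j); last by rewrite oz_ii ?mul0r.
  rewrite (xE k k) mulr_sumr mulr_suml; apply: eq_bigr => p _.
  by rewrite starM ozE_star !mulrA.
have h2 p q : x p j * star (x q k) = 0.
  apply: starl_eq0; apply: (@psd_sum_eq0 _ _ _ (fun p => star (x p j * star (x q k)) * (x p j * star (x q k))) p).
    by move=> r; exact: psd_starl.
  transitivity (x q k * ozE j j * star (x q k)); last by rewrite h mul0r.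
  rewrite xE mulr_sumr mulr_suml; apply: eq_bigr => r _.
  by rewrite starM starK !mulrA.
rewrite (xE i j) (xE k l) mulr_suml big1// => p _; rewrite mulr_sumr big1// => q _.
by rewrite mulrA -(mulrA (star _)) h2 mulr0 mul0r.
Qed.

Lemma oz_rank1_sum i j k (t : C) :  i != j -> k != i -> k != j ->
  (ozE i i + ozE i j + ozE j i + ozE j j) *
  phi ((e i - e j + t *: e k) *m adjmx (e i - e j + t *: e k)) = 0.
Proof.
move=> ij ki kj.
have -> : ozE i i + ozE i j + ozE j i + ozE j j = phi ((e i + e j) *m adjmx (e i + e j)).
  rewrite adjmxD !adjmx_delta mulmxDl !mulmxDr !mul_delta_mx !ozD.
  by rewrite /ozE !addrA.
apply: oz_rank1; rewrite adjmxD !adjmx_delta mulmxDl !mulmxDr !mulmxN !mul_delta_mx_cond.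
rewrite -!scalemxAr !mul_delta_mx_cond (eq_sym i k) (eq_sym j k) (eq_sym j i).
by rewrite (negPf ij) (negPf ki) (negPf kj) !eqxx !mulr0n !mulr1n !scaler0 !addr0 oppr0 addr0 add0r subrr.
Qed.

(** The vectors [e_i + e_j] and [e_i - e_j] are orthogonal, whence
    [(S + T) (S - T) = 0 = (S - T) (S + T)]. *)
Lemma oz_pair i j : i != j -> let S := ozE i i + ozE j j in let T := ozE i j + ozE j i in
  S * S = T * T /\ S * T = T * S.
Proof.
move=> ij S T.
have ST : phi ((e i + e j) *m adjmx (e i + e j)) = S + T.
  rewrite adjmxD !adjmx_delta mulmxDl !mulmxDr !mul_delta_mx !ozD /S /T /ozE.
  by rewrite !addrA [RHS](ACl (1*3*4*2)).
have SmT : phi ((e i - e j) *m adjmx (e i - e j)) = S - T.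
  rewrite adjmxB !adjmx_delta mulmxBl !mulmxBr !mul_delta_mx !(ozD, ozN) /S /T /ozE.
  by rewrite !opprD opprK !addrA [RHS](ACl (1*3*4*2)).
have orth1 : adjmx (e i + e j) *m (e i - e j) = 0.
  rewrite adjmxD !adjmx_delta mulmxDl !mulmxBr !mul_delta_mx_cond (eq_sym j i).
  by rewrite (negPf ij) !eqxx !mulr0n !mulr1n subr0 sub0r subrr.
have orth2 : adjmx (e i - e j) *m (e i + e j) = 0.
  rewrite adjmxB !adjmx_delta mulmxBl !mulmxDr !mul_delta_mx_cond (eq_sym j i).
  by rewrite (negPf ij) !eqxx !mulr0n !mulr1n addr0 add0r subrr.
have h1 := oz_rank1 orth1; have h2 := oz_rank1 orth2; rewrite ST SmT in h1 h2.
have k1 : S * S - T * T = (2^-1 : R) *` ((S + T) * (S - T) + (S - T) * (S + T)).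
  by rewrite -[LHS]rs_half; congr (_ *: _); ncring.
have k2 : S * T - T * S = (2^-1 : R) *` ((S - T) * (S + T) - (S + T) * (S - T)).
  by rewrite -[LHS]rs_half; congr (_ *: _); ncring.
by split; apply/eqP; rewrite -subr_eq0 ?k1 ?k2 h1 h2 ?addr0 ?subr0 scaler0.
Qed.

Lemma oz_move i j : ozE i j * ozE j j = ozE i i * ozE i j.
Proof.
have [->//|ij] := eqVneq i j.
have ji : j != i by rewrite eq_sym.
have [_ comm] := oz_pair ij.
have [x xE] := ozE_gram.
apply/eqP; rewrite -subr_eq0; apply/eqP; apply: (@ozE_cancel i).
  exists (fun k => x k j * ozE j j - x k i * ozE i j), x => //.
  rewrite {1}(xE i j) (xE i i) !mulr_suml -sumrB; apply: eq_bigr => p _.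
  by rewrite mulrBr !mulrA.
have := congr1 (fun z => ozE i i * z) comm.
rewrite !mulrDr !mulrDl !mulrDr.
rewrite (oz_ort i i ij) (oz_ort j j ji) (oz_ort i i ji) (oz_ort j j ij).
rewrite !mulr0 !addr0 !add0r ![ozE i i * (_ * _)]mulrA (oz_ort i j ij) (oz_ort i i ij) !mul0r !addr0.
by move=> E; rewrite mulrN !mulrA E add0r subrr.
Qed.

(** By [oz_pair], [E_ii ^ 2 - E_ij E_ji] is minus its counterpart with i and j exchanged, while the
    product of the two is zero; so it is self-adjoint with square 0. *)
Lemma oz_back i j : ozE i j * ozE j i = ozE i i * ozE i i.
Proof.
have [->//|ij] := eqVneq i j.
have ji : j != i by rewrite eq_sym.
have [sq _] := oz_pair ij; move: sq; rewrite !mulrDl !mulrDr.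
rewrite (oz_ort i j ij) (oz_ort j i ji) (oz_ort i j ji) (oz_ort j i ij) !addr0 !add0r.
set D := ozE i i * _; set D' := ozE j j * _; set F := ozE i j * _; set F' := ozE j i * _ => E.
have DF : D - F = F' - D' by apply/eqP; rewrite subr_eq addrAC eq_sym subr_eq E addrC.
have sD : sa (D - F).
  by apply: saB; rewrite /sa /D /F starM !ozE_star.
apply/esym/eqP; rewrite -subr_eq0; apply/eqP; apply: sa_sqr_eq0 => //.
rewrite {2}DF /D /F /F' /D' mulrBr !mulrBl !mulrA.
have z1 x y z : x * ozE i i * ozE j j * y = 0 :> A by rewrite -(mulrA x) (oz_ort i j ij) mulr0 mul0r.
rewrite -!(mulrA _ (ozE _ i) (ozE j _)).
rewrite (oz_ort i i ij) (oz_ort j i ij) (oz_ort i j ij) (oz_ort j j ij) !mulr0 !mul0r !subrr //.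
Qed.

(** For distinct i, j, l the vector [e_i + e_j] is orthogonal to [e_i - e_j + e_l] and to
    [e_i - e_j - e_l]; the difference of the two relations isolates the terms linear in [e_l]. With
    [oz_ort] these are the multiplication rules of [h e_ij] for an h commuting with matrix units. *)
Lemma oz_mul i j l : ozE i j * ozE j l = ozE i i * ozE i l.
Proof.
have [->|ij] := eqVneq i j; first by [].
have ji : j != i by rewrite eq_sym.
have [->|lj] := eqVneq l j; first exact: oz_move.
have [->|li] := eqVneq l i; first exact: oz_back.
have il : i != l by rewrite eq_sym.
have jl : j != l by rewrite eq_sym.
have := oz_rank1_sum 1 ij li lj; have := oz_rank1_sum (-1) ij li lj.
rewrite scale1r scaleN1r; set P := ozE i i + ozE i j + ozE j i + ozE j j.
pose u := e i - e j.
pose a := phi (u *m adjmx u) + phi (e l *m adjmx (e l)).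
pose b := ozE i l - ozE j l + (ozE l i - ozE l j).
have bE : phi (u *m adjmx (e l)) + phi (e l *m adjmx u) = b.
  rewrite /u adjmxB !adjmx_delta mulmxBl mulmxBr !mul_delta_mx.
  by rewrite !(ozD, ozN).
have h1 : phi ((u + e l) *m adjmx (u + e l)) = a + b.
  rewrite adjmxD mulmxDl !mulmxDr !ozD -bE /a.
  by rewrite !addrA [LHS](ACl (1*4*2*3)).
have h2 : phi ((u - e l) *m adjmx (u - e l)) = a - b.
  rewrite adjmxB mulmxBl !mulmxBr !(ozD, ozN) -bE /a.
  by rewrite !opprD opprK !addrA [LHS](ACl (1*4*2*3)).
rewrite -/u h1 h2 => k2 k1.
have Pb : P * b = 0.
  rewrite -(rs_half (P * b)) (_ : P * b + P * b = P * (a + b) - P * (a - b)); last by ncring.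
  by rewrite k1 k2 subr0 scaler0.
have key : (ozE i i * ozE i l - ozE i j * ozE j l) + (ozE j i * ozE i l - ozE j j * ozE j l) = 0.
  move: Pb; rewrite /P /b !mulrDl !mulrDr !mulrN.
  rewrite (oz_ort i i il) (oz_ort i j il) (oz_ort i i jl) (oz_ort i j jl).
  rewrite (oz_ort j i il) (oz_ort j j il) (oz_ort j i jl) (oz_ort j j jl).
  rewrite (oz_ort i l ij) (oz_ort i l ji) (oz_ort j l ij) (oz_ort j l ji).
  rewrite !oppr0 !addr0 !add0r => <-.
  by rewrite !addrA.
have [x xE] := ozE_gram.
apply/eqP; rewrite -subr_eq0; apply/eqP; apply: (@ozE_cancel i).
  exists (fun k => x k j * ozE j l - x k i * ozE i l), x => //.
  rewrite {1}(xE i j) {1}(xE i i) !mulr_suml -sumrB; apply: eq_bigr => p _.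
  by rewrite mulrBr !mulrA.
have := congr1 (fun z => ozE i i * z) key.
rewrite mulr0 mulrDr !mulrBr ![ozE i i * (ozE j _ * _)]mulrA (oz_ort i i ij) (oz_ort i j ij).
by rewrite !mul0r subrr addr0 => E; apply/eqP; rewrite -oppr_eq0 opprB E.
Qed.

Lemma oz1 : phi 1 = \sum_i ozE i i.
Proof.
have phi_sum (s : seq 'I_n.+1) (F : 'I_n.+1 -> 'M[C]_n.+1) :
    phi (\sum_(i <- s) F i) = \sum_(i <- s) phi (F i).
  by apply: (big_morph phi) => [x y|]; [exact: ozD|exact: oz0].
rewrite -phi_sum; congr phi; apply/matrixP => i j; rewrite summxE (bigD1 i)//= big1 => [|k ki].
  by rewrite !mxE !eqxx addr0 eq_sym.
by rewrite !mxE eq_sym (negPf ki).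
Qed.

Lemma oz1_psd : psd (phi 1).
Proof. by rewrite oz1; apply: psd_sum => i _; exact: ozE_psd. Qed.

Lemma opnorm_delta i j : opnorm (delta_mx i j : 'M[C]_n.+1) = 1.
Proof.
apply/le_anti/andP; split.
  apply: opnorm_le => v v1; rewrite (le_trans _ (le_trans (coord_le v j) v1))//.
  apply: le_trans (vnorm_le_sum _) _; rewrite (bigD1 i)//= big1 ?addr0 => [|k ki].
    rewrite mxE (bigD1 j)//= big1 ?addr0 => [|k kj]; first by rewrite mxE !eqxx mul1r.
    by rewrite mxE (negPf kj) andbF mul0r.
  rewrite mxE big1 ?cnorm0// => l _.
  by rewrite mxE (negPf ki) mul0r.
by have := entry_le_opnorm (delta_mx i j : 'M[C]_n.+1) i j; rewrite mxE !eqxx cnorm1.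
Qed.

Lemma ozE_norm i j : cnorm (ozE i j) <= 1.
Proof. by have [_ _ ct _] := oz; rewrite -(opnorm_delta i j); exact: ct. Qed.

Lemma oz1_norm : cnorm (phi 1) <= 1.
Proof.
have [_ _ ct _] := oz; apply: le_trans (ct 1) _.
exact: (@opnorm1_le R C n.+1).
Qed.

End OrderZero.

(** * Comparison through order zero maps *)

Section AsymptoticEquality.
Variables (R : realType) (A : cstarAlgType R).

Definition anear m n (u v : nat -> 'M[A]_(m, n)) :=
  (fun s => opnorm (u s - v s)) @ \oo --> (0 : R).

Definition bounded_seq m n (u : nat -> 'M[A]_(m, n)) := exists K : R, forall s, opnorm (u s) <= K.

Lemma squeeze0 (f g : nat -> R) :
  (forall s, 0 <= f s <= g s) -> g @ \oo --> (0 : R) -> f @ \oo --> (0 : R).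
Proof.
move=> fg g0; apply: (@squeeze_cvgr _ _ _ _ (fun=> 0) g) => //; last exact: cvg_cst.
by apply: nearW => s; exact: fg.
Qed.

Lemma cvgD0 (f g : nat -> R) : f @ \oo --> (0 : R) -> g @ \oo --> (0 : R) ->
  (fun s => f s + g s) @ \oo --> (0 : R).
Proof. by move=> f0 g0; rewrite -[0](addr0 0); exact: cvgD. Qed.

Lemma opnormM3 m n p q (x : 'M[A]_(m, n)) (y : 'M[A]_(n, p)) (z : 'M[A]_(p, q)) K L :
  opnorm x <= K -> opnorm z <= L -> opnorm (x *m y *m z) <= K * opnorm y * L.
Proof.
move=> xK zL; apply: le_trans (opnormM _ _) _; apply: ler_pM => //; try exact: opnorm_ge0.
by apply: le_trans (opnormM _ _) _; apply: ler_pM => //; exact: opnorm_ge0.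
Qed.

Lemma opnorm_near m n (a u v : 'M[A]_(m, n)) e :
  opnorm (a - v) <= e / 2 -> opnorm (u - v) < e / 2 -> opnorm (a - u) < e.
Proof.
move=> av; rewrite -opprB opnormN => vu; have := opnormD (a - v) (v - u).
by rewrite addrA subrK => /le_lt_trans; apply; rewrite (splitr e) ler_ltD.
Qed.

Lemma anear_eq m n (u v : nat -> 'M[A]_(m, n)) : (forall s, u s = v s) -> anear u v.
Proof.
move=> uv; rewrite /anear (_ : (fun s => _) = fun=> 0); first exact: cvg_cst.
by apply: funext => s; rewrite uv subrr opnorm0.
Qed.

Lemma anear_trans m n (v u w : nat -> 'M[A]_(m, n)) : anear u v -> anear v w -> anear u w.
Proof.
move=> uv vw; apply: (@squeeze0 _ (fun s => opnorm (u s - v s) + opnorm (v s - w s))).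
  move=> s; rewrite opnorm_ge0 /=; have -> : u s - w s = (u s - v s) + (v s - w s).
    by rewrite addrA subrK.
  exact: opnormD.
exact: (cvgD0 uv vw).
Qed.

Lemma anear_sym m n (u v : nat -> 'M[A]_(m, n)) : anear u v -> anear v u.
Proof.
move=> uv; apply: (@squeeze0 _ (fun s => opnorm (u s - v s))) => // s.
by rewrite opnorm_ge0 /= -opprB opnormN.
Qed.

Lemma anearD m n (u v u' v' : nat -> 'M[A]_(m, n)) : anear u v -> anear u' v' ->
  anear (fun s => u s + u' s) (fun s => v s + v' s).
Proof.
move=> uv uv'; apply: (@squeeze0 _ (fun s => opnorm (u s - v s) + opnorm (u' s - v' s))).
  move=> s; rewrite opnorm_ge0 /= opprD addrACA; exact: opnormD.
exact: (cvgD0 uv uv').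
Qed.

Lemma anearN m n (u v : nat -> 'M[A]_(m, n)) : anear u v ->
  anear (fun s => - u s) (fun s => - v s).
Proof.
move=> uv; apply: (@squeeze0 _ (fun s => opnorm (u s - v s))) => // s.
by rewrite opnorm_ge0 /= -opprD opnormN.
Qed.

Lemma anear_sum m n (I : finType) (u v : I -> nat -> 'M[A]_(m, n)) :
  (forall i, anear (u i) (v i)) -> anear (fun s => \sum_i u i s) (fun s => \sum_i v i s).
Proof.
move=> uv; apply: (@squeeze0 _ (fun s => \sum_i opnorm (u i s - v i s))).
  move=> s; rewrite opnorm_ge0 /= -sumrB.
  elim/big_ind2: _ => [|x r y t xr yt|//]; first by rewrite opnorm0.
  by rewrite (le_trans (opnormD _ _)) ?lerD.
exact: cvg_sum0.
Qed.

Lemma anear_mull m n p (z : nat -> 'M[A]_(m, n)) (u v : nat -> 'M[A]_(n, p)) :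
  bounded_seq z -> anear u v -> anear (fun s => z s *m u s) (fun s => z s *m v s).
Proof.
move=> [K zK] uv; apply: (@squeeze0 _ (fun s => K * opnorm (u s - v s))).
  move=> s; rewrite opnorm_ge0 /= -mulmxBr (le_trans (opnormM _ _)) //.
  by rewrite ler_wpM2r ?opnorm_ge0.
by rewrite -[0](mulr0 K); apply: cvgM => //; exact: cvg_cst.
Qed.

Lemma anear_mulr m n p (z : nat -> 'M[A]_(n, p)) (u v : nat -> 'M[A]_(m, n)) :
  bounded_seq z -> anear u v -> anear (fun s => u s *m z s) (fun s => v s *m z s).
Proof.
move=> [K zK] uv; apply: (@squeeze0 _ (fun s => opnorm (u s - v s) * K)).
  move=> s; rewrite opnorm_ge0 /= -mulmxBl (le_trans (opnormM _ _)) //.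
  by rewrite ler_wpM2l ?opnorm_ge0.
by rewrite -[0](mul0r K); apply: cvgM => //; exact: cvg_cst.
Qed.

Lemma anear_small m n (u v : nat -> 'M[A]_(m, n)) e : anear u v -> 0 < e ->
  exists s, opnorm (u s - v s) < e.
Proof.
move=> uv e0; have [N _ /(_ N (leqnn _))] := (cvgr_lt 0 uv) e e0.
by exists N.
Qed.

Lemma bounded_cst m n (a : 'M[A]_(m, n)) : bounded_seq (fun=> a).
Proof. by exists (opnorm a). Qed.

Lemma boundedM m n p (u : nat -> 'M[A]_(m, n)) (v : nat -> 'M[A]_(n, p)) :
  bounded_seq u -> bounded_seq v -> bounded_seq (fun s => u s *m v s).
Proof.
move=> [K uK] [L vL]; exists (K * L) => s; rewrite (le_trans (opnormM _ _)) //.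
by rewrite ler_pM ?opnorm_ge0.
Qed.

Lemma opnorm_scalar_le n (x : A) : opnorm (x%:M : 'M[A]_n.+1) <= n.+1%:R * cnorm x.
Proof.
apply: le_trans (opnorm_le_nrm1 _) _; rewrite /nrm1.
rewrite (eq_bigr (fun=> cnorm x)); first by rewrite sumr_const card_ord mulr_natl.
move=> i _; rewrite (bigD1 i) //= big1 ?addr0 ?mxE ?eqxx // => j ji.
by rewrite mxE eq_sym (negPf ji) cnorm0.
Qed.

Lemma bounded_scalar n (x : nat -> A) (K : R) : (forall s, cnorm (x s) <= K) ->
  bounded_seq (fun s => (x s)%:M : 'M[A]_n.+1).
Proof.
move=> xK; exists (n.+1%:R * K) => s; apply: le_trans (opnorm_scalar_le _ _) _.
by rewrite ler_wpM2l.
Qed.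

Lemma anear_comm m n (x : nat -> A) (a : 'M[A]_(m.+1, n.+1)) :
  (forall i j, (fun s => cnorm (x s * a i j - a i j * x s)) @ \oo --> (0 : R)) ->
  anear (fun s => (x s)%:M *m a) (fun s => a *m (x s)%:M).
Proof.
move=> xa; apply: (@squeeze0 _ (fun s => \sum_i \sum_j cnorm (x s * a i j - a i j * x s))).
  move=> s; rewrite opnorm_ge0 /=; apply: le_trans (opnorm_le_nrm1 _) _.
  rewrite /nrm1 le_eqVlt; apply/orP; left; apply/eqP.
  apply: eq_bigr => i _; apply: eq_bigr => j _; congr cnorm.
  rewrite !mxE (bigD1 i) //= [X in _ - X](bigD1 j) //= !mxE !eqxx !mulr1n.
  rewrite !big1 ?addr0 // => k ki; rewrite mxE.
    by rewrite (negPf ki) mulr0.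
  by rewrite eq_sym (negPf ki) mul0r.
by apply: cvg_sum0 => i; exact: cvg_sum0.
Qed.

Lemma csub_scalar n (x y : A) : cle x y -> csub (x%:M : 'M[A]_n.+1) (y%:M : 'M[A]_n.+1).
Proof.
move=> xy e e0; have e1 : 0 < e / n.+1%:R by rewrite divr_gt0.
have [z zP] := xy _ e1; exists z%:M.
rewrite adjmx_scalar -!scalar_mxM -raddfB (le_lt_trans (opnorm_scalar_le _ _)) //.
by rewrite mulrC -ltr_pdivlMr.
Qed.

Lemma sub_sqr_cle (h : A) : psd h -> cnorm h <= 1 -> psd (1 - h * h) /\ cle (1 - h * h) (1 - h).
Proof.
move=> ph h1; have sh := psd_sa ph.
have p1 : psd (1 - h * h).
  rewrite -[1 in X in psd X]rs1; apply: psd_of_norm; first exact: saM.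
  by rewrite (le_trans (ler_cnormM _ _)) // mulr_ile1 ?cnorm_ge0.
split=> // e e0.
have [|x xP] := @cle_of_le _ _ (1 - h * h) ((2 : R) *` (1 - h)) p1 _ e e0.
  rewrite rs2 (_ : _ - _ = (1 - h) * (1 - h)); last by ncring.
  by apply: psd_sqr; apply: saB => //; exact: sa1.
exists (Num.sqrt 2 *` x); rewrite starR !(rsMl, rsMr) -rsM.
rewrite -[Num.sqrt 2 * _]expr2 sqr_sqrtr //.
by move: xP; rewrite !(rsMl, rsMr).
Qed.

Lemma cle_cuntz (x y : A) : cuntz_sub x y -> cle x y.
Proof.
by move=> [z zP] e e0; have [N _ /(_ N (leqnn _))] := (cvgr_lt 0 zP) e e0; exists (z N).
Qed.

End AsymptoticEquality.

Section Multiples.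
Variables (R : realType) (A : cstarAlgType R).

(** c is the k-fold direct sum of b, with coordinate projections v and inclusions w; through them a
    comparison of multiples is read entrywise. *)
Lemma cz_muln (b : minf A) k : mpos b -> exists c : minf A, [/\ mpos c, cz b *+ k = cz c,
  exists v : nat -> 'M[A]_((mdim b).+1, (mdim c).+1), forall i j, (i < k)%N -> (j < k)%N ->
    v i *m mval c *m adjmx (v j) = if i == j then mval b else 0
  & exists w : nat -> 'M[A]_((mdim c).+1, (mdim b).+1),
    mval c = \sum_(l < k) w l *m mval b *m adjmx (w l)].
Proof.
move=> pb; elim: k => [|k [c [pc bc [v vP] [w wP]]]].
  exists (minf0 A); split; [exact: mpos0 | by rewrite mulr0n |..].
    by exists (fun=> 0).
  by exists (fun=> 0); rewrite big_ord0.
exists (minf_oplus b c); split; first exact: mpos_oplus.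
- by rewrite mulrS bc cz_oplus.
- exists (fun i => if i is i'.+1 then row_mx 0 (v i') else row_mx 1%:M 0).
  move=> [|i] [|j]; rewrite ?ltnS => ik jk; rewrite (row_dsum _ _ _ _ (mval b) (mval c));
    rewrite ?adjmx0 ?adjmx_scalar ?star1 ?mulmx1 ?mul1mx ?mul0mx ?mulmx0 ?add0r ?addr0 //.
  by rewrite vP.
exists (fun i => if i is i'.+1 then col_mx 0 (w i') else col_mx 1%:M 0).
pose F (i : nat) : 'M[A]_((mdim b).+1 + (mdim c).+1, (mdim b).+1) :=
  if i is i'.+1 then col_mx 0 (w i') else col_mx 1%:M 0.
suff : dsum (mval b) (mval c) = \sum_(l < k.+1) F l *m mval b *m adjmx (F l) by [].
rewrite big_ord_recl /F /= conj_col !(mul0mx, mulmx0, adjmx0) mul1mx adjmx_scalar star1 mulmx1.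
under eq_bigr => l _ do rewrite add0n conj_col !(mul0mx, mulmx0, adjmx0).
rewrite (_ : \sum_(i < k) _ = block_mx 0 0 0 (\sum_(l < k) w l *m mval b *m adjmx (w l))).
  by rewrite add_block_mx !addr0 !add0r -wP.
elim/big_rec2: _ => [|i x y _ ->]; first by rewrite block_mx0.
by rewrite add_block_mx !addr0.
Qed.

(** With x a witness between the direct sums, [c i l = v_i x w_l]. The tolerance is divided by
    [K ^ 2] because the error is multiplied by [v_i] on the left and [adjmx v_j] on the right. *)
Lemma muln_csub_data (a b : minf A) p k : mpos a -> mpos b -> cule (cz a *+ p) (cz b *+ k) ->
  forall e, 0 < e -> exists c : nat -> nat -> 'M[A]_((mdim a).+1, (mdim b).+1),
    forall i j, (i < p)%N -> (j < p)%N ->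
    opnorm ((if i == j then mval a else 0) - \sum_(l < k) c i l *m mval b *m adjmx (c j l)) < e.
Proof.
move=> pa pb + e e0.
have [c [pc -> [v vP] _]] := cz_muln p pa; have [d [pd -> _ [w wP]]] := cz_muln k pb.
move/(cule_cz pc pd) => cd.
pose K : R := 1 + \sum_(i < p) opnorm (v i).
have vK i : (i < p)%N -> opnorm (v i) <= K.
  move=> ip; rewrite /K (bigD1 (Ordinal ip)) //= addrCA lerDl addr_ge0 //.
  by apply: sumr_ge0 => j _; exact: opnorm_ge0.
have K0 : 0 < K by rewrite ltr_pwDl // sumr_ge0 // => j _; exact: opnorm_ge0.
have eK : 0 < e / K ^+ 2 by rewrite divr_gt0 ?exprn_gt0.
have [x xP] := cd _ eK; exists (fun i l => v i *m x *m w l) => i j ip jp.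
have -> : \sum_(l < k) v i *m x *m w l *m mval b *m adjmx (v j *m x *m w l) =
    v i *m (x *m mval d *m adjmx x) *m adjmx (v j).
  rewrite wP mulmx_sumr mulmx_suml mulmx_sumr mulmx_suml.
  by apply: eq_bigr => l _; rewrite !adjmxM !mulmxA.
rewrite -(vP _ _ ip jp) -mulmxBl -mulmxBr.
have vj : opnorm (adjmx (v j)) <= K by rewrite opnorm_adj; exact: vK.
apply: le_lt_trans (opnormM3 _ (vK _ ip) vj) _.
by rewrite mulrC mulrA -expr2 mulrC -ltr_pdivlMr ?exprn_gt0.
Qed.

End Multiples.

Section Core.
Variables (R : realType) (A : cstarAlgType R).
Hypothesis tz : tracially_Z_absorbing A.

Lemma approx_oz n (F : set A) (d : A) : finite_set F -> psd d -> d != 0 ->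
  exists phi : nat -> 'M[R[i]]_n.+1 -> A, [/\ forall s, cpc_order_zero (phi s),
    forall s, cle (1 - phi s 1) d
  & forall i j y, F y ->
    (fun s => cnorm (ozE (phi s) i j * y - y * ozE (phi s) i j)) @ \oo --> (0 : R)].
Proof.
move=> fF pd d0.
have /choice[phi phiP] (s : nat) := tz.2 F s.+1%:R^-1 d n.+1 fF ltac:(by rewrite invr_gt0)
  ((positiveP d).2 pd) d0 (ltn0Sn n).
exists phi; split=> [s|s|i j y Fy]; first by case: (phiP s).
  by apply: cle_cuntz; case: (phiP s).
apply: (@squeeze0 _ _ (fun s => s.+1%:R^-1)); last exact: cvg_harmonic.
move=> s; rewrite cnorm_ge0 /=; apply: ltW.
by have [_ _] := phiP s; apply => //; exact: opnorm_delta.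
Qed.

Lemma anear_congr m n (u v u' v' : nat -> 'M[A]_(m, n)) : (forall s, u s = u' s) ->
  (forall s, v s = v' s) -> anear u v -> anear u' v'.
Proof. by move=> /funext <- /funext <-. Qed.

Lemma muln_csub_small m n k (a : 'M[A]_m.+1) (b : 'M[A]_n.+1) (d : A) e : mpsd a -> mpsd b -> psd d ->
  d != 0 -> 0 < e ->
  (forall r, 0 < r -> exists c : nat -> nat -> 'M[A]_(m.+1, n.+1),
    forall i j, (i < k.+1)%N -> (j < k.+1)%N ->
    opnorm ((if i == j then a else 0) - \sum_(l < k) c i l *m b *m adjmx (c j l)) < r) ->
  csub (mcut e a) (dsum b (d%:M : 'M[A]_m.+1)).
Proof.
move=> pa pb pd d0 e0 dat.
(* There are [(k + 1) ^ 2] error terms, and a scalar matrix of size m + 1 has norm at most m + 1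
   times that of its entry. *)
pose N : R := k.+1%:R * k.+1%:R * m.+1%:R.
have N0 : 0 < N by rewrite !mulr_gt0.
have [|c cP] := dat (e / 2 / N); first by rewrite !divr_gt0.
pose g (t : 'I_k.+1 * 'I_k * 'I_m.+1 * 'I_n.+1) : A := c t.1.1.1 t.1.1.2 t.1.2 t.2.
(* Commutation with [a^(1/2)] lets the remainder [a - a h^2], where [h = phi(1)], be replaced by the
   positive element [a^(1/2) (1 - h^2) a^(1/2)]. *)
pose F : set A := range g `|` range (star \o g) `|` range (fun t : 'I_n.+1 * 'I_n.+1 => b t.1 t.2)
  `|` range (fun t : 'I_m.+1 * 'I_m.+1 => msqrt a t.1 t.2).
have fF : finite_set F by rewrite /F !finite_setU; split; [split; [split|]|]; exact: finite_image.
have [phi [oz cl com]] := approx_oz k fF pd d0.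
pose E s i j := ozE (phi s) i j.
pose S p (x : A) : 'M[A]_p.+1 := x%:M.
have bE p i j : bounded_seq (fun s => S p (E s i j)).
  by apply: (@bounded_scalar _ _ _ _ 1) => s; exact: (ozE_norm (oz s)).
have cC (i : 'I_k.+1) (l : 'I_k) j j' : anear (fun s => S n (E s j j') *m adjmx (c i l)) (fun s => adjmx (c i l) *m S m (E s j j')).
  by apply: anear_comm => p q; apply: com; do 2 left; right; exists (i, l, q, p) => //=; rewrite mxE.
have cB j j' : anear (fun s => S n (E s j j') *m b) (fun s => b *m S n (E s j j')).
  by apply: anear_comm => p q; apply: com; left; right; exists (p, q).
have cR j j' : anear (fun s => S m (E s j j') *m msqrt a) (fun s => msqrt a *m S m (E s j j')).
  by apply: anear_comm => p q; apply: com; right; exists (p, q).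
(* The column indices l < k are read among the k + 1 indices of the matrix units, of which the rows
   use all. *)
pose w (l : 'I_k) : 'I_k.+1 := widen_ord (leqnSn k) l.
have ES p i l l' i' s : S p (E s i (w l)) *m S p (E s (w l') i') = if l == l' then S p (E s i i) *m S p (E s i i') else 0.
  rewrite -!scalar_mxM; case: eqVneq => [->|ll'].
    by rewrite [E s i (w l') * _](oz_mul (oz s)).
  have wl : w l != w l' by apply: contra ll' => /eqP[/val_inj->].
  by rewrite [E s i (w l) * _](oz_ort (oz s)) // /S raddf0.
(* Once the left factor is moved past b, the two matrix units meet and collapse to [E_ii E_ii'] or
   to 0; what remains is moved past [adjmx (c i' l')] to the right end. *)
have term (i : 'I_k.+1) (l : 'I_k) (i' : 'I_k.+1) (l' : 'I_k) : anear (fun s => c i l *m S n (E s i (w l)) *m b *m (S n (E s (w l') i') *m adjmx (c i' l')))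
    (fun s => if l == l' then c i l *m b *m adjmx (c i' l') *m (S m (E s i i) *m S m (E s i i')) else 0).
  apply: (anear_trans (v := fun s => c i l *m b *m S n (E s i (w l)) *m (S n (E s (w l') i') *m adjmx (c i' l')))).
    apply: anear_mulr; first by apply: boundedM => //; exact: bounded_cst.
    apply: (anear_congr _ _ (anear_mull (bounded_cst (c i l)) (cB i (w l)))) => s;
      by rewrite mulmxA.
  case: (eqVneq l l') => [<-|ll']; last first.
    by apply: anear_eq => s; rewrite -mulmxA (mulmxA (S _ _)) ES (negPf ll') mul0mx mulmx0.
  apply: (anear_trans (v := fun s => c i l *m b *m (S n (E s i i) *m adjmx (c i' l) *m S m (E s i i')))).
    apply: (anear_congr (u := fun s => c i l *m b *m (S n (E s i i) *m (S n (E s i i') *m adjmx (c i' l))))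
      (v := fun s => c i l *m b *m (S n (E s i i) *m (adjmx (c i' l) *m S m (E s i i'))))) => [s|s|].
    - by rewrite -[RHS]mulmxA (mulmxA (S _ (E s i (w l)))) ES eqxx -(mulmxA (S _ (E s i i))).
    - by rewrite !mulmxA.
    by apply: anear_mull; [exact: bounded_cst|apply: anear_mull].
  apply: (anear_congr (u := fun s => c i l *m b *m (S n (E s i i) *m adjmx (c i' l) *m S m (E s i i')))
      (v := fun s => c i l *m b *m (adjmx (c i' l) *m S m (E s i i) *m S m (E s i i')))) => [//|s|].
    by rewrite !mulmxA.
  by apply: anear_mull; [exact: bounded_cst|apply: anear_mulr].
pose Y s := \sum_(i < k.+1) \sum_(l < k) c i l *m S n (E s i (w l)).
pose P s (i i' : 'I_k.+1) := S m (E s i i) *m S m (E s i i').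
have YY : anear (fun s => Y s *m b *m adjmx (Y s))
    (fun s => \sum_(i < k.+1) \sum_(i' < k.+1) (\sum_(l < k) c i l *m b *m adjmx (c i' l)) *m P s i i').
  apply: (anear_congr (u := fun s => \sum_(i < k.+1) \sum_(l < k) \sum_(i' < k.+1) \sum_(l' < k)
      c i l *m S n (E s i (w l)) *m b *m (S n (E s (w l') i') *m adjmx (c i' l')))
    (v := fun s => \sum_(i < k.+1) \sum_(l < k) \sum_(i' < k.+1) \sum_(l' < k)
      (if l == l' then c i l *m b *m adjmx (c i' l') *m P s i i' else 0))) => [s|s|].
  - rewrite /Y !mulmx_suml; apply: eq_bigr => i _; rewrite !mulmx_suml; apply: eq_bigr => l _.
    rewrite adjmx_sum mulmx_sumr; apply: eq_bigr => i' _.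
    rewrite adjmx_sum mulmx_sumr; apply: eq_bigr => l' _; congr (_ *m _).
    by rewrite adjmxM adjmx_scalar [star _](ozE_star (oz s)).
  - apply: eq_bigr => i _; rewrite exchange_big /=; apply: eq_bigr => i' _.
    rewrite mulmx_suml; apply: eq_bigr => l _.
    rewrite (bigD1 l) //= eqxx big1 ?addr0 // => l' ll'; by rewrite eq_sym (negPf ll').
  by do 4! [apply: anear_sum => ?]; exact: term.
pose h s := phi s 1.
have hE s : S m (h s * h s) = \sum_i S m (E s i i) *m S m (E s i i).
  rewrite /S; under eq_bigr => i _ do rewrite -scalar_mxM.
  rewrite -raddf_sum; congr _%:M.
  rewrite /h (oz1 (oz s)) mulr_suml; apply: eq_bigr => i _; rewrite mulr_sumr (bigD1 i) //=.
  by rewrite big1 ?addr0 // => j ji; rewrite (oz_ort (oz s)) // eq_sym.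
have hP s : a *m S m (h s * h s) = \sum_(i < k.+1) \sum_(i' < k.+1) (if (i : nat) == i' then a else 0) *m P s i i'.
  rewrite hE mulmx_sumr; apply: eq_bigr => i _; rewrite (bigD1 i) //= eqxx big1 ?addr0 //.
  by move=> j ji; rewrite ifN ?mul0mx // eq_sym.
have hR : anear (fun s => msqrt a *m S m (1 - h s * h s) *m adjmx (msqrt a))
    (fun s => a - a *m S m (h s * h s)).
  have hS : anear (fun s => S m (h s * h s) *m msqrt a) (fun s => msqrt a *m S m (h s * h s)).
    apply: (anear_congr (u := fun s => \sum_i S m (E s i i) *m (S m (E s i i) *m msqrt a))
        (v := fun s => \sum_i msqrt a *m S m (E s i i) *m S m (E s i i))) => [s|s|].
    - by rewrite hE mulmx_suml; apply: eq_bigr => i _; rewrite mulmxA.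
    - by rewrite hE mulmx_sumr; apply: eq_bigr => i _; rewrite mulmxA.
    apply: anear_sum => i.
    apply: (anear_trans (v := fun s => S m (E s i i) *m (msqrt a *m S m (E s i i)))).
      exact: (anear_mull (bE m i i) (cR i i)).
    apply: (anear_congr (u := fun s => S m (E s i i) *m msqrt a *m S m (E s i i))
      (v := fun s => msqrt a *m S m (E s i i) *m S m (E s i i))) => [s|//|].
      by rewrite mulmxA.
    exact: (anear_mulr (bE m i i) (cR i i)).
  apply: (anear_congr (u := fun s => a - msqrt a *m (S m (h s * h s) *m msqrt a))
    (v := fun s => a - msqrt a *m (msqrt a *m S m (h s * h s)))) => [s|s|].
  - rewrite (msqrt_adj pa) /S raddfB /= mulmxBr mulmx1 mulmxBl msqrtK //.
    by rewrite mulmxA.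
  - by rewrite mulmxA msqrtK.
  apply: anearD; first exact: anear_eq.
  by apply: anearN; apply: anear_mull => //; exact: bounded_cst.
have e2 : 0 < e / 2 by rewrite divr_gt0.
have [s sP] := anear_small (anearD YY hR) e2.
set V := (X in opnorm (_ - X)) in sP; set U := (X in opnorm (X - _)) in sP.
have aV : opnorm (a - V) <= e / 2.
  have -> : a - V = \sum_(i < k.+1) \sum_(i' < k.+1)
      ((if (i : nat) == i' then a else 0) - \sum_(l < k) c i l *m b *m adjmx (c i' l)) *m P s i i'.
    rewrite /V hP opprD opprB addrCA [a + _]addrCA subrr addr0 addrC -sumrB.
    apply: eq_bigr => i _; rewrite -sumrB; apply: eq_bigr => i' _.
    by rewrite mulmxBl.
  have onb p (G : 'I_p -> 'M[A]_m.+1) (r : R) : (forall i, opnorm (G i) <= r) ->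
      opnorm (\sum_i G i) <= p%:R * r.
    move=> Gr; rewrite mulr_natl -[X in _ <= _ *+ X](card_ord p) -sumr_const; elim/big_ind2: _ => [|x u y v xu yv|//].
      by rewrite opnorm0.
    by rewrite (le_trans (opnormD _ _)) ?lerD.
  have -> : e / 2 = k.+1%:R * (k.+1%:R * (e / 2 / N * m.+1%:R)).
    have aux (x y : R) : x != 0 -> y != 0 -> e / 2 = x * (x * (e / 2 / (x * x * y) * y)).
      by move=> x0 y0; field; rewrite x0 y0.
    by apply: aux; rewrite pnatr_eq0.
  apply: (onb _ _ _ _) => i; apply: (onb _ _ _ _) => i'.
  apply: le_trans (opnormM _ _) _; apply: ler_pM; rewrite ?opnorm_ge0 //.
    by apply: ltW; exact: cP.
  rewrite /P -scalar_mxM; apply: le_trans (opnorm_scalar_le _ _) _.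
  rewrite ler_piMr // (le_trans (ler_cnormM _ _)) // mulr_ile1 ?cnorm_ge0 //; exact: (ozE_norm (oz s)).
have near : opnorm (a - U) < e := opnorm_near aV sP.
have hp := oz1_psd (oz s).
have [h1 h2] := sub_sqr_cle hp (oz1_norm (oz s)).
have pU1 : mpsd (Y s *m b *m adjmx (Y s)) by exact: mpsd_conj.
have pS : mpsd (S m (1 - h s * h s)).
  have -> : S m (1 - h s * h s) = S m (psqrt (1 - h s * h s)) *m adjmx (S m (psqrt (1 - h s * h s))).
    by rewrite /S adjmx_scalar psqrt_sa // -scalar_mxM psqrtK.
  exact: mpsd_mulmx_adj.
have pU : mpsd U := mpsdD pU1 (mpsd_conj (msqrt a) pS).
apply: csub_trans (csub_pcut_near pa pU near) _.
apply: csub_trans (csub_sum _ _) _; apply: csub_dsum; first exact: csub_conj.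
apply: csub_trans (csub_conj _ _) _.
by apply: csub_trans (csub_scalar m h2) _; exact: csub_scalar.
Qed.

End Core.

(** * Orthogonal elements in corners *)

Section Simplicity.
Variables (R : realType) (A : cstarAlgType R).

(** The elements approximable by such sums form the closed two-sided ideal generated by d. *)
Lemma simple_full (d : A) (e : R) : simple_cstar A -> d != 0 -> 0 < e ->
  exists s : seq (A * A), cnorm (1 - \sum_(p <- s) p.1 * d * p.2) < e.
Proof.
move=> sA d0; move: e; pose I : set A := [set x | forall e : R, 0 < e ->
  exists s : seq (A * A), cnorm (x - \sum_(p <- s) p.1 * d * p.2) < e].
suff: I = setT by move=> IT e e0; have I1 : I 1 by [rewrite IT]; exact: I1.
have Id : I d.
  move=> e e0; exists [:: (1, 1)].
  by rewrite big_cons big_nil addr0 mul1r mulr1 subrr cnorm0.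
have half (e : R) : 0 < e -> 0 < e / 2 by move=> e0; rewrite divr_gt0.
have mulI (F : A -> A) (K : R) x : 0 < K -> (forall y, cnorm (F y) <= K * cnorm y) ->
    (forall y z, F (y + z) = F y + F z) ->
    (forall u v, exists u' v', F (u * d * v) = u' * d * v') -> I x -> I (F x).
  move=> K0 FK FD Fd Ix e e0; have [s sP] := Ix (e / K) (divr_gt0 e0 K0).
  have F0 : F 0 = 0 by apply: (addrI (F 0)); rewrite -FD !addr0.
  have FN y : F (- y) = - F y by apply: (addrI (F y)); rewrite -FD !subrr F0.
  have [t tP] : exists t : seq (A * A), F (\sum_(p <- s) p.1 * d * p.2) = \sum_(p <- t) p.1 * d * p.2.
    elim: (s) => [|[u v] s' [t tP]]; first by exists [::]; rewrite !big_nil F0.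
    have [u' [v' E]] := Fd u v; exists ((u', v') :: t).
    by rewrite !big_cons FD tP E.
  exists t; rewrite -tP -FN -FD (le_lt_trans (FK _)) //.
  by rewrite mulrC -ltr_pdivlMr.
have KP (r : R) : 0 <= r -> 0 < r + 1 by move=> r0; rewrite ltr_wpDl.
case: (sA I) => //.
- by move=> e e0; exists [::]; rewrite big_nil subrr cnorm0.
- move=> x y Ix Iy e e0.
  have [s sP] := Ix _ (half _ e0); have [t tP] := Iy _ (half _ e0).
  exists (s ++ t); rewrite big_cat opprD addrACA (le_lt_trans (ler_cnormD _ _)) //.
  by rewrite (splitr e) ltrD.
- move=> c x; apply: (mulI (fun x => c *: x) (normc c + 1)) => [|y|y z|u v].
  + by apply: KP; case: (c) => ? ?; exact: sqrtr_ge0.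
  + by rewrite cnormZ ler_wpM2r ?cnorm_ge0 // lerDl.
  + exact: scalerDr.
  + by exists (c *: u), v; rewrite !scalerAl.
- move=> a x Ix; split.
    apply: (mulI (fun x => a * x) (cnorm a + 1)) => // [|y|y z|u v].
    + exact/KP/cnorm_ge0.
    + by rewrite (le_trans (ler_cnormM _ _)) // ler_wpM2r ?cnorm_ge0 // lerDl.
    + exact: mulrDr.
    + by exists (a * u), v; rewrite !mulrA.
  apply: (mulI (fun x => x * a) (cnorm a + 1)) => // [|y|y z|u v].
  + exact/KP/cnorm_ge0.
  + by rewrite mulrC (le_trans (ler_cnormM _ _)) // ler_wpM2l ?cnorm_ge0 // lerDl.
  + exact: mulrDl.
  + by exists u, (v * a); rewrite !mulrA.
- move=> u l Iu ul e e0.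
  have [N _ /(_ N (leqnn _))/= uN] := (cvgr_lt 0 ul) (e / 2) (half _ e0).
  have [s sP] := Iu N _ (half _ e0); exists s.
  rewrite (le_lt_trans (ler_cnorm_dist (u N) _ _)) // (splitr e) ltrD //.
  by rewrite cnorm_distC.
- by move=> I0; move: Id; rewrite I0 /= => /eqP; rewrite (negPf d0).
Qed.

Lemma psd_diag n (e : mxalg A n) i : psd e -> psd (e i i).
Proof.
move=> /positiveP[x ->]; rewrite mxE; apply: psd_sum => k _.
by rewrite [star x i k]mxE; exact: psd_starl.
Qed.

Lemma psd_diag_neq0 n (e : mxalg A n) : psd e -> e != 0 -> exists i, e i i != 0.
Proof.
move=> /positiveP[x ex] e0; apply: contrapT => H; move/eqP: e0; apply.
have H0 i : e i i = 0 by apply/eqP; apply: contrapT => /negP ei; apply: H; exists i.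
suff x0 : x = 0 by rewrite ex x0 mulr0.
apply/matrixP => k i; rewrite [RHS]mxE; apply: starl_eq0.
apply: (psd_sum_eq0 (F := fun k => star (x k i) * x k i)) => [j|]; first exact: psd_starl.
by rewrite -[RHS](H0 i) ex [RHS]mxE; apply: eq_bigr => j _; rewrite [star x i j]mxE.
Qed.

Lemma csub_diag n (e : 'M[A]_n.+1) i : csub ((e i i)%:M : 'M[A]_1) e.
Proof.
apply: (@csub_exact _ _ _ _ (delta_mx ord0 i)); rewrite adjmx_delta.
rewrite -rowE; apply/matrixP => j k; rewrite !ord1 [RHS]mxE eqxx mulr1n mxE (bigD1 i) //=.
rewrite big1 => [|l li]; last by rewrite !mxE (negPf li) mulr0.
by rewrite addr0 !mxE !eqxx mulr1.
Qed.

End Simplicity.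

(** * Elements without orthogonal pairs below them *)

Section NoSplitting.
Variables (R : realType) (A : cstarAlgType R).
Implicit Types (e x y p q : A) (C D : R).

(* Under this condition the corner of e turns out to consist of the multiples of e, which is
   then a multiple of a projection. *)
Definition nosplit e := forall x y C, 0 <= C -> psd x -> psd y -> x * y = 0 ->
  psd (C *` e - x) -> psd (C *` e - y) -> x = 0 \/ y = 0.

Lemma psd_leZ C D x y z : 0 <= D -> psd (C *` x - y) -> psd (D *` y - z) -> psd ((D * C) *` x - z).
Proof.
move=> D0 xy yz; rewrite (_ : _ - z = D *` (C *` x - y) + (D *` y - z)).
  by apply: psdD => //; exact: psdZ.
by rewrite scalerBr rsM addrA subrK.
Qed.

Lemma nosplit_le e y C : 0 <= C -> psd (C *` e - y) -> nosplit e -> nosplit y.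
Proof.
move=> C0 ey ne u v D D0 pu pv uv yu yv; apply: (ne u v (D * C)) => //.
- exact: mulr_ge0.
- exact: psd_leZ ey yu.
- exact: psd_leZ ey yv.
Qed.

(** For t < 1 the orthogonal elements [(e - t)_+] and [e (t - e)_+] are dominated by e, and the
    first is nonzero, so the second vanishes: e has no part strictly between 0 and t. Letting t tend
    to 1 leaves the values 0 and 1. *)
Lemma nosplit_proj e : psd e -> cnorm e = 1 -> nosplit e -> e * e = e.
Proof.
move=> pe e1 ne; have se := psd_sa pe.
have lg (t : R) : lucont (fun s : R => s * Num.max (t - s) 0).
  apply: lucontM; first exact: lucont_id.
  apply: (lucont_comp (g := fun s => t - s) (lucont_max 0)).
  by apply: lucontB; [exact: lucont_cst|exact: lucont_id].
have ge (t : R) : 0 <= t -> t < 1 -> fc (fun s => s * Num.max (t - s) 0) e = 0.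
  move=> t0 t1; have [] := ne (pcut t e) (fc (fun s => s * Num.max (t - s) 0) e) 1 => //.
  - exact: pcut_psd.
  - by apply: fc_psd_ge0 => // s s0; rewrite mulr_ge0 // le_max lexx orbT.
  - rewrite -fcM //; last exact: lucont_cut.
    rewrite (fc_eq _ (g := fun=> 0)) ?fc_cst ?rs0 // => s; rewrite /cut.
    have [st|st] := leP s t; first by rewrite max_r ?subr_le0 // mul0r.
    by rewrite (max_r (x := t - s)) ?mulr0 // subr_le0 ltW.
  - by rewrite rs1; apply: pcut_le.
  - rewrite rs1 -{1}(fc_id se); apply: fc_psd_le => //; first exact: lucont_id.
    move=> s s0; rewrite ler_piMr // ge_max ler01 andbT; lra.
  - move/eqP; by rewrite (negPf (pcut_neq0 pe t0 _)) // e1.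
apply/esym/eqP; rewrite -subr_eq0; apply/eqP/(@cnorm_eq0 _ A)/eqP.
rewrite eq_le cnorm_ge0 andbT; apply/ler_addgt0Pl => r r0; rewrite addr0.
wlog r1 : r r0 / r <= 1.
  by move=> H; have [/H->//|/ltW r1] := leP r 1; rewrite (le_trans (H 1 _ _)).
have lgs : lucont (fun s : R => s * Num.max (1 - r - s) 0) := lg (1 - r).
have -> : e - e * e = fc (fun s => s - s * s - s * Num.max (1 - r - s) 0) e.
  have lid := @lucont_id R; have lss := lucontM lid lid.
  have E1 : fc (fun s : R => s * s) e = e * e.
    by apply: etrans (fcM se lid lid) _; rewrite fc_id.
  have E2 : fc (fun s : R => s - s * s) e = e - e * e.
    by apply: etrans (fcB se lid lss) _; rewrite E1 fc_id.
  apply: esym; apply: etrans (fcB se (lucontB lid lss) lgs) _.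
  rewrite ge ?subr0 //; lra.
apply: fc_psd_norm_le => //; first by luc.
move=> s s0; rewrite e1 => s1; rewrite ler_norml.
have [h|h] := leP (1 - r - s) 0.
  rewrite mulr0; nra.
nra.
Qed.

(** The normalisation q of y is again a projection and lies under p. Then q and [p - q] are
    orthogonal, so [p - q] vanishes. *)
Lemma nosplit_scalar p y C : psd p -> cnorm p = 1 -> nosplit p -> psd y -> 0 <= C ->
  psd (C *` p - y) -> y = cnorm y *` p.
Proof.
move=> pp p1 np py C0 yp; have pE := nosplit_proj pp p1 np.
have [->|y0] := eqVneq y 0; first by rewrite cnorm0 rs0.
have ny0 : 0 < cnorm y.
  by rewrite lt0r cnorm_ge0 andbT; apply/eqP => /(@cnorm_eq0 _ A)/eqP; rewrite (negPf y0).
have ny1 : cnorm y != 0 by rewrite gt_eqF.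
pose q := (cnorm y)^-1 *` y.
have pq : psd q by apply: psdZ => //; rewrite invr_ge0 ltW.
have q1 : cnorm q = 1 by rewrite cnormR ger0_norm ?mulVf // invr_ge0 ltW.
have qp : psd (((cnorm y)^-1 * C) *` p - q).
  by rewrite rsM -scalerBr; apply: psdZ => //; rewrite invr_ge0 ltW.
have D0 : 0 <= (cnorm y)^-1 * C by rewrite mulr_ge0 // invr_ge0 ltW.
have qE := nosplit_proj pq q1 (nosplit_le D0 qp np).
have ort : (1 - p) * q = 0.
  have h : psd ((1 - p) * (((cnorm y)^-1 * C) *` p - q) * (1 - p)).
    rewrite -{1}[1 - p](_ : star (1 - p) = 1 - p); first exact: psd_conj.
    by rewrite starB star1 (psd_sa pp).
  have pc : (1 - p) * p = 0 by rewrite mulrBl mul1r pE subrr.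
  have h2 : psd (star (q * (1 - p)) * (q * (1 - p))) by exact: psd_starl.
  have sq : star (q * (1 - p)) = (1 - p) * q.
    by rewrite starM starB star1 (psd_sa pp) (psd_sa pq).
  have E : (1 - p) * q * (1 - p) = 0.
    apply: psd_antisym.
      by rewrite -[q]qE mulrA -mulrA -{1}sq.
    by move: h; rewrite (mulrBr (1 - p) (_ *` p) q) rsMr pc scaler0 sub0r mulNr.
  rewrite -sq; have /starl_eq0 -> : star (q * (1 - p)) * (q * (1 - p)) = 0.
    by rewrite sq mulrA -(mulrA _ q q) qE.
  exact: star0.
have pqq : p * q = q by apply/eqP; rewrite eq_sym -subr_eq0 -{1}[q]mul1r -mulrBl ort.
have qpq : q * p = q.
  by rewrite -{1}(psd_sa pq) -{1}(psd_sa pp) -starM pqq (psd_sa pq).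
have ppq : psd (p - q).
  have -> : p - q = (p - q) * (p - q) by rewrite mulrBr !mulrBl pE qE pqq qpq subrr subr0.
  by apply: psd_sqr; apply: saB; exact: psd_sa.
have [q0|/eqP] : q = 0 \/ p - q = 0.
  apply: (np q (p - q) 1) => //.
  - by rewrite mulrBr qpq qE subrr.
  - by rewrite rs1.
  - by rewrite rs1 opprB addrC subrK.
- by move: q1; rewrite q0 cnorm0 => /eqP; rewrite eq_sym oner_eq0.
by rewrite subr_eq0 => /eqP ->; rewrite -rsM divff ?rs1.
Qed.

Lemma corner_le p x : psd p -> p * p = p -> psd x -> psd (cnorm x *` p - star p * x * p).
Proof.
move=> pp pE px; rewrite -{1}pE -{1}(psd_sa pp); exact: psd_conj_le.
Qed.

Lemma nosplit_or_split e : nosplit e \/ exists x y C,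
  [/\ psd x /\ psd y, x != 0 /\ y != 0, x * y = 0 & 0 <= C /\ psd (C *` e - x) /\ psd (C *` e - y)].
Proof.
have [H|H] := pselect (exists x y C, [/\ psd x /\ psd y, x != 0 /\ y != 0, x * y = 0 &
  0 <= C /\ psd (C *` e - x) /\ psd (C *` e - y)]); [by right|left].
move=> x y C C0 px py xy ex ey; have [->|x0] := eqVneq x 0; first by left.
have [->|y0] := eqVneq y 0; first by right.
by case: H; exists x, y, C.
Qed.

Lemma nosplit_unit e : psd e -> e != 0 -> nosplit e ->
  exists p, [/\ psd p, cnorm p = 1, nosplit p & p != 0].
Proof.
move=> pe e0 ne; pose p := (cnorm e)^-1 *` e.
have en : 0 < cnorm e.
  by rewrite lt0r cnorm_ge0 andbT; apply/eqP => /(@cnorm_eq0 _ A)/eqP; rewrite (negPf e0).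
have ei : 0 <= (cnorm e)^-1 by rewrite invr_ge0 ltW.
have p1 : cnorm p = 1 by rewrite cnormR ger0_norm // mulVf // gt_eqF.
exists p; split=> //; first exact: psdZ.
  by apply: (nosplit_le (C := (cnorm e)^-1) ei) ne; rewrite subrr; exact: psd0.
by apply/eqP => p0; move/eqP: p1; rewrite p0 cnorm0 eq_sym oner_eq0.
Qed.

Lemma idem_scale (r t : R) p : p * p = p -> (r *` p) * (t *` p) = (r * t) *` p.
Proof. by move=> pE; rewrite rsMl rsMr pE rsM. Qed.

Lemma idem_norm_diff (r t : R) p : p * p = p -> cnorm p = 1 ->
  cnorm ((r *` p) * (r *` p) - (t *` p) * (t *` p)) = `|r ^+ 2 - t ^+ 2|.
Proof. by move=> pE p1; rewrite !idem_scale // -rsB cnormR p1 mulr1 !expr2. Qed.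

Lemma nosplit_psd_corner p x : psd p -> cnorm p = 1 -> nosplit p -> psd x ->
  p * x * p = cnorm (p * x * p) *` p.
Proof.
move=> pp p1 np px; have := corner_le pp (nosplit_proj pp p1 np) px; rewrite (psd_sa pp).
apply: nosplit_scalar => //; last exact: cnorm_ge0.
by rewrite -{1}(psd_sa pp); exact: psd_conj.
Qed.

(** By [nosplit_psd_corner] both sides are nonnegative multiples of p, and the C*-identity gives
    them the same norm. *)
Lemma nosplit_corner_comm p x : psd p -> cnorm p = 1 -> nosplit p ->
  p * x * p * (p * star x * p) = p * star x * p * (p * x * p).
Proof.
move=> pp p1 np; have pE := nosplit_proj pp p1 np.
have E y z : p * y * p * (p * z * p) = p * (y * p * z) * p.
  by rewrite !mulrA -(mulrA _ p p) pE.
have xx : psd (x * p * star x) := psd_conjr x pp.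
have sxx : psd (star x * p * x) := psd_conj x pp.
rewrite !E (nosplit_psd_corner pp p1 np xx) (nosplit_psd_corner pp p1 np sxx) -!E.
have sp : star (p * x * p) = p * star x * p by rewrite !starM (psd_sa pp) mulrA.
by rewrite -sp cnorm_starr cnorm_star.
Qed.

End NoSplitting.

Section Splitting.
Variables (R : realType) (A : cstarAlgType R).

Lemma right_cancel (r u v : A) : cnorm (1 - r) < 1 -> u * r = v * r -> u = v.
Proof.
move=> r1 uv; apply/eqP; rewrite -subr_eq0; apply/eqP/(@cnorm_eq0 _ A)/eqP.
have E : (u - v) * (1 - r) = u - v by rewrite mulrBr mulr1 (mulrBl r) uv subrr subr0.
have := ler_cnormM (u - v) (1 - r); rewrite E => H.
rewrite eq_le cnorm_ge0 andbT leNgt; apply/negP => h; move: H.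
by rewrite leNgt gtr_pMr ?r1.
Qed.

(** Put [r = x p star x], at distance less than 1 from the unit. Since [p (star x z x) p] is a
    multiple l of p, [r z r = l r]; cancelling r on the right leaves [r z = l], and z = 1 shows that
    r is itself a nonzero scalar. *)
Lemma scalars_of_corner n (x : 'M[A]_(1, n.+1)) (p : mxalg A n) : psd p -> p * p = p ->
  (forall y, psd y -> (exists2 D, 0 <= D & psd (D *` p - y)) -> exists r : R, y = r *` p) ->
  opnorm (1%:M - x *m (p : 'M[A]_n.+1) *m adjmx x) < 1 ->
  forall z : A, psd z -> exists r : R, z = r *` 1.
Proof.
move=> pp pE pc x1; set P : 'M[A]_n.+1 := p in x1.
have PE : P *m P = P := pE; have Pa : adjmx P = P := mpsd_adj pp.
pose r : A := (x *m P *m adjmx x) ord0 ord0.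
have rE : x *m P *m adjmx x = r%:M by rewrite [LHS]mx11_scalar.
have r1 : cnorm (1 - r) < 1.
  apply: le_lt_trans x1; apply: le_trans _ (entry_le_opnorm _ ord0 ord0).
  by rewrite rE !mxE eqxx !mulr1n.
have key z : psd z -> exists l : R, r * z * r = l *` r.
  move=> pz; pose m : 'M[A]_n.+1 := adjmx x *m z%:M *m x.
  have pzm : mpsd (z%:M : 'M[A]_1).
    have -> : (z%:M : 'M[A]_1) = (psqrt z)%:M *m adjmx (psqrt z)%:M.
      by rewrite adjmx_scalar psqrt_sa // -scalar_mxM psqrtK.
    exact: mpsd_mulmx_adj.
  have pm : psd (m : mxalg A n) by rewrite /m -{2}(adjmxK x); exact: mpsd_conj.
  have psp : star p = p := psd_sa pp.
  have [||l lE] := pc (star p * (m : mxalg A n) * p).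
  - exact: psd_conj.
  - by exists (cnorm (m : mxalg A n)); [exact: cnorm_ge0|exact: (corner_le pp pE pm)].
  have lE' : P *m m *m P = (l *` (p : mxalg A n) : mxalg A n) :> 'M[A]_n.+1.
    by rewrite -lE psp.
  have inj1 (u v : A) : u%:M = v%:M :> 'M[A]_1 -> u = v.
    by move=> /matrixP/(_ ord0 ord0); rewrite !mxE eqxx !mulr1n.
  exists l; apply: inj1.
  have -> : (r * z * r)%:M = x *m (P *m m *m P) *m adjmx x :> 'M[A]_1.
    by rewrite !scalar_mxM -rE /m !mulmxA.
  rewrite lE' (mx_rs_mulr x l (p : mxalg A n)) -/P.
  apply/matrixP => i j; rewrite !ord1 [RHS]mxE eqxx mulr1n /r [LHS]mxE [X in _ *: X]mxE scaler_sumr.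
  by apply: eq_bigr => k _; rewrite mxE scalerAl.
have key' z : psd z -> exists l : R, r * z = l *` 1.
  move=> /key[l lE]; exists l; apply: (right_cancel r1).
  by rewrite lE rsMl mul1r.
have [l] := key' 1 (psd1 A); rewrite mulr1 => rl.
have l0 : l != 0.
  apply/eqP => l0; move: r1; rewrite rl l0 rs0 subr0 cnorm1; by rewrite ltxx.
move=> z /key'[t]; rewrite rl rsMl mul1r => zt; exists (l^-1 * t).
by rewrite rsM -zt -rsM mulVf ?rs1.
Qed.

Definition scalar_emb (c : R[i]) : A := c%:A.

Let scalar_embZ (c d : R[i]) : scalar_emb (c *: d) = c *: scalar_emb d.
Proof. by rewrite /scalar_emb scalerA. Qed.

HB.instance Definition _ := GRing.RMorphism.copy scalar_emb (GRing.in_alg A).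
HB.instance Definition _ := GRing.isScalable.Build R[i] R[i] A *:%R scalar_emb scalar_embZ.

Lemma scalars_isomorphic : (forall z : A, psd z -> exists r : R, z = r *` 1) -> isomorphic_to_C A.
Proof.
move=> H.
have Hsa (x : A) : sa x -> exists r : R, x = r *` 1.
  move=> sx; have [r rE] := H _ (psd_of_normN sx (lexx _)); exists (r - cnorm x).
  by rewrite rsB -rE addrC addKr.
have Hall (x : A) : exists c : R[i], x = c%:A.
  pose i : R[i] := (0 +i* 1)%C; pose j : R[i] := (0 -i* 1)%C.
  have ij : i * j = 1 by simpc.
  have cj : conjc j = i by rewrite /i /j /= opprK.
  have [r rE] : exists r : R, 2^-1 *` (x + star x) = r *` (1 : A).
    by apply: Hsa; apply: saR; rewrite /sa starD starK addrC.
  have [t tE] : exists t : R, 2^-1 *` (j *: (x - star x)) = t *` (1 : A).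
    apply: Hsa; apply: saR; rewrite /sa starZ starB starK cj -opprB scalerN -scaleNr.
    by congr (_ *: _); rewrite /i /j; simpc.
  have E (w : A) : i *: ((2^-1 : R) *` (j *: w)) = (2^-1 : R) *` w.
    by rewrite !scalerA mulrAC ij mul1r.
  exists (r%:C + i * t%:C); rewrite scalerDl -rE -scalerA -tE E.
  by rewrite -scalerDr addrACA subrr addr0 rs_half.
have inj : injective (GRing.in_alg A).
  move=> c d /eqP; rewrite -subr_eq0 -scalerBl => /eqP E.
  have : cnorm ((c - d)%:A : A) = 0 by rewrite E cnorm0.
  by rewrite cnormZ cnorm1 mulr1 => /eq0_normc/eqP; rewrite subr_eq0 => /eqP.
pose g x : R[i] := sval (cid (Hall x)).
have gE x : (g x)%:A = x by rewrite /g; case: cid.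
exists (scalar_emb : {lrmorphism R[i] -> A}); split.
  exists g => [c|x]; last exact: gE.
  by apply: inj; exact: gE.
by move=> c; rewrite /= /scalar_emb starZ star1.
Qed.

End Splitting.

(** * Orthogonal pairs from order zero maps of M_2 *)

Section Absorbing.
Variables (R : realType) (A : cstarAlgType R).
Hypotheses (sA : simple_cstar A) (tz : tracially_Z_absorbing A).

Lemma cvg0_eps (f : nat -> R) : f @ \oo --> (0 : R) -> forall e, 0 < e -> exists N, forall s, (N <= s)%N -> f s < e.
Proof. by move=> f0 e e0; have [N _ NP] := cvgr_lt 0 f0 e e0; exists N => s /NP. Qed.

(** If both were at least t the product would be too large. If one is below t and the sum at least
    [3 t], the other exceeds it by at least t, and the squares differ by at least [3 t ^ 2]. *)
Lemma add_lt_of_sqr_close (x y t : R) : 0 <= x -> 0 <= y -> 0 < t -> x * y < t ^+ 2 ->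
  `|x ^+ 2 - y ^+ 2| < t ^+ 2 -> x + y < 3 * t.
Proof.
move=> x0 y0 t0 xy; rewrite ltr_norml => /andP[h1 h2].
have aux (u v : R) : 0 <= u -> u < t -> v ^+ 2 - u ^+ 2 < t ^+ 2 -> u + v < 3 * t.
  move=> u0 ut uv; rewrite ltNge; apply/negP => h.
  have : t * (3 * t) <= (v - u) * (v + u) by apply: ler_pM; lra.
  by move: uv; rewrite !expr2; nra.
have [xt|xt] := ltP x t; first by apply: aux => //; lra.
rewrite addrC; apply: aux => //; rewrite ltNge; apply/negP => yt.
have : t * t <= x * y by apply: ler_pM; lra.
by move: xy; rewrite expr2 => /lt_le_trans /[apply]; rewrite ltxx.
Qed.

Lemma cvg0_pair (a b : nat -> R) : (forall s, 0 <= a s) -> (forall s, 0 <= b s) ->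
  (fun s => a s * b s) @ \oo --> (0 : R) -> (fun s => `|a s ^+ 2 - b s ^+ 2|) @ \oo --> (0 : R) ->
  forall e, 0 < e -> exists N, forall s, (N <= s)%N -> a s + b s < e.
Proof.
move=> a0 b0 ab aabb e e0; have t0 : 0 < e / 3 by rewrite divr_gt0.
have d0 : 0 < (e / 3) ^+ 2 by rewrite exprn_gt0.
have [N1 N1P] := cvg0_eps ab d0; have [N2 N2P] := cvg0_eps aabb d0.
exists (maxn N1 N2) => s; rewrite geq_max => /andP[/N1P h1 /N2P h2].
have := add_lt_of_sqr_close (a0 s) (b0 s) t0 h1 h2; lra.
Qed.

Lemma one_cle_small (h d : A) : psd h -> cnorm h < 2^-1 -> cle (1 - h) d -> cle 1 d.
Proof.
move=> ph h2 hd e e0; have p12 : psd ((2 : R) *` (1 - h) - 1).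
  rewrite (_ : _ - 1 = (2 : R) *` (2^-1 *` 1 - h)).
    by apply: psdZ => //; apply: psd_of_norm; [exact: psd_sa|exact: ltW].
  by rewrite !scalerBr -rsM divff // rs1 rs2 addrAC -[1 + 1 - 1]addrA subrr addr0.
have [x xP] := cle_of_le (psd1 A) p12 (divr_gt0 e0 (ltr0Sn R 1)).
have [y yP] : exists y, cnorm (x * ((2 : R) *` (1 - h)) * star x - y * d * star y) < e / 2.
  have k0 : 0 < 2 * (cnorm x ^+ 2 + 1) by rewrite mulr_gt0 // ltr_wpDl // sqr_ge0.
  have [y yP] := hd _ (divr_gt0 (divr_gt0 e0 (ltr0Sn R 1)) k0).
  exists (Num.sqrt 2 *` (x * y)).
  have -> : x * ((2 : R) *` (1 - h)) * star x - Num.sqrt 2 *` (x * y) * d * star (Num.sqrt 2 *` (x * y))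
     = (2 : R) *` (x * (1 - h - y * d * star y) * star x).
    rewrite starR starM !(rsMl, rsMr) -rsM -[Num.sqrt 2 * _]expr2 sqr_sqrtr //.
    by rewrite -scalerBr (mulrBr x (1 - h)) (mulrBl (star x)) !mulrA.
  rewrite cnormR ger0_norm // (le_lt_trans (y := 2 * (cnorm x ^+ 2 * cnorm (1 - h - y * d * star y)))) //.
    rewrite ler_wpM2l // (le_trans (ler_cnormM _ _)) // cnorm_starE expr2 mulrAC.
    by rewrite ler_wpM2r ?cnorm_ge0 // ler_cnormM.
  rewrite ltr_pdivlMr // in yP; apply: le_lt_trans yP.
  by rewrite [leRHS]mulrC -(mulrA 2) ler_wpM2l // ler_wpM2r ?cnorm_ge0 // lerDl.
exists y; rewrite (le_lt_trans (ler_cnorm_dist (x * ((2 : R) *` (1 - h)) * star x) _ _)) //.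
by rewrite (splitr e) ltrD.
Qed.

(** An order zero map of M_2 is compressed to the corner of p. There [E_00] and [E_11] become
    scalars a and b; [a b] is small as [E_00 E_11 = 0], and [a^2 - b^2] is small because
    [E_00^2 = E_01 E_10], [E_11^2 = E_10 E_01] and the compressions of [E_01] and [E_10] commute. So
    both scalars are small, and [h = phi(1)] is nearly orthogonal to p. *)
Lemma nosplit_h n (p : mxalg A n) (d : A) (ys : seq A) i : psd p -> cnorm p = 1 -> nosplit p ->
  psd d -> d != 0 ->
  exists h : nat -> A, [/\ forall s, psd (h s), forall s, cnorm (h s) <= 1,
    forall s, cle (1 - h s) d,
    forall y, y \in ys -> (fun s => cnorm (h s * y - y * h s)) @ \oo --> (0 : R)
  & forall e, 0 < e -> exists N, forall s, (N <= s)%N -> cnorm (p i i * h s) < e].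
Proof.
move=> pp p1 np pd d0; set P : 'M[A]_n.+1 := p.
have pE : P *m P = P := nosplit_proj pp p1 np.
pose F : set A := [set` ys] `|` range (fun t : 'I_n.+1 * 'I_n.+1 => P t.1 t.2).
have fF : finite_set F by rewrite /F finite_setU; split; [exact: finite_seq|exact: finite_image].
have [phi [oz cl com]] := approx_oz tz 1 fF pd d0.
pose S x : 'M[A]_n.+1 := x%:M.
pose E s (a b : 'I_2) := ozE (phi s) a b.
have bE a b : bounded_seq (fun s => S (E s a b)).
  by apply: (@bounded_scalar _ _ _ _ 1) => s; exact: (ozE_norm (oz s)).
have bP : bounded_seq (fun _ : nat => P) := bounded_cst P.
have cP a b : anear (fun s => S (E s a b) *m P) (fun s => P *m S (E s a b)).
  by apply: anear_comm => k l; apply: com; right; exists (k, l).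
have pSSp (a b c e : 'I_2) : anear (fun s => P *m S (E s a b) *m P *m (P *m S (E s c e) *m P))
    (fun s => P *m S (E s a b * E s c e) *m P).
  apply: (anear_congr (u := fun s => P *m S (E s a b) *m P *m S (E s c e) *m P)
      (v := fun s => P *m P *m S (E s a b) *m S (E s c e) *m P)) => [s|s|].
  - by rewrite !mulmxA -(mulmxA _ P P) pE.
  - by rewrite pE /S scalar_mxM !mulmxA.
  apply: anear_mulr => //; apply: anear_mulr => //.
  apply: (anear_congr (u := fun s => P *m (S (E s a b) *m P)) (v := fun s => P *m (P *m S (E s a b)))) => [s|s|];
    rewrite ?mulmxA //.
  exact: (anear_mull bP (cP a b)).
pose a s := opnorm (P *m S (E s 0 0) *m P); pose b s := opnorm (P *m S (E s 1 1) *m P).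
have pS s k : mpsd (S (E s k k)).
  have pe := ozE_psd (oz s) k.
  have -> : S (E s k k) = S (psqrt (E s k k)) *m adjmx (S (psqrt (E s k k))).
    by rewrite /S adjmx_scalar psqrt_sa // -scalar_mxM psqrtK.
  exact: mpsd_mulmx_adj.
have aE s k : P *m S (E s k k) *m P = (opnorm (P *m S (E s k k) *m P) *` p : mxalg A n).
  exact: (nosplit_psd_corner pp p1 np (pS s k)).
have ppp : p * p = p := pE.
have ab : (fun s => a s * b s) @ \oo --> (0 : R).
  have := pSSp 0 0 1 1; rewrite /anear (_ : (fun s => _) = (fun s => a s * b s)) //.
  apply: funext => s; rewrite [E s 0 0 * _](oz_ort (oz s)) // /S raddf0 mulmx0 mul0mx subr0.
  rewrite (aE s 0) (aE s 1) -/(a s) -/(b s).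
  have -> : (a s *` p : mxalg A n) *m (b s *` p : mxalg A n) = ((a s * b s) *` p : mxalg A n).
    exact: (idem_scale (a s) (b s) ppp).
  by have := cnormR (a s * b s) p; rewrite p1 mulr1 ger0_norm // mulr_ge0 ?opnorm_ge0.
have aabb : (fun s => `|a s ^+ 2 - b s ^+ 2|) @ \oo --> (0 : R).
  have : anear (fun s => P *m S (E s 0 0) *m P *m (P *m S (E s 0 0) *m P))
      (fun s => P *m S (E s 1 1) *m P *m (P *m S (E s 1 1) *m P)).
    apply: anear_trans (pSSp 0 0 0 0) _; apply: anear_sym; apply: anear_trans (pSSp 1 1 1 1) _.
    have e0 : (fun s => P *m S (E s 0 0 * E s 0 0) *m P) = (fun s => P *m S (E s 0 1 * E s 1 0) *m P).
      by apply: funext => s; rewrite [E s 0 1 * _](oz_back (oz s)).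
    have e1 : (fun s => P *m S (E s 1 1 * E s 1 1) *m P) = (fun s => P *m S (E s 1 0 * E s 0 1) *m P).
      by apply: funext => s; rewrite [E s 1 0 * _](oz_back (oz s)).
    rewrite e0 e1; apply: anear_trans (anear_sym (pSSp 1 0 0 1)) _.
    apply: anear_trans _ (pSSp 0 1 1 0); apply: anear_eq => s.
    have := nosplit_corner_comm (S (E s 1 0) : mxalg A n) pp p1 np.
    have -> : star (S (E s 1 0) : mxalg A n) = S (E s 0 1).
      by rewrite -[LHS]/(adjmx (S (E s 1 0))) /S adjmx_scalar [star _](ozE_star (oz s)).
    exact.
  rewrite /anear (_ : (fun s => _) = (fun s => `|a s ^+ 2 - b s ^+ 2|)) //.
  apply: funext => s; rewrite (aE s 0) (aE s 1) -/(a s) -/(b s).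
  exact: (idem_norm_diff (a s) (b s) ppp p1).
pose h s := phi s 1.
have hE s : h s = E s 0 0 + E s 1 1.
  rewrite /h (oz1 (oz s)) !big_ord_recl big_ord0 addr0 /E.
  by congr (_ + ozE _ _ _); apply: val_inj.
exists h; split=> [s|s|s|y yl|e e0].
- exact: (oz1_psd (oz s)).
- exact: (oz1_norm (oz s)).
- exact: cl.
- apply: (squeeze0 (g := fun s => cnorm (E s 0 0 * y - y * E s 0 0) + cnorm (E s 1 1 * y - y * E s 1 1))).
    move=> s; rewrite cnorm_ge0 /= hE mulrDl mulrDr opprD addrACA; exact: ler_cnormD.
  by apply: cvgD0; apply: com; left.
have SD x y : S (x + y) = S x + S y by rewrite /S raddfD.
have hP : anear (fun s => P *m S (h s)) (fun s => P *m S (h s) *m P).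
  apply: (anear_congr (u := fun s => P *m (P *m S (E s 0 0)) + P *m (P *m S (E s 1 1)))
     (v := fun s => P *m (S (E s 0 0) *m P) + P *m (S (E s 1 1) *m P))) => [s|s|].
  - by rewrite !mulmxA pE -mulmxDr hE SD.
  - by rewrite hE SD mulmxDr mulmxDl !mulmxA.
  by apply: anearD; apply: (anear_mull bP); exact/anear_sym.
have e2 : 0 < e / 2 by rewrite divr_gt0.
have [N1 N1P] := cvg0_eps hP e2.
have [N2 N2P] := cvg0_pair (fun s => opnorm_ge0 _) (fun s => opnorm_ge0 _) ab aabb e2.
exists (maxn N1 N2) => s; rewrite geq_max => /andP[/N1P h1 /N2P h2].
have h3 : opnorm (P *m S (h s) *m P) <= a s + b s.
  by rewrite hE SD mulmxDr mulmxDl; exact: opnormD.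
have h4 : opnorm (P *m S (h s)) < e.
  have := opnorm_near (a := 0) (u := P *m S (h s)) (v := P *m S (h s) *m P) (e := e).
  rewrite !sub0r !opnormN; apply => //; exact: (le_trans h3 (ltW h2)).
apply: le_lt_trans _ h4; apply: le_trans _ (entry_le_opnorm _ i i).
by rewrite [X in _ <= cnorm X]mxE (bigD1 i) //= big1 ?addr0 ?mxE ?eqxx ?mulr1n // => k ki;
  rewrite mxE (negPf ki) mulr0.
Qed.

(** As h nearly commutes with the right coefficients and [d h] is small, h nearly annihilates a sum
    that is close to 1, so h is small. The bounds are [1/4 + 1/4 = 1/2]. *)
Lemma full_small (d : A) (s : seq (A * A)) (h : nat -> A) : cnorm (1 - \sum_(q <- s) q.1 * d * q.2) < 4^-1 ->
  (forall k, cnorm (h k) <= 1) -> clim (fun k => d * h k) 0 ->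
  (forall y, y \in map snd s -> clim (fun k => h k * y - y * h k) 0) ->
  exists k, cnorm (h k) < 2^-1.
Proof.
move=> s4 h1 dh hs.
have lim : clim (fun k => (\sum_(q <- s) q.1 * d * q.2) * h k) 0.
  elim: s {s4} hs => [|q s IH] hs.
    by apply: (clim_ext (clim_cst 0)) => k; rewrite big_nil mul0r.
  have l1 := climM (climM (clim_cst q.1) dh) (clim_cst q.2).
  have l2 := climM (clim_cst (q.1 * d)) (hs q.2 (mem_head _ _)).
  have l3 := IH (fun y ys => hs y (mem_behead (s := q.2 :: map snd s) ys)).
  have := climD (climB l1 l2) l3; rewrite !mulr0 mul0r subrr addr0 => l.
  apply: (clim_ext l) => k; rewrite big_cons mulrDl; congr (_ + _).
  by rewrite mulrBr !mulrA opprB addrC subrK.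
have [N /(_ N (leqnn _))] := (climP _ _).1 lim 4^-1 ltac:(by rewrite invr_gt0).
rewrite subr0 => hN; exists N.
have -> : h N = (1 - \sum_(q <- s) q.1 * d * q.2) * h N + (\sum_(q <- s) q.1 * d * q.2) * h N.
  by rewrite -mulrDl subrK mul1r.
apply: le_lt_trans (ler_cnormD _ _) _.
have : cnorm ((1 - \sum_(q <- s) q.1 * d * q.2) * h N) <= 4^-1 * 1.
  by rewrite (le_trans (ler_cnormM _ _)) // ler_pM ?cnorm_ge0 // ltW.
move: hN; move: (cnorm _) (cnorm _) => u v; lra.
Qed.

(** Otherwise the h of [nosplit_h] is nearly annihilated by the full element d and so has small
    norm, while [1 - h] is Cuntz below d. This puts 1 below d, hence below p, and the scalar corner
    of p makes all of A scalar. *)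
Lemma split_elem n (e : mxalg A n) : psd e -> e != 0 -> exists x y C,
  [/\ psd x /\ psd y, x != 0 /\ y != 0, x * y = 0 & 0 <= C /\ psd (C *` e - x) /\ psd (C *` e - y)].
Proof.
move=> pe e0; case: (nosplit_or_split e) => // ne; exfalso.
have [p [pp p1 np p0]] := nosplit_unit pe e0 ne.
have [i pi0] := psd_diag_neq0 pp p0.
pose d := p i i; have pd : psd d := psd_diag i pp.
have [s sP] := simple_full sA pi0 (ltac:(by rewrite invr_gt0) : 0 < 4^-1 :> R).
have [h [ph h1 hd hy hp]] := nosplit_h (map snd s) i pp p1 np pd pi0.
have [k hk] : exists k, cnorm (h k) < 2^-1.
  apply: (full_small sP h1) => [|y ys].
    by apply/climP => e' /hp[N NP]; exists N => m /NP; rewrite subr0.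
  by apply/climP => e' /(cvg0_eps (hy y ys))[N NP]; exists N => m /NP; rewrite subr0.
have one : cle 1 d := one_cle_small (ph k) hk (hd k).
have [x xP] := csub_trans (csub_scalar 0 one) (csub_diag p i) ltr01.
apply: tz.1; apply: scalars_isomorphic; apply: (scalars_of_corner pp (nosplit_proj pp p1 np) _ xP).
by move=> y py [D D0 Dy]; exists (cnorm y); exact: (nosplit_scalar pp p1 np py D0 Dy).
Qed.

End Absorbing.

(** * Almost unperforation *)

Section OneAlgebraInequalities.
Variables (R : realType) (A : cstarAlgType R).
Implicit Types (a b e f g x y z : A) (C D : R).

Lemma psd_le_ann C x y z : psd z -> psd (C *` y - z) -> y * x = 0 -> z * x = 0.
Proof.
move=> pz yz yx.
have h : star x * z * x = 0.
  apply: psd_antisym; first exact: psd_conj.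
  have := psd_conjB x yz.
  by rewrite rsMr rsMl -(mulrA (star x) y) yx mulr0 scaler0 sub0r.
have : psqrt z * x = 0.
  apply: starl_eq0; rewrite starM psqrt_sa // mulrA -(mulrA (star x)) psqrtK //.
by move=> h2; rewrite -(psqrtK pz) -mulrA h2 mulr0.
Qed.

Lemma sa_ann x y : sa x -> sa y -> x * y = 0 -> y * x = 0.
Proof. by move=> sx sy xy; rewrite -sx -sy -starM xy star0. Qed.

Lemma cle_leZ C a b : psd a -> psd b -> 0 <= C -> psd (C *` b - a) -> cle a b.
Proof.
move=> pa pb C0 ab e e0; have [x xP] := cle_of_le pa ab e0.
exists (Num.sqrt C *` x); rewrite starR !(rsMl, rsMr) -rsM.
rewrite -[Num.sqrt C * _]expr2 sqr_sqrtr //.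
by move: xP; rewrite !(rsMl, rsMr).
Qed.

Definition below b a := exists2 C, 0 <= C & psd (C *` b - a).

Lemma below_refl a : below a a.
Proof. by exists 1; rewrite // rs1 subrr; exact: psd0. Qed.

Lemma below_trans x y z : below x y -> below y z -> below x z.
Proof.
move=> [C C0 xy] [D D0 yz]; exists (D * C); first exact: mulr_ge0.
exact: psd_leZ xy yz.
Qed.

Lemma below_le a b : psd (b - a) -> below b a.
Proof. by exists 1; rewrite ?rs1. Qed.

Lemma below_scale C a b : 0 <= C -> psd (C *` b - a) -> below b a.
Proof. by exists C. Qed.

Lemma belowD x y z : below x y -> below x z -> below x (y + z).
Proof.
move=> [C C0 xy] [D D0 xz]; exists (C + D); first exact: addr_ge0.
by rewrite rsD opprD addrACA; exact: psdD.
Qed.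

Lemma below_sum I (r : seq I) (P : pred I) (F : I -> A) x : (forall i, P i -> below x (F i)) ->
  below x (\sum_(i <- r | P i) F i).
Proof.
move=> xF; elim/big_ind: _ => //; last exact: belowD.
by exists 0; rewrite // rs0 subr0; exact: psd0.
Qed.

Lemma below_ann x y z : psd z -> below y z -> y * x = 0 -> z * x = 0.
Proof. by move=> pz [C _ yz]; exact: psd_le_ann yz. Qed.

Lemma cle_below a b : psd a -> psd b -> below b a -> cle a b.
Proof. by move=> pa pb [C]; exact: cle_leZ. Qed.

(** Zero up to 1/4 and one from 1/2 on, so that it acts as a unit on [cut (3 / 4)]. *)
Definition bump (s : R) := Num.min (4 * cut 4^-1 s) 1.

Lemma lucont_bump : lucont bump.
Proof.
apply: (lucont_comp (g := fun s => 4 * cut 4^-1 s) (lucont_min 1)).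
by apply: lucontZ; exact: lucont_cut.
Qed.

Lemma bumpP (s : R) : 0 <= s -> [/\ 0 <= bump s, bump s <= 1, bump s <= 4 * s &
  bump s * cut (3 / 4) s = cut (3 / 4) s].
Proof.
move=> s0; rewrite /bump /cut; have [h|h] := leP (s - 4^-1) 0.
  rewrite mulr0 (min_l ler01) mul0r; split=> //; first lra.
  by rewrite max_r //; lra.
have [h2|h2] := leP (4 * (s - 4^-1)) 1.
  split=> //; try lra; have [h3|h3] := leP (s - 3 / 4) 0; first by rewrite mulr0.
  lra.
split=> //; try lra; by rewrite mul1r.
Qed.

Lemma bump_elem e : psd e -> cnorm e = 1 -> exists f g, [/\ psd f, psd g, g != 0, f * g = g &
  [/\ psd ((4 : R) *` e - f), psd (f - f * f), psd (e - g) & forall x, e * x = 0 -> f * x = 0]].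
Proof.
move=> pe e1; have se := psd_sa pe; have lb := lucont_bump.
have sf : sa (fc bump e) := fc_sa se lb.
exists (fc bump e), (pcut (3 / 4) e); split; first by apply: fc_psd_ge0 => // s /bumpP[].
- exact: pcut_psd.
- by apply: pcut_neq0 => //; rewrite ?e1; lra.
- rewrite -(fcM se lb (lucont_cut _)); apply: fc_psd_ext => //; last by move=> s /bumpP[].
    by apply: lucontM => //; exact: lucont_cut.
  exact: lucont_cut.
split.
- rewrite -{1}(fc_id se) -(fcZ _ se (@lucont_id R)); apply: fc_psd_le => //.
    by apply: lucontZ; exact: lucont_id.
  by move=> s /bumpP[].
- rewrite -(fcM se lb lb); apply: fc_psd_le => //; first exact: lucontM.
  by move=> s /bumpP[b0 b1 _ _]; rewrite ler_piMl.
- by apply: pcut_le => //; lra.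
move=> x ex; apply: fc_annl => //; have [b0 _ b4 _] := bumpP (lexx 0).
by apply/eqP; rewrite eq_le b0 andbT; move: b4; rewrite mulr0.
Qed.

Lemma conj_bound b f : psd b -> psd f -> psd (f - f * f) -> psd (cnorm b *` f - f * b * f).
Proof.
move=> pb pf ff; have := psd_conj_le f pb; rewrite (psd_sa pf) => h.
apply: psd_trans h _; rewrite -scalerBr; apply: psdZ => //; exact: cnorm_ge0.
Qed.

(** Parallelogram identities for conjugation of b: by [(1 - f) + f] and [(1 - f) - f], then by
    [1 + f] and [1 - f]. *)
Lemma corner_split b f : psd b -> psd f ->
  psd ((2 : R) *` ((1 - f) * b * (1 - f)) + (2 : R) *` (f * b * f) - b) /\
  psd ((2 : R) *` b + (2 : R) *` (f * b * f) - (1 - f) * b * (1 - f)).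
Proof.
move=> pb pf; rewrite !rs2; split.
  rewrite (_ : _ - b = star (1 - (f + f)) * b * (1 - (f + f))); first exact: psd_conj.
  rewrite starB star1 starD (psd_sa pf); ncring.
rewrite (_ : _ - _ = star (1 + f) * b * (1 + f)); first exact: psd_conj.
rewrite starD star1 (psd_sa pf); ncring.
Qed.

End OneAlgebraInequalities.

Section MatrixClasses.
Variables (R : realType) (A : cstarAlgType R).

Definition mz n (a : mxalg A n) : cuW A := cz (MInf (a : 'M[A]_n.+1)).

Lemma csub_below n (a b : mxalg A n) : psd a -> psd b -> below b a ->
  csub (a : 'M[A]_n.+1) (b : 'M[A]_n.+1).
Proof. exact: (@cle_below R (mxalg A n)). Qed.

Lemma mz_csub m n (a : mxalg A m) (b : mxalg A n) : psd a -> psd b ->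
  csub (a : 'M[A]_m.+1) (b : 'M[A]_n.+1) -> cule (mz a) (mz b).
Proof. by move=> /mpsdP pa /mpsdP pb ab; apply/cule_cz. Qed.

Lemma mz_csubP m n (a : mxalg A m) (b : mxalg A n) : psd a -> psd b ->
  cule (mz a) (mz b) -> csub (a : 'M[A]_m.+1) (b : 'M[A]_n.+1).
Proof. by move=> /mpsdP pa /mpsdP pb /cule_cz; apply. Qed.

Lemma mz_dsum m n (a : mxalg A m) (b : mxalg A n) : psd a -> psd b ->
  mz a + mz b = mz (dsum (a : 'M[A]_m.+1) (b : 'M[A]_n.+1) : mxalg A (m + n.+1)).
Proof. by move=> /mpsdP pa /mpsdP pb; rewrite /mz -cz_oplus. Qed.

Lemma mz_below n (a b : mxalg A n) : psd a -> psd b -> below b a -> cule (mz a) (mz b).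
Proof. by move=> pa pb ba; apply: mz_csub => //; exact: csub_below. Qed.

Lemma mz_add n (a b : mxalg A n) : psd a -> psd b -> cule (mz (a + b)) (mz a + mz b).
Proof.
move=> pa pb; rewrite (mz_dsum pa pb).
exact: (mz_csub (psdD pa pb) (mpsd_dsum pa pb) (csub_sum _ _)).
Qed.

Lemma mz_orth n (a b : mxalg A n) : psd a -> psd b -> a * b = 0 -> cule (mz a + mz b) (mz (a + b)).
Proof.
move=> pa pb ab; rewrite (mz_dsum pa pb).
exact: (mz_csub (mpsd_dsum pa pb) (psdD pa pb) (csub_orth pa pb ab)).
Qed.

Lemma culeMn (X Y : cuW A) k : cule X Y -> cule (X *+ k) (Y *+ k).
Proof.
by move=> XY; elim: k => [|k IH]; [exact: cule_refl|rewrite !mulrS; exact: culeD].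
Qed.

Lemma psd_scalar n (d : A) : psd d -> mpsd (d%:M : 'M[A]_n.+1).
Proof.
move=> pd; have -> : (d%:M : 'M[A]_n.+1) = (psqrt d)%:M *m adjmx (psqrt d)%:M.
  by rewrite adjmx_scalar psqrt_sa // -scalar_mxM psqrtK.
exact: mpsd_mulmx_adj.
Qed.

Lemma mz_scalar (d : A) m : psd d -> mz (d%:M : 'M[A]_m.+1) = mz (d%:M : 'M[A]_1) *+ m.+1.
Proof.
move=> pd.
elim: m => [|m IH] //; rewrite mulrS -IH mz_dsum; [|exact: psd_scalar..].
by rewrite /dsum -scalar_mx_block.
Qed.

Lemma mz_orth_family n (f : mxalg A n) (e : nat -> mxalg A n) M : psd f ->
  (forall i, (i < M)%N -> psd (e i) /\ csub (f : 'M[A]_n.+1) (e i)) ->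
  (forall i j, (i < M)%N -> (j < M)%N -> i != j -> e i * e j = 0) ->
  cule (mz f *+ M) (mz (\sum_(i < M) e i)).
Proof.
move=> pf; elim: M => [|M IH] pe ort; first by rewrite mulr0n; exact: cule0.
rewrite big_ord_recr mulrSr /=.
have [pM fM] := pe M (leqnn _).
have pS : psd (\sum_(i < M) e i).
  by apply: psd_sum => i _; have [] := pe i (leqW (ltn_ord i)).
apply: cule_trans (mz_orth _ pM _) => //.
  apply: culeD; last exact: mz_csub.
  by apply: IH => [i iM|i j iM jM]; [exact: (pe i (leqW iM))|apply: ort; exact: leqW].
rewrite mulr_suml big1 // => i _; apply: ort => //; first exact: (leqW (ltn_ord i)).
by rewrite neq_ltn ltn_ord.
Qed.

End MatrixClasses.

(** * Room below an element, and almost unperforation *)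

Section Perforation.
Variables (R : realType) (A : cstarAlgType R).
Hypotheses (sA : simple_cstar A) (tz : tracially_Z_absorbing A).

Lemma orth_family n (b : mxalg A n) M : psd b -> b != 0 -> exists e : nat -> mxalg A n,
  (forall i, (i < M)%N -> [/\ psd (e i), e i != 0 & below b (e i)]) /\
  (forall i j, (i < M)%N -> (j < M)%N -> i != j -> e i * e j = 0).
Proof.
elim: M b => [|M IH] b pb b0; first by exists (fun=> 0).
have [x [y [C [[px py] [x0 y0] xy [C0 [bx byy]]]]]] := split_elem sA tz pb b0.
have [e [eP eo]] := IH y py y0.
have ex i : (i < M)%N -> e i * x = 0.
  move=> iM; have [pe _ yD] := eP i iM.
  exact: (below_ann pe yD (sa_ann (psd_sa px) (psd_sa py) xy)).
exists (fun i => if i is i'.+1 then e i' else x); split.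
  move=> [_|i iM]; first exact: And3 px x0 (below_scale C0 bx).
  have [pe e0 yD] := eP i iM; exact: And3 pe e0 (below_trans (below_scale C0 byy) yD).
move=> [|i] [|j] //= iM jM ij; [|exact: ex|exact: eo].
have [pe _ _] := eP j jM.
exact: (sa_ann (psd_sa pe) (psd_sa px) (ex j jM)).
Qed.

(** A simple algebra is prime: the nonzero entry [e i i] is full, so [e i i * x * f j j = 0] for all
    x would force [f j j = 0]. *)
Lemma prime_elem n (e f : mxalg A n) : psd e -> psd f -> e != 0 -> f != 0 ->
  exists y, e * y * f != 0.
Proof.
move=> pe pf e0 f0; have [i ei] := psd_diag_neq0 pe e0; have [j fj] := psd_diag_neq0 pf f0.
apply: contrapT => H; have eyf y : e * y * f = 0 by apply/eqP; apply: contrapT => /negP yP; apply: H; exists y.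
have edf x : e i i * x * f j j = 0.
  have /matrixP/(_ i j) := eyf (x *: delta_mx i j); rewrite [RHS]mxE => <-.
  rewrite [RHS]mxE (bigD1 j) //= big1 ?addr0 => [|k kj].
    rewrite [X in _ = X * _]mxE (bigD1 i) //= big1 ?addr0 ?mxE ?eqxx ?mulr1 // => l li.
    by rewrite !mxE (negPf li) !mulr0.
  rewrite [X in X * _]mxE big1 ?mul0r // => l _.
  by rewrite !mxE (negPf kj) andbF !mulr0.
suff : f j j = 0 by move/eqP; rewrite (negPf fj).
apply: (@cnorm_eq0 _ A); apply/eqP; rewrite eq_le cnorm_ge0 andbT; apply/ler_addgt0Pl => r r0.
have k0 : 0 < cnorm (f j j) + 1 by rewrite ltr_wpDl // cnorm_ge0.
have [s sP] := simple_full sA ei (divr_gt0 r0 k0).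
have -> : f j j = (1 - \sum_(p <- s) p.1 * e i i * p.2) * f j j.
  rewrite mulrBl mul1r mulr_suml big1 ?subr0 // => p _.
  by rewrite -!mulrA (mulrA (e i i)) edf mulr0.
rewrite addr0 (le_trans (ler_cnormM _ _)) //.
apply: le_trans (_ : r / (cnorm (f j j) + 1) * (cnorm (f j j) + 1) <= _).
  by rewrite ler_pM ?cnorm_ge0 ?lerDl // ltW.
by rewrite divfK // gt_eqF.
Qed.

Lemma psqrt_neq0 (B : cstarAlgType R) (e : B) : psd e -> e != 0 -> psqrt e != 0.
Proof.
by move=> pe; apply: contra => /eqP h; rewrite -(psqrtK pe) h mulr0.
Qed.

(** f is [w star w] for [w = g^(1/2) y h^(1/2)]: the outer factors place it below g, and the inner h
    makes it a conjugate of h. *)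
Lemma conj_product (B : cstarAlgType R) (g h y : B) : psd g -> psd h -> psqrt g * y * psqrt h != 0 ->
  exists f, [/\ psd f, f != 0, below g f & cle f h].
Proof.
move=> pg ph w0; have sg := psqrt_sa pg; have sh := psqrt_sa ph.
pose f := psqrt g * (y * h * star y) * psqrt g; exists f.
have fE : f = psqrt g * y * psqrt h * star (psqrt g * y * psqrt h).
  by rewrite /f !starM sg sh !mulrA -(mulrA _ (psqrt h) (psqrt h)) psqrtK.
have pm : psd (y * h * star y) by exact: psd_conjr.
split.
- by rewrite fE; exact: psd_starr.
- apply: contra w0; rewrite fE => /eqP h0; apply/eqP.
  rewrite -[LHS]starK (@starl_eq0 _ B (star (psqrt g * y * psqrt h))) ?star0 //.
  by rewrite starK.
- apply: (below_scale (C := cnorm (y * h * star y))); first exact: cnorm_ge0.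
  by have := psd_conj_le (psqrt g) pm; rewrite sg psqrtK.
by rewrite /f -{2}sg -!mulrA (mulrA (psqrt g)) -starM mulrA; exact: cle_conj.
Qed.

Lemma common_minorant n (e : nat -> mxalg A n) M : (forall i, (i < M.+1)%N -> psd (e i) /\ e i != 0) ->
  exists f : mxalg A n, [/\ psd f, f != 0, below (e 0%N) f &
    forall i, (i < M)%N -> csub (f : 'M[A]_n.+1) (e i.+1)].
Proof.
elim: M => [|M IH] eP.
  have [p0 e0] := eP 0%N isT; exists (e 0%N).
  by apply: (And4 p0 e0 (below_refl _)) => i; rewrite ltn0.
have [g [pg g0 eg ge]] := IH (fun i iM => eP i (leqW iM)).
have [pe e0] := eP M.+1 (leqnn _).
have [y yP] := prime_elem (psqrt_psd pg) (psqrt_psd pe) (psqrt_neq0 pg g0) (psqrt_neq0 pe e0).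
have [f [pf f0 gf fe]] := conj_product pg pe yP.
exists f; apply: (And4 pf f0 (below_trans eg gf)) => i.
rewrite ltnS leq_eqVlt => /predU1P[->|/ge gi]; first exact: fe.
exact: csub_trans (csub_below pf pg gf) gi.
Qed.

Lemma multiples_below n (b : mxalg A n) M : psd b -> b != 0 ->
  exists d : A, [/\ psd d, d != 0 & cule (mz (d%:M : 'M[A]_1) *+ M) (mz b)].
Proof.
move=> pb b0; have [e [eP eo]] := orth_family M.+1 pb b0.
have [|f [pf f0 ef fe]] := @common_minorant n e M.
  by move=> i /eP[].
have [i fi] := psd_diag_neq0 pf f0; have pfi := psd_diag i pf.
exists (f i i); apply: (And3 pfi fi).
apply: cule_trans (culeMn M (mz_csub (psd_scalar 0 pfi) pf (csub_diag f i))) _.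
apply: cule_trans (mz_orth_family (e := fun i => e i.+1) (M := M) pf _ _) _.
- by move=> k kM; split; [by case: (eP k.+1 kM)|exact: fe].
- by move=> k l kM lM kl; apply: eo.
apply: mz_below pb _.
  by apply: psd_sum => k _; have [] := eP k.+1 (ltn_ord k).
by apply: below_sum => k _; have [] := eP k.+1 (ltn_ord k).
Qed.

Lemma psd_normalize (B : cstarAlgType R) (e : B) : psd e -> e != 0 ->
  exists f, [/\ psd f, cnorm f = 1, below e f & below f e].
Proof.
move=> pe e0; have en : 0 < cnorm e.
  by rewrite lt0r cnorm_ge0 andbT; apply/eqP => /(@cnorm_eq0 _ B)/eqP; rewrite (negPf e0).
have ei : 0 <= (cnorm e)^-1 by rewrite invr_ge0 ltW.
exists ((cnorm e)^-1 *` e); split; first exact: psdZ.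
- by rewrite cnormR ger0_norm // mulVf // gt_eqF.
- by apply: (below_scale ei); rewrite subrr; exact: psd0.
by apply: (below_scale (ltW en)); rewrite -rsM divff ?gt_eqF // rs1 subrr; exact: psd0.
Qed.

(* b' = (1 - f) b (1 - f), where f and g are functions of e with f g = g. *)
Lemma small_orth_split (B : cstarAlgType R) (b e : B) : psd b -> psd e -> cnorm e = 1 -> below b e ->
  exists b' f g, [/\ psd b', psd f, psd g, g != 0 & b' * g = 0] /\
    [/\ below (b' + f) b, below e f, below b (b' + g) &
      forall x, psd x -> below b x -> e * x = 0 -> below b' x].
Proof.
move=> pb pe e1 be; have [f [g [pf pg g0 fg [ef ff eg fx]]]] := bump_elem pe e1.
pose u := 1 - f; have su : star u = u by rewrite starB star1 (psd_sa pf).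
exists (u * b * u), f, g; have pb' : psd (u * b * u) by rewrite -{1}su; exact: psd_conj.
have ug : u * g = 0 by rewrite mulrBl mul1r fg subrr.
have fbf : below f (f * b * f) := below_scale (cnorm_ge0 b) (conj_bound pb pf ff).
have bef : below e f by apply: (below_scale (C := 4)).
have [c1 c2] := corner_split pb pf.
have b2 (x y : B) : below x y -> below x ((2 : R) *` y) by move=> xy; rewrite rs2; exact: belowD.
have ubg : u * b * u * g = 0 by rewrite -(mulrA (u * b)) ug mulr0.
split; first exact: And5 pb' pf pg g0 ubg.
have belowl (x y : B) : psd y -> below (x + y) x.
  by move=> py; apply: below_le; rewrite addrC addKr.
have belowr (x y : B) : psd x -> below (x + y) y.
  by move=> px; rewrite addrC; exact: belowl.
split=> //.
- apply: below_trans (below_le c1); apply: belowD; apply: b2; first exact: belowl.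
  exact: below_trans (belowr _ _ pb') fbf.
- apply: belowD; last exact: below_trans be (below_le eg).
  apply: below_trans (below_le c2); apply: belowD; apply: b2; first exact: below_refl.
  exact: below_trans be (below_trans bef fbf).
move=> x px [C C0 bx] ex; exists C => //.
have fx0 := fx x ex; have xf0 := sa_ann (psd_sa pf) (psd_sa px) fx0.
have -> : x = u * x * u by rewrite mulrBl mul1r fx0 subr0 mulrBr mulr1 xf0 subr0.
by have := psd_conjB u bx; rewrite su rsMr rsMl.
Qed.

(** Adding f to b' recovers b, and g may be added to b' without leaving b. As f is Cuntz below each
    of M orthogonal elements that survive in b', M copies of f cost only one further b'. *)
Lemma almost_split n (b : mxalg A n) M : psd b -> b != 0 -> exists b' f g : mxalg A n,
  [/\ psd b', psd f, psd g & g != 0] /\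
  [/\ cule (mz b) (mz b' + mz f), cule (mz f *+ M) (mz b') & cule (mz b' + mz g) (mz b)].
Proof.
move=> pb b0; have [e [eP eo]] := orth_family M.+1 pb b0.
(* The member [e 0] is set apart: f and g will be functions of an element dominated by it, so the
   other M members are orthogonal to them and stay below b'. *)
have [|e0 [pe0 e00 ee0 fe]] := @common_minorant n e M.
  by move=> i /eP[].
have [p [pp p1 e0p pe0']] := psd_normalize pe0 e00.
have [_ _ be] := eP 0%N isT.
have [b' [f [g [[pb' pf pg g0 bg] [bf fp bb' orth]]]]] :=
  small_orth_split pb pp p1 (below_trans be (below_trans ee0 e0p)).
exists b', f, g; split; first exact: And4 pb' pf pg g0.
split.
- apply: cule_trans (mz_add pb' pf); exact: (mz_below pb (psdD pb' pf) bf).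
- have fe0 : csub (f : 'M[A]_n.+1) (e0 : 'M[A]_n.+1).
    exact: csub_below pf pe0 (below_trans e0p fp).
  apply: cule_trans (mz_orth_family (e := fun i => e i.+1) (M := M) pf _ _) _.
  + by move=> k kM; split; [by case: (eP k.+1 kM)|exact: csub_trans fe0 (fe k kM)].
  + by move=> k l kM lM kl; apply: eo.
  have pS : psd (\sum_(k < M) e k.+1).
    by apply: psd_sum => k _; have [] := eP k.+1 (ltn_ord k).
  have bS : below b (\sum_(k < M) e k.+1).
    by apply: below_sum => k _; have [] := eP k.+1 (ltn_ord k).
  apply: (mz_below pS pb' (orth _ pS bS _)); rewrite mulr_sumr big1 // => k _.
  have e0k : e 0%N * e k.+1 = 0 by apply: eo; rewrite // ltnS; exact: (ltn_ord k).
  exact: (below_ann pp (below_trans ee0 e0p) e0k).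
exact: cule_trans (mz_orth pb' pg bg) (mz_below (psdD pb' pg) pb bb').
Qed.

Lemma mz_surj (X : cuW A) : exists n (a : mxalg A n), psd a /\ X = mz a.
Proof. by have [[n a] /mpsdP pa ->] := cz_surj X; exists n, a. Qed.

Lemma mz_ext (X Y : cuW A) n (a : mxalg A n) : psd a -> X = mz a ->
  (forall e, 0 < e -> cule (mz (mcut e (a : 'M[A]_n.+1) : mxalg A n)) Y) -> cule X Y.
Proof.
move=> pa ->; have [m [b [pb ->]]] := mz_surj Y => H.
apply: (mz_csub pa pb); apply: csub_of_pcut => // e e0.
exact: mz_csubP (mcut_psd e pa) pb (H e e0).
Qed.

Lemma almost_unperforated (X Y : cuW A) k : (0 < k)%N -> cule (X *+ k.+1) (Y *+ k) -> cule X Y.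
Proof.
move=> k0; have [m [a [pa Xa]]] := mz_surj X; have [n [b [pb Yb]]] := mz_surj Y => XY.
have [b0|b0] := eqVneq b 0.
  apply: cule_trans (_ : cule X (X *+ k.+1)) _.
    by rewrite mulrSr -{1}[X]add0r; apply: culeD; [exact: cule0|exact: cule_refl].
  apply: cule_trans XY _.
  have Y0 : cule Y 0.
    rewrite Yb b0; apply/(cule_cz _ (mpos0 A)); first exact/mpsdP/mpsd0.
    exact: csub0.
  apply: cule_trans (culeMn k Y0) _; rewrite mul0rn; exact: cule0.
have [b' [f [g [[pb' pf pg g0] [h1 h2 h3]]]]] := almost_split (2 * k) pb b0.
(* The remainder in [muln_csub_small] is a scalar matrix of size m + 1, that is, m + 1 copies of
   d. *)
have [d [pd d0 dg]] := multiples_below m.+1 pg g0.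
apply: (mz_ext pa Xa) => e e0; rewrite Yb.
(* [(2k + 2) a <= 2k b <= 2k b' + 2k f <= (2k + 1) b']: one of the two spare copies is spent on
   f. *)
have key : cule (mz a *+ (2 * k).+2) (mz b' *+ (2 * k).+1).
  have -> : mz a *+ (2 * k).+2 = (X *+ k.+1) *+ 2 by rewrite -mulrnA -Xa; congr (_ *+ _); lia.
  apply: cule_trans (culeMn 2 XY) _; rewrite -mulrnA mulnC Yb.
  apply: cule_trans (culeMn (2 * k) h1) _; rewrite mulrnDl mulrSr.
  by apply: culeD => //; exact: cule_refl.
have /mpsdP pa' := pa; have /mpsdP pb'' := pb'.
have dat := muln_csub_data (pa' : mpos (MInf (a : 'M[A]_m.+1))) (pb'' : mpos (MInf (b' : 'M[A]_n.+1))) key.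
have := muln_csub_small tz pa pb' pd d0 e0 dat.
move/(mz_csub (mcut_psd e pa) (mpsd_dsum pb' (psd_scalar m pd))) => cut.
apply: cule_trans cut _; rewrite -(mz_dsum pb' (psd_scalar m pd)).
rewrite mz_scalar //; apply: cule_trans _ h3; apply: culeD dg; exact: cule_refl.
Qed.

Lemma mz_unit n (a : mxalg A n) : psd a -> cule (mz a) (mz (1%:M : 'M[A]_1) *+ n.+1).
Proof.
move=> pa; rewrite -(mz_scalar n (psd1 A)); apply: (mz_below pa (psd1 _)).
exact: (below_scale (cnorm_ge0 a) (psd_le_norm pa)).
Qed.

(** Fullness gives w, a sum of terms [p d q], within 1/2 of the unit, so [1 <= w + star w]. Each
    [p d q + star (p d q)] lies below [p d star p + star q d q], two conjugates of d, whence the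
    doubled length. *)
Lemma unit_le_multiple n (b : mxalg A n) : psd b -> b != 0 ->
  exists N, cule (mz (1%:M : 'M[A]_1)) (mz b *+ N).
Proof.
move=> pb b0; have [i bi] := psd_diag_neq0 pb b0; have pd := psd_diag i pb.
set d := b i i in bi pd.
have [s sP] := simple_full sA bi (ltac:(by rewrite invr_gt0) : 0 < 2^-1 :> R).
pose w := \sum_(p <- s) p.1 * d * p.2.
pose T := \sum_(p <- s) (p.1 * d * star p.1 + star p.2 * d * p.2).
have wT : psd (T - (w + star w)).
  rewrite /T /w star_sum -big_split -sumrB; apply: psd_sum => p _ /=.
  have -> : p.1 * d * star p.1 + star p.2 * d * p.2 - (p.1 * d * p.2 + star (p.1 * d * p.2)) =
      (p.1 - star p.2) * d * star (p.1 - star p.2).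
    rewrite starB starK !starM (psd_sa pd); ncring.
  exact: psd_conjr.
have w1 : psd (w + star w - 1).
  have h : psd (2^-1 *` 1 - 2^-1 *` ((1 - w) + star (1 - w))).
    apply: psd_of_norm; first by apply: saR; rewrite /sa starD starK addrC.
    rewrite cnormR ger0_norm ?invr_ge0 // ler_piMr ?invr_ge0 //.
    by rewrite (le_trans (ler_cnormD _ _)) // cnorm_starE; move: sP; rewrite -/w; move: (cnorm _) => v; lra.
  have -> : w + star w - 1 = (2 : R) *` (2^-1 *` 1 - 2^-1 *` ((1 - w) + star (1 - w))).
    rewrite scalerBr -!rsM divff // !rs1 starB star1; ncring.
  by apply: psdZ.
have pT : psd T.
  by apply: psd_sum => p _; apply: psdD; [exact: psd_conjr|exact: psd_conj].
exists (size s).*2.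
have oneT : below T 1 by apply: below_le; exact: psd_trans w1 wT.
pose S x : mxalg A 0 := x%:M.
have pS x : psd x -> psd (S x) by move=> px; exact: psd_scalar.
have ST : cule (mz (S 1)) (mz (S T)).
  apply: (mz_csub (pS _ (psd1 A)) (pS _ pT)); apply: csub_scalar.
  exact: (cle_below (psd1 A) pT oneT).
apply: cule_trans ST _.
have Sd : cule (mz (S d)) (mz b) by apply: (mz_csub (pS _ pd) pb); exact: csub_diag.
apply: cule_trans _ (culeMn _ Sd); rewrite /T.
have Sconj x : psd (x * d * star x) /\ cule (mz (S (x * d * star x))) (mz (S d)).
  have px := psd_conjr x pd; split=> //.
  by apply: (mz_csub (pS _ px) (pS _ pd)); apply: csub_scalar; exact: cle_conj.
have SD x y : S (x + y) = S x + S y by rewrite /S raddfD.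
elim: s {sP w T wT w1 pT oneT} => [|p s IH].
  rewrite big_nil; rewrite /S raddf0; apply: (@cule_trans _ _ _ 0); last exact: cule0.
  by apply/(cule_cz _ (mpos0 A)); [exact/mpsdP/mpsd0|exact: csub0].
rewrite big_cons /= doubleS !mulrS addrA.
have [p1 c1] := Sconj p.1; have [p2 c2] := Sconj (star p.2); rewrite starK in p2 c2.
have pT : psd (\sum_(q <- s) (q.1 * d * star q.1 + star q.2 * d * q.2)).
  by apply: psd_sum => q _; apply: psdD; [exact: psd_conjr|exact: psd_conj].
rewrite SD; apply: cule_trans (mz_add (pS _ (psdD p1 p2)) (pS _ pT)) _; apply: culeD => //.
rewrite SD; apply: cule_trans (mz_add (pS _ p1) (pS _ p2)) _; exact: culeD.
Qed.

End Perforation.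

(** * Modularity *)

Section Modularity.
Variables (R : realType) (A : cstarAlgType R).

Lemma below_mul (B : cstarAlgType R) (x y z : B) : psd z -> z * x = x * z -> z * y = y * z ->
  below x y -> below (x * z) (y * z).
Proof.
move=> pz zx zy [C C0 xy]; exists C => //; rewrite -rsMl -mulrBl; apply: psdM => //.
by rewrite mulrBl mulrBr rsMl rsMr zx zy.
Qed.

Lemma below_norm (B : cstarAlgType R) (x y : B) : psd x -> psd y -> x * y = y * x -> below y (x * y).
Proof.
move=> px py xy; apply: (below_scale (cnorm_ge0 x)).
rewrite -{1}[y]mul1r -rsMl -mulrBl; apply: psdM => //; first exact: psd_le_norm.
by rewrite mulrBl mulrBr rsMl rsMr mul1r mulr1 xy.
Qed.

Lemma cle_trans (B : cstarAlgType R) (x y z : B) : cle x y -> cle y z -> cle x z.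
Proof.
move=> xy yz e e0; have e2 : 0 < e / 2 by rewrite divr_gt0.
have [u uP] := xy _ e2; pose K := cnorm u ^+ 2 + 1.
have K0 : 0 < K by rewrite ltr_wpDl // sqr_ge0.
have [v vP] := yz _ (divr_gt0 e2 K0); exists (u * v).
apply: le_lt_trans (ler_cnorm_dist (u * y * star u) _ _) _; rewrite (splitr e) ltrD //.
have -> : u * y * star u - u * v * z * star (u * v) = u * (y - v * z * star v) * star u.
  by rewrite starM (mulrBr u) (mulrBl (star u)) !mulrA.
rewrite ltr_pdivlMr // in vP; apply: le_lt_trans vP.
apply: le_trans (ler_cnormM _ _) _; rewrite cnorm_starE.
apply: le_trans (_ : cnorm u * cnorm (y - v * z * star v) * cnorm u <= _).
  by rewrite ler_wpM2r ?cnorm_ge0 // ler_cnormM.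
by rewrite mulrAC -expr2 mulrC ler_wpM2l ?cnorm_ge0 // lerDl.
Qed.

(** Squaring three times gives h below [h^8]. Since [h^2] is dominated by q, [h^5] is dominated by
    [q^2 h = q h q], and [h^8 = h^3 h^5] by [h^5]. *)
Lemma cle_conj_sqr (B : cstarAlgType R) (h q : B) : psd h -> psd q -> h * q = q * h ->
  below q (h * h) -> cle h (q * h * q).
Proof.
move=> ph pq hq qh.
have hh : h * (h * h) = h * h * h by rewrite mulrA.
have p2 : psd (h * h) by exact: psdM.
have p4 : psd (h * h * (h * h)) by exact: psdM.
have c1 : cle h (h * h * (h * h)).
  exact: cle_trans (cle_sqr ph) (cle_sqr p2).
have c2 := cle_trans c1 (cle_sqr p4); apply: cle_trans c2 _.
have sq := psd_sa pq.
have pqq : psd (q * h * q) by rewrite -{1}sq; exact: psd_conj.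
have comm : h * h * q = q * (h * h) by rewrite -mulrA hq mulrA hq mulrA.
apply: cle_below => //; first exact: psdM.
have b1 : below (q * q * h) (h * h * (h * h) * h).
  have hp : h * (h * h * (h * h)) = h * h * (h * h) * h by rewrite !mulrA.
  apply: below_mul => //; first by rewrite mulrA hq -mulrA hq mulrA.
  apply: below_trans (_ : below _ (h * h * q)) _.
    exact: (below_mul (x := q) (y := h * h) pq erefl (esym comm)).
  by rewrite comm; apply: (below_mul (x := q) (y := h * h)).
have -> : q * h * q = q * q * h by rewrite -!mulrA hq.
apply: below_trans b1 _.
have -> : h * h * (h * h) * (h * h * (h * h)) = h * (h * h) * (h * h * (h * h) * h) by rewrite !mulrA.
have p3 : psd (h * (h * h)) by apply: psdM.
have p5 : psd (h * h * (h * h) * h) by apply: psdM => //; rewrite !mulrA.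
by apply: below_norm => //; rewrite !mulrA.
Qed.

Lemma adjmx_block m n p q (a : 'M[A]_(m, n)) (b : 'M[A]_(m, p)) (c : 'M[A]_(q, n)) (d : 'M[A]_(q, p)) :
  adjmx (block_mx a b c d) = block_mx (adjmx a) (adjmx c) (adjmx b) (adjmx d).
Proof. by rewrite adjmx_col_mx !adjmx_row_mx -block_mxEh. Qed.

Lemma mean_below (B : cstarAlgType R) (x y z : B) : psd x -> psd y -> x + y = (2 : R) *` z ->
  psd z /\ below z x.
Proof.
move=> px py E; split; last by apply: (below_scale (C := 2)); rewrite // -E addrC addKr.
have -> : z = 2^-1 *` (x + y) by rewrite E rs2 rs_half.
by apply: psdZ; [rewrite invr_ge0|exact: psdD].
Qed.

(** The mean of the matrix and its conjugate by [diag(1, -1)] is [diag(a, d)], so the matrix is at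
    most twice its diagonal. *)
Lemma csub_block_diag n (a b c d : 'M[A]_n.+1) : mpsd (block_mx a b c d : 'M[A]_((n + n.+1).+1)) ->
  csub (block_mx a b c d) (dsum a d).
Proof.
move=> pH; pose J : 'M[A]_(n.+1 + n.+1) := block_mx 1%:M 0 0 (- 1%:M).
have JH : J *m block_mx a b c d *m adjmx J = block_mx a (- b) (- c) d.
  have -> : adjmx J = J by rewrite /J adjmx_block adjmxN !adjmx_scalar !star1 !adjmx0.
  rewrite /J !mulmx_block !(mul1mx, mulmx1, mul0mx, mulmx0, addr0, add0r, mulNmx, mulmxN).
  by rewrite opprK.
have pJ : mpsd (J *m block_mx a b c d *m adjmx J : 'M[A]_((n + n.+1).+1)).
  exact: (@mpsd_conj R A (n + n.+1) (n + n.+1) J (block_mx a b c d) pH).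
have E : (block_mx a b c d + J *m block_mx a b c d *m adjmx J : mxalg A (n + n.+1)) = (2 : R) *` (dsum a d : mxalg A (n + n.+1)).
  rewrite rs2 JH /dsum; have := add_block_mx a b c d a (- b) (- c) d; rewrite !subrr => ->.
  by have := add_block_mx a 0 0 d a 0 0 d; rewrite !addr0.
have [pD bD] := mean_below pH pJ E.
exact: (@csub_below R A (n + n.+1) (block_mx a b c d) (dsum a d) pH pD bD).
Qed.

Section CommutingPair.
Variables (B : cstarAlgType R) (u v : B).
Hypotheses (pu : psd u) (pv : psd v) (uv : u * v = v * u).

Let vu : v * u = u * v. Proof. by []. Qed.
Let vuA z : v * (u * z) = u * (v * z). Proof. by rewrite !mulrA vu. Qed.
Local Ltac comm2 := rewrite -?mulrA; repeat first [rewrite vuA | rewrite vu]; done.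
Let pq : psd (u * u + v * v). Proof. by apply: psdD; apply: psdM. Qed.
Let puv : psd (u * v). Proof. exact: psdM. Qed.
Let Cq x : x * u = u * x -> x * v = v * x -> x * (u * u + v * v) = (u * u + v * v) * x.
Proof.
move=> xu xv; rewrite mulrDr mulrDl; congr (_ + _).
  by rewrite mulrA xu -mulrA xu mulrA.
by rewrite mulrA xv -mulrA xv mulrA.
Qed.
Let bl (x y : B) : psd y -> below (x + y) x.
Proof. by move=> py; apply: below_le; rewrite addrC addKr. Qed.
Let br (x y : B) : psd x -> below (x + y) y.
Proof. by move=> px; rewrite addrC; exact: bl. Qed.
Let Cuu : u * v * u = u * (u * v). Proof. comm2. Qed.
Let Cuv : u * v * v = v * (u * v). Proof. comm2. Qed.

(** [u^2 + v^2] dominates the square of each of the four elements up to a factor, so [cle_conj_sqr]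
    applies; these comparisons absorb the factor [u^2 + v^2] that [dsum_rot] introduces on both
    sides. *)
Lemma pair_cle : [/\ cle u ((u * u + v * v) * u * (u * u + v * v)),
  cle v ((u * u + v * v) * v * (u * u + v * v)),
  cle (u + v) ((u * u + v * v) * (u + v) * (u * u + v * v))
  & cle (u * v) ((u * u + v * v) * (u * v) * (u * u + v * v))].
Proof.
have puu : psd (u * u) by exact: psdM.
have pvv : psd (v * v) by exact: psdM.
have sq : below (u * u + v * v) ((u - v) * (u - v) + (u + v) * (u + v)).
  apply: (below_scale (C := 2)) => //; rewrite rs2.
  rewrite (_ : _ - _ = 0); [exact: psd0|ncring].
have suv : psd ((u - v) * (u - v)) by apply: psd_sqr; apply: saB; exact: psd_sa.
split; apply: cle_conj_sqr => //.
- by apply: Cq.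
- exact: bl.
- by apply: Cq.
- exact: br.
- exact: psdD.
- by apply: Cq; rewrite mulrDl mulrDr uv.
- exact: below_trans sq (br _ suv).
- exact: Cq.
apply: below_trans (_ : below _ (u * v)) _; last exact: below_norm.
apply: (below_scale (C := 1)) => //.
have -> : 1 *` (u * u + v * v) - u * v = 2^-1 *` ((u - v) * (u - v) + (u * u + v * v)).
  rewrite rs1 -[LHS]rs_half; congr (_ *: _).
  have E : v * u = u * v by [].
  transitivity (u * u + v * v - u * v - v * u + (u * u + v * v)); last ncring.
  rewrite E; ncring.
by apply: psdZ; [rewrite invr_ge0|exact: psdD].
Qed.

Lemma pair_below : [/\ below (u + v) (u * u * u + v * v * v),
  below (u * v) (v * u * v + u * v * u),
  below u (u * (u + v) * u + v * (u * v) * v)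
  & below v (v * (u + v) * v + u * (u * v) * u)].
Proof.
have puu : psd (u * u) by exact: psdM.
have pvv : psd (v * v) by exact: psdM.
have pvvv : psd (v * v * v) by apply: psdM => //; comm2.
have puuu : psd (u * u * u) by apply: psdM => //; comm2.
split.
- apply: belowD; [apply: below_trans (bl u pv) _ | apply: below_trans (br v pu) _];
    by apply: below_norm; rewrite // mulrA.
- have -> : v * u * v = v * (u * v) by comm2.
  have -> : u * v * u = u * (u * v) by comm2.
  by apply: belowD; apply: below_norm => //; comm2.
- have -> : u * (u + v) * u = u * u * u + u * v * u by rewrite mulrDr mulrDl.
  have -> : v * (u * v) * v = v * v * v * u by comm2.
  by apply: belowD; [apply: belowD|]; apply: below_norm => //; comm2.
have -> : v * (u + v) * v = u * v * v + v * v * v by rewrite mulrDr mulrDl vu.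
have -> : u * (u * v) * u = u * u * u * v by comm2.
by apply: belowD; [apply: belowD|]; apply: below_norm => //; comm2.
Qed.

End CommutingPair.

(* Conjugation by [[u, v], [-v, u]], whose square modulus is the scalar u^2 + v^2. *)
Lemma dsum_rot n (u v a d : 'M[A]_n.+1) : mpsd u -> mpsd v -> mpsd a -> mpsd d ->
  u *m v = v *m u -> u *m a = a *m u -> v *m a = a *m v -> u *m d = d *m u -> v *m d = d *m v ->
  csub (dsum ((u *m u + v *m v) *m a *m (u *m u + v *m v)) ((u *m u + v *m v) *m d *m (u *m u + v *m v)))
    (dsum (u *m a *m u + v *m d *m v) (v *m a *m v + u *m d *m u)).
Proof.
move=> pu pv pa pd uv ua va ud vd; have au := mpsd_adj pu; have av := mpsd_adj pv.
pose r : 'M[A]_(n.+1 + n.+1) := block_mx u v (- v) u.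
have rE : adjmx r = block_mx u (- v) v u.
  by rewrite /r adjmx_block adjmxN au av.
pose q := u *m u + v *m v.
have rr : adjmx r *m r = dsum q q.
  rewrite rE /r mulmx_block /dsum; congr block_mx; rewrite ?(mulNmx, mulmxN) ?opprK //.
  - by rewrite uv subrr.
  - by rewrite uv subrr.
  - by rewrite addrC.
pose D := dsum a d.
have pD : mpsd (D : 'M[A]_((n + n.+1).+1)) := mpsd_dsum pa pd.
have pH : mpsd (r *m D *m adjmx r : 'M[A]_((n + n.+1).+1)).
  exact: (@mpsd_conj R A (n + n.+1) (n + n.+1) r D pD).
have HE : r *m D *m adjmx r = block_mx (u *m a *m u + v *m d *m v) (v *m d *m u - u *m a *m v)
     (u *m d *m v - v *m a *m u) (v *m a *m v + u *m d *m u).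
  rewrite rE /r /D /dsum !mulmx_block !(mulmx0, addr0, add0r) !(mulNmx, mulmxN) ?opprK.
  by congr block_mx; rewrite addrC.
have -> : dsum (q *m a *m q) (q *m d *m q) = adjmx r *m (r *m D *m adjmx r) *m r.
  rewrite !mulmxA rr -(mulmxA _ (adjmx r) r) rr /D /dsum !mulmx_block.
  by rewrite !(mulmx0, mul0mx, addr0, add0r).
apply: csub_trans (_ : csub _ (r *m D *m adjmx r)) _.
  have := csub_conj (adjmx r) (r *m D *m adjmx r); rewrite (adjmxK r); exact.
by rewrite HE in pH *; exact: csub_block_diag pH.
Qed.

(** The algebraic form of additivity on the supports: [u + v] lives on their union and [u v] on
    their intersection. Rotating [diag(u, v)] yields diagonal entries below [u + v] and [u v];
    rotating [diag(u + v, u v)] yields entries below u and v. *)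
Lemma mz_modular n (u v : mxalg A n) : psd u -> psd v -> u * v = v * u ->
  mz u + mz v = mz (u + v) + mz (u * v).
Proof.
move=> pu pv uv; have puv := psdM pu pv uv; have pupv := psdD pu pv.
have [c1 c2 c3 c4] := pair_cle pu pv uv; have [b1 b2 b3 b4] := pair_below pu pv uv.
have cu : u * (u + v) = (u + v) * u by rewrite mulrDr mulrDl uv.
have cv : v * (u + v) = (u + v) * v by rewrite mulrDr mulrDl uv.
have cu' : u * (u * v) = u * v * u by rewrite -[RHS]mulrA uv.
have cv' : v * (u * v) = u * v * v by rewrite mulrA -uv.
have rot1 := @dsum_rot n u v u v pu pv pu pv uv erefl (esym uv) uv erefl.
have rot2 := @dsum_rot n u v (u + v) (u * v) pu pv pupv puv uv cu cv cu' cv'.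
rewrite (mz_dsum pu pv) (mz_dsum pupv puv).
have conjp (x y : mxalg A n) : psd x -> psd y -> psd (y * x * y).
  by move=> px py; rewrite -{1}(psd_sa py); exact: psd_conj.
have d1 : csub (u : 'M[A]_n.+1) ((u *m u + v *m v) *m u *m (u *m u + v *m v)) := c1.
have d2 : csub (v : 'M[A]_n.+1) ((u *m u + v *m v) *m v *m (u *m u + v *m v)) := c2.
have d3 : csub (u + v : 'M[A]_n.+1) ((u *m u + v *m v) *m (u + v) *m (u *m u + v *m v)) := c3.
have d4 : csub (u *m v : 'M[A]_n.+1) ((u *m u + v *m v) *m (u *m v) *m (u *m u + v *m v)) := c4.
have e1 : csub (u *m u *m u + v *m v *m v : 'M[A]_n.+1) (u + v : 'M[A]_n.+1).
  exact: (csub_below (psdD (conjp _ _ pu pu) (conjp _ _ pv pv)) pupv b1).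
have e2 : csub (v *m u *m v + u *m v *m u : 'M[A]_n.+1) (u *m v : 'M[A]_n.+1).
  exact: (csub_below (psdD (conjp _ _ pu pv) (conjp _ _ pv pu)) puv b2).
have e3 : csub (u *m (u + v) *m u + v *m (u *m v) *m v : 'M[A]_n.+1) (u : 'M[A]_n.+1).
  exact: (csub_below (psdD (conjp _ _ pupv pu) (conjp _ _ puv pv)) pu b3).
have e4 : csub (v *m (u + v) *m v + u *m (u *m v) *m u : 'M[A]_n.+1) (v : 'M[A]_n.+1).
  exact: (csub_below (psdD (conjp _ _ pupv pv) (conjp _ _ puv pu)) pv b4).
have pw1 := mpsd_dsum pu pv; have pw2 := mpsd_dsum pupv puv.
apply: cz_eq.
- by apply/mpsdP; exact: pw1.
- by apply/mpsdP; exact: pw2.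
- exact: (csub_trans (csub_dsum d1 d2) (csub_trans rot1 (csub_dsum e1 e2))).
exact: (csub_trans (csub_dsum d3 d4) (csub_trans rot2 (csub_dsum e3 e4))).
Qed.

End Modularity.

(** * Dimension functions *)

Section DimensionFunction.
Variables (R : realType) (B : cstarAlgType R).
Implicit Types (a b c u v w x y : B) (s t d : R).

Lemma pcut_comm t c x : sa c -> x * c = c * x -> x * pcut t c = pcut t c * x.
Proof. by move=> sc xc; apply: fc_comm => //; exact: lucont_cut. Qed.

Lemma fc_below f g a K : psd a -> lucont f -> lucont g -> 0 <= K ->
  (forall s, 0 <= s -> f s <= K * g s) -> below (fc g a) (fc f a).
Proof.
move=> pa lf lg K0 fg; have sa_a := psd_sa pa; exists K => //.
by rewrite -fcZ //; apply: fc_psd_le => //; exact: lucontZ.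
Qed.

Lemma lucont_cutN t : lucont (fun s : R => Num.max (t - s) 0).
Proof.
apply: (lucont_comp (g := fun s => t - s) (lucont_max 0)).
by apply: lucontB; [exact: lucont_cst|exact: lucont_id].
Qed.

Lemma pcut_shift t d c : sa c -> pcut (t + d) (c + d *` 1) = pcut t c.
Proof.
move=> sc; have lid := @lucont_id R; have lc := @lucont_cst R d.
have E : fc (fun s : R => s + d) c = c + d *` 1.
  by apply: etrans (fcD sc lid lc) _; rewrite fc_id // fc_cst.
have lsd : lucont (fun s : R => s + d) := lucontD lid lc.
rewrite -E /pcut (fc_comp sc (lucont_cut (t + d)) lsd).
by apply: fc_eq => s; rewrite /cut /=; congr Num.max; ring.
Qed.

Lemma pcut_mulcut t d c : psd c -> 0 <= t -> 0 <= d ->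
  psd (pcut (t + d) c * pcut t c - d *` pcut (t + d) c).
Proof.
move=> pc t0 d0; have sc := psd_sa pc; have lc := @lucont_cut R.
rewrite -fcM // -fcZ //; apply: fc_psd_le => //; [exact: lucontZ|exact: lucontM|].
move=> s s0; rewrite mulrC /cut; have [h|h] := leP (s - (t + d)) 0; first by rewrite !mul0r.
by rewrite ler_wpM2l ?(ltW h) // le_max; apply/orP; left; lra.
Qed.

Lemma pcut_sub_psd t a : psd a -> psd (pcut t a - (a - t *` 1)).
Proof.
move=> pa; have sa_a := psd_sa pa; have lid := @lucont_id R; have lt := @lucont_cst R t.
have -> : a - t *` 1 = fc (fun s => s - t) a.
  by apply: esym; apply: etrans (fcB sa_a lid lt) _; rewrite fc_id // fc_cst.
apply: fc_psd_le => //; [exact: lucontB|exact: lucont_cut|].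
by move=> s s0; rewrite /cut le_max lexx.
Qed.

(** With P and Q the cuts of c at t + d and t, it is enough by [pcut_le_comm] that [P + Q v / d]
    dominates [c + v - (t + d)]. The difference is [(N (d - v) + (N + Q - d) v) / d], where N is the
    negative part of [c - (t + d)] and [N + Q >= d]. *)
Lemma upper_below t d c v : psd c -> psd v -> psd (d *` 1 - v) -> c * v = v * c -> 0 < d ->
  below (pcut (t + d) c + pcut t c * v) (pcut (t + d) (c + v)).
Proof.
move=> pc pv dv cv d0; have sc := psd_sa pc; have lc := @lucont_cut R.
pose P := pcut (t + d) c; pose Q := pcut t c; pose N := fc (fun s => Num.max (t + d - s) 0) c.
have lN := lucont_cutN (t + d).
have pP : psd P := pcut_psd _ sc; have pQ : psd Q := pcut_psd _ sc.
have pN : psd N by apply: fc_psd => // s; rewrite le_max lexx orbT.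
have vN : v * N = N * v by apply: fc_comm.
have vQ : v * Q = Q * v by apply: pcut_comm.
have vP : v * P = P * v by apply: pcut_comm.
have di : 0 <= d^-1 by rewrite invr_ge0 ltW.
have E1 : P - N = c - (t + d) *` 1.
  apply: etrans (esym (fcB sc (lc _) lN)) _.
  rewrite (@fc_eq _ _ _ (fun s => s - (t + d))).
    by apply: etrans (fcB sc (@lucont_id R) (lucont_cst _)) _; rewrite fc_id // fc_cst.
  move=> s; rewrite /cut; have [h|h] := leP (s - (t + d)) 0; first by rewrite max_l; lra.
  by rewrite max_r; lra.
have pNQ : psd (N + Q - d *` 1).
  rewrite -(fc_cst d sc) -fcD // -fcB //; [|exact: lucontD|exact: lucont_cst].
  apply: fc_psd => //; first by apply: lucontB; [exact: lucontD|exact: lucont_cst].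
  move=> s; rewrite subr_ge0 /cut.
  have h1 : t + d - s <= Num.max (t + d - s) 0 by rewrite le_max lexx.
  have h2 : s - t <= Num.max (s - t) 0 by rewrite le_max lexx.
  lra.
have E2 : P + d^-1 *` (Q * v) - (c + v - (t + d) *` 1) =
    d^-1 *` (N * (d *` 1 - v) + (N + Q - d *` 1) * v).
  have -> : N * (d *` 1 - v) + (N + Q - d *` 1) * v = d *` N + Q * v - d *` v.
    rewrite mulrBr rsMr mulr1 mulrBl mulrDl rsMl mul1r addrA; congr (_ - _).
    by rewrite addrA subrK.
  rewrite scalerBr scalerDr -!rsM mulVf ?gt_eqF // !rs1.
  have -> : c + v - (t + d) *` 1 = P - N + v by rewrite E1 addrAC.
  by move: (d^-1 *` (Q * v)) => D; ncring.
apply: below_trans (_ : below _ (P + d^-1 *` (Q * v))) _.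
  apply: belowD; first by apply: below_le; rewrite addrC addKr; exact: psdM.
  have pQv : psd (Q * v) by exact: psdM.
  apply: (below_scale di); rewrite scalerDr addrK; exact: psdZ.
apply: below_le; apply: pcut_le_comm.
- by apply: saD => //; exact: psd_sa.
- by apply: psdD => //; apply: psdZ => //; exact: psdM.
- have cP : c * P = P * c by apply: pcut_comm.
  have cQ : c * Q = Q * c by apply: pcut_comm.
  have h1 : (c + v) * P = P * (c + v) by rewrite mulrDl mulrDr cP vP.
  have h2 : (c + v) * (Q * v) = Q * v * (c + v).
    rewrite mulrDl mulrDr; congr (_ + _); first by rewrite mulrA cQ -!mulrA cv.
    by rewrite mulrA vQ.
  by rewrite (mulrDr (c + v)) (mulrDl P _ (c + v)) h1 rsMr rsMl h2.
rewrite E2; apply: psdZ => //; apply: psdD; apply: psdM => //.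
  by rewrite mulrBr mulrBl rsMr rsMl mulr1 mul1r vN.
by rewrite mulrBr mulrBl mulrDr mulrDl rsMr rsMl mulr1 mul1r vN vQ.
Qed.

(** [w v = d w] says that v equals d where w lives, so w intertwines [c + v] with [c + d] and
    carries [(c + v - (t + d))_+] to [(c - t)_+]. *)
Lemma lower_below t d c v w : psd c -> psd v -> psd w -> c * v = v * c -> c * w = w * c ->
  w * v = d *` w -> v * w = d *` w ->
  below (pcut (t + d) (c + v)) (pcut (t + d) c + pcut t c * w).
Proof.
move=> pc pv pw cv cw wv vw; have sc := psd_sa pc; have lc := @lucont_cut R.
have pcv := psdD pc pv; have scv := psd_sa pcv.
set X := pcut (t + d) (c + v); have pX : psd X := pcut_psd _ scv.
have cX : c * X = X * c by apply: pcut_comm; rewrite // mulrDl mulrDr cv.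
have wX : w * X = pcut t c * w.
  rewrite -(pcut_shift t d sc); apply: fc_intertwine => //.
    by apply: saD => //; exact: saC.
  by rewrite mulrDr mulrDl -cw wv rsMl mul1r.
have wX' : w * X = X * w.
  apply: pcut_comm => //; by rewrite mulrDl mulrDr cw wv vw.
apply: belowD; last by rewrite -wX; exact: below_norm.
apply: below_le; apply: pcut_le_comm => //.
have -> : X - (c - (t + d) *` 1) = (X - (c + v - (t + d) *` 1)) + v.
  by rewrite -addrA; congr (_ + _); rewrite !opprB [c + v]addrC -addrA [RHS]addrC; ncring.
by apply: psdD => //; exact: pcut_sub_psd.
Qed.

Lemma pcut_antitone s t a : psd a -> 0 <= s <= t -> below (pcut s a) (pcut t a).
Proof.
move=> pa /andP[s0 st]; apply: (fc_below (K := 1)) => // [||r r0]; try exact: lucont_cut.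
by rewrite mul1r /cut ge_max !le_max lexx orbT andbT; apply/orP; left; lra.
Qed.

Variables (Phi : B -> R) (C : R).
Hypotheses (Phi0 : Phi 0 = 0) (Phi_le : forall a, psd a -> Phi a <= C).
Hypothesis Phi_mono : forall a b, psd a -> psd b -> cle a b -> Phi a <= Phi b.
Hypothesis Phi_mod : forall a b, psd a -> psd b -> a * b = b * a ->
  Phi (a + b) + Phi (a * b) = Phi a + Phi b.

Lemma Phi_below a b : psd a -> psd b -> below b a -> Phi a <= Phi b.
Proof. by move=> pa pb ab; apply: Phi_mono => //; exact: cle_below. Qed.

Lemma Phi_ge0 a : psd a -> 0 <= Phi a.
Proof.
move=> pa; rewrite -Phi0; apply: Phi_below => //; first exact: psd0.
by apply: below_le; rewrite subr0.
Qed.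

(* In measure terms, {c + v > t + d} is contained in {c > t + d} U ({c > t} n {v > 0}); the
   last two terms telescope when summed over t in a progression of step d. *)
Lemma upper_term t d c v : psd c -> psd v -> psd (d *` 1 - v) -> c * v = v * c -> 0 <= t -> 0 < d ->
  Phi (pcut (t + d) (c + v)) <= Phi (pcut (t + d) c) + (Phi (pcut t c * v) - Phi (pcut (t + d) c * v)).
Proof.
move=> pc pv dv cv t0 d0; have sc := psd_sa pc.
set P := pcut (t + d) c; set Q := pcut t c.
have pP : psd P := pcut_psd _ sc; have pQ : psd Q := pcut_psd _ sc.
have vQ : v * Q = Q * v by apply: pcut_comm.
have vP : v * P = P * v by apply: pcut_comm.
have cQ : c * Q = Q * c by apply: pcut_comm.
have QP : Q * P = P * Q by apply: pcut_comm.
have pQv : psd (Q * v) by exact: psdM.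
have pPv : psd (P * v) by exact: psdM.
have PQv : P * (Q * v) = Q * v * P by rewrite mulrA -QP -!mulrA vP.
have pPQv : psd (P * (Q * v)) by exact: psdM.
have h1 : Phi (pcut (t + d) (c + v)) <= Phi (P + Q * v).
  apply: Phi_below; [apply: pcut_psd; exact/psd_sa/psdD|exact: psdD|exact: upper_below].
have h2 := Phi_mod pP pQv PQv.
have h3 : Phi (P * v) <= Phi (P * (Q * v)).
  apply: Phi_below => //; have := pcut_mulcut pc t0 (ltW d0); rewrite -/P -/Q => PQ.
  apply: (below_scale (C := d^-1)); first by rewrite invr_ge0 ltW.
  have -> : d^-1 *` (P * (Q * v)) - P * v = d^-1 *` ((P * Q - d *` P) * v).
    by rewrite mulrBl rsMl scalerBr -rsM mulVf ?gt_eqF // rs1 mulrA.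
  apply: psdZ; first by rewrite invr_ge0 ltW.
  have vPQ : v * (P * Q) = P * Q * v by rewrite mulrA vP -mulrA vQ mulrA.
  by apply: psdM => //; rewrite (mulrBr v) (mulrBl v) rsMr rsMl vP vPQ.
move: h1 h2 h3; lra.
Qed.

Lemma lower_term t d c v w : psd c -> psd v -> psd w -> c * v = v * c -> c * w = w * c ->
  w * v = d *` w -> v * w = d *` w ->
  Phi (pcut (t + d) c) + (Phi (pcut t c * w) - Phi (pcut (t + d) c * w)) <= Phi (pcut (t + d) (c + v)).
Proof.
move=> pc pv pw cv cw wv vw; have sc := psd_sa pc.
set P := pcut (t + d) c; set Q := pcut t c.
have pP : psd P := pcut_psd _ sc; have pQ : psd Q := pcut_psd _ sc.
have wQ : w * Q = Q * w by apply: pcut_comm.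
have wP : w * P = P * w by apply: pcut_comm.
have cQ : c * Q = Q * c by apply: pcut_comm.
have QP : Q * P = P * Q by apply: pcut_comm.
have pQw : psd (Q * w) by exact: psdM.
have pPw : psd (P * w) by exact: psdM.
have PQw : P * (Q * w) = Q * w * P by rewrite mulrA -QP -!mulrA wP.
have pPQw : psd (P * (Q * w)) by exact: psdM.
have h1 : Phi (P + Q * w) <= Phi (pcut (t + d) (c + v)).
  apply: Phi_below; [exact: psdD|apply: pcut_psd; exact/psd_sa/psdD|exact: lower_below].
have h2 := Phi_mod pP pQw PQw.
have h3 : Phi (P * (Q * w)) <= Phi (P * w).
  apply: Phi_below => //; rewrite mulrA -QP -mulrA; apply: below_norm => //.
  by rewrite mulrA QP -mulrA -wQ mulrA.
move: h1 h2 h3; lra.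
Qed.

(** The bottom term, at level 0, of the telescoping sum in [lower_sum]. Here w is dominated by v
    because it is a multiple of [w v]. *)
Lemma lower_term0 d c v w : psd c -> psd v -> psd w -> c * v = v * c -> c * w = w * c ->
  w * v = d *` w -> v * w = d *` w -> 0 < d ->
  Phi c + (Phi w - Phi (c * w)) <= Phi (c + v).
Proof.
move=> pc pv pw cv cw wv vw d0.
have h1 : Phi (c + w) <= Phi (c + v).
  apply: Phi_below; [exact: psdD|exact: psdD|].
  apply: belowD; first by apply: below_le; rewrite addrC addKr.
  have [K K0 h] : below v (w * v) by apply: below_norm; rewrite // wv vw.
  apply: below_trans (_ : below _ v) _; first by apply: below_le; rewrite addrK.
  apply: (below_scale (C := d^-1 * K)); first by rewrite mulr_ge0 // invr_ge0 ltW.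
  have -> : (d^-1 * K) *` v - w = d^-1 *` (K *` v - w * v).
    by rewrite wv scalerBr -!rsM mulVf ?gt_eqF // rs1.
  by apply: psdZ; rewrite // invr_ge0 ltW.
have := Phi_mod pc pw cw; move: h1; lra.
Qed.

Lemma upper_sum d c v K : psd c -> psd v -> psd (d *` 1 - v) -> c * v = v * c -> 0 < d ->
  \sum_(j < K) Phi (pcut (j.+1%:R * d) (c + v)) <= \sum_(j < K) Phi (pcut (j.+1%:R * d) c) + Phi v.
Proof.
move=> pc pv dv cv d0.
have pw j : psd (pcut (j%:R * d) c * v).
  by apply: psdM => //; [exact: pcut_psd (psd_sa pc)|apply/esym/pcut_comm => //; exact: psd_sa].
suff : \sum_(j < K) Phi (pcut (j.+1%:R * d) (c + v)) <= \sum_(j < K) Phi (pcut (j.+1%:R * d) c) +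
    (Phi (pcut (0%:R * d) c * v) - Phi (pcut (K%:R * d) c * v)).
  have := Phi_ge0 (pw K); have : Phi (pcut (0%:R * d) c * v) <= Phi v.
    by apply: Phi_below => //; rewrite mul0r cut0 //; exact: below_norm.
  lra.
elim: K => [|K IH]; first by rewrite !big_ord0 subrr addr0.
rewrite !big_ord_recr /=.
have tK : 0 <= K%:R * d by rewrite mulr_ge0 // ltW.
have := upper_term pc pv dv cv tK d0.
have -> : K%:R * d + d = K.+1%:R * d by rewrite -natr1 mulrDl mul1r.
move: IH; lra.
Qed.

Lemma lower_sum d c v w K : psd c -> psd v -> psd w -> c * v = v * c -> c * w = w * c ->
  w * v = d *` w -> v * w = d *` w -> 0 < d -> cnorm c <= K%:R * d ->
  \sum_(j < K.+1) Phi (pcut (j%:R * d) c) + Phi w <= \sum_(j < K.+1) Phi (pcut (j%:R * d) (c + v)).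
Proof.
move=> pc pv pw cv cw wv vw d0 cK.
have {cK} : Phi (pcut (K%:R * d) c * w) = 0 by rewrite pcut_eq0 // mul0r.
suff : \sum_(j < K.+1) Phi (pcut (j%:R * d) c) + (Phi w - Phi (pcut (K%:R * d) c * w)) <=
    \sum_(j < K.+1) Phi (pcut (j%:R * d) (c + v)) by lra.
elim: K => [|K IH].
  rewrite !big_ord_recr !big_ord0 /= !add0r mul0r !cut0 //; last exact: psdD.
  exact: (lower_term0 pc pv pw cv cw wv vw d0).
rewrite big_ord_recr [leRHS]big_ord_recr /=.
have := lower_term (K%:R * d) pc pv pw cv cw wv vw.
have -> : K%:R * d + d = K.+1%:R * d by rewrite -natr1 mulrDl mul1r.
move: IH; lra.
Qed.

(* The slices v of b between the levels i d and (i + 1) d sum up to b. *)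
Lemma slice d b i : psd b -> 0 < d -> let v := pcut (i%:R * d) b - pcut (i.+1%:R * d) b in
  let w := pcut (i.+1%:R * d) b in
  [/\ psd v, psd (d *` 1 - v), w * v = d *` w, v * w = d *` w & below (pcut (i%:R * d) b) v].
Proof.
move=> pb d0 v w; have sb := psd_sa pb; have lc := @lucont_cut R.
have S1 : (i.+1%:R : R) * d = i%:R * d + d by rewrite -natr1 mulrDl mul1r.
have i0 : 0 <= i%:R * d by rewrite mulr_ge0 // ltW.
have lv : lucont (fun s => cut (i%:R * d) s - cut (i.+1%:R * d) s) by apply: lucontB.
have vE : v = fc (fun s => cut (i%:R * d) s - cut (i.+1%:R * d) s) b by rewrite fcB.
have cutB s : 0 <= cut (i%:R * d) s - cut (i.+1%:R * d) s <= d.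
  rewrite S1 /cut; have [h1|h1] := leP (s - i%:R * d) 0.
    by have [h2|h2] := leP (s - (i%:R * d + d)) 0; apply/andP; lra.
  by have [h2|h2] := leP (s - (i%:R * d + d)) 0; apply/andP; lra.
have wv : w * v = d *` w.
  rewrite vE /w -fcM // -fcZ //; apply: fc_eq => s.
  rewrite S1 /cut; have [h1|h1] := leP (s - (i%:R * d + d)) 0; first by rewrite mul0r mulr0.
  rewrite max_l; [|lra]; ring.
have vw : v * w = w * v.
  by rewrite vE /w -!fcM //; apply: fc_eq => s; rewrite mulrC.
have pv : psd v by rewrite vE; apply: fc_psd => // s; case/andP: (cutB s).
split=> //; [|by rewrite vw|].
- rewrite vE -(fc_cst d sb) -fcB //; [|exact: lucont_cst].
  apply: fc_psd => //; first by apply: lucontB => //; exact: lucont_cst.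
  by move=> s; rewrite subr_ge0; case/andP: (cutB s).
by apply: below_le; rewrite /v opprB addrC subrK; exact: pcut_psd.
Qed.

Section Slices.
Variables (d : R) (a b : B).
Hypotheses (d0 : 0 < d) (pa : psd a) (pb : psd b) (ab : a * b = b * a).
(** [a + min(b, k d)]: it grows from a to [a + b], one slice of b at a time. *)
Let c k := a + (b - pcut (k%:R * d) b).
Let Kd k : 0 <= k%:R * d. Proof. by rewrite mulr_ge0 // ltW. Qed.
Let pc k : psd (c k). Proof. by apply: psdD => //; exact: pcut_le. Qed.
Let cS k : c k.+1 = c k + (pcut (k%:R * d) b - pcut (k.+1%:R * d) b).
Proof. by rewrite /c -!addrA; congr (_ + _); rewrite addKr. Qed.
Let acut t : a * pcut t b = pcut t b * a.
Proof. by apply: pcut_comm => //; exact: psd_sa. Qed.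
Let cutcut t s : pcut t b * pcut s b = pcut s b * pcut t b.
Proof. by apply: pcut_comm; [exact: psd_sa|apply/esym/pcut_comm => //; exact: psd_sa]. Qed.
Let bcut t : b * pcut t b = pcut t b * b.
Proof. by apply: pcut_comm => //; exact: psd_sa. Qed.
Let ccut k t : c k * pcut t b = pcut t b * c k.
Proof. by rewrite /c mulrDl mulrDr acut mulrBl mulrBr bcut cutcut. Qed.
Let cv k : c k * (pcut (k%:R * d) b - pcut (k.+1%:R * d) b) =
  (pcut (k%:R * d) b - pcut (k.+1%:R * d) b) * c k.
Proof. by rewrite mulrBr mulrBl !ccut. Qed.
Let c0 : c 0 = a. Proof. by rewrite /c mul0r cut0 // subrr addr0. Qed.
Let cK k : cnorm b <= k%:R * d -> c k = a + b.
Proof. by move=> h; rewrite /c pcut_eq0 // subr0. Qed.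

(** The i-th slice of b lives where b exceeds [i d], so it adds at most [Phi (pcut (i d) b)], and
    the levels of b start at 0. In [sum_lower] it adds at least [Phi (pcut ((i + 1) d) b)], and they
    start at d. *)
Lemma sum_upper K : cnorm b <= K%:R * d ->
  \sum_(j < K) Phi (pcut (j.+1%:R * d) (a + b)) <=
  \sum_(j < K) Phi (pcut (j.+1%:R * d) a) + \sum_(j < K) Phi (pcut (j%:R * d) b).
Proof.
move=> /cK <-; suff H k : \sum_(j < K) Phi (pcut (j.+1%:R * d) (c k)) <=
  \sum_(j < K) Phi (pcut (j.+1%:R * d) a) + \sum_(j < k) Phi (pcut (j%:R * d) b) by exact: H.
elim: k => [|k IH]; first by rewrite c0 big_ord0 addr0.
have [pv dv _ _ bv] := slice k pb d0.
rewrite cS big_ord_recr /= [leRHS]addrA.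
apply: le_trans (upper_sum K (pc k) pv dv (cv k) d0) _; apply: lerD => //.
by apply: Phi_below => //; exact/pcut_psd/psd_sa.
Qed.

Lemma sum_lower K : cnorm a + cnorm b <= K%:R * d ->
  \sum_(j < K.+1) Phi (pcut (j%:R * d) a) + \sum_(j < K) Phi (pcut (j.+1%:R * d) b) <=
  \sum_(j < K.+1) Phi (pcut (j%:R * d) (a + b)).
Proof.
move=> abK; have bK : cnorm b <= K%:R * d by rewrite (le_trans _ abK) // lerDr cnorm_ge0.
rewrite -(cK bK); suff H k : \sum_(j < K.+1) Phi (pcut (j%:R * d) a) +
  \sum_(j < k) Phi (pcut (j.+1%:R * d) b) <= \sum_(j < K.+1) Phi (pcut (j%:R * d) (c k)) by exact: H.
elim: k => [|k IH]; first by rewrite c0 big_ord0 addr0.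
have [pv _ wv vw _] := slice k pb d0.
rewrite cS [X in _ + X <= _]big_ord_recr /= [leLHS]addrA.
apply: le_trans (_ : \sum_(j < K.+1) Phi (pcut (j%:R * d) (c k)) + Phi (pcut (k.+1%:R * d) b) <= _).
  by rewrite lerD2r.
apply: (lower_sum (w := pcut (k.+1%:R * d) b) (pc k) pv _ (cv k) _ wv vw d0).
- exact/pcut_psd/psd_sa.
- exact: ccut.
apply: le_trans abK; apply: le_trans (ler_cnormD _ _) _; rewrite lerD2l.
by apply: psd_norm_mono; [exact: pcut_le|rewrite subKr; exact/pcut_psd/psd_sa].
Qed.

End Slices.

End DimensionFunction.

(** * Integration of a dimension function *)

Section DyadicSums.
Variable R : realType.
Implicit Types (F : R -> R) (h : R -> R).

Definition dy n : R := 2^-1 ^+ n.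

Lemma dy_gt0 n : 0 < dy n. Proof. by rewrite exprn_gt0 // invr_gt0. Qed.

Lemma dyS n : dy n = 2 * dy n.+1.
Proof. by rewrite /dy exprS mulrA divff // mul1r. Qed.

Lemma dy_pow n : (2 ^ n)%:R * dy n = 1.
Proof. by rewrite /dy natrX exprVn divff // expf_neq0. Qed.

Lemma dy_cvg0 : dy @ \oo --> (0 : R).
Proof. by apply: cvg_expr; rewrite ger0_norm ?invr_ge0 // invf_lt1 // ltr1n. Qed.

(* Lower Riemann sums of F on [0, N]. *)
Definition dyadic F N n : R := dy n * \sum_(j < N * 2 ^ n) F (j.+1%:R * dy n).

Definition antitone F := forall s t, 0 <= s -> s <= t -> F t <= F s.

Lemma sum_double (G : nat -> R) M : \sum_(j < M.*2) G j = \sum_(i < M) (G i.*2 + G i.*2.+1).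
Proof.
elim: M => [|M IH]; first by rewrite !big_ord0.
by rewrite doubleS !big_ord_recr /= IH addrA.
Qed.

Lemma dyadic_homo F N n : antitone F -> dyadic F N n <= dyadic F N n.+1.
Proof.
move=> aF; rewrite /dyadic expnS mulnCA mul2n (sum_double (fun j => F (j.+1%:R * dy n.+1))).
rewrite {1}dyS -mulrA mulrCA ler_pM2l ?dy_gt0 // mulr_sumr ler_sum // => i _.
have -> : i.+1%:R * dy n = i.*2.+2%:R * dy n.+1.
  by rewrite dyS mulrA -natrM -doubleS -mul2n mulnC.
rewrite [leLHS]mulr_natl mulr2n lerD2r; apply: aF.
  by rewrite mulr_ge0 // ltW // dy_gt0.
by rewrite ler_pM2r ?dy_gt0 // ler_nat.
Qed.

Lemma dyadic_le F N n (C : R) : (forall s, 0 <= s -> F s <= C) -> dyadic F N n <= N%:R * C.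
Proof.
move=> FC; apply: le_trans (_ : dy n * (\sum_(j < N * 2 ^ n) C) <= _).
  rewrite ler_pM2l ?dy_gt0 // ler_sum // => j _; apply: FC.
  by rewrite mulr_ge0 // ltW // dy_gt0.
rewrite sumr_const card_ord -[C *+ _]mulr_natl natrM !mulrA.
by rewrite [dy n * _]mulrC -(mulrA N%:R) [dy n * _]mulrC dy_pow mulr1.
Qed.

Lemma dyadic_cvg F N (C : R) : antitone F -> (forall s, 0 <= s -> F s <= C) -> cvgn (dyadic F N).
Proof.
move=> aF FC; apply: nondecreasing_is_cvgn.
  by apply/nondecreasing_seqP => n; exact: dyadic_homo.
by exists (N%:R * C) => _ [n _ <-]; exact: dyadic_le.
Qed.

Lemma dyadic_indep F N M n B : (forall s, B <= s -> F s = 0) -> B <= N%:R -> (N <= M)%N ->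
  dyadic F M n = dyadic F N n.
Proof.
move=> F0 BN NM; rewrite /dyadic; congr (_ * _).
rewrite -!(big_mkord xpredT (fun j => F (j.+1%:R * dy n))).
rewrite (big_cat_nat _ (n := (N * 2 ^ n)%N)) //=; last by rewrite leq_mul2r NM orbT.
rewrite [X in _ + X]big_nat_cond [X in _ + X]big1 ?addr0 // => j; rewrite andbT => /andP[jN _].
apply: F0; apply: le_trans BN _; have -> : N%:R = (N * 2 ^ n)%:R * dy n by rewrite natrM -mulrA dy_pow mulr1.
by rewrite ler_pM2r ?dy_gt0 // ler_nat ltnW.
Qed.

(** Cauchy's functional equation: nonnegativity makes h monotone, and [h (n s)] is compared with h
    at the integers around [n s]. *)
Lemma additive_linear h : (forall s t, 0 <= s -> 0 <= t -> h (s + t) = h s + h t) ->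
  (forall s, 0 <= s -> 0 <= h s) -> forall s, 0 <= s -> h s = s * h 1.
Proof.
move=> hD h0 s s0.
have mono u v : 0 <= u -> u <= v -> h u <= h v.
  by move=> u0 uv; rewrite -(subrK u v) addrC hD ?subr_ge0 // lerDl h0 // subr_ge0.
have hn u n : 0 <= u -> h (n%:R * u) = n%:R * h u.
  move=> u0; elim: n => [|n IH].
    by rewrite !mul0r; apply: (addrI (h 0)); rewrite -hD // !addr0.
  by rewrite -natr1 !mulrDl !mul1r hD ?IH // mulr_ge0.
have hk m : h m%:R = m%:R * h 1 by rewrite -hn ?mulr1.
apply/eqP; rewrite eq_le; apply/andP; split; apply/ler_addgt0Pl => e e0.
all: have [n nP] : exists n, h 1 < n.+1%:R * e
  by exists (Num.truncn (h 1 / e)); rewrite -ltr_pdivrMr // truncnS_gt.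
all: have n0 : 0 < n.+1%:R :> R by [].
all: have m0 : 0 <= n.+1%:R * s by rewrite mulr_ge0.
all: have /andP[k1 k2] := truncn_itv m0; set k := Num.truncn _ in k1 k2.
all: rewrite -(ler_pM2l n0) mulrDr -?hn //.
- have := mono _ _ m0 (ltW k2); rewrite hk => H; apply: le_trans H _.
  rewrite -natr1 mulrDl mul1r [leRHS]addrC lerD ?(ltW nP) //.
  by rewrite mulrA ler_wpM2r ?h0.
- have := mono _ _ (ler0n R k) k1; rewrite hk => H.
  apply: le_trans (_ : k%:R * h 1 + h 1 <= _); last by rewrite addrC lerD // ltW.
  by rewrite mulrA -[X in _ + X]mul1r -mulrDl natr1 ler_wpM2r ?h0 // ltW.
Qed.

End DyadicSums.

Section TraceOfDimension.
Variables (R : realType) (B : cstarAlgType R).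
Implicit Types (a b p q x y : B) (r s t : R).

Record dimension_function (Phi : B -> R) (C : R) : Prop := DimensionFunction {
  dim0 : Phi 0 = 0;
  dim_le : forall a, psd a -> Phi a <= C;
  dim_mono : forall a b, psd a -> psd b -> cle a b -> Phi a <= Phi b;
  dim_mod : forall a b, psd a -> psd b -> a * b = b * a -> Phi (a + b) + Phi (a * b) = Phi a + Phi b }.

Variables (Phi : B -> R) (C : R).
Hypothesis dP : dimension_function Phi C.

Let Phi_ge a : psd a -> 0 <= Phi a. Proof. exact: (Phi_ge0 (dim0 dP) (dim_mono dP)). Qed.
Let C0 : 0 <= C. Proof. by rewrite -(dim0 dP); apply: (dim_le dP); exact: psd0. Qed.

Definition level a s := Phi (pcut s a).

Lemma level_antitone a : psd a -> antitone (level a).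
Proof.
move=> pa s t s0 st; apply: (Phi_below (dim_mono dP)); try exact/pcut_psd/psd_sa.
by apply: pcut_antitone; rewrite // s0.
Qed.

Lemma level_le a s : psd a -> level a s <= C.
Proof. by move=> pa; apply: (dim_le dP); exact/pcut_psd/psd_sa. Qed.

Lemma level_eq0 a s : psd a -> cnorm a <= s -> level a s = 0.
Proof. by move=> pa h; rewrite /level pcut_eq0 // (dim0 dP). Qed.

(* The integral of [level a] over [0, +oo[. *)
Definition tr a : R := limn (dyadic (level a) (Num.truncn (cnorm a)).+1).

Lemma tr_lim a N : psd a -> cnorm a <= N%:R -> dyadic (level a) N @ \oo --> tr a.
Proof.
move=> pa aN; pose M := (Num.truncn (cnorm a)).+1.
have aM : cnorm a <= M%:R by apply/ltW/truncnS_gt.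
have cM : dyadic (level a) M @ \oo --> tr a.
  exact: (@dyadic_cvg _ _ M _ (level_antitone pa) (fun s _ => level_le s pa)).
have F0 s : cnorm a <= s -> level a s = 0 by exact: level_eq0.
rewrite (_ : dyadic (level a) N = dyadic (level a) M) //; apply: funext => n.
have [NM|MN] := leqP N M; first by rewrite (dyadic_indep _ F0 aN NM).
by rewrite (dyadic_indep _ F0 aM (ltnW MN)).
Qed.

Lemma dyadic_le_tr a N n : psd a -> cnorm a <= N%:R -> dyadic (level a) N n <= tr a.
Proof.
move=> pa aN; have l := tr_lim pa aN; rewrite -(cvg_lim (@Rhausdorff R) l).
apply: nondecreasing_cvgn_le; last by apply/cvg_ex; exists (tr a).
by apply/nondecreasing_seqP => m; exact/dyadic_homo/level_antitone.
Qed.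

Lemma tr_ge0 a : psd a -> 0 <= tr a.
Proof.
move=> pa; have aM : cnorm a <= (Num.truncn (cnorm a)).+1%:R by apply/ltW/truncnS_gt.
apply: le_trans (@dyadic_le_tr _ _ 0%N pa aM); apply: mulr_ge0; first exact/ltW/dy_gt0.
by apply: sumr_ge0 => j _; exact/Phi_ge/pcut_psd/psd_sa.
Qed.

(** At mesh d at most [s / d + 1] levels are nonzero, each contributing at most G; the extra one
    disappears as d tends to 0. *)
Lemma tr_le a s G : psd a -> cnorm a <= s -> (forall t, 0 < t -> level a t <= G) -> tr a <= s * G.
Proof.
move=> pa a_s aG; have s0 : 0 <= s by rewrite (le_trans _ a_s) // cnorm_ge0.
have aM : cnorm a <= (Num.truncn s).+1%:R by apply: le_trans a_s _; apply/ltW/truncnS_gt.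
have l := tr_lim pa aM; rewrite -(cvg_lim (@Rhausdorff R) l).
have G0 : 0 <= G by apply: le_trans (aG 1 _) => //; exact/Phi_ge/pcut_psd/psd_sa.
have l2 : (fun n => (s + dy R n) * G) @ \oo --> s * G.
  rewrite -[X in _ --> X * G]addr0; apply: cvgM; last exact: cvg_cst.
  by apply: cvgD; [exact: cvg_cst|exact: dy_cvg0].
rewrite -(cvg_lim (@Rhausdorff R) l2); apply: ler_lim; [by apply/cvg_ex; eexists; exact: l|by apply/cvg_ex; eexists; exact: l2|].
apply: nearW => n; rewrite /dyadic.
have d0 := dy_gt0 R n; set d := dy R n in d0 *.
have sd0 : 0 <= s / d by rewrite divr_ge0 // ltW.
have /andP[k1 k2] := truncn_itv sd0; set k := Num.truncn _ in k1 k2.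
have bound (M : nat) : \sum_(j < M) level a (j.+1%:R * d) <= k.+1%:R * G.
  apply: le_trans (_ : (minn M k.+1)%:R * G <= _); last by rewrite ler_wpM2r // ler_nat geq_minr.
  elim: M => [|M IH]; first by rewrite big_ord0 min0n mul0r.
  rewrite big_ord_recr /=; have [h|h] := ltnP M k.+1.
    rewrite (minn_idPl h); rewrite (minn_idPl (ltnW h)) in IH.
    have -> : M.+1%:R * G = M%:R * G + G by rewrite -natr1 mulrDl mul1r.
    by apply: lerD => //; apply: aG; rewrite mulr_gt0.
  rewrite (minn_idPr (leqW h)); rewrite (minn_idPr h) in IH.
  rewrite level_eq0 ?addr0 //; apply: le_trans a_s _.
  by rewrite -ler_pdivrMr //; apply: le_trans (ltW k2) _; rewrite ler_nat leqW.
apply: le_trans (_ : d * (k.+1%:R * G) <= _); first by rewrite ler_pM2l.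
rewrite mulrA ler_wpM2r // -natr1 mulrDr mulr1 lerD2r mulrC -ler_pdivlMr //.
Qed.

(** A rectangle under the antitone level function. Its base stays short of 1, since already for the
    unit the level function vanishes from 1 on. *)
Lemma tr_ge a n : psd a -> (1 - dy R n) * level a (1 - dy R n) <= tr a.
Proof.
move=> pa; have aM : cnorm a <= (Num.truncn (cnorm a)).+1%:R by apply/ltW/truncnS_gt.
apply: le_trans (@dyadic_le_tr _ _ n pa aM); set N := (Num.truncn _).+1.
have d0 := dy_gt0 R n; have dn := dy_pow R n; rewrite /dyadic; set d := dy R n in d0 dn *.
have n1 : (0 < 2 ^ n)%N by rewrite expn_gt0.
have E : 1 - d = d * (2 ^ n).-1%:R.
  by rewrite -{1}dn -{1}(prednK n1) -natr1 mulrDl mul1r addrK mulrC.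
rewrite {1}E -mulrA ler_pM2l //.
have le1 : ((2 ^ n).-1 <= N * 2 ^ n)%N by rewrite (leq_trans (leq_pred _)) // leq_pmull.
rewrite -(big_mkord xpredT (fun j => level a (j.+1%:R * d))) (big_cat_nat _ (n := (2 ^ n).-1)) //=.
apply: le_trans (_ : \sum_(0 <= j < (2 ^ n).-1) level a (j.+1%:R * d) <= _); last first.
  by rewrite lerDl; apply: sumr_ge0 => j _; exact/Phi_ge/pcut_psd/psd_sa.
rewrite mulr_natl -[X in _ *+ X]subn0 -sumr_const_nat big_nat_cond [leRHS]big_nat_cond.
apply: ler_sum => j; rewrite andbT => /andP[_ jn]; apply: level_antitone => //.
  by rewrite mulr_ge0 // ltW.
by rewrite E mulrC ler_pM2l // ler_nat.
Qed.

Let L d a K := \sum_(j < K) level a (j.+1%:R * d).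

(** The two slice estimates differ from exact additivity by terms at level 0, which lie between 0
    and C. The bound does not depend on d, so multiplied by the mesh it vanishes in the limit. *)
Lemma sum_level_add d a b K : 0 < d -> psd a -> psd b -> a * b = b * a ->
  cnorm a + cnorm b <= K%:R * d -> `|L d (a + b) K - (L d a K + L d b K)| <= C.
Proof.
move=> d0 pa pb ab abK; have pab := psdD pa pb.
have aK : cnorm a <= K%:R * d by rewrite (le_trans _ abK) // lerDl cnorm_ge0.
have bK : cnorm b <= K%:R * d by rewrite (le_trans _ abK) // lerDr cnorm_ge0.
have up := sum_upper (dim0 dP) (dim_mono dP) (dim_mod dP) d0 pa pb ab bK.
have lo := sum_lower (dim0 dP) (dim_mono dP) (dim_mod dP) d0 pa pb ab abK.
have E x : psd x -> \sum_(j < K.+1) Phi (pcut (j%:R * d) x) = Phi x + L d x K.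
  by move=> px; rewrite big_ord_recl mul0r cut0.
have E2 : \sum_(j < K) Phi (pcut (j%:R * d) b) = Phi b + L d b K.
  by rewrite -E // [RHS]big_ord_recr /= pcut_eq0 // (dim0 dP) addr0.
rewrite E2 in up; rewrite !E // in lo; rewrite -/(L d _ K) in up lo.
have := dim_le dP pab; have := dim_le dP pb; have := Phi_ge pa; have := Phi_ge pb.
move: up lo; rewrite -!/(L d _ K) /L /level ler_norml.
move: (\sum_(j < K) _) (\sum_(j < K) _) (\sum_(j < K) _) => u v w *; apply/andP; lra.
Qed.

Lemma trD a b : psd a -> psd b -> a * b = b * a -> tr (a + b) = tr a + tr b.
Proof.
move=> pa pb ab; pose N := (Num.truncn (cnorm a + cnorm b)).+1.
have abN : cnorm a + cnorm b <= N%:R by apply/ltW/truncnS_gt.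
have aN : cnorm a <= N%:R by rewrite (le_trans _ abN) // lerDl cnorm_ge0.
have bN : cnorm b <= N%:R by rewrite (le_trans _ abN) // lerDr cnorm_ge0.
have lab := tr_lim (psdD pa pb) (le_trans (ler_cnormD a b) abN).
have la := tr_lim pa aN; have lb := tr_lim pb bN.
have l1 : (fun n => dyadic (level (a + b)) N n - (dyadic (level a) N n + dyadic (level b) N n)) @ \oo -->
    tr (a + b) - (tr a + tr b) by apply: cvgB => //; exact: cvgD.
suff l2 : (fun n => dyadic (level (a + b)) N n - (dyadic (level a) N n + dyadic (level b) N n)) @ \oo --> (0 : R).
  by apply/eqP; rewrite -subr_eq0; apply/eqP; exact: (cvg_unique _ l1 l2).
apply/norm_cvg0P; apply: (squeeze0 (g := fun n => dy R n * C)); last first.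
  by rewrite -[0](mul0r C); apply: cvgM; [exact: dy_cvg0|exact: cvg_cst].
move=> n; rewrite normr_ge0 /= /dyadic -mulrDr -mulrBr normrM gtr0_norm ?dy_gt0 //.
rewrite ler_pM2l ?dy_gt0 //; apply: sum_level_add => //; first exact: dy_gt0.
by rewrite natrM -mulrA dy_pow mulr1.
Qed.

Lemma trZ r a : psd a -> 0 <= r -> tr (r *` a) = r * tr a.
Proof.
move=> pa r0; rewrite -{2}[a]rs1; apply: (additive_linear (h := fun s => tr (s *` a))) => // [s t s0 t0|s s0].
  by rewrite rsD trD //; [exact: psdZ|exact: psdZ|rewrite !(rsMl, rsMr) -!rsM mulrC].
by apply: tr_ge0; exact: psdZ.
Qed.

End TraceOfDimension.

(** * Extension to all elements *)

Section SelfAdjointTrace.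
Variables (R : realType) (B : cstarAlgType R) (Phi : B -> R) (C : R).
Hypothesis dP : dimension_function Phi C.
Implicit Types (a b p q x y z : B) (r s t : R).

Lemma pos_neg_part a : sa a -> [/\ psd (pcut 0 a), psd (fc (@negp R) a),
  pcut 0 a - fc (@negp R) a = a & pcut 0 a * fc (@negp R) a = fc (@negp R) a * pcut 0 a].
Proof.
move=> sea; have lc := @lucont_cut R 0; have ln := @lucont_negp R.
split; first exact: pcut_psd.
- by apply: fc_psd => // s; exact: negp_ge0.
- apply: etrans (esym (fcB sea lc ln)) _; rewrite -[RHS](fc_id sea); apply: fc_eq => s.
  rewrite /cut /negp subr0; have [h|h] := leP s 0; first by rewrite max_l; lra.
  by rewrite max_r; lra.
- by rewrite -!fcM //; apply: fc_eq => s; rewrite mulrC.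
Qed.

Definition ts a : R := tr Phi (pcut 0 a) - tr Phi (fc (@negp R) a).

(** If u and v are the positive and negative parts of [p - q], then [u + q = p + v], and on both
    sides the summands commute. *)
Lemma ts_sub p q : psd p -> psd q -> p * q = q * p -> ts (p - q) = tr Phi p - tr Phi q.
Proof.
move=> pp pq pq_comm; have sd : sa (p - q) by apply: saB; exact: psd_sa.
have [h1 h2 h3 _] := pos_neg_part sd; rewrite /ts.
set u := pcut 0 (p - q) in h1 h3 *; set v := fc _ (p - q) in h2 h3 *.
have qu : q * u = u * q by apply: pcut_comm; rewrite // mulrBr mulrBl pq_comm.
have pv : p * v = v * p.
  by apply: fc_comm; rewrite ?mulrBr ?mulrBl ?pq_comm //; exact: lucont_negp.
have e1 := trD dP h1 pq (esym qu); have e2 := trD dP pp h2 pv.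
have E : u + q = p + v by apply/eqP; rewrite -subr_eq addrAC h3 subrK.
move: e2; rewrite -E e1; move: (tr _ _) (tr _ _) (tr _ _) (tr _ _) => *; lra.
Qed.

Lemma tr0 : tr Phi 0 = 0.
Proof.
have p0 := psd0 B; have := trD dP p0 p0 erefl; rewrite addr0 => h; lra.
Qed.

Lemma ts_psd a : psd a -> ts a = tr Phi a.
Proof.
move=> pa; rewrite -{1}[a]subr0 ts_sub ?tr0 ?subr0 //; first exact: psd0.
by rewrite mulr0 mul0r.
Qed.

Lemma tsD a b : sa a -> sa b -> a * b = b * a -> ts (a + b) = ts a + ts b.
Proof.
move=> sea sb ab; have [pa na ea ca] := pos_neg_part sea; have [pb nb eb cb] := pos_neg_part sb.
have ln := @lucont_negp R.
have ab1 : a * pcut 0 b = pcut 0 b * a by exact: pcut_comm.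
have ab2 : a * fc (@negp R) b = fc (@negp R) b * a by exact: fc_comm.
have c1 : pcut 0 a * pcut 0 b = pcut 0 b * pcut 0 a by apply/esym/pcut_comm.
have c2 : fc (@negp R) a * pcut 0 b = pcut 0 b * fc (@negp R) a by apply/esym/fc_comm.
have c3 : pcut 0 a * fc (@negp R) b = fc (@negp R) b * pcut 0 a by apply/esym/pcut_comm.
have c4 : fc (@negp R) a * fc (@negp R) b = fc (@negp R) b * fc (@negp R) a by apply/esym/fc_comm.
have -> : a + b = (pcut 0 a + pcut 0 b) - (fc (@negp R) a + fc (@negp R) b).
  by rewrite -{1}ea -{1}eb opprD addrACA.
rewrite ts_sub; [|exact: psdD|exact: psdD|].
  by rewrite (trD dP pa pb c1) (trD dP na nb c4) /ts opprD addrACA.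
by rewrite !mulrDl !mulrDr ca cb c3 -c2 addrACA.
Qed.

Lemma tsZ r a : sa a -> ts (r *` a) = r * ts a.
Proof.
move=> sea; have [pa na ea ca] := pos_neg_part sea.
have [r0|r0] := leP 0 r.
  rewrite -{1}ea scalerBr ts_sub; [|exact: psdZ|exact: psdZ|].
    by rewrite (trZ dP pa r0) (trZ dP na r0) /ts mulrBr.
  by rewrite !(rsMl, rsMr) ca.
have r1 : 0 <= - r by rewrite oppr_ge0 ltW.
have -> : r *` a = (- r) *` fc (@negp R) a - (- r) *` pcut 0 a.
  by rewrite -scalerBr -[_ - pcut _ _]opprB ea rsN scalerN opprK.
rewrite ts_sub; [|exact: psdZ|exact: psdZ|by rewrite !(rsMl, rsMr) ca].
by rewrite (trZ dP pa r1) (trZ dP na r1) /ts mulrBr !mulNr opprK addrC.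
Qed.

Definition re_part x : B := 2^-1 *` (x + star x).
Definition im_part x : B := 2^-1 *` ((- 'i)%C *: (x - star x)).

Lemma re_part_sa x : sa (re_part x).
Proof. by apply: saR; rewrite /sa starD starK addrC. Qed.

Lemma im_part_sa x : sa (im_part x).
Proof.
apply: saR; rewrite /sa starZ starB starK.
have -> : conjc (- 'i)%C = 'i%C :> R[i] by simpc.
by rewrite -opprB scalerN scaleNr.
Qed.

Lemma re_part_comm x z : x * z = z * x -> star x * z = z * star x -> re_part x * z = z * re_part x.
Proof. by move=> h1 h2; rewrite /re_part rsMl rsMr mulrDl mulrDr h1 h2. Qed.

Lemma im_part_comm x z : x * z = z * x -> star x * z = z * star x -> im_part x * z = z * im_part x.
Proof.
move=> h1 h2; rewrite /im_part rsMl rsMr; congr (_ *: _).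
by rewrite -scalerAl -scalerAr mulrBl mulrBr h1 h2.
Qed.

Let iC : R[i] := 'i%C.

Lemma complex_rect (c : R[i]) : c = (complex.Re c)%:C + iC * (complex.Im c)%:C.
Proof. by case: c => r s; rewrite /iC; simpc. Qed.

Lemma conjc_rect (c : R[i]) : conjc c = (complex.Re c)%:C - iC * (complex.Im c)%:C.
Proof. by case: c => r s; rewrite /iC; simpc. Qed.

Let ii : iC * iC = -1. Proof. by rewrite /iC; simpc. Qed.

Lemma re_part_lin (c : R[i]) x y : re_part (c *: x + y) =
  complex.Re c *` re_part x - complex.Im c *` im_part x + re_part y.
Proof.
rewrite /re_part /im_part starD starZ conjc_rect {1}[c]complex_rect -/iC.
move: (complex.Re c)%:C (complex.Im c)%:C (2^-1)%:C => r s h.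
rewrite !(scalerDr, scalerBr, scalerN, scalerA).
have -> : h * (r + iC * s) = r * h - s * h * - iC by ring.
have -> : h * (r - iC * s) = r * h + s * h * - iC by ring.
rewrite !(scalerDl, scalerBl, scaleNr).
move: (r * h *: x) (s * h * - iC *: x) (r * h *: star x) (s * h * - iC *: star x) (h *: y) (h *: star y).
move=> a1 a2 a3 a4 a5 a6; ncring.
Qed.

Lemma im_part_lin (c : R[i]) x y : im_part (c *: x + y) =
  complex.Re c *` im_part x + complex.Im c *` re_part x + im_part y.
Proof.
rewrite /re_part /im_part starD starZ conjc_rect {1}[c]complex_rect -[(- 'i)%C]/(- iC).
move: (complex.Re c)%:C (complex.Im c)%:C (2^-1)%:C => r s h.
rewrite !(scalerDr, scalerBr, scalerN, opprD, scalerA).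
have -> : h * - iC * (r + iC * s) = r * h * - iC + s * h.
  transitivity (r * h * - iC - iC * iC * (s * h)); first by ring.
  by rewrite ii; ring.
have -> : h * - iC * (r - iC * s) = r * h * - iC - s * h.
  transitivity (r * h * - iC + iC * iC * (s * h)); first by ring.
  by rewrite ii; ring.
rewrite ?mulrA !(scalerDl, scalerBl, scaleNr).
move: (r * h * - iC *: x) (r * h * - iC *: star x) (s * h *: x) (s * h *: star x) (h * - iC *: y) (h * - iC *: star y).
move=> a1 a2 a3 a4 a5 a6; ncring.
Qed.

Definition qtr x : R[i] := (ts (re_part x))%:C + iC * (ts (im_part x))%:C.

Lemma ts0 : ts 0 = 0. Proof. by rewrite ts_psd ?tr0 //; exact: psd0. Qed.

Lemma re_part_of_sa a : sa a -> re_part a = a.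
Proof. by move=> sea; rewrite /re_part sea rs_half. Qed.

Lemma im_part_of_sa a : sa a -> im_part a = 0.
Proof. by move=> sea; rewrite /im_part sea subrr !scaler0. Qed.

Lemma qtr_sa a : sa a -> qtr a = (ts a)%:C.
Proof.
by move=> sea; rewrite /qtr re_part_of_sa // im_part_of_sa // ts0 mulr0 addr0.
Qed.

Lemma qtr_psd a : psd a -> qtr a = (tr Phi a)%:C.
Proof. by move=> pa; rewrite qtr_sa ?ts_psd //; exact: psd_sa. Qed.

Lemma qtr_i a b : sa a -> sa b -> qtr (a + 'i%C *: b) = qtr a + 'i%C * qtr b.
Proof.
move=> sea sb; rewrite addrC {1}/qtr re_part_lin im_part_lin /=.
rewrite !re_part_of_sa // !im_part_of_sa // !rs0 !rs1 subr0 !add0r addr0.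
by rewrite !qtr_sa.
Qed.

Lemma complex_comb r s (u v u' v' : R) : (r * u - s * v + u')%:C + iC * (r * v + s * u + v')%:C =
  (r%:C + iC * s%:C) * (u%:C + iC * v%:C) + (u'%:C + iC * v'%:C).
Proof. by rewrite /iC; simpc; congr Complex; ring. Qed.

Lemma ts_comb r s p q a : sa p -> sa q -> sa a -> p * q = q * p -> a * p = p * a -> a * q = q * a ->
  ts (r *` p + s *` q + a) = r * ts p + s * ts q + ts a.
Proof.
move=> sp sq sea pq ap aq; rewrite tsD; [|by apply: saD; exact: saR|by []|].
  rewrite tsD; [|exact: saR|exact: saR|].
    by rewrite (tsZ r sp) (tsZ s sq).
  by rewrite !(rsMl, rsMr) pq -!rsM mulrC.
by rewrite mulrDl mulrDr !(rsMl, rsMr) ap aq.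
Qed.

Lemma qtr_lin c x y : x * star x = star x * x -> y * star y = star y * y ->
  x * y = y * x -> x * star y = star y * x -> qtr (c *: x + y) = c * qtr x + qtr y.
Proof.
move=> xx yy xy xsy.
have sxy : star x * y = y * star x by rewrite -[y in LHS]starK -starM -xsy starM starK.
have sxsy : star x * star y = star y * star x by rewrite -!starM xy.
have [r1 r2 r3 r4] : [/\ sa (re_part x), sa (im_part x), sa (re_part y) & sa (im_part y)].
  by split; [exact: re_part_sa|exact: im_part_sa|exact: re_part_sa|exact: im_part_sa].
have cz z : x * z = z * x -> star x * z = z * star x ->
    re_part x * z = z * re_part x /\ im_part x * z = z * im_part x.
  by move=> h1 h2; split; [exact: re_part_comm|exact: im_part_comm].
have cw z : y * z = z * y -> star y * z = z * star y ->
    re_part y * z = z * re_part y /\ im_part y * z = z * im_part y.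
  by move=> h1 h2; split; [exact: re_part_comm|exact: im_part_comm].
have [a1 a2] := cz x erefl (esym xx); have [a3 a4] := cz (star x) xx erefl.
have [b1 b2] := cz y xy sxy; have [b3 b4] := cz (star y) xsy sxsy.
have [e1 _] := cz (im_part x) (esym a2) (esym a4).
have [f1 f2] := cw (re_part x) (esym b1) (esym b3).
have [g1 g2] := cw (im_part x) (esym b2) (esym b4).
have rl := re_part_lin c x y; have il := im_part_lin c x y; rewrite {1}/qtr rl il.
move: (complex.Re c) (complex.Im c) (complex_rect c) => r s ->.
have rE : ts (r *` re_part x - s *` im_part x + re_part y) =
    r * ts (re_part x) - s * ts (im_part x) + ts (re_part y).
  by rewrite -rsN (ts_comb r (- s) r1 r2 r3 e1 f1 g1) mulNr.
have iE : ts (r *` im_part x + s *` re_part x + im_part y) =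
    r * ts (im_part x) + s * ts (re_part x) + ts (im_part y).
  exact: (ts_comb r s r2 r1 r4 (esym e1) g2 f2).
rewrite rE iE; exact: complex_comb.
Qed.

End SelfAdjointTrace.

(** * Roots and the dimension function of a quasitrace *)

Section Roots.
Variable R : realType.
Implicit Types (x y s t : R).

Definition rt n s : R := (Num.max s 0) `^ (n.+1%:R^-1).

Lemma rt_ge0 n s : 0 <= rt n s. Proof. exact: powR_ge0. Qed.

Lemma rtK n s : 0 <= s -> rt n s ^+ n.+1 = s.
Proof.
move=> s0; rewrite -powR_mulrn ?rt_ge0 // /rt -powRrM mulVf ?pnatr_eq0 //.
by rewrite max_l // powRr1.
Qed.

Lemma rt_neg n s : s <= 0 -> rt n s = 0.
Proof. by move=> s0; rewrite /rt max_r // powR0 // invr_neq0 // pnatr_eq0. Qed.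

Lemma expr_superadd n x y : 0 <= x -> 0 <= y -> x ^+ n.+1 + y ^+ n.+1 <= (x + y) ^+ n.+1.
Proof.
move=> x0 y0; elim: n => [|n IH]; first by rewrite !expr1.
apply: le_trans (_ : (x + y) * (x ^+ n.+1 + y ^+ n.+1) <= _); last first.
  by rewrite [leRHS]exprS ler_wpM2l // addr_ge0.
rewrite mulrDl !mulrDr -!exprS; have := exprn_ge0 n.+1 x0; have := exprn_ge0 n.+1 y0.
move: (x ^+ n.+1) (y ^+ n.+1) => u v *; have := mulr_ge0 x0; nra.
Qed.

Lemma expr_dist n x y : 0 <= x -> 0 <= y -> `|x - y| ^+ n.+1 <= `|x ^+ n.+1 - y ^+ n.+1|.
Proof.
wlog xy : x y / y <= x => [H x0 y0|x0 y0].
  by have [|/ltW] := leP y x => h; [exact: H|rewrite distrC [leRHS]distrC; exact: H].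
rewrite ger0_norm ?subr_ge0 // ger0_norm ?subr_ge0 ?lerXn2r // lerBrDl.
have h : 0 <= x - y by rewrite subr_ge0.
by have := expr_superadd n y0 h; rewrite addrC [y + _]addrC subrK addrC.
Qed.

(** Let D be the distance of the roots and suppose it exceeds e. Then [|s - t| >= D^(n+1) >= h], and
    [D <= 1 + |s - t|]; both terms are multiples of [(s - t)^2] at most, with factors [h^-2] and
    [h^-1]. *)
Lemma lucont_rt n : lucont (rt n).
Proof.
move=> M e e0; pose h := e ^+ n.+1; have h0 : 0 < h by rewrite exprn_gt0.
exists (h ^- 2 + h^-1); first by rewrite addr_ge0 // invr_ge0 ltW // exprn_gt0.
move=> s t _ _; set D := `|_|; have D0 : 0 <= D by exact: normr_ge0.
have Dst : D ^+ n.+1 <= `|s - t|.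
  apply: le_trans (expr_dist n (rt_ge0 n s) (rt_ge0 n t)) _.
  have E u : rt n u ^+ n.+1 = Num.max u 0.
    have [u0|u0] := leP u 0; last by rewrite rtK // ltW.
    by rewrite rt_neg // expr0n.
  rewrite !E; have [s0|s0] := leP s 0; have [t0|t0] := leP t 0; rewrite ?subrr ?normr0 ?normr_ge0 //.
    by rewrite sub0r normrN gtr0_norm // distrC ler_normr; apply/orP; left; lra.
  by rewrite subr0 gtr0_norm // ler_normr; apply/orP; left; lra.
have [De|De] := leP D e.
  apply: le_trans De _; rewrite lerDl mulr_ge0 ?sqr_ge0 // addr_ge0 // invr_ge0 ltW //.
  by rewrite exprn_gt0.
have hd : h <= `|s - t| by apply: le_trans Dst; rewrite lerXn2r // ?nnegrE ltW.
have D1 : D <= 1 + `|s - t|.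
  apply: le_trans (_ : 1 + D ^+ n.+1 <= _); last by rewrite lerD2l.
  have [d1|d1] := leP D 1; first by apply: le_trans d1 _; rewrite lerDl exprn_ge0.
  by apply: le_trans (_ : D ^+ n.+1 <= _); [rewrite exprS ler_peMr // exprn_ege1 // ltW|rewrite lerDr].
rewrite -[(s - t) ^+ 2]real_normK ?num_real //; move: `|s - t| hd D1 => d hd D1.
apply: le_trans (_ : (h ^- 2 + h^-1) * d ^+ 2 <= _); last by rewrite lerDr ltW.
apply: le_trans D1 _; rewrite mulrDl; apply: lerD.
  by rewrite -exprVn -exprMn exprn_ege1 // mulrC ler_pdivlMr // mul1r.
by rewrite expr2 mulrA ler_peMl ?(le_trans (ltW h0)) // mulrC ler_pdivlMr // mul1r.
Qed.

Lemma rt_expr n s : 0 <= s -> rt n (s ^+ n.+1) = s.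
Proof.
move=> s0; apply/eqP; rewrite -(@eqrXn2 R n.+1) ?rt_ge0 //; first by rewrite rtK // exprn_ge0.
Qed.

Lemma rt_mono n s t : s <= t -> rt n s <= rt n t.
Proof.
move=> st; have [t0|t0] := leP t 0; first by rewrite !rt_neg // (le_trans st).
have [s0|s0] := leP s 0; first by rewrite (rt_neg n s0) rt_ge0.
by rewrite -(@ler_pXn2r R n.+1) ?nnegrE ?rt_ge0 // !rtK // ltW.
Qed.

Lemma rt_bernoulli n s : 0 <= s -> rt n s <= 1 + s / n.+1%:R.
Proof.
move=> s0; have u0 : 0 <= s / n.+1%:R by rewrite divr_ge0.
rewrite -(@ler_pXn2r R n.+1) ?nnegrE ?rt_ge0 ?addr_ge0 // rtK //.
have ber m (u : R) : 0 <= u -> 1 + m%:R * u <= (1 + u) ^+ m.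
  move=> v0; elim: m => [|m IH]; first by rewrite mul0r addr0 expr0.
  rewrite exprS; apply: le_trans (_ : (1 + u) * (1 + m%:R * u) <= _).
    by have m0 : 0 <= m%:R :> R by []; rewrite -natr1; nra.
  by rewrite ler_wpM2l // addr_ge0.
by apply: le_trans (ber _ _ u0); rewrite mulrC divfK ?pnatr_eq0 // lerDr.
Qed.

Lemma expr_sub_ge n x y : 0 <= y -> y <= x -> (x - y) * y ^+ n <= x ^+ n.+1 - y ^+ n.+1.
Proof.
move=> y0 yx; rewrite !exprS; have := lerXn2r n y0 (le_trans y0 yx) yx.
have := exprn_ge0 n y0; move: (x ^+ n) (y ^+ n) => u v; nra.
Qed.

Lemma expr_sub_le n X : 0 <= X -> exists2 K, 0 <= K & forall x y, 0 <= y -> y <= x -> x <= X ->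
  x ^+ n.+1 - y ^+ n.+1 <= K * (x - y).
Proof.
move=> X0; elim: n => [|n [K K0 KP]].
  by exists 1 => // x y _ _ _; rewrite !expr1 mul1r.
exists (X * K + X ^+ n.+1); first by rewrite addr_ge0 ?mulr_ge0 // exprn_ge0.
move=> x y y0 yx xX; have := KP x y y0 yx xX; rewrite ![_ ^+ n.+2]exprS.
have yX : y ^+ n.+1 <= X ^+ n.+1 by rewrite lerXn2r // ?nnegrE ?(le_trans yx).
move: (x ^+ n.+1) (y ^+ n.+1) (X ^+ n.+1) yX => u v w yX h.
have x0 : 0 <= x by exact: le_trans yx.
have d0 : 0 <= x - y by rewrite subr_ge0.
have h2 : x * (u - v) <= X * (K * (x - y)).
  apply: le_trans (_ : x * (K * (x - y)) <= _); first by rewrite ler_wpM2l.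
  by rewrite ler_wpM2r // mulr_ge0.
have h3 : (x - y) * v <= (x - y) * w by rewrite ler_wpM2l.
have -> : x * u - y * v = x * (u - v) + (x - y) * v by ring.
have -> : (X * K + w) * (x - y) = X * (K * (x - y)) + (x - y) * w by ring.
exact: lerD.
Qed.

End Roots.

Section QuasitraceOfDimension.
Variables (R : realType) (B : cstarAlgType R) (Phi : B -> R) (C : R).
Hypothesis dP : dimension_function Phi C.
Implicit Types (a b x y : B) (s t : R).

Lemma cle_starr (x : B) : cle (x * star x) (star x * x).
Proof.
apply: cle_trans (cle_sqr (psd_starr x)) _.
have -> : x * star x * (x * star x) = x * (star x * x) * star x by rewrite !mulrA.
exact: cle_conj.
Qed.

Lemma pcut_star_cle t x : 0 <= t -> cle (pcut t (x * star x)) (pcut t (star x * x)).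
Proof.
rewrite le_eqVlt => /predU1P[<-|t0].
  by rewrite !cut0; [exact: cle_starr|exact: psd_starl|exact: psd_starr].
by have [y [<- <-]] := pcut_polar x t0; exact: cle_starr.
Qed.

Lemma level_star x s : 0 <= s -> level Phi (star x * x) s = level Phi (x * star x) s.
Proof.
move=> s0; have h y : level Phi (y * star y) s <= level Phi (star y * y) s.
  apply: (dim_mono dP); [| |exact: pcut_star_cle]; apply: pcut_psd; apply: psd_sa.
    exact: psd_starr.
  exact: psd_starl.
have h2 := h (star x); rewrite starK in h2.
by apply: le_anti; apply/andP; split; [exact: h2|exact: h].
Qed.

Lemma qtr_quasitrace : quasitrace (fun (c : R[i]) x => c *: x) (qtr Phi).
Proof.
split=> [x|a b sea sb|S [S0 SDM SZ Sstar Scomm] c x y Sx Sy].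
- have p1 := psd_starl x; have p2 := psd_starr x; split.
    by rewrite (qtr_psd dP p1) ler0c; exact: (tr_ge0 dP p1).
  rewrite (qtr_psd dP p1) (qtr_psd dP p2); congr _%:C.
  pose N := maxn (Num.truncn (cnorm (star x * x))).+1 (Num.truncn (cnorm (x * star x))).+1.
  have n1 : cnorm (star x * x) <= N%:R.
    by apply: le_trans (ltW (truncnS_gt _)) _; rewrite ler_nat leq_maxl.
  have n2 : cnorm (x * star x) <= N%:R.
    by apply: le_trans (ltW (truncnS_gt _)) _; rewrite ler_nat leq_maxr.
  apply: (cvg_unique _ (tr_lim dP p1 n1)); first exact: Rhausdorff.
  rewrite (_ : dyadic (level Phi (star x * x)) N = dyadic (level Phi (x * star x)) N).
    exact: (tr_lim dP p2 n2).
  apply: funext => n; congr (_ * _); apply: eq_bigr => j _; apply: level_star.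
  by rewrite mulr_ge0 // ltW // dy_gt0.
- exact: (qtr_i dP).
- by apply: (qtr_lin dP); apply: Scomm => //; exact: Sstar.
Qed.

Definition root n a : B := fc (@rt R n) a.

Lemma fcX f a n : sa a -> lucont f -> fc (fun s => f s ^+ n) a = fc f a ^+ n /\ lucont (fun s => f s ^+ n).
Proof.
move=> sea lf; elim: n => [|n [IH l]].
  by split; [rewrite expr0 fc_cst // rs1|exact: lucont_cst].
have l' : lucont (fun s => f s * f s ^+ n) by exact: lucontM.
have E : (fun s => f s ^+ n.+1) = (fun s => f s * f s ^+ n) by apply: funext => s; rewrite exprS.
by rewrite E exprS -IH fcM.
Qed.

Lemma root_psd n a : psd a -> psd (root n a).
Proof. by move=> pa; apply: fc_psd_ge0 => // [|s _]; [exact: lucont_rt|exact: rt_ge0]. Qed.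

Lemma rootK n a : psd a -> root n a ^+ n.+1 = a.
Proof.
move=> pa; have sea := psd_sa pa; have lr := @lucont_rt R n.
have [<- l] := fcX n.+1 sea lr; rewrite -[RHS](fc_id sea).
by apply: fc_psd_ext => //; [exact: lucont_id|move=> s s0; exact: rtK].
Qed.

Lemma root_unique n r : psd r -> root n (r ^+ n.+1) = r.
Proof.
move=> pr; have sr := psd_sa pr; have lr := @lucont_rt R n; have lid := @lucont_id R.
have [E l] := fcX n.+1 sr lid; rewrite fc_id // in E.
rewrite /root -E fc_comp // -[RHS](fc_id sr).
by apply: fc_psd_ext => //; [exact: lucont_comp|move=> s s0; exact: rt_expr].
Qed.

Lemma root_norm n a : psd a -> cnorm (root n a) <= 1 + cnorm a / n.+1%:R.
Proof.
move=> pa; apply: fc_psd_norm_le => //; first exact: lucont_rt.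
move=> s s0 sa_; rewrite ger0_norm ?rt_ge0 // (le_trans (rt_bernoulli n s0)) //.
by rewrite lerD2l ler_wpM2r // invr_ge0.
Qed.

(** This and [below_root_pcut] compare [x - t] with [x^(n+1) - t^(n+1)] for [x >= t]: the quotient
    of the second by the first is at least [t^n], and at most a constant on a bounded interval. *)
Lemma below_pcut_root n a t : psd a -> 0 < t -> below (pcut (t ^+ n.+1) a) (pcut t (root n a)).
Proof.
move=> pa t0; have sea := psd_sa pa; have lr := @lucont_rt R n; have lc := @lucont_cut R.
rewrite /pcut /root fc_comp //; apply: (fc_below (K := (t ^+ n)^-1)) => //.
- exact: lucont_comp.
- by rewrite invr_ge0 exprn_ge0 // ltW.
move=> s s0; rewrite /= -[s in leRHS](rtK n s0); have x0 := rt_ge0 n s; move: (rt n s) x0 => x x0.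
rewrite /cut; have [h|h] := leP (x - t) 0.
  by rewrite mulr_ge0 // ?invr_ge0 ?exprn_ge0 ?(ltW t0) // le_max lexx orbT.
have tx : t <= x by move: h; lra.
have tn : 0 < t ^+ n by rewrite exprn_gt0.
rewrite mulrC ler_pdivlMr //; apply: le_trans (expr_sub_ge n (ltW t0) tx) _.
by rewrite le_max lexx.
Qed.

Lemma below_root_pcut n a t : psd a -> 0 < t -> below (pcut t (root n a)) (pcut (t ^+ n.+1) a).
Proof.
move=> pa t0; have sea := psd_sa pa; have lr := @lucont_rt R n; have lc := @lucont_cut R.
have M0 : 0 < cnorm a + 1 by rewrite ltr_wpDl // cnorm_ge0.
have [K K0 KP] := expr_sub_le n (rt_ge0 n (cnorm a + 1)).
have l1 : lucont (cut t \o @rt R n) by exact: lucont_comp.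
rewrite /pcut /root fc_comp //; exists K => //.
rewrite -fcZ // -fcB //; last exact: lucontZ.
apply: (fc_psdM (M := cnorm a + 1)) => //; [by apply: lucontB => //; exact: lucontZ|by rewrite lerDl|].
move=> s sM; rewrite subr_ge0 /= /cut.
have [s0|s0] := leP 0 s; last first.
  rewrite rt_neg ?(ltW s0) // [leLHS]max_r.
    by rewrite mulr_ge0 // le_max lexx orbT.
  by rewrite subr_le0 (le_trans (ltW s0)) // exprn_ge0 // ltW.
have xX : rt n s <= rt n (cnorm a + 1).
  by apply: rt_mono; move: sM; rewrite ger0_norm.
rewrite -[s in leLHS](rtK n s0); have x0 := rt_ge0 n s; move: (rt n s) x0 xX => x x0 xX.
have [h|h] := leP (x - t) 0.
  rewrite mulr0 max_r // subr_le0 lerXn2r // ?nnegrE // ?(ltW t0) //; move: h; lra.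
have tx : t <= x by move: h; lra.
rewrite max_l; first exact: (KP x t (ltW t0) tx xX).
by rewrite subr_ge0 lerXn2r // ?nnegrE // ltW.
Qed.

(** The lower semicontinuous regularisation of Phi, which is what the quasitrace obtained by
    integration retains of it. *)
Definition lsc_dim a : R := sup [set Phi (pcut e a) | e in [set e | 0 < e]].

Lemma lsc_dim_sup a : psd a -> has_sup [set Phi (pcut e a) | e in [set e : R | 0 < e]].
Proof.
move=> pa; split; first by exists (Phi (pcut 1 a)), 1 => //=.
by exists C => _ [e _ <-]; exact: (level_le dP).
Qed.

Lemma lsc_dim_ge a e : psd a -> 0 < e -> Phi (pcut e a) <= lsc_dim a.
Proof. by move=> pa e0; apply: sup_upper_bound; [exact: lsc_dim_sup|exists e]. Qed.

Lemma lsc_dim_le a : psd a -> lsc_dim a <= Phi a.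
Proof.
move=> pa; apply: ge_sup; first by exists (Phi (pcut 1 a)), 1 => //=.
move=> _ [e /= e0 <-]; have := level_antitone dP pa (lexx 0) (ltW e0).
by rewrite /level cut0.
Qed.

(** From above, all levels of the root are at most G and its norm is at most [1 + |a| / (n + 1)].
    From below, the rectangle of [tr_ge] with s near 1 has height at least
    [Phi (pcut (s ^ (n + 1)) a)], and [s ^ (n + 1)] tends to 0. *)
Lemma tr_root_cvg a : psd a -> (fun n => tr Phi (root n a)) @ \oo --> lsc_dim a.
Proof.
move=> pa; set G := lsc_dim a.
have G0 : 0 <= G by apply: le_trans (lsc_dim_ge pa ltr01); exact: (Phi_ge0 (dim0 dP) (dim_mono dP) (pcut_psd _ (psd_sa pa))).
have up n : tr Phi (root n a) <= (1 + cnorm a / n.+1%:R) * G.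
  apply: (tr_le dP (root_psd n pa) (root_norm n pa)) => t t0.
  apply: le_trans (lsc_dim_ge pa (_ : 0 < t ^+ n.+1)); last by rewrite exprn_gt0.
  apply: (Phi_below (dim_mono dP)); [exact/pcut_psd/psd_sa/root_psd|exact/pcut_psd/psd_sa|].
  exact: below_pcut_root.
apply/cvgrPdist_lt => e e0.
have e2 : 0 < e / 2 by rewrite divr_gt0.
have [_ [d /= d0 <-] dG] := sup_adherent e2 (lsc_dim_sup pa).
(* The index k + 1 makes s at least 1/2, in particular positive. *)
have [k kP] : exists k, dy R k.+1 * G < e / 2.
  have l : (fun k => dy R k.+1 * G) @ \oo --> (0 : R).
    rewrite -[0](mul0r G); apply: cvgM; last exact: cvg_cst.
    by have := @dy_cvg0 R; rewrite -(cvg_shiftS (@dy R)).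
  by have [N /(_ N (leqnn _))] := cvg0_eps l e2; exists N.
set s := 1 - dy R k.+1; have [s0 s1] : 0 < s /\ s < 1.
  have d1 := dy_gt0 R k.+1; have d2 : dy R k.+1 <= 2^-1.
    rewrite /dy exprS ler_piMr ?invr_ge0 // exprn_ile1 ?invr_ge0 // invf_le1 //; lra.
  rewrite /s; split; lra.
have ls : (fun n => s ^+ n) @ \oo --> (0 : R) by apply: cvg_expr; rewrite gtr0_norm.
have [N1 N1P] := cvg0_eps ls d0.
have lu : (fun n => cnorm a / n.+1%:R * G) @ \oo --> (0 : R).
  rewrite -[0](mul0r G); apply: cvgM; last exact: cvg_cst.
  rewrite -[0](mulr0 (cnorm a)); apply: cvgM; [exact: cvg_cst|exact: cvg_harmonic].
have [N2 N2P] := cvg0_eps lu e0.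
exists (maxn N1 N2) => // n /=; rewrite geq_max => /andP[n1 /N2P n2].
have lo : s * Phi (pcut d a) <= tr Phi (root n a).
  apply: le_trans (tr_ge dP k.+1 (root_psd n pa)); rewrite -/s ler_pM2l //.
  have sd : s ^+ n.+1 <= d.
    by apply: ltW; apply: N1P; exact: leqW.
  apply: le_trans (_ : Phi (pcut (s ^+ n.+1) a) <= _).
    by apply: (level_antitone dP pa _ sd); rewrite exprn_ge0 // ltW.
  apply: (Phi_below (dim_mono dP)); [exact/pcut_psd/psd_sa|exact/pcut_psd/psd_sa/root_psd|].
  exact: below_root_pcut.
have upn := up n; move: dG; rewrite -/(lsc_dim a) -/G => dG.
have lo2 : s * (G - e / 2) <= s * Phi (pcut d a) by rewrite ler_pM2l // ltW.
have lo3 : G - e / 2 - e / 2 < s * (G - e / 2).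
  have h : s * (e / 2) < e / 2 by rewrite gtr_pMl.
  have E : s * (G - e / 2) = G - dy R k.+1 * G - s * (e / 2) by rewrite /s; ring.
  rewrite E; move: kP h; move: (dy R k.+1 * G) (s * (e / 2)) => u v; lra.
rewrite mulrDl mul1r in upn.
move: lo lo2 lo3 upn n2; move: (tr _ _) (s * Phi _) (s * (G - _)) (_ / _ * G) => u v w z.
rewrite ltr_norml => *; apply/andP; lra.
Qed.

End QuasitraceOfDimension.

(** * Strict comparison *)

Section StateQuasitrace.
Variables (R : realType) (A : cstarAlgType R) (f : cuW A -> R).
Hypotheses (fD : forall X Y, f (X + Y) = f X + f Y) (f_mono : forall X Y, cule X Y -> f X <= f Y).
Hypothesis f1 : f (mz (1%:M : 'M[A]_1)) = 1.

Let f0 : f 0 = 0. Proof. by apply: (addrI (f 0)); rewrite -fD !addr0. Qed.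

Let fMn X k : f (X *+ k) = k%:R * f X.
Proof.
by elim: k => [|k IH]; rewrite ?mulr0n ?f0 ?mul0r // mulrSr fD IH -natr1 mulrDl mul1r.
Qed.

Lemma mz0 n : mz (0 : mxalg A n) = 0 :> cuW A.
Proof. by apply: cz_eq; [exact/mpsdP/mpsd0|exact: mpos0|exact: csub0|exact: csub0]. Qed.

Definition sdim n (a : mxalg A n) : R := f (mz a).

Lemma sdimP n : dimension_function (@sdim n) n.+1%:R.
Proof.
split.
- by rewrite /sdim mz0 f0.
- move=> a pa; apply: le_trans (f_mono (mz_unit pa)) _; by rewrite fMn f1 mulr1.
- move=> a b pa pb ab; exact: (f_mono (mz_csub pa pb ab)).
- move=> a b pa pb ab; rewrite /sdim -!fD; congr f; exact/esym/mz_modular.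
Qed.

Definition strace n : 'M[A]_n.+1 -> R[i] := qtr (@sdim n).

Lemma strace_quasitrace n : quasitrace (@mx_cscale R A n.+1) (@strace n).
Proof. exact: (qtr_quasitrace (sdimP n)). Qed.

Definition corner (x : A) : mxalg A 0 := x%:M.
Definition strace1 (x : A) : R[i] := strace (x%:M : 'M[A]_1).

Lemma cornerD x y : corner (x + y) = corner x + corner y.
Proof. exact: (raddfD (@scalar_mx A 1)). Qed.

Lemma cornerM x y : corner (x * y) = corner x * corner y.
Proof. exact: scalar_mxM. Qed.

Lemma corner_star x : corner (star x) = star (corner x).
Proof. by rewrite -[RHS]/(adjmx (x%:M : 'M[A]_1)) adjmx_scalar. Qed.

Lemma cornerZ c x : corner (c *: x) = c *: corner x.
Proof. by apply/matrixP => i j; rewrite !ord1 !mxE eqxx !mulr1n. Qed.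

Lemma strace1_quasitrace : quasitrace (fun (c : R[i]) (x : A) => c *: x) strace1.
Proof.
have [q1 q2 q3] := qtr_quasitrace (sdimP 0).
have sc (x : A) : star x = x -> star (corner x) = corner x by rewrite -corner_star => ->.
split=> [x|a b sea sb|S [S0 SDM SZ Sstar Scomm] c x y Sx Sy].
- have := q1 (corner x); rewrite -corner_star -!cornerM; exact.
- have := q2 _ _ (sc a sea) (sc b sb); rewrite -cornerZ -cornerD; exact.
have cc u v : S u -> S v -> corner u * corner v = corner v * corner u.
  by move=> Su Sv; rewrite -!cornerM Scomm.
rewrite /strace1 -!/(corner _) cornerD cornerZ.
by apply: (qtr_lin (sdimP 0)); rewrite -?corner_star; apply: cc => //; exact: Sstar.
Qed.

Section Amplification.
Variable n : nat.
Let v : 'M[A]_(n.+1, 1) := delta_mx ord0 ord0.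
Let vv : adjmx v *m v = 1%:M.
Proof.
rewrite /v adjmx_delta mul_delta_mx; apply/matrixP => i j.
by rewrite !ord1 !mxE !eqxx.
Qed.

(** The upper left corner embedding, written with an isometry so that [mcut_isometry] applies. *)
Definition amp (x : mxalg A 0) : mxalg A n := v *m (x : 'M[A]_1) *m adjmx v.

Lemma ampD x y : amp (x + y) = amp x + amp y.
Proof. by rewrite /amp mulmxDr mulmxDl. Qed.

Lemma ampN x : amp (- x) = - amp x.
Proof. by rewrite /amp mulmxN mulNmx. Qed.

Lemma amp_star x : amp (star x) = star (amp x).
Proof.
rewrite -[RHS]/(adjmx (amp x)) /amp !adjmxM adjmxK mulmxA; congr (_ *m _ *m _).
Qed.

Lemma ampM x y : amp x * amp y = amp (x * y).
Proof.
rewrite -[LHS]/(amp x *m amp y) /amp -!mulmxA (mulmxA (adjmx v)) vv mul1mx.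
by rewrite (mulmxA x y).
Qed.

Lemma amp_psd x : psd x -> psd (amp x).
Proof. by move=> px; exact: mpsd_conj. Qed.

Lemma ampZ (c : R[i]) x : amp (c *: x) = c *: amp x.
Proof.
apply/matrixP => i j; rewrite [RHS]mxE [LHS]mxE [X in _ = _ *: X]mxE scaler_sumr.
apply: eq_bigr => k _; rewrite scalerAl; congr (_ * _).
rewrite [LHS]mxE [X in _ = _ *: X]mxE scaler_sumr; apply: eq_bigr => l _.
by rewrite [X in _ * X]mxE scalerAr.
Qed.

Lemma mz_amp x : psd x -> mz (amp x) = mz x.
Proof.
move=> px; have pa := amp_psd px; apply: cz_eq; [exact/mpsdP|exact/mpsdP|exact: csub_conj|].
have := csub_conj (adjmx v) (amp x); rewrite adjmxK /amp.
have -> : adjmx v *m (v *m x *m adjmx v) *m v = x.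
  by rewrite !mulmxA vv mul1mx -mulmxA vv mulmx1.
exact.
Qed.

Lemma tr_amp x : psd x -> tr (@sdim n) (amp x) = tr (@sdim 0) x.
Proof.
move=> px; have pa := amp_psd px.
pose N := maxn (Num.truncn (cnorm x)).+1 (Num.truncn (cnorm (amp x))).+1.
have n1 : cnorm x <= N%:R.
  by apply: le_trans (ltW (truncnS_gt _)) _; rewrite ler_nat leq_maxl.
have n2 : cnorm (amp x) <= N%:R.
  by apply: le_trans (ltW (truncnS_gt _)) _; rewrite ler_nat leq_maxr.
apply: (cvg_unique _ (tr_lim (sdimP n) pa n2)); first exact: Rhausdorff.
rewrite (_ : dyadic (level (@sdim n) (amp x)) N = dyadic (level (@sdim 0) x) N).
  exact: (tr_lim (sdimP 0) px n1).
apply: funext => k; congr (_ * _); apply: eq_bigr => j _.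
have s0 : 0 <= j.+1%:R * dy R k by rewrite mulr_ge0 // ltW // dy_gt0.
rewrite /level /sdim; have := mcut_isometry px s0 vv; rewrite /mcut => E.
by rewrite [pcut _ (amp x)]E; congr f; apply: mz_amp; exact/pcut_psd/psd_sa.
Qed.

Lemma ts_amp x : sa x -> ts (@sdim n) (amp x) = ts (@sdim 0) x.
Proof.
move=> sx; have [pp pn E c] := pos_neg_part sx.
have -> : amp x = amp (pcut 0 x) - amp (fc (@negp R) x) by rewrite -ampN -ampD E.
have c' := etrans (ampM _ _) (etrans (congr1 amp c) (esym (ampM _ _))).
apply: etrans (ts_sub (sdimP n) (amp_psd pp) (amp_psd pn) c') _.
exact: (congr2 (fun s t : R => s - t) (tr_amp pp) (tr_amp pn)).
Qed.

Lemma qtr_amp x : qtr (@sdim n) (amp x) = qtr (@sdim 0) x.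
Proof.
have re : re_part (amp x) = amp (re_part x) by rewrite /re_part ampZ ampD amp_star.
have im : im_part (amp x) = amp (im_part x).
  by rewrite /im_part !ampZ ampD ampN amp_star.
have h1 := ts_amp (re_part_sa x); have h2 := ts_amp (im_part_sa x).
by rewrite /qtr re im h1 h2.
Qed.

(** All the traces come from one f. A corner element has the Cuntz class of its entry, and cutting
    commutes with the corner embedding, so all levels of positive elements agree. *)
Lemma strace_ext : quasitrace_ext strace1 (@strace n).
Proof.
split; first exact: strace_quasitrace.
move=> x; rewrite /strace1 -[RHS]qtr_amp; congr qtr.
rewrite /amp /v; apply/matrixP => i j; rewrite !mxE big_ord1 !mxE big_ord1 !mxE eqxx mulr1n.
by case: (i == _); case: (j == _); rewrite /= ?(mulr0, mul0r, mulr1, mul1r, star0, star1).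
Qed.

End Amplification.

Lemma fc_one (B : cstarAlgType R) (g : R -> R) : lucont g -> fc g (1 : B) = g 1 *` 1.
Proof.
move=> lg; have l1 := @lucont_cst R 1; have s1 := @sa1 B.
have -> : fc g (1 : B) = fc g (fc (fun=> 1) (1 : B)) by rewrite fc_cst // rs1.
by rewrite fc_comp // fc_cst.
Qed.

(** The level function of the unit is 1 on [[0, 1[] and 0 from 1 on. *)
Lemma strace1_unit : strace1 1 = 1.
Proof.
have p1 := psd1 (mxalg A 0); have n1 : cnorm (1 : mxalg A 0) <= 1 by rewrite cnorm1.
apply: etrans (qtr_psd (sdimP 0) p1) _.
suff -> : tr (@sdim 0) 1 = 1 by [].
have lev s : 0 <= s -> s < 1 -> level (@sdim 0) 1 s = 1.
  move=> s0 s1; have s2 : 0 <= 1 - s by rewrite subr_ge0 ltW.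
  have E : pcut s (1 : mxalg A 0) = (1 - s) *` 1.
    by rewrite /pcut fc_one; [rewrite /cut max_l|exact: lucont_cut].
  have ps := pcut_psd s (psd_sa p1).
  apply: le_anti; apply/andP; split; rewrite -f1 /level /sdim; apply: f_mono.
    apply: (mz_below ps p1); apply: below_le; exact: pcut_le.
  apply: (mz_below p1 ps); apply: (below_scale (C := (1 - s)^-1)); first by rewrite invr_ge0.
  rewrite E -rsM mulVf ?rs1 ?subrr; [exact: psd0|by rewrite gt_eqF // subr_gt0].
apply: le_anti; apply/andP; split.
  have := tr_le (G := 1) (sdimP 0) p1 n1; rewrite mulr1; apply => t _.
  exact: (level_le (sdimP 0) t p1).
apply/ler_addgt0Pl => e e0.
have [N /(_ N (leqnn _)) dN] := cvg0_eps (@dy_cvg0 R) e0.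
have := tr_ge (sdimP 0) N p1; have d0 := dy_gt0 R N; move: dN d0; move: (dy R N) => d de d0.
have d1 : 1 - d < 1 by lra.
have [dl|dl] := leP 0 (1 - d).
  rewrite lev // mulr1; move: (tr _ _) => t; lra.
move=> _; have := tr_ge0 (sdimP 0) p1; move: (tr _ _) => t; lra.
Qed.

Lemma dtau_strace n (a : 'M[A]_n.+1) : mpsd a ->
  dtau (@strace n) a = lsc_dim (@sdim n) (a : mxalg A n).
Proof.
move=> pa; rewrite /dtau; apply: cvg_lim; first exact: Rhausdorff.
rewrite (_ : (fun k => _) = (fun k => tr (@sdim n) (root k (a : mxalg A n)))).
  exact: (tr_root_cvg (sdimP n) pa).
apply: funext => k; have -> : nth_root k.+1 a = root k (a : mxalg A n).
  rewrite /nth_root; case: xgetP => [r _ [/mpsdP pr E]|/(_ (root k (a : mxalg A n)))].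
    by have := @root_unique R (mxalg A n) k r pr; rewrite -E => /esym; exact.
  have h1 := @root_psd R (mxalg A n) k a pa; have h2 := @rootK R (mxalg A n) k a pa.
  by case; split; [exact/mpsdP|exact: h2].
by rewrite /strace (qtr_psd (sdimP n) (root_psd k pa)).
Qed.

End StateQuasitrace.

(** * From a failing comparison to a state *)

Section StrictComparison.
Variables (R : realType) (A : cstarAlgType R).
Hypotheses (sA : simple_cstar A) (tz : tracially_Z_absorbing A).

Let u : cuW A := mz (1%:M : 'M[A]_1).

Lemma cule_compatible : compatible (@cule R A).
Proof.
split; [exact: cule_refl|move=> X Y Z; exact: cule_trans|].
by move=> X Y Z XY; apply: culeD => //; exact: cule_refl.
Qed.

Lemma le_unit (X : cuW A) : exists n, cule X (u *+ n).
Proof. by have [n [a [pa ->]]] := mz_surj X; exists n.+1; exact: mz_unit. Qed.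

Lemma culeMnl (X : cuW A) k l : (k <= l)%N -> cule (X *+ k) (X *+ l).
Proof.
move=> kl; rewrite -(subnKC kl) mulrnDr -{1}[X *+ k]addr0.
by apply: culeD; [exact: cule_refl|exact: cule0].
Qed.

Lemma cule_iterate (S T W : cuW A) k : cule (S + W) (T + W) -> cule (S *+ k + W) (T *+ k + W).
Proof.
move=> h; elim: k => [|k IH]; first by rewrite !mulr0n; exact: cule_refl.
rewrite !mulrSr -!addrA; apply: cule_trans (_ : cule _ (S *+ k + (T + W))) _.
  by apply: culeD => //; exact: cule_refl.
rewrite (addrCA (S *+ k) T) (addrCA (T *+ k) T).
by apply: culeD => //; exact: cule_refl.
Qed.

(* Iterating the relation absorbs the common summand, and then u is compared with X and Y. *)
Lemma no_relation (X : cuW A) n (b : mxalg A n) : psd b -> b != 0 -> ~ cule X (mz b) ->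
  ~ exists n m q, cule (u *+ n.+1 + X *+ m + q) (u *+ n + mz b *+ m + q).
Proof.
move=> pb b0 XY [k [m [q h]]]; apply: XY; set Y := mz b in h *.
have [L uL] := unit_le_multiple sA pb b0; rewrite -/u -/Y in uL.
have [N0 XN] := le_unit X; pose c := u *+ k + q.
have [N cN] := le_unit c.
have h2 : cule (u + X *+ m + c) (Y *+ m + c).
  rewrite /c; have <- : u *+ k.+1 + X *+ m + q = u + X *+ m + (u *+ k + q).
    by rewrite mulrS !addrA; congr (_ + _); rewrite -!addrA; congr (_ + _); rewrite addrC.
  by have <- : u *+ k + Y *+ m + q = Y *+ m + (u *+ k + q) by rewrite [u *+ k + _]addrC -addrA.
(* With this K, [K u] dominates [(N L + 2) X], while the leftover summand c lies below [N u] and so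
   below [N L] copies of Y. The result is [(K m + N L + 2) X <= (K m + N L + 1) Y], the form that
   almost unperforation takes. *)
pose K := (N0 * (N * L).+2)%N.
have hK := cule_iterate K h2.
apply: (almost_unperforated sA tz (k := (K * m + N * L).+1)) => //.
have -> : X *+ (K * m + N * L).+2 = X *+ (K * m) + X *+ (N * L).+2 by rewrite -mulrnDr; congr (_ *+ _); lia.
apply: cule_trans (_ : cule _ (X *+ (K * m) + u *+ K)) _.
  apply: culeD; first exact: cule_refl.
  by rewrite /K mulrnA; exact: culeMn.
apply: cule_trans (_ : cule _ ((u + X *+ m) *+ K + c)) _.
  rewrite mulrnDl addrC -[X in cule X _]addr0 (mulnC K) (mulrnA X m K).
  by apply: culeD; [exact: cule_refl|exact: cule0].
apply: cule_trans hK _; apply: cule_trans (_ : cule _ (Y *+ (K * m) + Y *+ (N * L))) _.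
  apply: culeD; first by rewrite (mulnC K) (mulrnA Y m K); exact: cule_refl.
  by apply: cule_trans cN _; rewrite (mulnC N) (mulrnA Y L N); exact: culeMn.
by rewrite -mulrnDr; exact: culeMnl.
Qed.

Lemma strict_comparison_of_absorbing : strict_comparison A.
Proof.
move=> a b /mpsdP pa /mpsdP pb b0 H; apply/minf_cuntzP; apply: csub_of_pcut => // e e0.
have pc := mcut_psd e pa; apply: contrapT => nab.
have nXY : ~ cule (mz (mcut e (mval a) : mxalg A (mdim a))) (mz (mval b : mxalg A (mdim b))).
  by move=> h; apply: nab; exact: (mz_csubP pc pb h).
have [f [fD f_mono f1 fba]] :=
  exists_state R cule_compatible (@cule0 R A) le_unit (no_relation pb b0 nXY).
have ext := strace_ext fD f_mono f1.
have q1 : two_quasitrace (strace1 f).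
  by split; [exact: strace1_quasitrace|exists (@strace R A f 1); exact: ext].
have := H (strace1 f) (@strace R A f) q1 (strace1_unit fD f_mono f1) ext.
apply/negP; rewrite -leNgt (dtau_strace fD f_mono f1 pa) (dtau_strace fD f_mono f1 pb).
apply: le_trans (lsc_dim_le (sdimP fD f_mono f1 _) pb) _; apply: le_trans fba _.
exact: (lsc_dim_ge (sdimP fD f_mono f1 _) pa e0).
Qed.

End StrictComparison.

Theorem theorem3p3 (R : realType) (A : cstarAlgType R) :
  simple_cstar A -> tracially_Z_absorbing A ->
  W_almost_unperforated A /\ strict_comparison A.
Proof.
move=> sA tz; split; last exact: strict_comparison_of_absorbing.
by apply/W_almost_unperforatedP => X Y k; exact: almost_unperforated.
Qed.
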